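(* Let $(X,g)$ be a Riemannian manifold and let $M\subset X$ be an oriented connected compact $m$-dimensional submanifold with $[M]\neq 0\in H_m(X;\mathbb{R})$. Then there exists a Riemannian metric $\hat g$ on $X$ conformal to $g$ such that $[[M]]$ is the unique mass-minimizer in its homology class in $(X,\hat g)$; that is, $\mathbf{M}([[M]])\le \mathbf{M}(T)$ for every compactly supported $m$-dimensional current $T$ on $X$ homologous to $[[M]]$, with equality only if $T=[[M]]$, where mass is computed with respect to $\hat g$.
   Context: Manifolds, submanifolds and metrics are smooth; compact submanifolds are without boundary. Metrics $g,\hat g$ are conformal if $\hat g=f g$ for a positive smooth function $f$. Comass: for an $m$-form $\phi$ on $(X,g)$ and $x\in X$, $\|\phi\|^*_{x,g}=\max\{\phi_x(\overrightarrow V_x):\overrightarrow V_x=e_1\wedge\cdots\wedge e_m \text{ a unit simple } m\text{-vector at } x\}$; $\|\phi\|^*_g$ denotes the resulting function of $x$. Currents: $\mathscr E'_m(X)$ is the space of $m$-dimensional de Rham currents with compact support (continuous linear functionals on smooth $m$-forms), and $d:\mathscr E'_{m+1}(X)\to\mathscr E'_{m}(X)$ is the adjoint of exterior differentiation. The mass is $\mathbf{M}(T)=\sup\{T(\psi):\psi \text{ a smooth } m\text{-form with } \sup_X\|\psi\|^*_{g}\le 1\}\in[0,\infty]$. Currents $T,T'$ are homologous if $T-T'=dS$ for some $S\in\mathscr E'_{m+1}(X)$. The homology of $(\mathscr E'_*(X),d)$ is identified with $H_*(X;\mathbb R)$. For an oriented compact submanifold $M$, $[[M]]$ is the current $\psi\mapsto\int_M\psi$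 and $[M]$ is its homology class.
   Formalization: The dimension m of M is assumed to be at least 1; for m = 0 the uniqueness claim fails, since a point and any other point of the same component of X (of positive dimension) are homologous with equal mass. *)

(* Defs.v *)
From HB Require Import structures.
From mathcomp Require Import all_boot all_order all_algebra.
From mathcomp Require Import all_classical all_reals all_analysis.
Import Order.TTheory GRing.Theory Num.Theory.
Import numFieldNormedType.Exports.
Set Implicit Arguments.
Unset Strict Implicit.
Unset Printing Implicit Defensive.
Local Open Scope classical_set_scope.
Local Open Scope ring_scope.

(** * Smooth maps and integration on R^n *)

Section Euclidean.
Context {R : realType}.

Definition iter_derive (V W : normedModType R) (vs : seq V) (f : V -> W)
  : V -> W := foldr (fun v h => 'D_v h) f vs.

(* To be used with an open [U]; the values of [f] outside [U] are irrelevant. *)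
Definition smooth_on (V W : normedModType R) (U : set V) (f : V -> W) : Prop :=
  forall (vs : seq V) (x : V), U x ->
    {for x, continuous (iter_derive vs f)} /\
    forall v, derivable (iter_derive vs f) x v.

(* Lebesgue integral over R^k as an iterated integral; it is only applied to
   continuous functions with compact support. *)
Fixpoint integral_rV (k : nat) : ('rV[R]_k -> R) -> R :=
  match k with
  | 0 => fun f => f 0
  | k'.+1 => fun f =>
      \int[lebesgue_measure]_t
        integral_rV (fun y : 'rV[R]_k' => f (row_mx (const_mx t : 'rV_1) y))
  end.

End Euclidean.

(** * Smooth manifolds *)

Record chart (R : realType) (n : nat) (X : topologicalType) := Chart {
  cdom : set X;
  cimg : set 'rV[R]_n;
  cmap : X -> 'rV[R]_n;
  cinv : 'rV[R]_n -> X;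
  cdom_open : open cdom;
  cimg_open : open cimg;
  cmap_img : forall x, cdom x -> cimg (cmap x);
  cinv_dom : forall y, cimg y -> cdom (cinv y);
  cmapK : forall x, cdom x -> cinv (cmap x) = x;
  cinvK : forall y, cimg y -> cmap (cinv y) = y;
  cmap_continuous : forall x, cdom x -> {for x, continuous cmap};
  cinv_continuous : forall y, cimg y -> {for y, continuous cinv}
}.

(* The atlas is [range chart_at], with a chosen chart [chart_at x] around every
   point [x]: every smooth atlas can be presented in this way. Vectors tangent
   at [x] are represented by their coordinates, a row vector, in the chart
   [chart_at x]; thus T_x X is ['rV[R]_n] for every [x]. *)
Record manifold (R : realType) (n : nat) := Manifold {
  mtop :> topologicalType;
  chart_at : mtop -> chart R n mtop;
  mem_chart_at : forall x, cdom (chart_at x) x;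
  chart_compat : forall p q : mtop,
    smooth_on [set y | cimg (chart_at p) y /\
                       cdom (chart_at q) (cinv (chart_at p) y)]
              (cmap (chart_at q) \o cinv (chart_at p));
  mtop_hausdorff : hausdorff_space mtop;
  mtop_second_countable : second_countable (T := mtop)
}.

Section Manifold.
Context {R : realType} {n : nat} {X : manifold R n}.

Definition transition (p q : X) : 'rV[R]_n -> 'rV[R]_n :=
  cmap (chart_at q) \o cinv (chart_at p).

Definition oriented : Prop := forall (p q : X) (y : 'rV[R]_n),
  cimg (chart_at p) y -> cdom (chart_at q) (cinv (chart_at p) y) ->
  0 < \det (jacobian (transition p q) y).

Definition smooth_fun (f : X -> R) : Prop :=
  forall q : X, smooth_on (cimg (chart_at q)) (f \o cinv (chart_at q)).

(* [u *m tangent_coord q y] is the tangent vector at [cinv (chart_at q) y]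
   whose coordinates in the chart [chart_at q] are [u]. *)
Definition tangent_coord (q : X) (y : 'rV[R]_n) : 'M[R]_n :=
  jacobian (transition q (cinv (chart_at q) y)) y.

(** ** Riemannian metrics *)

(* [g x] is the Gram matrix of the metric on T_x X. *)
Definition local_metric (g : X -> 'M[R]_n) (q : X) (y : 'rV[R]_n) : 'M[R]_n :=
  tangent_coord q y *m g (cinv (chart_at q) y) *m (tangent_coord q y)^T.

Definition riemannian_metric (g : X -> 'M[R]_n) : Prop :=
  [/\ forall x, (g x)^T = g x,
      forall x (v : 'rV[R]_n), v != 0 -> 0 < (v *m g x *m v^T) 0 0 &
      forall (q : X) i j,
        smooth_on (cimg (chart_at q)) (fun y => local_metric g q y i j)].

Definition conformal (g ghat : X -> 'M[R]_n) : Prop :=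
  exists f : X -> R, [/\ smooth_fun f, forall x, 0 < f x &
                         forall x, ghat x = f x *: g x].

(** ** Differential forms *)

(* An m-form evaluates, at each [x], m tangent vectors at [x] given as the rows
   of a matrix. *)
Definition diff_form (m : nat) : Type := X -> 'M[R]_(m, n) -> R.

Definition multilinear (m : nat) (a : 'M[R]_(m, n) -> R) : Prop :=
  forall (i : 'I_m) (A B C : 'M[R]_(m, n)) (b c : R),
    row i A = b *: row i B + c *: row i C ->
    row' i A = row' i B -> row' i A = row' i C ->
    a A = b * a B + c * a C.

Definition alternating (m : nat) (a : 'M[R]_(m, n) -> R) : Prop :=
  forall (A : 'M[R]_(m, n)) (i j : 'I_m),
    i != j -> row i A = row j A -> a A = 0.

Definition local_form (m : nat) (psi : diff_form m) (q : X)
    (y : 'rV[R]_n) (E : 'M[R]_(m, n)) : R :=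
  psi (cinv (chart_at q) y) (E *m tangent_coord q y).

Definition smooth_form (m : nat) (psi : diff_form m) : Prop :=
  [/\ forall x, multilinear (psi x), forall x, alternating (psi x) &
      forall (q : X) (E : 'M[R]_(m, n)),
        smooth_on (cimg (chart_at q)) (fun y => local_form psi q y E)].

(* d psi (v_0, ..., v_m)
     = \sum_i (-1)^i D_{v_i} (psi (v_0, ..., v_{i-1}, v_{i+1}, ..., v_m)),
   computed at [x] in the chart [chart_at x], the v_i being extended as vector
   fields with constant coordinates. The value at [x] does not depend on the
   chart, so [ext_deriv] maps smooth forms to smooth forms. *)
Definition ext_deriv (m : nat) (psi : diff_form m) : diff_form m.+1 :=
  fun x (E : 'M[R]_(m.+1, n)) =>
    \sum_(i < m.+1) (-1) ^+ i *
      'D_(row i E) (fun y => local_form psi x y (row' i E))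
        (cmap (chart_at x) x).

(* |e_1 /\ ... /\ e_m|^2 is the Gram determinant det (g (e_i, e_j)). *)
Definition comass (g : X -> 'M[R]_n) (m : nat) (psi : diff_form m) (x : X)
  : R :=
  sup [set psi x E | E in
        [set E : 'M[R]_(m, n) | \det (E *m g x *m E^T) = 1]].

(** ** Currents *)

(* Neighbourhoods of 0 for the C^infinity topology on smooth m-forms, i.e.
   uniform convergence of all derivatives of all components on the compact
   subsets of charts. A tuple (q, K, vs, E) stands for the seminorm
     sup_{y in K} |d_vs (psi_q (E)) (y)|. *)
Definition cinfty_nbhs0 (m : nat) (A : set (diff_form m)) : Prop :=
  exists (L : set (X * set 'rV[R]_n * seq 'rV[R]_n * 'M[R]_(m, n))) (delta : R),
    [/\ finite_set L,
        forall q K vs E, L (q, K, vs, E) ->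
          compact K /\ K `<=` cimg (chart_at q),
        0 < delta &
        forall psi : diff_form m, smooth_form psi ->
          (forall q K vs E, L (q, K, vs, E) -> forall y, K y ->
             `|iter_derive vs (fun z => local_form psi q z E) y| < delta) ->
          A psi].

(* Being defined on all smooth forms, such a functional automatically has
   compact support. The values of [T] off the smooth forms are irrelevant. *)
Definition current (m : nat) (T : diff_form m -> R) : Prop :=
  (forall (a : R) (psi eta : diff_form m), smooth_form psi -> smooth_form eta ->
     T (fun x E => a * psi x E + eta x E) = a * T psi + T eta) /\
  (forall eps : R, 0 < eps ->
     cinfty_nbhs0 [set psi : diff_form m | `|T psi| < eps]).

Definition eq_current (m : nat) (T T' : diff_form m -> R) : Prop :=
  forall psi : diff_form m, smooth_form psi -> T psi = T' psi.

Definition boundary (m : nat) (S : diff_form m.+1 -> R) : diff_form m -> R :=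
  fun psi => S (ext_deriv psi).

Definition homologous (m : nat) (T T' : diff_form m -> R) : Prop :=
  exists S : diff_form m.+1 -> R,
    current S /\ eq_current (fun psi => T psi - T' psi) (boundary S).

Definition mass (g : X -> 'M[R]_n) (m : nat) (T : diff_form m -> R) : \bar R :=
  ereal_sup [set (T psi)%:E | psi in
    [set psi : diff_form m | smooth_form psi /\ forall x, comass g psi x <= 1]].

(** ** Integration of top-degree forms *)

Definition partition_of_unity (s : seq (X * (X -> R))) : Prop :=
  (forall q rho, (q, rho) \in s ->
     [/\ smooth_fun rho, forall x, 0 <= rho x &
         closure [set x | rho x != 0] `<=` cdom (chart_at q)]) /\
  (forall x, \sum_(c <- s) c.2 x = 1).

End Manifold.

Arguments oriented {R n} X.
Arguments diff_form {R n} X m.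
Arguments partition_of_unity {R n} X s.

Section IntegrationOverSubmanifolds.
Context {R : realType}.

Definition integral_pou (m : nat) (N : manifold R m)
    (s : seq (N * (N -> R))) (omega : diff_form N m) : R :=
  \sum_(c <- s) integral_rV
    ((fun y => c.2 (cinv (chart_at c.1) y) * local_form omega c.1 y 1%:M)
       \_ (cimg (chart_at c.1))).

(* For [N] compact and oriented, the value does not depend on the partition of
   unity; the default 0 is never reached. *)
Definition integral_form (m : nat) (N : manifold R m) (omega : diff_form N m)
  : R :=
  xget 0 [set v | exists2 s, partition_of_unity N s & v = integral_pou s omega].

Context {n m : nat} {X : manifold R n} {N : manifold R m}.

Definition differential (f : N -> X) (p : N) : 'M[R]_(m, n) :=
  jacobian (cmap (chart_at (f p)) \o f \o cinv (chart_at p))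
           (cmap (chart_at p) p).

Definition smooth_map (f : N -> X) : Prop :=
  continuous f /\
  forall (p : N) (q : X),
    smooth_on [set y | cimg (chart_at p) y /\
                       cdom (chart_at q) (f (cinv (chart_at p) y))]
              (cmap (chart_at q) \o f \o cinv (chart_at p)).

Definition embedding (f : N -> X) : Prop :=
  [/\ smooth_map f,
      injective f,
      forall p, row_free (differential f p) &
      forall U : set N, open U ->
        exists2 W : set X, open W & f @` U = W `&` range f].

Definition pullback (f : N -> X) (k : nat) (psi : diff_form X k)
  : diff_form N k :=
  fun p E => psi (f p) (E *m differential f p).

Definition integration_current (f : N -> X) : diff_form X m -> R :=
  fun psi => integral_form (pullback f psi).

End IntegrationOverSubmanifolds.

(* Main.v *)
Require Import Defs.
From HB Require Import structures.
From mathcomp Require Import all_boot all_order all_algebra all_fingroup.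
From mathcomp Require Import all_classical all_reals all_analysis.
From mathcomp Require Import ring lra zify.
Import Order.TTheory GRing.Theory Num.Theory.
Import numFieldNormedType.Exports.
Set Implicit Arguments.
Unset Strict Implicit.
Unset Printing Implicit Defensive.
Local Open Scope classical_set_scope.
Local Open Scope ring_scope.

(* Since [M] <> 0, some linear functional on currents kills the boundaries and
   takes the value 1 on [[M]]. By the de Rham argument in the dual complex
   (Poincare lemma in charts, Mayer-Vietoris, exhaustion by compact sets) it is
   given on cycles by a closed form phi, so [[M]](phi) = 1.

   Let nu be a form which at every point x of M is, up to a positive factor, the
   g-volume of the orthogonal projection to T_x M. As the top cohomology of M is
   a line, nu - [[M]](nu) phi coincides along M with an exact form d eta; hence
   Phi = [[M]](nu) phi + d eta is closed and equal to nu along M.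

   Let N be the squared Hilbert-Schmidt norm of m-forms: it dominates the squared
   comass, with equality for simple forms such as nu. Let w >= 0 be a smooth
   function with zero set M, comparable near M to the squared distance to M. Put
   Psi = N(Phi) + w and ghat = Psi^(1/m) g. Then Phi has comass at most 1 and
   calibrates M, so that mass(T) >= T(Phi) = [[M]](Phi) = mass([[M]]).

   In the case of equality let psi vanish along M. On compact sets
   N(Phi + t psi) <= Psi (1 + C t^2), because <Phi, psi>^2 <= C w; so
   T(Phi) + t T(psi) <= (1 + C t^2) T(Phi) for all t and T(psi) = 0. As T also
   vanishes on exact forms, it is a multiple of [[M]], and T(phi) = 1. *)

(** The exponent 1/m is forced: [Psi^(1/m) g] multiplies the Gram determinants of m vectors by Psi,
    so it divides squared comasses by Psi. The comass cannot itself serve as conformal factor, being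
    in general only continuous in the point; the Hilbert-Schmidt norm is polynomial in the
    coefficients of the form and of the inverse metric. The term w keeps Psi positive where Phi
    vanishes and pays for the cross term 2t <Phi, psi>, which would otherwise be of first order in
    t. That the class is nonzero means only that a current is not a boundary. The functional
    obtained from this is merely algebraic, which is why the dual complex consists of arbitrary
    linear functionals and why they are localized through currents cut off by smooth functions. Two
    restrictions to M must be kept apart: values at points of M on all vectors of X, which control
    the comass, and the pullback to M, which the integral sees. The homotopy to a local retraction,
    whose operator vanishes along M, passes from one to the other modulo exact forms. *)

Local Notation alternating := Defs.alternating.

(** * Functions of class C^k *)

Section Ck.
Context {R : realType}.

Section CkDef.
Context {V W : normedModType R}.

(** The first derivative taken is the innermost one, whereas [iter_derive] adds derivatives on the
    outside. With this order an induction on [k], generalized over [f], closes at once; [smooth_onP]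
    reconciles the two by reading the list from its end. *)
Fixpoint Ck (k : nat) (U : set V) (f : V -> W) : Prop :=
  (forall x, U x -> {for x, continuous f}) /\
  if k is k'.+1 then
    (forall x v, U x -> derivable f x v) /\ (forall v, Ck k' U ('D_v f))
  else True.

End CkDef.

Implicit Types V W : normedModType R.

Lemma Ck_continuous k V W (U : set V) (f : V -> W) x :
  Ck k U f -> U x -> {for x, continuous f}.
Proof. by case: k => [|k] [+ _] => /(_ x); apply. Qed.

Lemma Ck_derivable k V W (U : set V) (f : V -> W) x v :
  Ck k.+1 U f -> U x -> derivable f x v.
Proof. by move=> [_ [+ _]]; apply. Qed.

Lemma Ck_derive k V W (U : set V) (f : V -> W) v :
  Ck k.+1 U f -> Ck k U ('D_v f).
Proof. by move=> [_ [_ +]]; apply. Qed.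

Lemma CkS k V W (U : set V) (f : V -> W) : Ck k.+1 U f -> Ck k U f.
Proof.
elim: k f => [|k IH] f; first by case.
by move=> [cf [df Df]]; split=> //; split=> // v; apply: IH; exact: Df.
Qed.

Lemma smooth_onP V W (U : set V) (f : V -> W) :
  smooth_on U f <-> forall k, Ck k U f.
Proof.
split=> [+ k|].
  elim: k f => [|k IH] f sf.
    by split=> // x Ux; have [] := sf [::] x Ux.
  split; first by move=> x Ux; have [] := sf [::] x Ux.
  split; first by move=> x v Ux; have [_] := sf [::] x Ux; apply.
  move=> v; apply: IH => vs x Ux.
  by have := sf (rcons vs v) x Ux; rewrite /iter_derive foldr_rcons.
move=> Cf vs; elim/last_ind: vs f Cf => [|vs v IH] f Cf x Ux.
  split; first exact: Ck_continuous (Cf 0%N) _.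
  by move=> v; exact: Ck_derivable (Cf 1%N) _.
have := IH ('D_v f) (fun k => Ck_derive v (Cf k.+1)) x Ux.
by rewrite /iter_derive foldr_rcons.
Qed.

Lemma Ck_near k V W (U : set V) (f g : V -> W) :
  (forall x, U x -> \near x, f x = g x) -> Ck k U f -> Ck k U g.
Proof.
elim: k f g => [|k IH] f g fg [cf Hf].
  split=> // x Ux; rewrite /prop_for /continuous_at -(nbhs_singleton (fg _ Ux)).
  apply: cvg_trans (cf _ Ux); apply: near_eq_cvg.
  by apply: filterS (fg _ Ux) => y ->.
split.
  move=> x Ux; rewrite /prop_for /continuous_at -(nbhs_singleton (fg _ Ux)).
  apply: cvg_trans (cf _ Ux); apply: near_eq_cvg.
  by apply: filterS (fg _ Ux) => y ->.
case: Hf => df Df; split=> [x v Ux|v].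
  by apply: near_eq_derivable (df _ _ Ux); exact: fg.
apply: IH (Df v) => x Ux.
have /nbhs_interior := fg _ Ux.
by apply: filterS => y; exact: near_eq_derive.
Qed.

Lemma Ck_eq k V W (U : set V) (f g : V -> W) :
  open U -> (forall x, U x -> f x = g x) -> Ck k U f -> Ck k U g.
Proof.
move=> oU fg; apply: Ck_near => x Ux.
by apply: filterS fg _; exact: open_nbhs_nbhs.
Qed.

Lemma Ck_sub k V W (U U' : set V) (f : V -> W) :
  U' `<=` U -> Ck k U f -> Ck k U' f.
Proof.
move=> UU; elim: k f => [|k IH] f [cf Hf].
  by split=> // x /UU; exact: cf.
split; first by move=> x /UU; exact: cf.
case: Hf => df Df; split; first by move=> x v /UU; exact: df.
by move=> v; exact: IH (Df v).
Qed.

Lemma Ck_local k V W (U : set V) (f : V -> W) :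
  (forall x, U x -> exists U', U' x /\ Ck k U' f) -> Ck k U f.
Proof.
elim: k f => [|k IH] f H.
  by split=> // x /H[U' [U'x [+ _]]]; apply.
split; first by move=> x /H[U' [U'x /Ck_continuous]]; apply.
split; first by move=> x v /H[U' [U'x /Ck_derivable]]; apply.
by move=> v; apply: IH => x /H[U' [U'x /(Ck_derive v) ?]]; exists U'.
Qed.

Lemma Ck_cst k V W (U : set V) (c : W) : Ck k U (fun=> c).
Proof.
elim: k c => [|k IH] c; first by split=> // x _; exact: cvg_cst.
split; first by move=> x _; exact: cvg_cst.
split; first by move=> x v _; exact: derivable_cst.
move=> v.
have -> : 'D_v (fun=> c) = fun _ : V => 0 :> W.
  by apply/funext => x; rewrite derive_cst.
exact: IH.
Qed.

Lemma CkD k V W (U : set V) (f g : V -> W) :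
  open U -> Ck k U f -> Ck k U g -> Ck k U (fun x => f x + g x).
Proof.
move=> oU; elim: k f g => [|k IH] f g [cf Hf] [cg Hg].
  by split=> // x Ux; apply: cvgD; [exact: cf|exact: cg].
split; first by move=> x Ux; apply: cvgD; [exact: cf|exact: cg].
case: Hf Hg => df Df [dg Dg]; split.
  by move=> x v Ux; apply: derivableD; [exact: df|exact: dg].
move=> v; apply: Ck_eq (IH _ _ (Df v) (Dg v)) => // x Ux.
by rewrite -deriveD//; [exact: df|exact: dg].
Qed.

Lemma CkN k V W (U : set V) (f : V -> W) :
  open U -> Ck k U f -> Ck k U (fun x => - f x).
Proof.
move=> oU; elim: k f => [|k IH] f [cf Hf].
  by split=> // x Ux; apply: cvgN; exact: cf.
split; first by move=> x Ux; apply: cvgN; exact: cf.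
case: Hf => df Df; split.
  by move=> x v Ux; apply: derivableN; exact: df.
move=> v; apply: Ck_eq (IH _ (Df v)) => // x Ux.
by rewrite -deriveN//; exact: df.
Qed.

Lemma CkB k V W (U : set V) (f g : V -> W) :
  open U -> Ck k U f -> Ck k U g -> Ck k U (fun x => f x - g x).
Proof. by move=> oU Cf Cg; apply: CkD => //; exact: CkN. Qed.

Lemma Ck_sum k V W (U : set V) (I : Type) (r : seq I) (P : pred I)
    (f : I -> V -> W) :
  open U -> (forall i, P i -> Ck k U (f i)) ->
  Ck k U (fun x => \sum_(i <- r | P i) f i x).
Proof.
move=> oU Cf; elim: r => [|i r IH].
  by apply: Ck_eq (Ck_cst _ _ 0) => // x _; rewrite big_nil.
case Pi : (P i); last first.
  by apply: Ck_eq IH => // x _; rewrite big_cons Pi.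
apply: (@Ck_eq _ _ _ _ (fun x => f i x + \sum_(i <- r | P i) f i x)) => //.
  by move=> x _; rewrite big_cons Pi.
by apply: CkD => //; exact: Cf.
Qed.

Lemma CkM k V (U : set V) (f g : V -> R) :
  open U -> Ck k U f -> Ck k U g -> Ck k U (fun x => f x * g x).
Proof.
move=> oU; elim: k f g => [|k IH] f g Cf Cg.
  by split=> // x Ux; apply: cvgM; apply: Ck_continuous Ux; [exact: Cf|exact: Cg].
split; first by move=> x Ux; apply: cvgM; apply: Ck_continuous Ux; [exact: Cf|exact: Cg].
split.
  by move=> x v Ux; apply: derivableM; apply: Ck_derivable Ux; [exact: Cf|exact: Cg].
move=> v.
apply: (@Ck_eq _ _ _ _ (fun x => f x * 'D_v g x + g x * 'D_v f x)) => //.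
  move=> x Ux; rewrite -[in RHS](_ : f * g = (fun x => f x * g x))//.
  by rewrite deriveM//; apply: Ck_derivable Ux; [exact: Cf|exact: Cg].
by apply: CkD => //; apply: IH => //; [exact: CkS|exact: Ck_derive|exact: CkS|exact: Ck_derive].
Qed.

Lemma Ck_prod k V (U : set V) (I : Type) (r : seq I) (P : pred I)
    (f : I -> V -> R) :
  open U -> (forall i, P i -> Ck k U (f i)) ->
  Ck k U (fun x => \prod_(i <- r | P i) f i x).
Proof.
move=> oU Cf; elim: r => [|i r IH].
  by apply: (@Ck_eq _ _ _ _ (fun=> 1 : R)) => [|x _|] //; [by rewrite big_nil|exact: Ck_cst].
case Pi : (P i); last first.
  by apply: Ck_eq IH => // x _; rewrite big_cons Pi.
apply: (@Ck_eq _ _ _ _ (fun x => f i x * \prod_(i <- r | P i) f i x)) => //.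
  by move=> x _; rewrite big_cons Pi.
by apply: CkM => //; exact: Cf.
Qed.

Lemma CkV k V (U : set V) (f : V -> R) :
  open U -> (forall x, U x -> f x != 0) -> Ck k U f -> Ck k U (fun x => (f x)^-1).
Proof.
move=> oU f0; elim: k f f0 => [|k IH] f f0 Cf.
  by split=> // x Ux; apply: cvgV; [exact: f0|exact: Ck_continuous Cf _].
split; first by move=> x Ux; apply: cvgV; [exact: f0|exact: Ck_continuous Cf _].
split.
  by move=> x v Ux; apply: derivableV; [exact: f0|exact: Ck_derivable Cf _].
move=> v.
apply: (@Ck_eq _ _ _ _ (fun x => - ((f x)^-1 * (f x)^-1) * 'D_v f x)) => //.
  move=> x Ux; rewrite deriveV//; [|exact: f0|exact: Ck_derivable Cf _].
  by rewrite -exprVn expr2.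
have CV : Ck k U (fun x => (f x)^-1) by apply: IH => //; exact: CkS.
by apply: CkM => //; [apply: CkN => //; exact: CkM|exact: Ck_derive].
Qed.

Lemma Ck_id k V (U : set V) : Ck k U (@id V).
Proof.
case: k => [|k]; first by split=> // x _; exact: cvg_id.
split; first by move=> x _; exact: cvg_id.
split; first by move=> x v _; exact: derivable_id.
move=> v; have -> : 'D_v (@id V) = fun=> v by apply/funext => x; rewrite derive_id.
exact: Ck_cst.
Qed.


Lemma continuous_mxP V m n (F : V -> 'M[R]_(m, n)) x :
  {for x, continuous F} <-> forall i j, {for x, continuous (fun y => F y i j)}.
Proof.
split=> [cF i j|cF].
  by apply: (@continuous_comp _ _ _ F (fun M => M i j)) => //; exact: coord_continuous.
apply/cvgrPdist_lt => /= e e0.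
have : \forall y \near x, forall ij : 'I_m * 'I_n, `|F x ij.1 ij.2 - F y ij.1 ij.2| < e.
  by apply: filter_forall => -[i j]; exact: ((cvgrPdist_lt _ _).1 (cF i j)).
apply: filterS => y Hy; rewrite [ltLHS]/Num.Def.normr/= mx_normrE.
by apply: bigmax_lt => // ij _; rewrite !mxE.
Qed.

Lemma Ck_mx k V m n (U : set V) (F : V -> 'M[R]_(m, n)) : open U ->
  Ck k U F <-> forall i j, Ck k U (fun x => F x i j).
Proof.
move=> oU; elim: k F => [|k IH] F.
  split=> [[cF _] i j|CF]; split=> // x Ux.
    by have /continuous_mxP := cF _ Ux; apply.
  by apply/continuous_mxP => i j; exact: Ck_continuous (CF i j) Ux.
split=> [CF i j|CF].
  have dF x v : U x -> derivable F x v by exact: Ck_derivable CF.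
  split; first by move=> x Ux; have /continuous_mxP := Ck_continuous CF Ux; exact.
  split; first by move=> x v Ux; exact: (derivable_mxP _ _ _).1 (dF _ _ Ux) _ _.
  move=> v; apply: (@Ck_eq _ _ _ _ (fun x => 'D_v F x i j)) => //.
    by move=> x Ux; rewrite derive_mx ?mxE//; exact: dF.
  by apply: (IH _).1; exact: Ck_derive.
have dF x v : U x -> derivable F x v.
  by move=> Ux; apply/derivable_mxP => i j; exact: Ck_derivable (CF i j) Ux.
split; first by move=> x Ux; apply/continuous_mxP => i j; exact: Ck_continuous (CF i j) Ux.
split=> // v; apply/IH => i j.
apply: (@Ck_eq _ _ _ _ ('D_v (fun x => F x i j))) => //.
  by move=> x Ux; rewrite derive_mx ?mxE//; exact: dF.
exact: Ck_derive.
Qed.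

Lemma is_derive1_dir V W (f : V -> W) (a v : V) (t : R) :
  derivable f (a + t *: v) v ->
  is_derive t (1 : R) (fun s => f (a + s *: v)) ('D_v f (a + t *: v)).
Proof.
move=> df.
have H h : h^-1 *: (f (a + (h *: (1 : R) + t) *: v) - f (a + t *: v)) =
   h^-1 *: (f (h *: v + (a + t *: v)) - f (a + t *: v)).
  by congr (_ *: (f _ - _)); rewrite [h *: 1]mulr1 scalerDl addrCA addrA.
split; last by rewrite /derive; under eq_fun do rewrite H.
by rewrite /derivable; under eq_fun do rewrite H.
Qed.

Lemma MVT_dir V (f : V -> R) (a v : V) :
  (forall t : R, 0 <= t <= 1 -> derivable f (a + t *: v) v) ->
  exists2 t : R, 0 <= t <= 1 & f (a + v) - f a = 'D_v f (a + t *: v).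
Proof.
move=> df.
have D (t : R) : t \in `]0, 1[ ->
    is_derive t (1 : R) (fun s => f (a + s *: v)) ('D_v f (a + t *: v)).
  rewrite in_itv/= => /andP[t0 t1].
  by apply: is_derive1_dir; apply: df; rewrite !ltW.
have C : {within `[0, 1], continuous (fun s => f (a + s *: v))}.
  apply: derivable_within_continuous => t; rewrite in_itv/= => t01.
  by have [] := @is_derive1_dir _ _ f a v t (df _ t01).
have [t] := MVT_segment ler01 D C.
rewrite in_itv/= => t01; rewrite scale1r scale0r addr0 subr0 mulr1 => ->.
by exists t.
Qed.

Lemma derivableZv V W (f : V -> W) (a v : V) (c : R) :
  derivable f a v -> is_derive a (c *: v) f (c *: 'D_v f a).
Proof.
move=> df; have [->|c0] := eqVneq c 0; first by rewrite !scale0r; exact: is_derive0.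
have H : (h^-1 *: (f (h *: (c *: v) + a) - f a)) @[h --> (0 : R)^'] --> c *: 'D_v f a.
  have -> : (fun h : R => h^-1 *: (f (h *: (c *: v) + a) - f a)) =
     (fun h : R => c *: (h^-1 *: (f (h *: v + a) - f a))) \o (fun h => h * c).
    apply/funext => h /=; rewrite scalerA scalerA.
    by have [->|h0] := eqVneq h 0; [rewrite mul0r !scale0r !add0r subrr !scaler0|rewrite invfM mulrCA divff// mulr1].
  have L : (h^-1 *: (f (h *: v + a) - f a)) @[h --> (0 : R)^'] --> 'D_v f a by exact: df.
  apply: cvg_comp; last exact: (cvgZr L).
  move=> A; rewrite /nbhs/= => /nbhs_ballP[e /= e0 eA].
  near=> h; apply: eA => /=; last by rewrite mulf_neq0//; near: h; exact: nbhs_dnbhs_neq.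
  rewrite /ball/= sub0r normrN normrM -ltr_pdivlMr ?normr_gt0//.
  near: h; apply: dnbhs0_lt; by rewrite divr_gt0// normr_gt0.
by split; [apply/cvg_ex; exists (c *: 'D_v f a)|exact/cvg_lim].
Unshelve. all: by end_near. Qed.


Lemma derivable_comp1 V (g : R -> R) (s : V -> R) (x v : V) :
  derivable g (s x) 1 -> derivable s x v ->
  is_derive x v (fun y => g (s y)) ('D_1 g (s x) * 'D_v s x).
Proof.
move=> dg ds.
have e0 : x + 0 *: v = x by rewrite scale0r addr0.
have ds0 : is_derive (0 : R) (1 : R) (fun t => s (x + t *: v)) ('D_v s x).
  by have := @is_derive1_dir _ _ s x v 0; rewrite e0; apply.
have dg' : is_derive (s (x + 0 *: v)) (1 : R) g ('D_1 g (s x)).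
  by rewrite e0; exact: (DeriveDef dg erefl).
have [] := @is_derive1_comp _ g (fun t : R => s (x + t *: v)) 0 _ _ dg' ds0.
rewrite /derivable /derive.
have E (h : R) : g (s (h *: v + x)) - g (s x) =
   (g \o (fun t : R => s (x + t *: v))) (h *: (1 : R) + 0) -
     (g \o (fun t : R => s (x + t *: v))) 0.
  by rewrite /= scale0r addr0 [h *: 1]mulr1 addr0 [h *: v + x]addrC.
move=> H1 H2; split.
  by rewrite /derivable; under eq_fun do rewrite E.
by rewrite /derive; under eq_fun do rewrite E.
Qed.

Lemma Ck_comp1 k V (U : set V) (O : set R) (g : R -> R) (s : V -> R) :
  open U -> (forall x, U x -> O (s x)) ->
  Ck k O g -> Ck k U s -> Ck k U (fun x => g (s x)).
Proof.
move=> oU sO; elim: k g => [|k IH] g Cg Cs.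
  split=> // x Ux; apply: (@continuous_comp _ _ _ s g).
    exact: Ck_continuous Cs Ux.
  exact: Ck_continuous Cg (sO _ Ux).
have D x v : U x -> is_derive x v (fun y => g (s y)) ('D_1 g (s x) * 'D_v s x).
  move=> Ux; apply: derivable_comp1; last exact: Ck_derivable Cs Ux.
  exact: Ck_derivable Cg (sO _ Ux).
split.
  move=> x Ux; apply: (@continuous_comp _ _ _ s g).
    exact: Ck_continuous Cs Ux.
  exact: Ck_continuous Cg (sO _ Ux).
split; first by move=> x v Ux; have [] := D x v Ux.
move=> v; apply: (@Ck_eq _ _ _ _ (fun x => 'D_1 g (s x) * 'D_v s x)) => //.
  by move=> x Ux; have [_ ->] := D x v Ux.
apply: CkM => //; last exact: Ck_derive.
exact: (IH ('D_1 g) (Ck_derive _ Cg) (CkS Cs)).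
Qed.

Definition rdot n (c v : 'rV[R]_n) : R := \sum_j v 0 j * c 0 j.

Lemma rdot_is_linear n (c : 'rV[R]_n) : linear (rdot c).
Proof.
move=> a u v; rewrite /rdot scaler_sumr -big_split/=; apply: eq_bigr => j _.
by rewrite !mxE mulrDl -mulrA.
Qed.

HB.instance Definition _ n (c : 'rV[R]_n) :=
  GRing.isLinear.Build R 'rV[R]_n R _ (rdot c) (rdot_is_linear c).

Lemma coord_le_norm m n (x : 'M[R]_(m, n)) i j : `|x i j| <= `|x|.
Proof.
rewrite [leRHS]/Num.Def.normr/= mx_normrE.
exact: (le_bigmax _ (fun ij : 'I_m * 'I_n => `|x ij.1 ij.2|) (i, j)).
Qed.

Lemma mx_norm_le m n (x : 'M[R]_(m, n)) e : 0 <= e ->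
  (forall i j, `|x i j| <= e) -> `|x| <= e.
Proof.
move=> e0 xe; rewrite [leLHS]/Num.Def.normr/= mx_normrE.
by apply: bigmax_le => // -[i j] _; exact: xe.
Qed.

Lemma mx_norm_lt m n (x : 'M[R]_(m, n)) e : 0 < e ->
  (forall i j, `|x i j| < e) -> `|x| < e.
Proof.
move=> e0 xe; rewrite [ltLHS]/Num.Def.normr/= mx_normrE.
by apply: bigmax_lt => // -[i j] _; exact: xe.
Qed.

Lemma rdot_continuous n (c : 'rV[R]_n) : continuous (rdot c).
Proof.
have H : Ck 0 setT (rdot c).
  apply: Ck_sum => [|j _]; first exact: openT.
  apply: CkM; [exact: openT| |exact: Ck_cst].
  by split=> // y _; exact: coord_continuous.
by move=> x; exact: Ck_continuous H I.
Qed.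

Definition er n (j : 'I_n) : 'rV[R]_n := delta_mx 0 j.

Lemma rV_basis n (v : 'rV[R]_n) : v = \sum_j v 0 j *: er j.
Proof. exact: row_sum_delta. Qed.

(* Telescoping over the coordinates: [trunc k h] keeps the first [k] coordinates of [h]. *)
Definition trunc n (k : nat) (h : 'rV[R]_n) : 'rV[R]_n := \row_j (if (j < k)%N then h 0 j else 0).

Lemma truncS n (j : 'I_n) h : trunc j.+1 h = trunc j h + h 0 j *: er j.
Proof.
apply/rowP => i; rewrite !mxE ltnS /=.
have [->|ij] := eqVneq i j; first by rewrite leqnn ltnn mulr1 add0r.
by rewrite mulr0 addr0 [in RHS]ltn_neqAle ij.
Qed.

Lemma mx_ballE m n (x y : 'M[R]_(m, n)) e : ball x e y = (`|x - y| < e) :> Prop.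
Proof. by rewrite mx_norm_ball. Qed.

(** Continuity of the partial derivatives gives differentiability: the increment is telescoped along
    the coordinates, and the mean value theorem turns each piece into a partial derivative at a
    nearby point. *)
Lemma C1_increment n (U : set 'rV[R]_n) (f : 'rV[R]_n -> R) (x : 'rV[R]_n) (e : R) :
  open U -> Ck 1 U f -> U x -> 0 < e ->
  \forall h \near (0 : 'rV[R]_n),
    `|f (x + h) - f x - rdot (\row_j 'D_(er j) f x) h| <= e * `|h|.
Proof.
move=> oU Cf Ux e0.
(* The error is shared among the n coordinates; [n.+1] avoids a division by zero for n = 0. *)
have e1 : 0 < e / n.+1%:R by rewrite divr_gt0.
have H1 : \forall y \near x, forall j : 'I_n, `|'D_(er j) f x - 'D_(er j) f y| < e / n.+1%:R.
  apply: (@filter_forall _ _ _ _ (nbhs_filter x)) => j.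
  by have /cvgrPdist_lt := Ck_continuous (Ck_derive (er j) Cf) Ux; apply.
have : \forall y \near x, U y /\ forall j, `|'D_(er j) f x - 'D_(er j) f y| < e / n.+1%:R.
  by apply: filterI => //; exact: open_nbhs_nbhs.
move=> /nbhs_ballP[d /= d0 dx].
apply/nbhs_ballP; exists d => //= h.
rewrite mx_ballE sub0r normrN => hd.
have B y : `|y| <= `|h| -> ball x d (x + y).
  by move=> yh; rewrite mx_ballE opprD addNKr normrN (le_lt_trans yh).
have -> : f (x + h) - f x = \sum_(j < n) (f (x + trunc j.+1 h) - f (x + trunc j h)).
  have := @telescope_sumr _ 0 n (fun k => f (x + trunc k h)) (leq0n _).
  rewrite big_mkord => ->; congr (f (x + _) - f _).
    by apply/rowP => j; rewrite mxE ltn_ord.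
  by rewrite [trunc _ _](_ : _ = 0) ?addr0//; apply/rowP => j; rewrite !mxE.
rewrite /rdot -sumrB (le_trans (ler_norm_sum _ _ _))//.
have H (j : 'I_n) : `|f (x + trunc j.+1 h) - f (x + trunc j h) -
    h 0 j * (\row_j 'D_(er j) f x) 0 j| <= e / n.+1%:R * `|h|.
  rewrite truncS addrA mxE.
  have T (t : R) : 0 <= t <= 1 -> ball x d (x + trunc j h + t *: (h 0 j *: er j)).
    move=> /andP[t0 t1]; rewrite -addrA; apply: B.
    apply: mx_norm_le => // i k; rewrite !mxE ord1; case: ltngtP => kj.
    + by rewrite (negbTE (_ : k != j)) ?mulr0 ?addr0 ?coord_le_norm// -val_eqE ltn_eqF.
    + by rewrite (negbTE (_ : k != j)) ?mulr0 ?addr0 ?normr0// -val_eqE gtn_eqF.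
    + have -> : k = j by exact/val_inj.
      rewrite !eqxx /= mulr1 add0r normrM (ger0_norm t0).
      by rewrite (le_trans _ (coord_le_norm h 0 j))// ler_piMl.
  have df (t : R) : 0 <= t <= 1 -> derivable f (x + trunc j h + t *: (h 0 j *: er j)) (er j).
    by move=> /T/dx[Uy _]; exact: Ck_derivable Cf Uy.
  have [t t01 ->] : exists2 t : R, 0 <= t <= 1 &
      f (x + trunc j h + h 0 j *: er j) - f (x + trunc j h) =
      'D_(h 0 j *: er j) f (x + trunc j h + t *: (h 0 j *: er j)).
    by apply: MVT_dir => t /df/(derivableZv (h 0 j))[].
  have [_ ->] := derivableZv (h 0 j) (df _ t01).
  rewrite [_ *: 'D_ _ _ _]/(h 0 j * _) -mulrBr normrM mulrC distrC.
  by apply: ler_pM => //; [rewrite ltW//; have /dx[_] := T _ t01; apply|exact: coord_le_norm].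
apply: (@le_trans _ _ (\sum_(j < n) e / n.+1%:R * `|h|)).
  by apply: ler_sum => j _; exact: H.
rewrite sumr_const card_ord -[leLHS]mulr_natl mulrA ler_wpM2r//.
by rewrite mulrCA ler_piMr ?ltW// ltr_pdivrMr// mul1r ltr_nat.
Qed.

Lemma C1_differentiable n (U : set 'rV[R]_n) (f : 'rV[R]_n -> R) (x : 'rV[R]_n) :
  open U -> Ck 1 U f -> U x -> differentiable f x /\
    'd f x = rdot (\row_j 'D_(er j) f x) :> ('rV[R]_n -> R).
Proof.
move=> oU Cf Ux.
pose df := rdot (\row_j 'D_(er j) f x).
have H : f \o shift x = cst (f x) + df +o_ (0 : 'rV[R]_n) id.
  apply/eqaddoP => e e0.
  near=> h; rewrite /= [X in `|X|](_ : _ = f (x + h) - f x - df h).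
    by near: h; exact: (C1_increment oU Cf Ux e0).
  by transitivity (f (h + x) - (f x + df h)) => //; rewrite opprD addrA [h + x]addrC.
have E : 'd f x = df :> ('rV[R]_n -> R).
  exact: (@diff_unique R 'rV[R]_n R f df x (@rdot_continuous _ _) H).
split=> //; apply/diff_locallyP; rewrite E; split=> //.
exact: rdot_continuous.
Unshelve. all: by end_near. Qed.

Lemma C1_deriveE n (U : set 'rV[R]_n) (f : 'rV[R]_n -> R) (x v : 'rV[R]_n) :
  open U -> Ck 1 U f -> U x -> 'D_v f x = \sum_j v 0 j * 'D_(er j) f x.
Proof.
move=> oU Cf Ux; have [df E] := C1_differentiable oU Cf Ux.
by rewrite deriveE// E /rdot; apply: eq_bigr => j _; rewrite mxE.
Qed.

End Ck.

(** * Vector-valued maps, the chain rule and the symmetry of second derivatives *)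

Section Smooth2.
Context {R : realType}.

Lemma C1_differentiable_mx n a b (U : set 'rV[R]_n) (F : 'rV[R]_n -> 'M[R]_(a, b)) x :
  open U -> Ck 1 U F -> U x -> differentiable F x.
Proof.
move=> oU /(Ck_mx _ _ oU) CF Ux.
have -> : F = \sum_i (fun y => \sum_j F y i j *: delta_mx i j).
  apply/funext => y; rewrite fct_sumE; exact: matrix_sum_delta.
apply: differentiable_sum => i.
have -> : (fun y => \sum_j F y i j *: delta_mx i j) =
    \sum_j (fun y => F y i j *: delta_mx i j) by apply/funext => y; rewrite fct_sumE.
apply: differentiable_sum => j; apply: differentiableZl.
by have [] := C1_differentiable oU (CF i j) Ux.
Qed.

Lemma C1_jacobianE n b (U : set 'rV[R]_n) (F : 'rV[R]_n -> 'rV[R]_b) x v :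
  open U -> Ck 1 U F -> U x -> 'D_v F x = v *m jacobian F x.
Proof. by move=> oU CF Ux; rewrite deriveEjacobian//; exact: C1_differentiable_mx CF Ux. Qed.

Lemma jacobian_coord n b (U : set 'rV[R]_n) (F : 'rV[R]_n -> 'rV[R]_b) x i j :
  open U -> Ck 1 U F -> U x -> jacobian F x i j = 'D_(er i) (fun y => F y 0 j) x.
Proof.
move=> oU CF Ux; have := C1_jacobianE (er i) oU CF Ux.
rewrite -rowE derive_mx; last exact: Ck_derivable CF Ux.
by move=> /rowP/(_ j); rewrite !mxE.
Qed.

Lemma Ck_jacobian k n b (U : set 'rV[R]_n) (F : 'rV[R]_n -> 'rV[R]_b) i j :
  open U -> Ck k.+1 U F -> Ck k U (fun x => jacobian F x i j).
Proof.
move=> oU CF; have C1F : Ck 1 U F by elim: k CF => // k IH /CkS.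
apply: (@Ck_eq _ _ _ _ _ ('D_(er i) (fun y => F y 0 j))) => //.
  by move=> x Ux; rewrite (jacobian_coord i j oU C1F Ux).
by apply: Ck_derive; apply: (Ck_mx _ _ oU).1.
Qed.

Lemma Ck_row_mx k n a b c (U : set 'rV[R]_n) (F : 'rV[R]_n -> 'M[R]_(a, b))
    (G : 'rV[R]_n -> 'M[R]_(a, c)) :
  open U -> Ck k U F -> Ck k U G -> Ck k U (fun x => row_mx (F x) (G x)).
Proof.
move=> oU /(Ck_mx _ _ oU) CF /(Ck_mx _ _ oU) CG; apply/(Ck_mx _ _ oU) => i j.
rewrite -(splitK j); case: (fintype.split j) => j' /=.
  by under eq_fun do rewrite row_mxEl.
by under eq_fun do rewrite row_mxEr.
Qed.

Lemma Ck_mulmx k n a b c (U : set 'rV[R]_n) (F : 'rV[R]_n -> 'M[R]_(a, b))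
    (G : 'rV[R]_n -> 'M[R]_(b, c)) :
  open U -> Ck k U F -> Ck k U G -> Ck k U (fun x => F x *m G x).
Proof.
move=> oU /(Ck_mx _ _ oU) CF /(Ck_mx _ _ oU) CG; apply/(Ck_mx _ _ oU) => i j.
under eq_fun do rewrite mxE.
by apply: Ck_sum => // l _; exact: CkM.
Qed.

Lemma Ck_det k (V : normedModType R) a (U : set V) (F : V -> 'M[R]_a) :
  open U -> Ck k U F -> Ck k U (fun x => \det (F x)).
Proof.
move=> oU /(Ck_mx _ _ oU) CF; apply: Ck_sum => // s _.
apply: CkM => //; first exact: Ck_cst.
by apply: Ck_prod => // i _.
Qed.

(** [F] is only known to be derivable in the direction [v], so the chain rule for differentials is
    applied to [F] along the line through [x]. *)
Lemma derive_chain (V : normedModType R) b (O : set 'rV[R]_b) (f : 'rV[R]_b -> R)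
    (F : V -> 'rV[R]_b) (x v : V) :
  open O -> Ck 1 O f -> O (F x) -> derivable F x v ->
  is_derive x v (fun y => f (F y)) ('D_('D_v F x) f (F x)).
Proof.
move=> oO Cf OF dF.
have [df _] := C1_differentiable oO Cf OF.
have e0 : x + 0 *: v = x by rewrite scale0r addr0.
have dF0 : is_derive (0 : R) (1 : R) (fun t => F (x + t *: v)) ('D_v F x).
  by have := @is_derive1_dir _ _ _ F x v 0; rewrite e0; apply.
pose G := fun t : R => F (x + t *: v).
have dG : differentiable G 0 by apply/derivable1_diffP; case: dF0.
have G0 : G 0 = F x by rewrite /G e0.
have dfG : differentiable (f \o G) 0.
  by apply: differentiable_comp; rewrite ?G0.
have H1 : derivable (f \o G) 0 1 by exact/derivable1_diffP.
have H2 : 'D_1 (f \o G) 0 = 'D_('D_v F x) f (F x).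
  have dfG0 : differentiable f (G 0) by rewrite G0.
  rewrite (deriveE (1 : R) dfG) (diff_comp dG dfG0) /= -(deriveE (1 : R) dG) G0 -(deriveE _ df).
  by congr ('D_ _ f _); case: dF0.
have E (h : R) : f (F (h *: v + x)) - f (F x) =
   (f \o G) (h *: (1 : R) + 0) - (f \o G) 0.
  by rewrite /= /G scale0r addr0 [h *: 1]mulr1 addr0 [h *: v + x]addrC.
split.
  by rewrite /derivable; under eq_fun do rewrite E.
by rewrite -H2 /derive; under eq_fun do rewrite E.
Qed.

Lemma C1_deriveE_chain (V : normedModType R) b (U : set V) (O : set 'rV[R]_b) (f : 'rV[R]_b -> R)
    (F : V -> 'rV[R]_b) (x v : V) :
  open O -> Ck 1 O f -> O (F x) -> derivable F x v ->
  'D_v (fun y => f (F y)) x = \sum_j 'D_v (fun y => F y 0 j) x * 'D_(er j) f (F x).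
Proof.
move=> oO Cf OF dF; have [_ ->] := derive_chain oO Cf OF dF.
rewrite (C1_deriveE _ oO Cf OF); apply: eq_bigr => j _.
by rewrite derive_mx// mxE.
Qed.

(** The chain rule writes a derivative of the composite as a sum of products whose factors have one
    order less, so the induction is on [k], with [f] replaced by its partial derivatives. *)
Lemma Ck_comp k (V : normedModType R) b (U : set V) (O : set 'rV[R]_b)
    (f : 'rV[R]_b -> R) (F : V -> 'rV[R]_b) :
  open U -> open O -> (forall x, U x -> O (F x)) ->
  Ck k O f -> Ck k U F -> Ck k U (fun x => f (F x)).
Proof.
move=> oU oO FO; elim: k f => [|k IH] f Cf CF.
  split=> // x Ux; apply: (@continuous_comp _ _ _ F f).
    exact: Ck_continuous CF Ux.
  exact: Ck_continuous Cf (FO _ Ux).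
have C1f : Ck 1 O f by elim: k {IH CF} Cf => // k IH /CkS.
have dF x v : U x -> derivable F x v by exact: Ck_derivable CF.
split.
  move=> x Ux; apply: (@continuous_comp _ _ _ F f).
    exact: Ck_continuous CF Ux.
  exact: Ck_continuous Cf (FO _ Ux).
split.
  by move=> x v Ux; have [] := derive_chain oO C1f (FO _ Ux) (dF _ v Ux).
move=> v.
apply: (@Ck_eq _ _ _ _ _ (fun x => \sum_j 'D_v (fun y => F y 0 j) x * 'D_(er j) f (F x))) => //.
  by move=> x Ux; rewrite (C1_deriveE_chain U oO C1f (FO _ Ux) (dF _ v Ux)).
apply: Ck_sum => // j _; apply: CkM => //.
  by apply: Ck_derive; apply: (Ck_mx _ _ oU).1.
exact: (IH ('D_(er j) f) (Ck_derive _ Cf) (CkS CF)).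
Qed.

Lemma Ck_comp_mx k (V : normedModType R) b c d (U : set V) (O : set 'rV[R]_b)
    (f : 'rV[R]_b -> 'M[R]_(c, d)) (F : V -> 'rV[R]_b) :
  open U -> open O -> (forall x, U x -> O (F x)) ->
  Ck k O f -> Ck k U F -> Ck k U (fun x => f (F x)).
Proof.
move=> oU oO FO /(Ck_mx _ _ oO) Cf CF; apply/(Ck_mx _ _ oU) => i j.
exact: (@Ck_comp _ _ _ U O (fun y => f y i j) F).
Qed.

Lemma jacobian_comp a b c (U : set 'rV[R]_a) (O : set 'rV[R]_b)
    (F : 'rV[R]_a -> 'rV[R]_b) (G : 'rV[R]_b -> 'rV[R]_c) x :
  open U -> open O -> Ck 1 U F -> Ck 1 O G -> U x -> O (F x) ->
  jacobian (G \o F) x = jacobian F x *m jacobian G (F x).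
Proof.
move=> oU oO CF CG Ux OFx.
have dF := C1_differentiable_mx oU CF Ux.
have dG := C1_differentiable_mx oO CG OFx.
have dGF : differentiable (G \o F) x by apply: differentiable_comp.
apply/row_matrixP => i; rewrite row_mul !rowE.
rewrite -(deriveEjacobian _ dGF) -(deriveEjacobian _ dF) -(deriveEjacobian _ dG).
by rewrite (deriveE _ dGF) (diff_comp dF dG) /= (deriveE _ dF) (deriveE _ dG).
Qed.

Lemma jacobian_near a b (F G : 'rV[R]_a -> 'rV[R]_b) x (U : set 'rV[R]_a) :
  open U -> Ck 1 U F -> U x -> (forall y, U y -> F y = G y) ->
  jacobian G x = jacobian F x.
Proof.
move=> oU CF Ux FG.
have CG : Ck 1 U G by exact: Ck_eq CF.
apply/matrixP => i j; apply: etrans (jacobian_coord i j oU CG Ux) _.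
apply: etrans _ (esym (jacobian_coord i j oU CF Ux)).
apply: near_eq_derive; apply: filterS (open_nbhs_nbhs (conj oU Ux)) => y Uy.
by rewrite FG.
Qed.

Lemma jacobian_id a (x : 'rV[R]_a) : jacobian (@id 'rV[R]_a) x = 1%:M.
Proof.
have d : differentiable (@id 'rV[R]_a) x by exact: (@ex_diff _ _ _ _ _ _ _ (is_diff_id x)).
by apply/row_matrixP => i; rewrite !rowE -(deriveEjacobian _ d) derive_id mulmx1.
Qed.

Lemma Ck_segment2 (V : normedModType R) (U : set V) (x u v : V) (r : R) :
  ball x r `<=` U -> forall s t t' : R, 0 <= t <= 1 -> 0 <= t' <= 1 ->
  `|s| * (`|u| + `|v|) < r -> U (x + t *: (s *: u) + t' *: (s *: v)).
Proof.
move=> BU s t t' /andP[t0 t1] /andP[s0 s1] sr; apply: BU.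
rewrite -ball_normE/= -addrA opprD addNKr normrN (le_lt_trans _ sr)//.
rewrite (le_trans (ler_normD _ _))// mulrDr !normrZ (ger0_norm t0) (ger0_norm s0).
by rewrite lerD// ler_piMl// mulr_ge0.
Qed.

(** The mean value theorem is applied first to [phi], the increment in the direction [v], along [u],
    and then to ['D_u f] along [v]. *)
Lemma second_difference (V : normedModType R) (U : set V) (f : V -> R) (x u v : V) (r s : R) :
  Ck 2 U f -> ball x r `<=` U -> `|s| * (`|u| + `|v|) < r ->
  exists y : V, ball x r y /\
   f (x + s *: u + s *: v) - f (x + s *: u) - (f (x + s *: v) - f x) =
   s ^+ 2 * 'D_v ('D_u f) y.
Proof.
move=> Cf BU sr.
have seg (t t' : R) : 0 <= t <= 1 -> 0 <= t' <= 1 -> ball x r (x + t *: (s *: u) + t' *: (s *: v)).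
  by move=> t01 t01'; exact: (@Ck_segment2 _ (ball x r) x u v r _ s t t').
pose phi y := f (y + s *: v) - f y.
have one : 0 <= (1 : R) <= 1 by rewrite ler01 lexx.
have zero : 0 <= (0 : R) <= 1 by rewrite ler01 lexx.
have D0 (t : R) : 0 <= t <= 1 -> derivable f (x + t *: (s *: u)) u.
  move=> t01; apply: Ck_derivable Cf _; apply: BU.
  by have := seg _ _ t01 zero; rewrite scale0r addr0.
have D1 (t : R) : 0 <= t <= 1 -> derivable (fun y => f (y + s *: v)) (x + t *: (s *: u)) u /\
    'D_u (fun y => f (y + s *: v)) (x + t *: (s *: u)) = 'D_u f (x + t *: (s *: u) + s *: v).
  move=> t01; have E (h : R) : f (h *: u + (x + t *: (s *: u)) + s *: v) =
     f (h *: u + (x + t *: (s *: u) + s *: v)) by rewrite !addrA.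
  split; last by rewrite /derive/=; under eq_fun do rewrite E.
  rewrite /derivable/=; under eq_fun do rewrite E.
  apply: Ck_derivable Cf _; apply: BU.
  by have := seg _ _ t01 one; rewrite scale1r.
have Dphi (t : R) : 0 <= t <= 1 -> is_derive (x + t *: (s *: u)) (s *: u) phi
    (s * ('D_u f (x + t *: (s *: u) + s *: v) - 'D_u f (x + t *: (s *: u)))).
  move=> t01; have [d1 e1] := D1 _ t01.
  have dphi : derivable phi (x + t *: (s *: u)) u by apply: derivableB => //; exact: D0.
  have e2 : 'D_u phi (x + t *: (s *: u)) =
      'D_u f (x + t *: (s *: u) + s *: v) - 'D_u f (x + t *: (s *: u)).
    by apply: etrans (deriveB d1 (D0 _ t01)) _; congr (_ - _).
  by rewrite -e2; exact: derivableZv.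
have [t t01] := @MVT_dir _ _ phi x (s *: u) (fun t t01 => let: DeriveDef d _ := Dphi t t01 in d).
have [_ ->] := Dphi _ t01.
have D2 (t' : R) : 0 <= t' <= 1 ->
    derivable ('D_u f) (x + t *: (s *: u) + t' *: (s *: v)) v.
  by move=> t01'; apply: Ck_derivable (Ck_derive u Cf) _; apply: BU; exact: seg.
have [t' t01'] := @MVT_dir _ _ ('D_u f) (x + t *: (s *: u)) (s *: v)
  (fun t' t01' => let: DeriveDef d _ := derivableZv s (D2 t' t01') in d).
move=> ->; have [_ ->] := derivableZv s (D2 t' t01') => /= E.
exists (x + t *: (s *: u) + t' *: (s *: v)); split; first exact: seg.
by rewrite expr2 -mulrA; exact: E.
Qed.

Lemma continuous_ball (V W : normedModType R) (f : V -> W) (x : V) (e : R) :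
  {for x, continuous f} -> 0 < e ->
  exists2 r : R, 0 < r & forall y, ball x r y -> `|f x - f y| < e.
Proof.
move=> cf e0; have /cvgrPdist_lt/(_ _ e0)/nbhs_ballP[r /= r0 rB] := cf.
by exists r.
Qed.

Lemma open_ball (V : normedModType R) (U : set V) (x : V) :
  open U -> U x -> exists2 r : R, 0 < r & ball x r `<=` U.
Proof.
by move=> oU Ux; have /nbhs_ballP[r /= r0 rB] := open_nbhs_nbhs (conj oU Ux); exists r.
Qed.

Lemma dist_half (a b c d e : R) :
  `|a - c| < e / 2 -> `|b - d| < e / 2 -> c = d -> `|a - b| < e.
Proof. by move=> + + cd; rewrite cd !ltr_norml; lra. Qed.

Lemma second_difference_eq (a b c d : R) : a - b - (c - d) = a - c - (b - d).
Proof. ring. Qed.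

(** The second difference does not see the order of [u] and [v], so for small [s] it exhibits a
    common value of both mixed derivatives, taken at points near [x]; continuity does the rest. *)
Lemma C2_symmetric (V : normedModType R) (U : set V) (f : V -> R) (x u v : V) :
  open U -> Ck 2 U f -> U x -> 'D_u ('D_v f) x = 'D_v ('D_u f) x.
Proof.
move=> oU Cf Ux; apply/eqP; rewrite -subr_eq0 -normr_eq0; apply/negPn/negP => n0.
set e := `|_| in n0; have e0 : 0 < e / 2 by rewrite divr_gt0// lt_def n0 normr_ge0.
have c1 : {for x, continuous ('D_u ('D_v f))} by exact: Ck_continuous (Ck_derive u (Ck_derive v Cf)) Ux.
have c2 : {for x, continuous ('D_v ('D_u f))} by exact: Ck_continuous (Ck_derive v (Ck_derive u Cf)) Ux.
have [r0 r00 B0] := open_ball oU Ux.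
have [r1 r10 H1] := continuous_ball c1 e0.
have [r2 r20 H2] := continuous_ball c2 e0.
pose r := Num.min r0 (Num.min r1 r2).
have rp : 0 < r by rewrite !lt_min r00 r10 r20.
have BU : ball x r `<=` U by apply: subset_trans B0; apply: le_ball; rewrite ge_min lexx.
have B1 y : ball x r y -> ball x r1 y by apply: le_ball; rewrite !ge_min lexx orbT.
have B2 y : ball x r y -> ball x r2 y by apply: le_ball; rewrite !ge_min lexx !orbT.
pose s := r / (`|u| + `|v| + 1) / 2.
have d0 : 0 < `|u| + `|v| + 1 by rewrite ltr_wpDl// addr_ge0.
have s0 : 0 < s by rewrite !divr_gt0.
have sr : `|s| * (`|u| + `|v|) < r.
  rewrite gtr0_norm// /s mulrAC ltr_pdivrMr// mulrAC ltr_pdivrMr// -mulrA ltr_pM2l//.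
  have := normr_ge0 u; have := normr_ge0 v; lra.
have [y [By Ey]] := second_difference Cf BU sr.
have sr' : `|s| * (`|v| + `|u|) < r by rewrite [_ + `|u|]addrC.
have [z [Bz Ez]] := second_difference Cf BU sr'.
have E : 'D_u ('D_v f) z = 'D_v ('D_u f) y.
  have s20 : s ^+ 2 != 0 by rewrite expf_neq0// gt_eqF.
  apply: (mulfI s20); apply: etrans (esym Ez) _; apply: etrans _ Ey.
  by rewrite [x + s *: v + s *: u]addrAC second_difference_eq.
have h1 := H1 _ (B1 _ Bz); have h2 := H2 _ (B2 _ By).
have := dist_half h1 h2 E; by rewrite /e ltxx.
Qed.

End Smooth2.

(** * Alternating forms in coordinates *)

Section Multilinear.
Context {R : realType}.

Definition setrow k n (E : 'M[R]_(k, n)) (i : 'I_k) (v : 'rV[R]_n) : 'M[R]_(k, n) :=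
  \matrix_(r, c) (if r == i then v 0 c else E r c).

Lemma row_setrow k n (E : 'M[R]_(k, n)) i v : row i (setrow E i v) = v.
Proof. by apply/rowP => c; rewrite !mxE eqxx. Qed.

Lemma row_setrow_neq k n (E : 'M[R]_(k, n)) i j v : j != i -> row j (setrow E i v) = row j E.
Proof. by move=> ji; apply/rowP => c; rewrite !mxE (negbTE ji). Qed.

Lemma row'_setrow k n (E : 'M[R]_(k, n)) i v : row' i (setrow E i v) = row' i E.
Proof. by apply/matrixP => r c; rewrite !mxE eq_sym (negbTE (neq_lift _ _)). Qed.

Lemma setrow_row k n (E : 'M[R]_(k, n)) i : setrow E i (row i E) = E.
Proof. by apply/matrixP => r c; rewrite !mxE; case: eqP => // ->. Qed.

Lemma setrowC k n (E : 'M[R]_(k, n)) i j u v : i != j ->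
  setrow (setrow E i u) j v = setrow (setrow E j v) i u.
Proof.
move=> ij; apply/matrixP => r c; rewrite !mxE.
by case: (eqVneq r j) => // ->; rewrite eq_sym (negbTE ij).
Qed.

Lemma row'_setrow_lift k n (E : 'M[R]_(k.+1, n)) i r v :
  row' i (setrow E (lift i r) v) = setrow (row' i E) r v.
Proof. by apply/matrixP => s c; rewrite !mxE (inj_eq lift_inj). Qed.

Lemma multilinearP k n (a : 'M[R]_(k, n) -> R) :
  multilinear a <-> forall E i b c u v,
    a (setrow E i (b *: u + c *: v)) = b * a (setrow E i u) + c * a (setrow E i v).
Proof.
split=> [ma E i b c u v|ma i A B C b c rA rB rC].
  by apply: (ma i); rewrite ?row_setrow ?row'_setrow.
have EB : setrow A i (row i B) = B.
  apply/matrixP => r s; rewrite !mxE; case: (unliftP i r) => [j ->|->]; last by rewrite eqxx.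
  rewrite eq_sym (negbTE (neq_lift _ _)).
  by have := congr1 (fun M : 'M[R]_(k.-1, n) => M j s) rB; rewrite !mxE.
have EC : setrow A i (row i C) = C.
  apply/matrixP => r s; rewrite !mxE; case: (unliftP i r) => [j ->|->]; last by rewrite eqxx.
  rewrite eq_sym (negbTE (neq_lift _ _)).
  by have := congr1 (fun M : 'M[R]_(k.-1, n) => M j s) rC; rewrite !mxE.
by rewrite -{1}(setrow_row A i) rA ma EB EC.
Qed.

Lemma multilinear0 k n (a : 'M[R]_(k, n) -> R) E i : multilinear a ->
  a (setrow E i 0) = 0.
Proof.
by move=> /multilinearP/(_ E i 0 0 0 0); rewrite !mul0r !scaler0 !addr0.
Qed.

Lemma multilinear_row0 k n (a : 'M[R]_(k, n) -> R) E i : multilinear a ->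
  row i E = 0 -> a E = 0.
Proof. by move=> ma E0; rewrite -(setrow_row E i) E0 multilinear0. Qed.

Lemma multilinear_sum k n (a : 'M[R]_(k, n) -> R) E i (I : Type) (s : seq I) (c : I -> R)
    (v : I -> 'rV[R]_n) : multilinear a ->
  a (setrow E i (\sum_(j <- s) c j *: v j)) = \sum_(j <- s) c j * a (setrow E i (v j)).
Proof.
move=> ma; elim: s => [|j s IH]; first by rewrite !big_nil multilinear0.
rewrite !big_cons -IH -[X in a (setrow _ _ (_ + X))]scale1r.
by rewrite ((multilinearP _).1 ma) mul1r.
Qed.

Definition deltaI k n (I : {ffun 'I_k -> 'I_n}) : 'M[R]_(k, n) :=
  \matrix_(r, c) (c == I r)%:R.

Lemma multilinear_ext k n (a b : 'M[R]_(k, n) -> R) :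
  multilinear a -> multilinear b ->
  (forall I : {ffun 'I_k -> 'I_n}, a (deltaI I) = b (deltaI I)) -> a =1 b.
Proof.
move=> ma mb ab.
(* [s] bounds the number of leading rows that are still arbitrary; the rows from [s] on are basis
   vectors. *)
suff H (s : nat) E : (s <= k)%N ->
    (forall r : 'I_k, (s <= r)%N -> exists c, row r E = er c) -> a E = b E.
  by move=> E; apply: (H k E (leqnn k)) => r; rewrite leqNgt ltn_ord.
elim: s E => [|s IH] E sk HE.
  have /choice[f Hf] : forall r : 'I_k, exists c, row r E = er c by move=> r; exact: HE.
  suff -> : E = deltaI [ffun r => f r] by exact: ab.
  apply/row_matrixP => r; rewrite Hf; apply/rowP => c; rewrite !mxE ffunE.
  by rewrite eqxx.
have E1 := setrow_row E (Ordinal sk); rewrite -E1 (rV_basis (row (Ordinal sk) E)).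
rewrite !multilinear_sum//; apply: eq_bigr => c _; congr (_ * _).
apply: IH; first exact: ltnW.
move=> r; rewrite leq_eqVlt => /orP[/eqP sr|sr].
  have -> : r = Ordinal sk by apply/val_inj.
  by exists c; rewrite row_setrow.
have rs : r != Ordinal sk by rewrite -val_eqE gtn_eqF.
by rewrite row_setrow_neq//; exact: HE.
Qed.

(** The expansion runs over all index maps rather than the increasing ones: it is valid for every
    multilinear map and reduces smooth dependence on the form and on [E] to that of finitely many
    products. *)
Definition mexp k n (a : 'M[R]_(k, n) -> R) (E : 'M[R]_(k, n)) :=
  \sum_(I : {ffun 'I_k -> 'I_n}) (\prod_r E r (I r)) * a (deltaI I).

Lemma mexp_multilinear k n (a : 'M[R]_(k, n) -> R) : multilinear (mexp a).
Proof.
apply/multilinearP => E i b c u v; rewrite /mexp !big_distrr -big_split/=.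
apply: eq_bigr => I _; rewrite !mulrA -mulrDl; congr (_ * _).
have H w : \prod_(r < k) setrow E i w r (I r) =
    w 0 (I i) * \prod_(r < k | r != i) E r (I r).
  rewrite (bigD1 i)//= mxE eqxx; congr (_ * _).
  by apply: eq_bigr => r /negbTE ri; rewrite mxE ri.
by rewrite !H !mxE mulrDl !mulrA.
Qed.

Lemma multilinear_expand k n (a : 'M[R]_(k, n) -> R) E : multilinear a -> a E = mexp a E.
Proof.
move=> ma; apply: multilinear_ext => //; first exact: mexp_multilinear.
move=> I; rewrite /mexp (bigD1 I)//=.
have -> : \prod_(r < k) deltaI I r (I r) = 1.
  by apply: big1 => r _; rewrite mxE eqxx.
rewrite mul1r big1 ?addr0// => J JI.
have [r rJ] : exists r, J r != I r.
  apply/existsP; apply: contraR JI; rewrite negb_exists => /forallP H.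
  by apply/eqP/ffunP => r; apply/eqP; rewrite -[_ == _]negbK.
by rewrite (bigD1 r)//= mxE (negbTE rJ) !mul0r.
Qed.

Lemma alternating_xrow k n (a : 'M[R]_(k, n) -> R) E i j :
  multilinear a -> alternating a -> i != j -> a (xrow i j E) = - a E.
Proof.
move=> ma aa ij; have := (multilinearP _).1 ma => mP.
pose u := row i E; pose v := row j E.
pose S x y := a (setrow (setrow E i x) j y).
have S0 x : S x x = 0.
  apply: (aa _ i j ij); rewrite row_setrow row_setrow_neq ?row_setrow//.
have Dl x y z : S (x + y) z = S x z + S y z.
  have := mP (setrow E j z) i 1 1 x y; rewrite !scale1r !mul1r /S.
  by rewrite -![setrow (setrow E j z) i _]setrowC 1?eq_sym// 1?eq_sym.
have Dr x y z : S z (x + y) = S z x + S z y.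
  by have := mP (setrow E i z) j 1 1 x y; rewrite !scale1r !mul1r.
have : S (u + v) (u + v) = 0 by [].
rewrite Dl !Dr !S0 add0r addr0 => /eqP; rewrite addrC addr_eq0 => /eqP.
have -> : S v u = a (xrow i j E).
  congr a; apply/row_matrixP => r; rewrite /xrow; apply/rowP => c; rewrite !mxE.
  case: (eqVneq r j) => [->|rj]; first by rewrite tpermR.
  case: (eqVneq r i) => [->|ri]; first by rewrite tpermL.
  by rewrite tpermD// eq_sym.
by rewrite /S setrow_row setrow_row.
Qed.

Lemma alternating_perm k n (a : 'M[R]_(k, n) -> R) E (s : 'S_k) :
  multilinear a -> alternating a -> a (row_perm s E) = (-1) ^+ s * a E.
Proof.
move=> ma aa; have [ts -> Hts] := prod_tpermP s.
elim: ts Hts => [|[i j] ts IH] /=.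
  by rewrite big_nil row_perm1 odd_perm1 mul1r.
move=> /andP[ij Hts]; rewrite big_cons row_permM.
rewrite -/(xrow i j _) alternating_xrow//= IH// odd_mul_tperm ij signr_addb expr1.
by rewrite mulN1r mulNr.
Qed.

(** The transposition of [i] and [l] carries the complement of [i] to that of [l], so the two
    matrices differ by a permutation of rows, whose sign comes from [odd_lift_perm]. Both the
    alternation of [fd] and the cancellation of second derivatives in [fd_pull] rest on this. *)
Lemma alternating_row' k n (a : 'M[R]_(k, n) -> R) (F : 'M[R]_(k.+1, n)) i l :
  multilinear a -> alternating a -> i != l -> row i F = row l F ->
  (-1) ^+ i * a (row' i F) = - ((-1) ^+ l * a (row' l F)).
Proof.
move=> ma aa il Fil.
have liftT r : exists r', lift l r' = tperm i l (lift i r).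
  case: (unliftP l (tperm i l (lift i r))) => [r' ->|]; first by exists r'.
  rewrite -{2}(tpermL i l) => /perm_inj/eqP.
  by rewrite eq_sym (negbTE (neq_lift _ _)).
have /choice[f Hf] := liftT.
have f_inj : injective f.
  by move=> r s fE; apply: (@lift_inj _ i); apply: (@perm_inj _ (tperm i l)); rewrite -!Hf fE.
have tE : tperm i l = lift_perm i l (perm f_inj).
  apply/permP => r; case: (unliftP i r) => [r' ->|->].
    by rewrite lift_perm_lift -[LHS]Hf; congr (lift l _); rewrite permE.
  by rewrite lift_perm_id tpermL.
have E : row' i F = row_perm (perm f_inj) (row' l F).
  apply/matrixP => r c; rewrite !mxE permE Hf.
  case: tpermP => [/eqP|->|//]; first by rewrite eq_sym (negbTE (neq_lift _ _)).
  by have /rowP/(_ c) := Fil; rewrite !mxE.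
have /(congr1 (fun p : 'S__ => odd_perm p)) := tE.
rewrite odd_tperm il odd_lift_perm => /esym Hodd.
rewrite E alternating_perm// mulrA -mulNr; congr (_ * _).
rewrite -[in LHS]signr_odd -[in RHS]signr_odd -signr_addb.
by move: Hodd; case: (odd i); case: (odd l); case: (odd_perm _) => //= _; rewrite ?expr0 ?expr1 ?opprK.
Qed.

(** Both sides are multilinear in [P], so its rows may be taken to be basis vectors: then [P] is a
    permutation matrix or has two equal rows. *)
Lemma alternating_mulmx m n (a : 'M[R]_(m, n) -> R) (P : 'M[R]_m) E :
  multilinear a -> alternating a -> a (P *m E) = \det P * a E.
Proof.
move=> ma aa.
have mP (A : 'M[R]_m) i b c u v : setrow A i (b *: u + c *: v) *m E =
    setrow (A *m E) i (b *: (u *m E) + c *: (v *m E)).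
  apply/row_matrixP => r; have [->|ri] := eqVneq r i.
    by rewrite row_mul !row_setrow mulmxDl -!scalemxAl.
  by rewrite row_mul !row_setrow_neq// row_mul.
have mP1 (A : 'M[R]_m) i u : setrow A i u *m E = setrow (A *m E) i (u *m E).
  by have := mP A i 1 0 u 0; rewrite scale1r scale0r addr0 mul0mx scaler0 addr0 scale1r.
apply: (@multilinear_ext _ _ (fun P => a (P *m E)) (fun P => \det P * a E)).
- by apply/multilinearP => A i b c u v; rewrite mP !mP1 ((multilinearP _).1 ma).
- apply/multilinearP => A i b c u v; rewrite !mulrA -mulrDl; congr (_ * _).
  by apply: (determinant_multilinear (i0 := i)); rewrite ?row_setrow ?row'_setrow.
move=> I; case: (boolP (injectiveb I)) => [/injectiveP Iinj|/injectivePn[i [j ij Iij]]].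
  have -> : deltaI I = perm_mx (perm Iinj).
    by apply/matrixP => r c; rewrite !mxE permE eq_sym.
  by rewrite -row_permE det_perm alternating_perm.
rewrite (determinant_alternate ij); last by move=> c; rewrite !mxE Iij.
rewrite mul0r (aa _ i j ij)// !row_mul; congr (_ *m _).
by apply/rowP => c; rewrite !mxE Iij.
Qed.

End Multilinear.

(** * Exterior derivative and pullback of forms on open subsets of R^n *)

Section FlatForms.
Context {R : realType}.

Lemma is_derive_bigsum (V W : normedModType R) (I : Type) (s : seq I) (P : pred I)
    (f : I -> V -> W) x v : (forall i, P i -> derivable (f i) x v) ->
  is_derive x v (fun y => \sum_(i <- s | P i) f i y) (\sum_(i <- s | P i) 'D_v (f i) x).
Proof.
move=> df; elim: s => [|i s IH].
  by under eq_fun do rewrite big_nil; rewrite big_nil; exact: is_derive_cst.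
rewrite big_cons; under eq_fun do rewrite big_cons.
case Pi : (P i) => //; apply: is_deriveD => //; split=> //; exact: df.
Qed.

Lemma is_derive_scale (V : normedModType R) (f : V -> R) (c : R) x v :
  derivable f x v -> is_derive x v (fun y => c * f y) (c * 'D_v f x).
Proof. by move=> df; apply: is_deriveZ; split. Qed.

Lemma is_derive_bigprod (V : normedModType R) (I : eqType) (s : seq I)
    (f : I -> V -> R) x v : uniq s -> (forall i, derivable (f i) x v) ->
  is_derive x v (fun y => \prod_(i <- s) f i y)
    (\sum_(i <- s) 'D_v (f i) x * \prod_(j <- s | j != i) f j x).
Proof.
move=> + df; elim: s => [_|i s IH /= /andP[i_s us]].
  by under eq_fun do rewrite big_nil; rewrite big_nil; exact: is_derive_cst.
have [D1 D2] := IH us.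
have -> : (fun y => \prod_(j <- i :: s) f j y) = f i * (fun y => \prod_(j <- s) f j y).
  by apply/funext => y; rewrite big_cons.
apply: (DeriveDef (derivableM (df i) D1)).
apply: etrans (deriveM (df i) D1) _; rewrite D2 big_cons addrC; congr (_ + _).
  rewrite big_cons eqxx /= [LHS]mulrC; congr (_ * _).
  rewrite [RHS]big_seq_cond [LHS]big_seq; apply: eq_bigl => j.
  by case: (boolP (j \in s)) => //= js; apply/esym; apply: contraNneq i_s => <-.
rewrite [LHS](_ : _ = f i x * (\sum_(l <- s) 'D_v (f l) x * \prod_(j <- s | j != l) f j x))//.
rewrite big_distrr/= [LHS]big_seq [RHS]big_seq; apply: eq_bigr => j js.
rewrite big_cons (_ : i != j); last by apply: contraNneq i_s => ->.
by rewrite mulrCA.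
Qed.

Lemma derive_nearE (V W : normedModType R) (U : set V) (f g : V -> W) x v :
  open U -> U x -> (forall y, U y -> f y = g y) -> 'D_v f x = 'D_v g x.
Proof.
move=> oU Ux fg; apply: near_eq_derive.
by apply: filterS (open_nbhs_nbhs (conj oU Ux)) => y; exact: fg.
Qed.

Lemma C1_derive_lin n (U : set 'rV[R]_n) (f : 'rV[R]_n -> R) (x u v : 'rV[R]_n) b c :
  open U -> Ck 1 U f -> U x ->
  'D_(b *: u + c *: v) f x = b * 'D_u f x + c * 'D_v f x.
Proof.
move=> oU Cf Ux; have [df _] := C1_differentiable oU Cf Ux.
by rewrite !(deriveE _ df) linearP linearZ.
Qed.

Lemma sum_lift n (i : 'I_n.+1) (F : 'I_n.+1 -> R) :
  \sum_(j < n) F (lift i j) = \sum_(l | l != i) F l.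
Proof.
have H1 : \sum_l F l = F i + \sum_(l | l != i) F l by rewrite (bigD1 i).
have H2 : \sum_l F l = F i + \sum_(j < n) F (lift i j) by rewrite (bigD1_ord i).
by apply: (@addrI _ (F i)); rewrite -H1 -H2.
Qed.

Lemma antisym_sum0 n (t : 'I_n -> 'I_n -> R) :
  (forall i l, i != l -> t i l = - t l i) -> \sum_i \sum_(l | l != i) t i l = 0.
Proof.
move=> tN; set S := LHS.
have : S = - S.
  rewrite {1}/S (exchange_big_dep xpredT)//= -sumrN; apply: eq_bigr => l _.
  by rewrite -sumrN; apply: eq_big => i; [rewrite eq_sym|move=> li; apply: tN; rewrite eq_sym].
move=> SN; have : S + S = 0 by rewrite {2}SN subrr.
by rewrite -mulr2n => /eqP; rewrite mulrn_eq0 => /eqP.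
Qed.

Definition fd k n (a : 'rV[R]_n -> 'M[R]_(k, n) -> R) :
    'rV[R]_n -> 'M[R]_(k.+1, n) -> R := fun y E =>
  \sum_(i < k.+1) (-1) ^+ i * 'D_(row i E) (fun z => a z (row' i E)) y.

(** Smoothness is asked for each constant frame [E] only; smooth dependence on varying frames
    follows from the expansion [mexp], see [Ck_form]. *)
Definition fform k n (U : set 'rV[R]_n) (a : 'rV[R]_n -> 'M[R]_(k, n) -> R) : Prop :=
  [/\ forall y, U y -> multilinear (a y), forall y, U y -> alternating (a y) &
      forall E j, Ck j U (fun y => a y E)].

Lemma fform_ml k n (U : set 'rV[R]_n) (a : 'rV[R]_n -> 'M[R]_(k, n) -> R) y :
  fform U a -> U y -> multilinear (a y).
Proof. by case=> + _ _; apply. Qed.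

Lemma fform_alt k n (U : set 'rV[R]_n) (a : 'rV[R]_n -> 'M[R]_(k, n) -> R) y :
  fform U a -> U y -> alternating (a y).
Proof. by case=> _ + _; apply. Qed.

Lemma fform_Ck k n (U : set 'rV[R]_n) (a : 'rV[R]_n -> 'M[R]_(k, n) -> R) j E :
  fform U a -> Ck j U (fun y => a y E).
Proof. by case=> _ _; apply. Qed.

Lemma fform_eq k n (U : set 'rV[R]_n) (a b : 'rV[R]_n -> 'M[R]_(k, n) -> R) :
  open U -> (forall y E, U y -> a y E = b y E) -> fform U a -> fform U b.
Proof.
move=> oU ab [ma aa Ca].
have e y : U y -> a y = b y by move=> Uy; apply/funext => E; exact: ab.
split=> [y Uy|y Uy|E j]; first by rewrite -e//; exact: ma.
  by rewrite -e//; exact: aa.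
by apply: Ck_eq (Ca E j) => // y Uy; exact: ab.
Qed.

Lemma fd_near k n (U : set 'rV[R]_n) (a b : 'rV[R]_n -> 'M[R]_(k, n) -> R) y E :
  open U -> U y -> (forall z F, U z -> a z F = b z F) -> fd a y E = fd b y E.
Proof.
move=> oU Uy ab; apply: eq_bigr => i _; congr (_ * _).
by apply: (derive_nearE _ oU Uy) => z Uz; exact: ab.
Qed.

Lemma fd_multilinear k n (U : set 'rV[R]_n) (a : 'rV[R]_n -> 'M[R]_(k, n) -> R) y :
  open U -> U y -> fform U a -> multilinear (fd a y).
Proof.
move=> oU Uy fa; apply/multilinearP => E i b c u v.
rewrite /fd !big_distrr/= -big_split/=; apply: eq_bigr => j _.
rewrite !(mulrCA _ ((-1) ^+ j)) -mulrDr; congr (_ * _).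
case: (unliftP j i) => [r ->|->].
  rewrite !row_setrow_neq ?neq_lift// !row'_setrow_lift.
  set w := row j E.
  have d E' : derivable (fun z => a z E') y w by exact: Ck_derivable (fform_Ck 1 E' fa) Uy.
  have [d1 <-] := is_derive_scale b (d (setrow (row' j E) r u)).
  have [d2 <-] := is_derive_scale c (d (setrow (row' j E) r v)).
  apply: etrans _ (deriveD d1 d2); apply: (derive_nearE _ oU Uy) => z Uz.
  by rewrite ((multilinearP _).1 (fform_ml fa Uz)).
rewrite !row_setrow !row'_setrow.
exact: C1_derive_lin oU (fform_Ck 1 _ fa) Uy.
Qed.

Lemma fd_alternating k n (U : set 'rV[R]_n) (a : 'rV[R]_n -> 'M[R]_(k, n) -> R) y :
  open U -> U y -> fform U a -> alternating (fd a y).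
Proof.
move=> oU Uy fa E i l il Eil.
rewrite /fd (bigD1 i)//= (bigD1 l)/=; last by rewrite eq_sym.
(* A term that deletes a third row still contains the two equal rows and vanishes. The terms
   deleting [i] and [l] cancel by [alternating_row']. *)
rewrite big1 ?addr0; last first.
  move=> j /andP[ji jl]; apply/eqP; rewrite mulf_eq0; apply/orP; right; apply/eqP.
  rewrite -(derive_cst (0 : R) y (row j E)); apply: (derive_nearE _ oU Uy) => z Uz.
  case: (unliftP j i) ji il Eil => [i' -> _|->]; last by rewrite eqxx.
  case: (unliftP j l) jl => [l' -> _|->]; last by rewrite eqxx.
  rewrite (inj_eq lift_inj) => il' Eil.
  apply: (fform_alt fa Uz il'); apply/rowP => c.
  by have /rowP/(_ c) := Eil; rewrite !mxE.
have d E' v : derivable (fun z => a z E') y v by exact: Ck_derivable (fform_Ck 1 E' fa) Uy.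
have [_ <-] := is_derive_scale ((-1) ^+ i) (d (row' i E) (row i E)).
have [_ <-] := is_derive_scale ((-1) ^+ l) (d (row' l E) (row l E)).
rewrite -Eil.
have [d2 _] := is_derive_scale ((-1) ^+ l) (d (row' l E) (row i E)).
suff -> : 'D_(row i E) (fun z => (-1) ^+ i * a z (row' i E)) y =
  - 'D_(row i E) (fun z => (-1) ^+ l * a z (row' l E)) y by rewrite addNr.
rewrite -(deriveN d2); apply: (derive_nearE _ oU Uy) => z Uz.
by rewrite (alternating_row' (fform_ml fa Uz) (fform_alt fa Uz) il Eil).
Qed.

Lemma Ck_fd k n (U : set 'rV[R]_n) (a : 'rV[R]_n -> 'M[R]_(k, n) -> R) E j :
  open U -> (forall E, Ck j.+1 U (fun y => a y E)) -> Ck j U (fun y => fd a y E).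
Proof.
move=> oU Ca; apply: Ck_sum => // i _; apply: CkM => //; first exact: Ck_cst.
by apply: Ck_derive; exact: Ca.
Qed.

Lemma fd_fform k n (U : set 'rV[R]_n) (a : 'rV[R]_n -> 'M[R]_(k, n) -> R) :
  open U -> fform U a -> fform U (fd a).
Proof.
move=> oU fa; split=> [y Uy|y Uy|E j].
- exact: fd_multilinear fa.
- exact: fd_alternating fa.
- by apply: Ck_fd => // E'; exact: fform_Ck fa.
Qed.

(** Two rows can be deleted in either order, with the same matrix left over and opposite signs. The
    hypothesis says that [j'] is the position of [i] once row [lift i j] is gone. *)
Lemma lift_lift_parity n (i : 'I_n.+2) (j j' : 'I_n.+1) :
  i = lift (lift i j) j' -> odd (i + j) != odd (lift i j + j').
Proof.
move=> /(congr1 val) /=; rewrite /bump.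
by case: (leqP i j) => ij; rewrite ?add0n ?add1n; case: leqP => ? /=; lia.
Qed.

Lemma lift_lift_unbump n (i : 'I_n.+2) (j j' : 'I_n.+1) (r : 'I_n) :
  i = lift (lift i j) j' -> lift i (lift j r) = lift (lift i j) (lift j' r).
Proof.
move=> /(congr1 val) /= ij; apply/val_inj; rewrite /=; move: ij; rewrite /bump.
by case: (leqP i j) => ij; rewrite ?add0n ?add1n; case: (leqP _ j') => ? /=;
  case: (leqP j r) => ?; case: (leqP j' r) => ? /=; rewrite ?add0n ?add1n;
  do ?[case: leqP => ? /=]; lia.
Qed.

Lemma fd_fd k n (U : set 'rV[R]_n) (a : 'rV[R]_n -> 'M[R]_(k, n) -> R) y E :
  open U -> U y -> fform U a -> fd (fd a) y E = 0.
Proof.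
move=> oU Uy fa.
pose G (i : 'I_k.+2) (j : 'I_k.+1) : R := (-1) ^+ i * ((-1) ^+ j *
  'D_(row i E) ('D_(row (lift i j) E) (fun z => a z (row' j (row' i E)))) y).
(* The double sum is indexed by the two deleted rows themselves, so that exchanging them is visible;
   the default 0 sits on the diagonal, which is excluded. *)
pose t i l : R := if unlift i l is Some j then G i j else 0.
have -> : fd (fd a) y E = \sum_i \sum_(l | l != i) t i l.
  apply: eq_bigr => i _; rewrite -sum_lift.
  have d (j : 'I_k.+1) : derivable
      (fun z => (-1) ^+ j * 'D_(row j (row' i E)) (fun z => a z (row' j (row' i E))) z) y (row i E).
    by apply: derivableM => //; exact: Ck_derivable (Ck_derive _ (fform_Ck 2 _ fa)) Uy.
  have [_ ->] := is_derive_bigsum (index_enum _) (fun j (_ : true) => d j).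
  rewrite big_distrr/=; apply: eq_bigr => j _.
  rewrite /t liftK /G; congr (_ * _).
  have -> : row (lift i j) E = row j (row' i E) by apply/rowP => c; rewrite !mxE.
  have d2 : derivable ('D_(row j (row' i E)) (fun z => a z (row' j (row' i E)))) y (row i E).
    exact: Ck_derivable (Ck_derive _ (fform_Ck 2 _ fa)) Uy.
  by have [_ ->] := is_derive_scale ((-1) ^+ j) d2.
apply: antisym_sum0 => i l il.
rewrite /t; case: (unliftP i l) il => [j lE _|->]; last by rewrite eqxx.
case: (unliftP l i) => [j' iE|il]; last first.
  by move: (neq_lift i j); rewrite -lE il eqxx.
have H r : lift i (lift j r) = lift l (lift j' r).
  by rewrite lE; apply: lift_lift_unbump; rewrite -lE.
rewrite /G -lE -iE.
have -> : row' j (row' i E) = row' j' (row' l E).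
  by apply/matrixP => r c; rewrite !mxE H.
rewrite (C2_symmetric _ _ oU (fform_Ck 2 _ fa) Uy).
rewrite !mulrA -mulNr; congr (_ * _).
rewrite -!exprD -signr_odd -[in RHS]signr_odd.
have : odd (i + j) != odd (l + j') by rewrite lE; apply: lift_lift_parity; rewrite -lE.
by case: (odd (i + j)); case: (odd (l + j')) => //= _; rewrite ?expr0 ?expr1 ?opprK.
Qed.

(** Product rule for a form evaluated at a moving point on moving vectors. Through [mexp] it reduces
    to the rule for finite products. *)
Lemma is_derive_form (V : normedModType R) k n (O : set 'rV[R]_n)
    (a : 'rV[R]_n -> 'M[R]_(k, n) -> R) (F : V -> 'rV[R]_n) (M : V -> 'M[R]_(k, n))
    (U : set V) x v :
  open U -> U x -> open O -> (forall y, U y -> O (F y)) -> fform O a -> derivable F x v ->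
  derivable M x v ->
  is_derive x v (fun y => a (F y) (M y))
    ('D_('D_v F x) (fun z => a z (M x)) (F x) +
     \sum_r a (F x) (setrow (M x) r (row r ('D_v M x)))).
Proof.
move=> oU Ux oO UO fa dF dM.
have dMrc r c : derivable (fun y => M y r c) x v by exact: (derivable_mxP _ _ _).1 dM _ _.
have DM r c : 'D_v M x r c = 'D_v (fun y => M y r c) x by rewrite derive_mx// mxE.
have CI I : Ck 1 O (fun z => a z (deltaI I)) by exact: fform_Ck fa.
have dI I := derive_chain oO (CI I) (UO _ Ux) dF.
have dP (I : {ffun 'I_k -> 'I_n}) := @is_derive_bigprod V _ (index_enum 'I_k)
   (fun r y => M y r (I r)) x v (index_enum_uniq _) (fun r => dMrc r (I r)).
pose h (I : {ffun 'I_k -> 'I_n}) y := \prod_r M y r (I r) * a (F y) (deltaI I).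
have dh (I : {ffun 'I_k -> 'I_n}) : is_derive x v (h I)
   (\prod_r M x r (I r) * 'D_('D_v F x) (fun z => a z (deltaI I)) (F x) +
    a (F x) (deltaI I) * (\sum_r 'D_v (fun y => M y r (I r)) x * \prod_(j | j != r) M x j (I j))).
  have [d1 <-] := dP I; have [d2 <-] := dI I.
  exact: (DeriveDef (derivableM d1 d2) (deriveM d1 d2)).
have [D1 D2] := is_derive_bigsum (index_enum _) (fun I (_ : true) => let: DeriveDef d _ := dh I in d).
have near_h : \near x, \sum_I h I x = a (F x) (M x).
  apply: filterS (open_nbhs_nbhs (conj oU Ux)) => y Uy.
  by rewrite [RHS](multilinear_expand _ (fform_ml fa (UO _ Uy))).
split; first exact: near_eq_derivable D1.
rewrite -(near_eq_derive _ near_h) D2.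
have -> : \sum_I 'D_v (h I) x = \sum_(I : {ffun 'I_k -> 'I_n}) (\prod_r M x r (I r) * 'D_('D_v F x) (fun z => a z (deltaI I)) (F x)) +
   \sum_(I : {ffun 'I_k -> 'I_n}) a (F x) (deltaI I) * (\sum_r 'D_v (fun y => M y r (I r)) x * \prod_(j | j != r) M x j (I j)).
  by rewrite -big_split/=; apply: eq_bigr => I _; case: (dh I).
congr (_ + _).
  have dc (I : {ffun 'I_k -> 'I_n}) := is_derive_scale (\prod_r M x r (I r))
     (Ck_derivable (v := 'D_v F x) (CI I) (UO _ Ux)).
  have dc1 (I : {ffun 'I_k -> 'I_n}) : derivable (fun z => \prod_r M x r (I r) * a z (deltaI I)) (F x) ('D_v F x).
    by case: (dc I).
  have [_ E1] := is_derive_bigsum (index_enum _) (fun I (_ : true) => dc1 I).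
  rewrite [RHS](@derive_nearE _ _ O _ (fun z => \sum_(I : {ffun 'I_k -> 'I_n}) \prod_r M x r (I r) * a z (deltaI I)) _ _ oO (UO _ Ux)).
    by rewrite E1; apply: eq_bigr => I _; case: (dc I).
  by move=> z Oz; rewrite [LHS](multilinear_expand _ (fform_ml fa Oz)).
rewrite (eq_bigr _ (fun I _ => big_distrr _ _ _)) exchange_big/=; apply: eq_bigr => r _.
rewrite (multilinear_expand _ (fform_ml fa (UO _ Ux))) /mexp; apply: eq_bigr => I _.
rewrite mulrC; congr (_ * _); rewrite [RHS](bigD1 r)//= !mxE eqxx DM; congr (_ * _).
by apply: eq_bigr => j /negbTE jr; rewrite mxE jr.
Qed.

Definition fpull k a b (F : 'rV[R]_a -> 'rV[R]_b) (w : 'rV[R]_b -> 'M[R]_(k, b) -> R) :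
  'rV[R]_a -> 'M[R]_(k, a) -> R := fun y E => w (F y) (E *m jacobian F y).

Lemma multilinear_mulmx k a b (w : 'M[R]_(k, b) -> R) (J : 'M[R]_(a, b)) :
  multilinear w -> multilinear (fun E : 'M[R]_(k, a) => w (E *m J)).
Proof.
move=> mw i A B C c d rA rB rC; apply: (mw i).
- by rewrite !row_mul rA mulmxDl !scalemxAl.
- by have := congr1 (mulmx^~ J) rB; rewrite /row' /= !mul_rowsub_mx.
- by have := congr1 (mulmx^~ J) rC; rewrite /row' /= !mul_rowsub_mx.
Qed.

Lemma alternating_mulmxr k a b (w : 'M[R]_(k, b) -> R) (J : 'M[R]_(a, b)) :
  alternating w -> alternating (fun E : 'M[R]_(k, a) => w (E *m J)).
Proof. by move=> aw A i j ij Aij; apply: (aw _ i j ij); rewrite !row_mul Aij. Qed.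

Lemma Ck_form k j n (V : normedModType R) (U : set V) (O : set 'rV[R]_n)
    (w : 'rV[R]_n -> 'M[R]_(k, n) -> R) (F : V -> 'rV[R]_n) (M : V -> 'M[R]_(k, n)) :
  open U -> open O -> (forall y, U y -> O (F y)) -> fform O w -> Ck j U F -> Ck j U M ->
  Ck j U (fun y => w (F y) (M y)).
Proof.
move=> oU oO UO fw CF /(Ck_mx _ _ oU) CM.
apply: (@Ck_eq _ _ _ _ _ (fun y => mexp (w (F y)) (M y))) => //.
  by move=> y Uy; rewrite -(multilinear_expand _ (fform_ml fw (UO _ Uy))).
apply: Ck_sum => // I _; apply: CkM => //.
  by apply: Ck_prod => // r _.
exact: (@Ck_comp _ j V n U O (fun z => w z (deltaI I)) F oU oO UO (fform_Ck j _ fw) CF).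
Qed.

Lemma fpull_fform k a b (U : set 'rV[R]_a) (O : set 'rV[R]_b) (F : 'rV[R]_a -> 'rV[R]_b)
    (w : 'rV[R]_b -> 'M[R]_(k, b) -> R) :
  open U -> open O -> (forall y, U y -> O (F y)) -> (forall j, Ck j U F) ->
  fform O w -> fform U (fpull F w).
Proof.
move=> oU oO UO CF fw; split=> [y Uy|y Uy|E j].
- by apply: multilinear_mulmx; exact: fform_ml fw (UO _ Uy).
- by apply: alternating_mulmxr; exact: fform_alt fw (UO _ Uy).
- apply: (@Ck_form _ _ _ _ U O) => //; apply: Ck_mulmx => //; first exact: Ck_cst.
  by apply/(Ck_mx _ _ oU) => r c; exact: Ck_jacobian.
Qed.

(** Differentiating the Jacobian inside the pullback produces second derivatives of [F]; they are
    symmetric in the two directions involved and cancel in pairs against the alternating form. *)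
Lemma fd_pull k a b (U : set 'rV[R]_a) (O : set 'rV[R]_b) (F : 'rV[R]_a -> 'rV[R]_b)
    (w : 'rV[R]_b -> 'M[R]_(k, b) -> R) y E :
  open U -> open O -> (forall y, U y -> O (F y)) -> Ck 2 U F -> fform O w -> U y ->
  fd (fpull F w) y E = fpull F (fd w) y E.
Proof.
move=> oU oO UO CF fw Uy.
have CJ i j : Ck 1 U (fun x => jacobian F x i j) by exact: Ck_jacobian.
have CJm : Ck 1 U (fun x => jacobian F x) by apply/(Ck_mx _ _ oU).
have dF v : derivable F y v by exact: Ck_derivable (CkS CF) Uy.
pose B v l := 'D_v (fun z => row l E *m jacobian F z) y.
have CM k' (A : 'M[R]_(k', a)) : Ck 1 U (fun z => A *m jacobian F z).
  by apply: Ck_mulmx => //; exact: Ck_cst.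
have Bsym i l : B (row i E) l = B (row l E) i.
  rewrite /B; apply/rowP => c.
  have H u : \forall z \near y, (u *m jacobian F z) 0 c = 'D_u (fun z => F z 0 c) z.
    apply: filterS (open_nbhs_nbhs (conj oU Uy)) => z Uz.
    rewrite -(C1_jacobianE _ oU (CkS CF) Uz) derive_mx ?mxE//.
    exact: Ck_derivable (CkS CF) Uz.
  rewrite !derive_mx; [|exact: Ck_derivable (CM _ _) Uy|exact: Ck_derivable (CM _ _) Uy].
  rewrite !mxE (near_eq_derive _ (H _)) (near_eq_derive _ (H _)).
  by apply: (C2_symmetric _ _ oU _ Uy); exact: (Ck_mx _ _ oU).1 CF _ _.
pose E' := E *m jacobian F y.
pose t (i l : 'I_k.+1) := (-1) ^+ i * w (F y) (row' i (setrow E' l (B (row i E) l))).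
have -> : fd (fpull F w) y E = fpull F (fd w) y E + \sum_i \sum_(l | l != i) t i l.
  rewrite /fd /fpull -big_split/=; apply: eq_bigr => i _.
  have dM : derivable (fun z => row' i E *m jacobian F z) y (row i E).
    exact: Ck_derivable (CM _ _) Uy.
  have [_ ->] := is_derive_form oU Uy oO UO fw (dF (row i E)) dM.
  have Erow : row' i E *m jacobian F y = row' i E' by rewrite /E' /row' /= mul_rowsub_mx.
  have DE : 'D_(row i E) F y = row i E'.
    by apply: etrans (C1_jacobianE _ oU (CkS CF) Uy) _; rewrite row_mul.
  apply: etrans (mulrDr _ _ _) _; apply: (f_equal2 (fun p q : R => p + q)).
    exact: (f_equal2 (fun v M => (-1) ^+ i * 'D_v (fun z => w z M) (F y)) DE Erow).
  rewrite -sum_lift big_distrr/=; apply: eq_bigr => r _; rewrite /t.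
  apply: (f_equal (fun M => (-1) ^+ i * w (F y) M)).
  apply: etrans _ (esym (row'_setrow_lift _ _ _ _)).
  apply: (f_equal2 (fun A v => setrow A r v) Erow).
  apply/rowP => c; rewrite /B mxE !derive_mx//; last exact: Ck_derivable (CM _ _) Uy.
  apply: etrans (mxE _ _ _ _) _; apply: etrans _ (esym (mxE _ _ _ _)).
  apply: (f_equal (fun f => 'D_(row i E) f y)); apply/funext => z.
  rewrite [LHS]mxE [RHS]mxE; apply: eq_bigr => s _.
  by apply: (f_equal (fun p => p * _)); rewrite !mxE.
rewrite antisym_sum0 ?addr0// => i l il.
rewrite /t -[X in _ = - X]mulr1 mulr1.
(* Rows [i] and [l] of [Ew] both equal the second derivative of [F] in the directions [i] and [l],
   so [alternating_row'] applies. *)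
pose Ew := setrow (setrow E' l (B (row i E) l)) i (B (row i E) l).
have -> : row' i (setrow E' l (B (row i E) l)) = row' i Ew by rewrite /Ew row'_setrow.
have -> : row' l (setrow E' i (B (row l E) i)) = row' l Ew.
  by rewrite /Ew Bsym setrowC 1?eq_sym// row'_setrow.
apply: alternating_row' => //; [exact: fform_ml fw (UO _ Uy)|exact: fform_alt fw (UO _ Uy)|].
by rewrite /Ew row_setrow row_setrow_neq 1?eq_sym// row_setrow.
Qed.

End FlatForms.

(** * Parameter integrals and homotopy operators *)

Section Integrals.
Context {R : realType}.

Definition rint (a b : R) (f : R -> R) : R :=
  \int[@lebesgue_measure R]_(t in `[a, b]) f t.

(** Continuity is two-sided even at the endpoints. The integrands come from functions on open
    neighbourhoods of the segment, and one-sided limits are avoided. *)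
Definition cc (a b : R) (f : R -> R) :=
  forall t, a <= t <= b -> {for t, continuous f}.

Lemma cc_within a b f : cc a b f -> {within `[a, b], continuous f}.
Proof.
move=> cf; apply: continuous_in_subspaceT => t; rewrite inE/= in_itv/= => tab.
exact: cf.
Qed.

Lemma cc_integrable a b f : cc a b f ->
  (@lebesgue_measure R).-integrable `[a, b] (EFin \o f).
Proof.
move=> cf; apply: continuous_compact_integrable; first exact: segment_compact.
exact: cc_within.
Qed.

Lemma ccD a b f g : cc a b f -> cc a b g -> cc a b (fun t => f t + g t).
Proof. by move=> cf cg t tab; apply: cvgD; [exact: cf|exact: cg]. Qed.

Lemma ccN a b f : cc a b f -> cc a b (fun t => - f t).
Proof. by move=> cf t tab; apply: cvgN; exact: cf. Qed.

Lemma ccM a b f g : cc a b f -> cc a b g -> cc a b (fun t => f t * g t).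
Proof. by move=> cf cg t tab; apply: cvgM; [exact: cf|exact: cg]. Qed.

Lemma cc_cst a b (c : R) : cc a b (fun=> c).
Proof. by move=> t _; exact: cvg_cst. Qed.

Lemma cc_sum a b (I : Type) (s : seq I) (f : I -> R -> R) :
  (forall i, cc a b (f i)) -> cc a b (fun t => \sum_(i <- s) f i t).
Proof.
move=> cf; elim: s => [|i s IH].
  by under eq_fun do rewrite big_nil; exact: cc_cst.
by under eq_fun do rewrite big_cons; exact: ccD.
Qed.

Lemma eq_rint a b f g : (forall t, a <= t <= b -> f t = g t) -> rint a b f = rint a b g.
Proof.
by move=> fg; apply: eq_Rintegral => t; rewrite inE/= in_itv/=; exact: fg.
Qed.

Lemma rintD a b f g : cc a b f -> cc a b g ->
  rint a b (fun t => f t + g t) = rint a b f + rint a b g.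
Proof. by move=> cf cg; apply: RintegralD => //; exact: cc_integrable. Qed.

Lemma rintZ a b c f : cc a b f -> rint a b (fun t => c * f t) = c * rint a b f.
Proof. by move=> cf; apply: RintegralZl => //; exact: cc_integrable. Qed.

Lemma rintN a b f : cc a b f -> rint a b (fun t => - f t) = - rint a b f.
Proof.
move=> cf; rewrite -[RHS]mulN1r -rintZ//; apply: eq_rint => t _.
by rewrite mulN1r.
Qed.

Lemma rintB a b f g : cc a b f -> cc a b g ->
  rint a b (fun t => f t - g t) = rint a b f - rint a b g.
Proof. by move=> cf cg; rewrite rintD ?rintN//; exact: ccN. Qed.

Lemma rint0 a b : rint a b (fun=> 0) = 0.
Proof.
have := @rintZ a b 0 (fun=> 1) (@cc_cst a b 1); rewrite !mul0r; exact.
Qed.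

Lemma rint_sum a b (I : Type) (s : seq I) (f : I -> R -> R) :
  (forall i, cc a b (f i)) ->
  rint a b (fun t => \sum_(i <- s) f i t) = \sum_(i <- s) rint a b (f i).
Proof.
move=> cf; elim: s => [|i s IH].
  by rewrite big_nil -[RHS](rint0 a b); apply: eq_rint => t _; rewrite big_nil.
rewrite big_cons -IH -rintD//; last exact: cc_sum.
by apply: eq_rint => t _; rewrite big_cons.
Qed.

Lemma rint_le a b f g : cc a b f -> cc a b g ->
  (forall t, a <= t <= b -> f t <= g t) -> rint a b f <= rint a b g.
Proof.
move=> cf cg fg; apply: le_Rintegral (cc_integrable cf) (cc_integrable cg) _ => //.
Qed.

Lemma rint_cst a b c : a <= b -> rint a b (fun=> c) = c * (b - a).
Proof.
move=> ab; rewrite /rint Rintegral_cst//; congr (_ * _).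
transitivity (fine (@lebesgue_measure R [set` `[a, b]])) => //.
rewrite lebesgue_measure_itv/= lte_fin.
by case: ltgtP ab => //= -> _; rewrite subrr.
Qed.

Lemma rint_norm_le a b f M : a <= b -> cc a b f ->
  (forall t, a <= t <= b -> `|f t| <= M) -> `|rint a b f| <= M * (b - a).
Proof.
move=> ab cf fM; rewrite ler_norml -mulNr -!(rint_cst _ ab); apply/andP; split.
  by apply: rint_le => //; [exact: cc_cst|move=> t /fM; rewrite ler_norml => /andP[]].
by apply: rint_le => //; [exact: cc_cst|move=> t /fM; rewrite ler_norml => /andP[]].
Qed.

Lemma rint_FTC a b (f F : R -> R) : a < b -> cc a b f ->
  (forall t, a <= t <= b -> is_derive t (1 : R) F (f t)) -> rint a b f = F b - F a.
Proof.
move=> ab cf dF; rewrite /rint /Rintegral.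
have cF t : a <= t <= b -> {for t, continuous F}.
  by move=> /dF[dt _]; apply: differentiable_continuous; apply/derivable1_diffP.
rewrite (@continuous_FTC2 _ f F)//; first exact: cc_within.
  split.
  - by move=> t; rewrite in_itv/= => /andP[/ltW at_ /ltW tb]; have [] := dF t; rewrite ?at_ ?tb.
  - by apply: cvg_at_right_filter; apply: cF; rewrite lexx ltW.
  - by apply: cvg_at_left_filter; apply: cF; rewrite lexx ltW.
move=> t; rewrite in_itv/= => /andP[/ltW at_ /ltW tb].
have tab : a <= t <= b by rewrite at_ tb.
by rewrite derive1E; have [_ ->] := dF t tab.
Qed.

(** The pairing that [integral_rV] uses; the added coordinate also serves as the time of
    homotopies. *)
Definition pr n (t : R) (y : 'rV[R]_n) : 'rV[R]_(1 + n) := row_mx (const_mx t : 'rV[R]_1) y.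

Lemma prD n t s (y z : 'rV[R]_n) : pr t y + pr s z = pr (t + s) (y + z).
Proof. by rewrite /pr add_row_mx; congr row_mx; apply/rowP => i; rewrite !mxE. Qed.

Lemma prZ n c t (y : 'rV[R]_n) : c *: pr t y = pr (c * t) (c *: y).
Proof. by rewrite /pr scale_row_mx; congr row_mx; apply/rowP => i; rewrite !mxE. Qed.

Lemma prB n t s (y z : 'rV[R]_n) : pr t y - pr s z = pr (t - s) (y - z).
Proof. by rewrite -scaleN1r prZ prD mulN1r scaleN1r. Qed.

Lemma pr_ball n t t' (y y' : 'rV[R]_n) e : 0 < e -> `|t - t'| < e -> ball y e y' ->
  ball (pr t y) e (pr t' y').
Proof.
move=> e0 te ye; rewrite mx_ballE prB; apply: mx_norm_lt => // i j.
rewrite -(splitK j); case: (fintype.split j) => j' /=; rewrite /pr ?row_mxEl ?row_mxEr.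
  by rewrite mxE.
by apply: le_lt_trans (coord_le_norm _ _ _) _; rewrite -mx_ballE.
Qed.

Lemma pr_continuous n (F : 'rV[R]_(1 + n) -> R) t y : {for pr t y, continuous F} ->
  {for t, continuous (fun s => F (pr s y))}.
Proof.
move=> cF; apply/cvgrPdist_lt => /= e e0.
have [r r0 H] := continuous_ball cF e0.
apply/nbhs_ballP; exists r => //= s ts; apply: H; apply: pr_ball => //.
exact: ballxx.
Qed.

Lemma ball_continuous (V V' : normedModType R) (f : V -> V') (x : V) :
  (forall e, 0 < e -> exists2 r : R, 0 < r & forall y, ball x r y -> `|f x - f y| < e) ->
  {for x, continuous f}.
Proof.
move=> H; apply/cvgrPdist_lt => e e0; have [r r0 Hr] := H e e0.
by apply/nbhs_ballP; exists r.
Qed.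

(** Compactness of [[a, b]] gives one radius for all [t], although [F] is assumed continuous only at
    the points of one segment. *)
Lemma tube_lemma n (F : 'rV[R]_(1 + n) -> R) a b y e :
  (forall t, a <= t <= b -> {for pr t y, continuous F}) -> 0 < e ->
  exists2 r : R, 0 < r & forall y' t, ball y r y' -> a <= t <= b ->
    `|F (pr t y) - F (pr t y')| < e.
Proof.
move=> cF e0.
have cpt : near_covering `[a, b]%classic.
  by rewrite -(compact_near_coveringP _); exact: segment_compact.
have [|r /= r0 H] := (nbhs_ballP _ _).1 (cpt _ (nbhs y)
    (fun y' t => `|F (pr t y) - F (pr t y')| < e) _ _); last first.
  by exists r => // y' t yy' tab; apply: (H y' yy'); rewrite /= in_itv.
move=> t; rewrite /= in_itv/= => tab.
have [r r0 H] := continuous_ball (cF t tab) (divr_gt0 e0 (ltr0n R 2)).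
exists (ball t r, ball y r); first by split; exact: nbhsx_ballx.
move=> [t' y'] [/= tt' yy'].
have h1 := H (pr t' y) (pr_ball r0 tt' (ballxx _ r0)).
have h2 := H (pr t' y') (pr_ball r0 tt' yy').
rewrite -(subrKA (F (pr t y))) (le_lt_trans (ler_normD _ _))// [ltRHS]splitr ltrD//.
by rewrite distrC.
Qed.

Section ParamIntegral.
Context (n : nat) (U : set 'rV[R]_n) (W : set 'rV[R]_(1 + n)) (a b : R).
Hypotheses (oU : open U) (oW : open W) (ab : a < b).
Hypothesis UW : forall t y, a <= t <= b -> U y -> W (pr t y).

Lemma cc_pr k (F : 'rV[R]_(1 + n) -> R) y : Ck k W F -> U y ->
  cc a b (fun t => F (pr t y)).
Proof.
by move=> CF Uy t tab; apply: pr_continuous; exact: Ck_continuous CF (UW tab Uy).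
Qed.

Lemma rint_param_continuous (F : 'rV[R]_(1 + n) -> R) y : Ck 0 W F -> U y ->
  {for y, continuous (fun y => rint a b (fun t => F (pr t y)))}.
Proof.
move=> CF Uy; apply: ball_continuous => e e0.
have e1 : 0 < e / (b - a) / 2 by rewrite !divr_gt0// subr_gt0.
have [|r r0 H] := @tube_lemma n F a b y _ _ e1.
  by move=> t tab; exact: Ck_continuous CF (UW tab Uy).
have [r' r'0 BU] := open_ball oU Uy.
have rr0 : 0 < Num.min r r' by rewrite lt_min r0 r'0.
exists (Num.min r r') => // z yz.
have Uz : U z by apply: BU; apply: le_ball yz; rewrite ge_min lexx orbT.
have yz' : ball y r z by apply: le_ball yz; rewrite ge_min lexx.
rewrite -rintB; [|exact: cc_pr CF _|exact: cc_pr CF _].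
have ba0 : b - a != 0 by rewrite gt_eqF// subr_gt0.
apply: (@le_lt_trans _ _ (e / (b - a) / 2 * (b - a))); last first.
  by rewrite mulrAC divfK// ltr_pdivrMr// ltr_pMr// ltr1n.
apply: rint_norm_le; [exact: ltW| |].
  by apply: ccD; [exact: cc_pr CF _|apply: ccN; exact: cc_pr CF _].
by move=> t tab; exact/ltW/H.
Qed.

(** By the mean value theorem the difference quotient under the integral is a value of the
    derivative at a nearby point, and [tube_lemma] makes the error uniform in [t]. *)
Lemma rint_param_derive (F : 'rV[R]_(1 + n) -> R) y v : Ck 1 W F -> U y ->
  is_derive y v (fun y => rint a b (fun t => F (pr t y)))
    (rint a b (fun t => 'D_(pr 0 v) F (pr t y))).
Proof.
move=> CF Uy; set P := fun y => _.
have CD : Ck 0 W ('D_(pr 0 v) F) by exact: Ck_derive.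
suff L : (h^-1 *: (P (h *: v + y) - P y)) @[h --> (0 : R)^'] -->
    rint a b (fun t => 'D_(pr 0 v) F (pr t y)).
  split; last exact/cvg_lim.
  by apply/cvg_ex; exists (rint a b (fun t => 'D_(pr 0 v) F (pr t y))).
apply/cvgrPdist_le => /= e e0.
have e1 : 0 < e / (b - a) by rewrite divr_gt0// subr_gt0.
have [|r r0 H] := @tube_lemma n ('D_(pr 0 v) F) a b y _ _ e1.
  by move=> t tab; exact: Ck_continuous CD (UW tab Uy).
have [r' r'0 BU] := open_ball oU Uy.
pose d := Num.min r r' / (`|v| + 1).
have v0 : 0 < `|v| + 1 by rewrite ltr_wpDl.
have d0 : 0 < d by rewrite divr_gt0// lt_min r0 r'0.
have Hs (h th : R) : `|h| < d -> 0 <= th <= 1 ->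
    ball y r (y + th *: (h *: v)) /\ U (y + th *: (h *: v)).
  move=> hd /andP[t0 t1].
  suff B : ball y (Num.min r r') (y + th *: (h *: v)).
    by split; [|apply: BU]; apply: le_ball B; rewrite ge_min lexx ?orbT.
  rewrite mx_ballE opprD addNKr normrN normrZ (ger0_norm t0).
  rewrite (@le_lt_trans _ _ (`|h| * (`|v| + 1)))//; last by rewrite -ltr_pdivlMr.
  rewrite normrZ (@le_trans _ _ (`|h| * `|v|))//; first by rewrite ler_piMl// mulr_ge0.
  by rewrite ler_wpM2l// lerDl.
apply/nbhs_ballP; exists d => //= h; rewrite /ball/= sub0r normrN => hd h0.
have one : 0 <= (1 : R) <= 1 by rewrite ler01 lexx.
have [_] := Hs h 1 hd one; rewrite scale1r => Uh.
have ccDF := cc_pr CD Uy; have cc1 := cc_pr CF Uh; have cc2 := cc_pr CF Uy.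
have cc3 : cc a b (fun t => F (pr t (y + h *: v)) - F (pr t y)).
  by apply: ccD => //; exact: ccN.
have cc4 : cc a b (fun t => h^-1 * (F (pr t (y + h *: v)) - F (pr t y))).
  by apply: ccM => //; exact: cc_cst.
have -> : h^-1 *: (P (h *: v + y) - P y) =
   rint a b (fun t => h^-1 * (F (pr t (y + h *: v)) - F (pr t y))).
  by rewrite rintZ// rintB// [h *: v + y]addrC.
rewrite -rintB//.
have ba0 : b - a != 0 by rewrite gt_eqF// subr_gt0.
rewrite -(divfK ba0 e); apply: rint_norm_le; first exact: ltW.
  by apply: ccD => //; exact: ccN.
move=> t tab.
have E (th : R) : pr t y + th *: (h *: pr 0 v) = pr t (y + th *: (h *: v)).
  by rewrite !prZ prD !mulr0 addr0.
have dF (th : R) : 0 <= th <= 1 -> derivable F (pr t y + th *: (h *: pr 0 v)) (pr 0 v).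
  by move=> th01; rewrite E; apply: Ck_derivable CF _; apply: UW => //; exact: (Hs h th hd th01).2.
have [th th01 Eth] := @MVT_dir _ _ F (pr t y) (h *: pr 0 v)
   (fun th th01 => let: DeriveDef d _ := derivableZv h (dF th th01) in d).
have -> : h^-1 * (F (pr t (y + h *: v)) - F (pr t y)) =
    'D_(pr 0 v) F (pr t (y + th *: (h *: v))).
  have E1 := E 1; rewrite !scale1r in E1; rewrite -E1 Eth.
  have [_ ->] := derivableZv h (dF th th01).
  by rewrite -E [_ *: _]/(h * _) mulKf.
by apply/ltW/H => //; exact: (Hs h th hd th01).1.
Qed.

Lemma Ck_rint k (F : 'rV[R]_(1 + n) -> R) : (forall j, Ck j W F) ->
  Ck k U (fun y => rint a b (fun t => F (pr t y))).
Proof.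
elim: k F => [|k IH] F CF.
  by split=> // y Uy; exact: rint_param_continuous (CF 0%N) Uy.
split; first by move=> y Uy; exact: rint_param_continuous (CF 0%N) Uy.
split; first by move=> y v Uy; have [] := rint_param_derive v (CF 1%N) Uy.
move=> v; have CD j : Ck j W ('D_(pr 0 v) F) by exact: Ck_derive.
apply: Ck_eq (IH _ CD) => // y Uy.
by have [_ ->] := rint_param_derive v (CF 1%N) Uy.
Qed.

End ParamIntegral.

(** * Integration along the fibre and the homotopy formula *)

Section Homotopy.

(** The unit time vector on top of the frame [E]. Evaluating on it contracts a form with the time
    direction, so [fint] is integration along the fibre [[0, 1]]. *)
Definition blk k n (E : 'M[R]_(k, n)) : 'M[R]_(1 + k, 1 + n) := block_mx 1%:M 0 0 E.

Lemma ord0_lshift n : (ord0 : 'I_(1 + n)) = lshift n ord0.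
Proof. exact/val_inj. Qed.

Lemma lift0_rshift n (c : 'I_n) : (lift ord0 c : 'I_(1 + n)) = rshift 1 c.
Proof. exact/val_inj. Qed.

Lemma blk00 k n (E : 'M[R]_(k, n)) : blk E ord0 ord0 = 1.
Proof. by rewrite /blk (ord0_lshift k) (ord0_lshift n) block_mxEul mxE. Qed.

Lemma blk0l k n (E : 'M[R]_(k, n)) c : blk E ord0 (lift ord0 c) = 0.
Proof. by rewrite /blk (ord0_lshift k) (lift0_rshift c) block_mxEur mxE. Qed.

Lemma blkl0 k n (E : 'M[R]_(k, n)) r : blk E (lift ord0 r) ord0 = 0.
Proof. by rewrite /blk (lift0_rshift r) (ord0_lshift n) block_mxEdl mxE. Qed.

Lemma blkll k n (E : 'M[R]_(k, n)) r c : blk E (lift ord0 r) (lift ord0 c) = E r c.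
Proof. by rewrite /blk (lift0_rshift r) (lift0_rshift c) block_mxEdr. Qed.

Lemma pr0 n t (v : 'rV[R]_n) : pr t v 0 ord0 = t.
Proof. by rewrite /pr (ord0_lshift n) row_mxEl mxE. Qed.

Lemma prl n t (v : 'rV[R]_n) c : pr t v 0 (lift ord0 c) = v 0 c.
Proof. by rewrite /pr (lift0_rshift c) row_mxEr. Qed.

Lemma row0_blk k n (E : 'M[R]_(k, n)) : row ord0 (blk E) = pr 1 0.
Proof.
apply/rowP => c; rewrite mxE; case: (unliftP ord0 c) => [c' ->|->].
  by rewrite blk0l (prl 1 0 c') mxE.
by rewrite blk00 pr0.
Qed.

Lemma rowl_blk k n (E : 'M[R]_(k, n)) r : row (lift ord0 r) (blk E) = pr 0 (row r E).
Proof.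
apply/rowP => c; rewrite mxE; case: (unliftP ord0 c) => [c' ->|->].
  by rewrite blkll (prl 0 _ c') mxE.
by rewrite blkl0 pr0.
Qed.

Lemma row'0_blk k n (E : 'M[R]_(k, n)) :
  row' ord0 (blk E) = row_mx (0 : 'cV[R]_k) E :> 'M[R]_(k, 1 + n).
Proof.
apply/matrixP => r c; rewrite mxE; case: (unliftP ord0 c) => [c' ->|->].
  by rewrite blkll (lift0_rshift c') row_mxEr.
by rewrite blkl0 (ord0_lshift n) row_mxEl mxE.
Qed.

Lemma row'l_blk k n (E : 'M[R]_(k.+1, n)) r : row' (lift ord0 r) (blk E) = blk (row' r E).
Proof.
apply/matrixP => i c; rewrite mxE; case: (unliftP ord0 i) => [i' ->|->].
  have -> : lift (lift ord0 r) (lift ord0 i') = lift ord0 (lift r i').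
    by apply/val_inj; rewrite /= /bump !leq0n !add1n ltnS addnS.
  case: (unliftP ord0 c) => [c' ->|->]; first by rewrite !blkll mxE.
  by rewrite !blkl0.
have -> : lift (lift ord0 r) ord0 = ord0 by exact/val_inj.
by case: (unliftP ord0 c) => [c' ->|->]; rewrite ?blk0l ?blk00.
Qed.

Lemma blk_setrow k n (E : 'M[R]_(k, n)) i v :
  blk (setrow E i v) = setrow (blk E) (lift ord0 i) (pr 0 v).
Proof.
apply/matrixP => r c; rewrite [RHS]mxE; case: (unliftP ord0 r) => [r' ->|->]; last first.
  by case: (unliftP ord0 c) => [c' ->|->]; rewrite ?blk0l ?blk00.
case: (unliftP ord0 c) => [c' ->|->]; last by rewrite !blkl0 pr0 if_same.
by rewrite !blkll mxE (inj_eq lift_inj) (prl 0 v c').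
Qed.

Definition fint k n (w : 'rV[R]_(1 + n) -> 'M[R]_(1 + k, 1 + n) -> R) :
    'rV[R]_n -> 'M[R]_(k, n) -> R :=
  fun y E => rint 0 1 (fun t => w (pr t y) (blk E)).

Context (n : nat) (U : set 'rV[R]_n) (W : set 'rV[R]_(1 + n)).
Hypotheses (oU : open U) (oW : open W).
Hypothesis UW : forall t y, 0 <= t <= 1 -> U y -> W (pr t y).

Lemma fint_fform k (w : 'rV[R]_(1 + n) -> 'M[R]_(1 + k, 1 + n) -> R) :
  fform W w -> fform U (fint w).
Proof.
move=> fw; have ccw y E : U y -> cc 0 1 (fun t => w (pr t y) E).
  by move=> Uy; exact: (cc_pr UW (fform_Ck 0 _ fw) Uy).
split=> [y Uy|y Uy|E j].
- apply/multilinearP => E i b c u v; rewrite /fint -!rintZ; try exact: ccw.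
  rewrite -rintD; [|by apply: ccM; [exact: cc_cst|exact: ccw]..].
  apply: eq_rint => t t01; rewrite !blk_setrow.
  have -> : pr 0 (b *: u + c *: v) = b *: pr 0 u + c *: pr 0 v :> 'rV[R]_(1 + n).
    by rewrite !prZ prD !mulr0 addr0.
  by rewrite ((multilinearP _).1 (fform_ml fw (UW t01 Uy))).
- move=> E i l il Eil; apply: etrans _ (rint0 0 1); apply: eq_rint => t t01.
  apply: (fform_alt fw (UW t01 Uy) (i := lift ord0 i) (j := lift ord0 l)).
    by rewrite (inj_eq lift_inj).
  by rewrite !rowl_blk Eil.
- exact: (Ck_rint oU ltr01 UW _ (fun j => fform_Ck j (blk E) fw)).
Qed.

(** The term of [fd w] that differentiates in time integrates to the boundary values by the
    fundamental theorem. In the others the row in front shifts the sign by one, so they cancel the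
    derivative of the fibre integral. *)
Lemma fd_fint k (w : 'rV[R]_(1 + n) -> 'M[R]_(k.+1, 1 + n) -> R) y (E : 'M[R]_(k.+1, n)) :
  (forall E j, Ck j W (fun z => w z E)) -> U y ->
  fd (fint w) y E + fint (fd w) y E =
    w (pr 1 y) (row_mx (0 : 'cV[R]_(k.+1)) E) - w (pr 0 y) (row_mx (0 : 'cV[R]_(k.+1)) E).
Proof.
move=> Cw Uy.
have ccD v M : cc 0 1 (fun t => 'D_v (fun z => w z M) (pr t y)).
  exact: (cc_pr UW (Ck_derive v (Cw M 1%N)) Uy).
have -> : fint (fd w) y E = rint 0 1 (fun t => 'D_(pr 1 0) (fun z => w z (row_mx (0 : 'cV[R]_(k.+1)) E)) (pr t y)) -
    \sum_(r < k.+1) (-1) ^+ r * rint 0 1 (fun t => 'D_(pr 0 (row r E)) (fun z => w z (blk (row' r E))) (pr t y)).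
  rewrite /fint /fd.
  rewrite (@eq_rint _ _ _ (fun t => 'D_(pr 1 0) (fun z => w z (row_mx (0 : 'cV[R]_(k.+1)) E)) (pr t y) -
    \sum_(r < k.+1) (-1) ^+ r * 'D_(pr 0 (row r E)) (fun z => w z (blk (row' r E))) (pr t y))).
    rewrite rintB// ?rint_sum.
    - by congr (_ - _); apply: eq_bigr => r _; rewrite rintZ.
    - by move=> r; apply: ccM => //; exact: cc_cst.
    - by apply: cc_sum => r; apply: ccM => //; exact: cc_cst.
  move=> t _; rewrite big_ord_recl expr0 mul1r; congr (_ + _).
    by apply: (f_equal2 (fun v M => 'D_v (fun z => w z M) (pr t y))); [exact: row0_blk|exact: row'0_blk].
  rewrite -sumrN; apply: eq_bigr => r _; rewrite lift0 exprS mulN1r mulNr; congr (- (_ * _)).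
  by apply: (f_equal2 (fun v M => 'D_v (fun z => w z M) (pr t y))); [exact: rowl_blk|exact: row'l_blk].
have -> : fd (fint w) y E = \sum_(r < k.+1) (-1) ^+ r * rint 0 1 (fun t => 'D_(pr 0 (row r E)) (fun z => w z (blk (row' r E))) (pr t y)).
  apply: eq_bigr => r _; congr (_ * _).
  by have [_ ->] := rint_param_derive oU ltr01 UW (row r E) (Cw (blk (row' r E)) 1%N) Uy.
rewrite addrC subrK.
set f := fun z => w z _.
have E1 t : pr t y = pr 0 y + t *: pr 1 0 by rewrite prZ prD mulr1 add0r scaler0 addr0.
apply: (@rint_FTC 0 1 _ (fun t => f (pr t y))) => // [|t t01]; first exact: ccD.
have -> : (fun t => f (pr t y)) = (fun t => f (pr 0 y + t *: pr 1 0)).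
  by apply/funext => s; rewrite E1.
rewrite (E1 t); apply: is_derive1_dir; rewrite -(E1 t).
exact: Ck_derivable (Cw _ 1%N) (UW t01 Uy).
Qed.

Definition hop k b (h : 'rV[R]_(1 + n) -> 'rV[R]_b) (w : 'rV[R]_b -> 'M[R]_(1 + k, b) -> R) :=
  fint (fpull h w).

Context (b : nat) (O : set 'rV[R]_b) (h : 'rV[R]_(1 + n) -> 'rV[R]_b).
Hypotheses (oO : open O) (WO : forall z, W z -> O (h z)) (Ch : forall j, Ck j W h).

Lemma hop_fform k (w : 'rV[R]_b -> 'M[R]_(1 + k, b) -> R) :
  fform O w -> fform U (hop h w).
Proof. by move=> fw; apply: fint_fform; exact: fpull_fform fw. Qed.

Lemma Ck_pr j t : Ck j U (pr t : 'rV[R]_n -> 'rV[R]_(1 + n)).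
Proof. by apply: Ck_row_mx => //; [exact: Ck_cst|exact: Ck_id]. Qed.

Lemma jacobian_pr t y : U y -> jacobian (pr t : 'rV[R]_n -> 'rV[R]_(1 + n)) y = row_mx 0 1%:M.
Proof.
move=> Uy; apply/matrixP => i j; rewrite (jacobian_coord _ _ oU (Ck_pr 1 t) Uy).
have := jacobian_coord i _ oU (@Ck_id R 1 'rV[R]_n U) Uy => Hid.
case: (unliftP ord0 j) => [c ->|->].
  rewrite [in RHS](lift0_rshift c) row_mxEr.
  rewrite -(jacobian_id y) Hid; apply: (f_equal (fun f => 'D_(er i) f y)).
  by apply/funext => z; exact: prl.
rewrite [in RHS](ord0_lshift n) row_mxEl mxE.
rewrite -(derive_cst (t : R) y (er i)); apply: (f_equal (fun f => 'D_(er i) f y)).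
by apply/funext => z; rewrite pr0.
Qed.

Lemma fpull_pr k (w : 'rV[R]_b -> 'M[R]_(k, b) -> R) t y E : 0 <= t <= 1 -> U y ->
  fpull h w (pr t y) (row_mx (0 : 'cV[R]_k) E) = fpull (h \o pr t) w y E.
Proof.
move=> t01 Uy; rewrite /fpull.
rewrite (jacobian_comp (x := y) oU oW (Ck_pr 1 t) (Ch 1)) ?jacobian_pr//; last exact: UW.
by rewrite mulmxA mul_mx_row mulmx0 mulmx1.
Qed.

(** Cartan's homotopy formula: [fd_fint] for the pullback of [w] by [h], combined with [fd_pull]. It
    concerns forms of positive degree; degree 0 is treated in [hop_formula0]. *)
Lemma hop_formula k (w : 'rV[R]_b -> 'M[R]_(k.+1, b) -> R) y E :
  fform O w -> U y ->
  fd (hop h w) y E + hop h (fd w) y E = fpull (h \o pr 1) w y E - fpull (h \o pr 0) w y E.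
Proof.
move=> fw Uy; rewrite /hop.
have fp : fform W (fpull h w) by exact: fpull_fform fw.
rewrite -!fpull_pr// ?lexx ?ler01//.
have Cp E' j : Ck j W (fun z => fpull h w z E') by exact: fform_Ck fp.
apply: etrans (fd_fint E Cp Uy).
apply: (f_equal (fun p : R => fd (fint (fpull h w)) y E + p)).
apply: eq_rint => t t01; apply: esym.
by apply: (fd_pull _ oW oO WO (Ch 2) fw); exact: UW.
Qed.

End Homotopy.
End Integrals.

(** * Real powers, the flat exponential and bump functions *)

Section Bumps.
Context {R : realType}.

Lemma Ck_R k (O : set R) (g g' : R -> R) : open O ->
  (forall x, O x -> is_derive x (1 : R) g (g' x)) -> Ck k O g' -> Ck k.+1 O g.
Proof.
move=> oO dg Cg.
have dv x v : O x -> is_derive x v g (v * g' x).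
  move=> /dg[d1 d2]; have := derivableZv v d1.
  by rewrite d2 [v *: 1]mulr1.
split.
  by move=> x /dg[d _]; apply: differentiable_continuous; exact/derivable1_diffP.
split; first by move=> x v /(dv x v)[].
move=> v; apply: (@Ck_eq _ _ _ _ _ (fun x => v * g' x)) => //.
  by move=> x /(dv x v)[_ ->].
by apply: CkM => //; exact: Ck_cst.
Qed.

Lemma Ck_powR k (a : R) : Ck k [set x : R | 0 < x] (fun x : R => x `^ a).
Proof.
elim: k a => [|k IH] a.
  split=> // x x0; apply: differentiable_continuous; apply/derivable1_diffP.
  by have [] := is_derive1_powR a x0.
have D (x : R) : [set x : R | 0 < x] x ->
    is_derive x (1 : R) (fun x : R => x `^ a) (a * x `^ (a - 1)).
  by move=> x0; exact: is_derive1_powR.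
have C' : Ck k [set x : R | 0 < x] (fun x : R => a * x `^ (a - 1)).
  by apply: CkM; [exact: open_gt|exact: Ck_cst|exact: IH].
exact: (Ck_R (@open_gt R 0) D C').
Qed.

(** The powers of 1/x are included because the span of this family is closed under differentiation,
    which makes smoothness at 0 an induction. *)
Definition flat_exp (k : nat) (x : R) : R :=
  if 0 < x then x^-1 ^+ k * expR (- x^-1) else 0.

(** The bound is the term of degree [k.+1] in the exponential series at 1/x. Used for [k.+1], it
    makes the difference quotient of [flat_exp k] at 0 tend to 0. *)
Lemma flat_exp_bound k x : 0 <= flat_exp k x <= k.+1`!%:R * `|x|.
Proof.
rewrite /flat_exp; case: ifPn => [x0|_]; last by rewrite lexx mulr_ge0.
have x1 : 0 < x^-1 by rewrite invr_gt0.
rewrite mulr_ge0 ?expR_ge0 ?exprn_ge0 ?(ltW x1)//=.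
rewrite gtr0_norm// expRN ler_pdivrMr ?expR_gt0//.
have e1 : x^-1 ^+ k = x * x^-1 ^+ k.+1.
  by rewrite exprS mulrA mulfV ?mul1r// gt_eqF.
rewrite e1 [_%:R * x]mulrC -mulrA ler_pM2l//.
rewrite mulrC -ler_pdivrMr ?ltr0n ?fact_gt0//.
by apply: le_trans (expR_ge1Dxn k (ltW x1)); rewrite lerDr ler01.
Qed.

Lemma is_derive_flat_exp k x :
  is_derive x (1 : R) (flat_exp k) (- k%:R * flat_exp k.+1 x + flat_exp k.+2 x).
Proof.
have [x0|x0|->] := ltgtP x 0.
- have -> : - k%:R * flat_exp k.+1 x + flat_exp k.+2 x = 0.
    by rewrite /flat_exp ltNge ltW// mulr0 addr0.
  have O : open [set y : R | y < 0] by exact: open_lt.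
  have d0 : is_derive x (1 : R) (cst (0 : R)) (0 : R) by exact: is_derive_cst.
  apply: near_eq_is_derive d0.
  apply: filterS (open_nbhs_nbhs (conj O x0)) => y /= y0.
  by rewrite /flat_exp ltNge ltW.
- have O : open [set y : R | 0 < y] by exact: open_gt.
  pose p := (@id R ^+ k) * (expR \o -%R).
  have idX u : (@id R ^+ k) u = u ^+ k.
    by elim: k {p} => // j IH; rewrite !exprS -IH.
  have dN : is_derive (x^-1) (1 : R) -%R (- 1) by exact: is_deriveNid.
  have dE : is_derive (x^-1) (1 : R) (expR \o -%R) (expR (- x^-1) * - 1).
    exact: is_derive1_comp.
  have dX : is_derive (x^-1) (1 : R) (@id R ^+ k) ((k%:R * x^-1 ^+ k.-1) *: 1).
    exact: is_deriveX.
  have [dp ep] := is_deriveM dX dE.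
  have xn0 : id x != 0 by rewrite gt_eqF.
  have dV := derivableV xn0 (@derivable_id R R x (1 : R)).
  have eV : 'D_1 (fun y : R => (id y)^-1) x = - x ^- 2.
    apply: etrans (deriveV xn0 (@derivable_id R R x (1 : R))) _.
    by rewrite derive_id [_ *: _]mulr1.
  have := @derivable_comp1 R R p (fun y => (id y)^-1) x 1 dp dV.
  rewrite ep eV => dpV.
  have N : \near x, p x^-1 = flat_exp k x.
    by apply: filterS (open_nbhs_nbhs (conj O x0)) => y /= y0; rewrite /flat_exp y0 -idX.
  apply: near_eq_is_derive N _; apply: is_derive_eq dpV _; rewrite /flat_exp x0 /= -exprVn.
  rewrite -![_ *: _]/(_ * _) /= !exprS expr0 ?mulr1.
  rewrite idX; by case: k {p dX dp ep idX} => [|k]; rewrite ?exprS/=; ring.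
have E j : flat_exp j 0 = 0 by rewrite /flat_exp ltxx.
rewrite !E mulr0 addr0.
suff L : (h^-1 *: (flat_exp k (h *: (1 : R) + 0) - flat_exp k 0)) @[h --> (0 : R)^'] --> (0 : R).
  by split; [apply/cvg_ex; exists 0|exact/cvg_lim].
have c0 : 0 < k.+2`!%:R :> R by rewrite ltr0n fact_gt0.
apply/cvgrPdist_le => /= e e0; apply/nbhs_ballP; exists (e / k.+2`!%:R) => /=.
  by rewrite divr_gt0.
move=> h; rewrite /ball/= sub0r normrN ltr_pdivlMr// => he h0.
rewrite sub0r normrN E subr0 addr0 [h *: 1]mulr1.
have -> : h^-1 *: flat_exp k h = flat_exp k.+1 h.
  transitivity (h^-1 * flat_exp k h) => //.
  by rewrite /flat_exp; case: ifP => _; rewrite ?mulr0// exprS mulrA.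
have /andP[h1 h2] := flat_exp_bound k.+1 h.
by rewrite ger0_norm// (le_trans h2)// mulrC ltW.
Qed.

Lemma Ck_flat_exp j k : Ck j setT (flat_exp k).
Proof.
elim: j k => [|j IH] k.
  split=> // x _; apply: differentiable_continuous; apply/derivable1_diffP.
  by have [] := is_derive_flat_exp k x.
apply: (Ck_R openT (fun x _ => is_derive_flat_exp k x)).
apply: CkD; [exact: openT| |exact: IH].
by apply: CkM; [exact: openT|exact: Ck_cst|exact: IH].
Qed.

Definition smoothstep (x : R) : R := flat_exp 0 x / (flat_exp 0 x + flat_exp 0 (1 - x)).

Lemma flat_exp_gt0 x : 0 < x -> 0 < flat_exp 0 x.
Proof. by move=> x0; rewrite /flat_exp x0 expr0 mul1r expR_gt0. Qed.

Lemma flat_exp_ge0 x : 0 <= flat_exp 0 x.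
Proof. by have /andP[] := flat_exp_bound 0 x. Qed.

Lemma flat_exp_le0 x : x <= 0 -> flat_exp 0 x = 0.
Proof. by move=> x0; rewrite /flat_exp ltNge x0. Qed.

Lemma smoothstep_den x : 0 < flat_exp 0 x + flat_exp 0 (1 - x).
Proof.
have [x0|x0] := ltP 0 x; first by rewrite ltr_pwDl ?flat_exp_gt0 ?flat_exp_ge0.
by rewrite ltr_wpDl ?flat_exp_ge0// flat_exp_gt0// subr_gt0 (le_lt_trans x0).
Qed.

Lemma Ck_smoothstep k : Ck k setT smoothstep.
Proof.
have C1 : Ck k setT (fun x : R => flat_exp 0 (1 - x)).
  apply: (@Ck_comp1 _ _ _ _ setT) => //; [exact: openT|exact: Ck_flat_exp|].
  by apply: CkB; [exact: openT|exact: Ck_cst|exact: Ck_id].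
apply: CkM; [exact: openT|exact: Ck_flat_exp|].
apply: CkV; [exact: openT|by move=> x _; rewrite gt_eqF// smoothstep_den|].
by apply: CkD => //; [exact: openT|exact: Ck_flat_exp].
Qed.

Lemma smoothstep01 x : 0 <= smoothstep x <= 1.
Proof.
rewrite /smoothstep divr_ge0 ?flat_exp_ge0//=; last by rewrite ltW ?smoothstep_den.
by rewrite ler_pdivrMr ?smoothstep_den// mul1r lerDl flat_exp_ge0.
Qed.

Lemma smoothstep_0 x : x <= 0 -> smoothstep x = 0.
Proof. by move=> x0; rewrite /smoothstep flat_exp_le0// mul0r. Qed.

Lemma smoothstep_1 x : 1 <= x -> smoothstep x = 1.
Proof.
move=> x1; rewrite /smoothstep [flat_exp _ (1 - x)]flat_exp_le0 ?subr_le0//.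
by rewrite addr0 divff// gt_eqF// flat_exp_gt0// (lt_le_trans _ x1).
Qed.

(* Equal to 1 on the closed max-norm ball of radius r about y0, and to 0 off the ball of radius 2r. *)
Definition cubebump n (y0 : 'rV[R]_n) (r : R) (y : 'rV[R]_n) : R :=
  \prod_(j < n) smoothstep (2 - ((y 0 j - y0 0 j) / r) ^+ 2).

Lemma Ck_coord k n (U : set 'rV[R]_n) j : Ck k U (fun y : 'rV[R]_n => y 0 j).
Proof.
apply: (@Ck_sub _ _ _ _ setT) => //.
by apply: (Ck_mx _ _ openT).1; exact: Ck_id.
Qed.

Lemma Ck_bump k n (y0 : 'rV[R]_n) r : Ck k setT (cubebump y0 r).
Proof.
apply: Ck_prod; [exact: openT|move=> j _].
apply: (@Ck_comp1 _ _ _ _ setT) => //; [exact: openT|exact: Ck_smoothstep|].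
apply: CkB; [exact: openT|exact: Ck_cst|].
have C : Ck k setT (fun y : 'rV[R]_n => (y 0 j - y0 0 j) / r).
  apply: CkM; [exact: openT| |exact: Ck_cst].
  by apply: CkB; [exact: openT|exact: Ck_coord|exact: Ck_cst].
by under eq_fun do rewrite expr2; apply: CkM => //; exact: openT.
Qed.

Lemma bump01 n (y0 : 'rV[R]_n) r y : 0 <= cubebump y0 r y <= 1.
Proof.
rewrite /cubebump; elim/big_ind : _ => [|a b /andP[a0 a1] /andP[b0 b1]|j _].
- by rewrite ler01 lexx.
- by rewrite mulr_ge0// mulr_ile1.
- exact: smoothstep01.
Qed.

Lemma bump_1 n (y0 : 'rV[R]_n) r y : 0 < r -> `|y - y0| <= r -> cubebump y0 r y = 1.
Proof.
move=> r0 yr; apply: big1 => j _; apply: smoothstep_1.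
suff : ((y 0 j - y0 0 j) / r) ^+ 2 <= 1 by lra.
rewrite -real_normK ?num_real// expr_le1// normrM normfV (gtr0_norm r0).
rewrite ler_pdivrMr// mul1r (le_trans _ yr)//.
by have := coord_le_norm (y - y0) 0 j; rewrite !mxE.
Qed.

Lemma bump_0 n (y0 : 'rV[R]_n) r y : 0 < r -> 2 * r <= `|y - y0| -> cubebump y0 r y = 0.
Proof.
move=> r0 yr.
have [j jr] : exists j, 2 * r <= `|y 0 j - y0 0 j|.
  apply: contrapT => /forallNP H.
  have : `|y - y0| < 2 * r.
    apply: mx_norm_lt; first by rewrite mulr_gt0.
    by move=> i j; rewrite !ord1 !mxE ltNge; apply/negP/H.
  by rewrite ltNge yr.
rewrite /cubebump (bigD1 j)//= smoothstep_0 ?mul0r//.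
suff : 4 <= ((y 0 j - y0 0 j) / r) ^+ 2 by lra.
rewrite -real_normK ?num_real// (_ : 4 = 2 ^+ 2); last by ring.
rewrite lerXn2r ?nnegrE// normrM normfV (gtr0_norm r0) ler_pdivlMr//.
Qed.

End Bumps.

(** * Forms on manifolds *)

Lemma open_preimage (T U : topologicalType) (A : set T) (f : T -> U) (B : set U) :
  open A -> (forall x, A x -> {for x, continuous f}) -> open B ->
  open [set x | A x /\ B (f x)].
Proof.
move=> oA cf oB; rewrite openE => x [Ax Bfx].
apply: filterI; first exact: open_nbhs_nbhs.
by apply: (cf x Ax); exact: open_nbhs_nbhs.
Qed.

Lemma compact_image (T U : topologicalType) (K : set T) (f : T -> U) :
  (forall x, K x -> {for x, continuous f}) -> compact K -> compact (f @` K).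
Proof.
move=> cf cK; apply: continuous_compact => //.
by apply: continuous_in_subspaceT => x; rewrite inE; exact: cf.
Qed.

(** Compactness is used as [near_covering], for the filter on sequences generated by those that
    contain all points of a given sequence. *)
Lemma compact_finite_cover (T : topologicalType) (K : set T) (P : T -> set T) :
  compact K -> (forall x, K x -> open (P x) /\ P x x) ->
  exists s : seq T, (forall x, x \in s -> K x) /\ (forall y, K y -> exists2 x, x \in s & P x y).
Proof.
move=> cK HP; have {}cK : near_covering K by rewrite -(compact_near_coveringP K).
pose F (A : set (seq T)) := exists s0 : seq T, forall s, {subset s0 <= s} -> A s.
have FF : Filter F.
  split; first by exists [::].
  - move=> A B [sA HA] [sB HB]; exists (sA ++ sB) => s sAB; split.
      by apply: HA => x xA; apply: sAB; rewrite mem_cat xA.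
    by apply: HB => x xB; apply: sAB; rewrite mem_cat xB orbT.
  - by move=> A B AB [s0 H0]; exists s0 => s /H0/AB.
have [x Kx|s0 H0] := cK (seq T) F (fun s y => exists2 x, x \in s & K x /\ P x y) FF.
  have [oP Px] := HP x Kx.
  exists (P x, [set s : seq T | x \in s]) => /=.
    by split; [exact: open_nbhs_nbhs|exists [:: x] => s; apply; rewrite mem_head].
  by move=> [y s] [/= Py xs]; exists x.
exists [seq x <- s0 | `[< K x >]]; split.
  by move=> x; rewrite mem_filter => /andP[/asboolP].
move=> y Ky; have [x xs [Kx Pxy]] := H0 s0 (fun _ => id) y Ky.
by exists x => //; rewrite mem_filter xs andbT; apply/asboolP.
Qed.

Section Mfd.
Context {R : realType} {n : nat} {X : manifold R n}.

Local Notation dom p := (cdom (chart_at p)).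
Local Notation img p := (cimg (chart_at p)).
Local Notation cm p := (cmap (chart_at p)).
Local Notation ci p := (cinv (chart_at p)).

Implicit Types p q x : X.

Definition ov (p q : X) : set 'rV[R]_n := [set y | img p y /\ dom q (ci p y)].

Lemma ov_open p q : open (ov p q).
Proof.
apply: open_preimage; [exact: cimg_open|exact: cinv_continuous|exact: cdom_open].
Qed.

Arguments ov_open : clear implicits.

Lemma img_open q : open (img q).
Proof. exact: cimg_open. Qed.
Arguments img_open : clear implicits.

Lemma Ck_transition k p q : Ck k (ov p q) (transition p q).
Proof. by apply: (smooth_onP _ _).1; exact: chart_compat. Qed.

Lemma transition_img p q y : ov p q y -> img q (transition p q y).
Proof. by move=> [_ dy]; exact: cmap_img. Qed.

Lemma cinv_transition p q y : ov p q y -> ci q (transition p q y) = ci p y.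
Proof. by move=> [_ dy]; rewrite /transition /= cmapK. Qed.

Lemma img_ov q y : img q y -> ov q (ci q y) y.
Proof. by move=> iy; split=> //; exact: mem_chart_at. Qed.

Lemma ov_self q y : img q y -> ov q q y.
Proof. by move=> iy; split=> //; exact: cinv_dom. Qed.

Lemma ov_cmap p q x : dom p x -> dom q x -> ov p q (cm p x).
Proof. by move=> px qx; split; [exact: cmap_img|rewrite cmapK]. Qed.

Lemma transition_cmap p q x : dom p x -> transition p q (cm p x) = cm q x.
Proof. by move=> px; rewrite /transition /= cmapK. Qed.

Lemma jacobian_transition_comp p q (r : X) y : ov p q y -> ov p r y ->
  jacobian (transition p r) y =
  jacobian (transition p q) y *m jacobian (transition q r) (transition p q y).
Proof.
move=> oq or.
pose O := ov p q `&` ov p r.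
have oO : open O by apply: openI; exact: ov_open.
have Oy : O y by [].
have H z : O z -> ov q r (transition p q z).
  by move=> [zq [_ zr]]; split; [exact: transition_img|rewrite cinv_transition].
rewrite -(jacobian_comp oO (ov_open q r) _ (Ck_transition 1 q r) Oy (H _ Oy)); last first.
  by apply: Ck_sub (Ck_transition 1 p q) => z [].
apply/esym/(jacobian_near oO _ Oy) => [|z [zq zr]].
  by apply: Ck_sub (Ck_transition 1 p r) => z [].
by rewrite /= {2}/transition /= cinv_transition.
Qed.

Lemma jacobian_transition_self p y : img p y -> jacobian (transition p p) y = 1%:M.
Proof.
move=> iy; rewrite -(jacobian_id y).
apply: (jacobian_near (img_open p) _ iy); first exact: Ck_id.
by move=> z iz; rewrite /transition /= cinvK.
Qed.

Lemma jacobian_transitionK p q y : ov p q y ->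
  jacobian (transition p q) y *m jacobian (transition q p) (transition p q y) = 1%:M.
Proof.
move=> oy; rewrite -jacobian_transition_comp//; last by apply: ov_self; case: oy.
by apply: jacobian_transition_self; case: oy.
Qed.

Lemma tangent_coordE q y : img q y ->
  tangent_coord q y = jacobian (transition q (ci q y)) y.
Proof. by []. Qed.

Lemma tangent_coord_ov p q y : ov p q y ->
  tangent_coord p y = jacobian (transition p q) y *m tangent_coord q (transition p q y).
Proof.
move=> oy; rewrite /tangent_coord cinv_transition//.
apply: jacobian_transition_comp => //; apply: img_ov; by case: oy.
Qed.

Lemma tangent_coord_center x : tangent_coord x (cm x x) = 1%:M.
Proof.
have dx := mem_chart_at x; rewrite /tangent_coord cmapK//.
by apply: jacobian_transition_self; exact: cmap_img.
Qed.

Lemma local_form_ov k (w : diff_form X k) p q y E : ov p q y ->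
  local_form w p y E = fpull (transition p q) (local_form w q) y E.
Proof.
by move=> oy; rewrite /fpull /local_form -mulmxA -(tangent_coord_ov oy) (cinv_transition oy).
Qed.

Lemma local_form_center k (w : diff_form X k) x E : local_form w x (cm x x) E = w x E.
Proof. by rewrite /local_form tangent_coord_center mulmx1 cmapK//; exact: mem_chart_at. Qed.

(** Vectors at [x] carry coordinates in [chart_at x]; the Jacobian factor converts them to the chart
    of [q]. Every computation in a fixed chart starts here. *)
Lemma form_local k (w : diff_form X k) q x E : dom q x ->
  w x E = local_form w q (cm q x) (E *m jacobian (transition x q) (cm x x)).
Proof.
move=> qx; have xx := mem_chart_at x.
have oy := ov_cmap xx qx.
by rewrite -local_form_center (local_form_ov w E oy) /fpull transition_cmap.
Qed.

Lemma smooth_formP k (w : diff_form X k) :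
  smooth_form w <-> forall q, fform (img q) (local_form w q).
Proof.
split=> [[mw aw Cw] q|fw].
  split=> [y iy|y iy|E j].
  - exact: multilinear_mulmx.
  - exact: alternating_mulmxr.
  - by apply: (smooth_onP _ _).1; exact: Cw.
have E x : w x = local_form w x (cm x x) by apply/funext => E; rewrite local_form_center.
have ix x : img x (cm x x) by apply: cmap_img; exact: mem_chart_at.
split=> [x|x|q E']; rewrite ?E.
- exact: fform_ml (fw x) (ix x).
- exact: fform_alt (fw x) (ix x).
- by apply/smooth_onP => j; exact: fform_Ck (fw q).
Qed.

Lemma ext_derivE k (w : diff_form X k) x E :
  ext_deriv w x E = fd (local_form w x) (cm x x) E.
Proof. by []. Qed.

(** [ext_deriv] changes chart from point to point; [fd_pull], applied to the transition map, shows
    that in a fixed chart the result is [fd]. *)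
Lemma local_ext_deriv k (w : diff_form X k) q y E : smooth_form w -> img q y ->
  local_form (ext_deriv w) q y E = fd (local_form w q) y E.
Proof.
move=> /smooth_formP fw iy.
have [x xE] : exists x, ci q y = x by exists (ci q y).
have oy : ov q x y by rewrite -xE; exact: img_ov.
have A : cm x x = transition q x y by rewrite /transition /= xE.
have B : E *m tangent_coord q y = E *m jacobian (transition q x) y.
  by rewrite /tangent_coord xE.
rewrite {1}/local_form xE ext_derivE.
apply: etrans (f_equal2 (fun z F => fd (local_form w x) z F) A B) _.
apply: etrans (esym (fd_pull E (ov_open q x) (img_open x) (@transition_img q x)
  (Ck_transition 2 q x) (fw x) oy)) _.
apply: (fd_near _ (ov_open q x) oy) => z F oz.
by rewrite -local_form_ov.
Qed.

Lemma smooth_ext_deriv k (w : diff_form X k) : smooth_form w -> smooth_form (ext_deriv w).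
Proof.
move=> sw; apply/smooth_formP => q.
apply: (@fform_eq _ _ _ _ (fd (local_form w q))); first exact: img_open.
  by move=> y E iy; rewrite local_ext_deriv.
by apply: fd_fform; [exact: img_open|exact: (smooth_formP w).1].
Qed.

Lemma ext_deriv2 k (w : diff_form X k) x E : smooth_form w -> ext_deriv (ext_deriv w) x E = 0.
Proof.
move=> sw; rewrite -local_form_center.
have ix : img x (cm x x) by apply: cmap_img; exact: mem_chart_at.
rewrite local_ext_deriv//; last exact: smooth_ext_deriv.
rewrite -(fd_fd E (img_open _) ix ((smooth_formP w).1 sw x)).
by apply: (fd_near _ (img_open _) ix) => z F iz; rewrite local_ext_deriv.
Qed.

Lemma smooth_funP (f : X -> R) : smooth_fun f <-> forall q k, Ck k (img q) (f \o ci q).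
Proof.
by split=> sf q; [move=> k; exact: (smooth_onP _ _).1|apply/smooth_onP].
Qed.

Definition chart_fun (q : X) (a : 'rV[R]_n -> R) : X -> R :=
  fun x => if pselect (dom q x) then a (cm q x) else 0.

Definition chart_form k (q : X) (a : 'rV[R]_n -> 'M[R]_(k, n) -> R) : diff_form X k :=
  fun x E => if pselect (dom q x) then a (cm q x) (E *m jacobian (transition x q) (cm x x)) else 0.

Lemma chart_fun_in q a x : dom q x -> chart_fun q a x = a (cm q x).
Proof. by move=> dx; rewrite /chart_fun; case: pselect. Qed.

Lemma chart_form_in k q (a : 'rV[R]_n -> 'M[R]_(k, n) -> R) x E : dom q x ->
  chart_form q a x E = a (cm q x) (E *m jacobian (transition x q) (cm x x)).
Proof. by move=> dx; rewrite /chart_form; case: pselect. Qed.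

Lemma local_chart_form k q (a : 'rV[R]_n -> 'M[R]_(k, n) -> R) y E : img q y ->
  local_form (chart_form q a) q y E = a y E.
Proof.
move=> iy; have oy := img_ov iy; rewrite /local_form chart_form_in; last exact: cinv_dom.
rewrite cinvK// -mulmxA /tangent_coord.
have -> : cm (ci q y) (ci q y) = transition q (ci q y) y by [].
by rewrite jacobian_transitionK// mulmx1.
Qed.

Lemma chart_image_closed q (K : set 'rV[R]_n) : compact K -> K `<=` img q ->
  closed (ci q @` K) /\ ci q @` K `<=` dom q.
Proof.
move=> cK Kq; split; last by move=> _ [y /Kq iy <-]; exact: cinv_dom.
apply: compact_closed; first exact: mtop_hausdorff.
by apply: compact_image => // y /Kq; exact: cinv_continuous.
Qed.

Lemma chart_supp_compl q (K : set 'rV[R]_n) x : K `<=` img q ->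
  ~ (ci q @` K) x -> dom q x -> ~ K (cm q x).
Proof. by move=> Kq nx dx Kx; apply: nx; exists (cm q x) => //; rewrite cmapK. Qed.

(** The manifold is Hausdorff, so the image of [K] is closed; the extension by zero vanishes on its
    open complement, which together with the chart domain covers everything. *)
Lemma smooth_chart_fun q a (K : set 'rV[R]_n) : compact K -> K `<=` img q ->
  (forall k, Ck k (img q) a) -> (forall y, img q y -> ~ K y -> a y = 0) -> smooth_fun (chart_fun q a).
Proof.
move=> cK Kq Ca a0; apply/smooth_funP => p k; have [clK Kd] := chart_image_closed cK Kq.
apply: Ck_local => y iy; have [dq|dq] := pselect (dom q (ci p y)).
  exists (ov p q); split=> //.
  apply: (@Ck_eq _ _ _ _ _ (fun y => a (transition p q y))); first exact: ov_open.
    by move=> z [iz dz]; rewrite /= chart_fun_in.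
  apply: (Ck_comp (ov_open p q) (img_open q) (@transition_img p q) (Ca k)).
  exact: Ck_transition.
exists [set z | img p z /\ (~` (ci q @` K)) (ci p z)]; split.
  by split=> // /Kd.
have oO : open [set z | img p z /\ (~` (ci q @` K)) (ci p z)].
  by apply: open_preimage; [exact: img_open|exact: cinv_continuous|exact: closed_openC].
apply: (@Ck_eq _ _ _ _ _ (fun=> 0)) => //; last exact: Ck_cst.
move=> z [iz nz]; rewrite /= /chart_fun; case: pselect => // dz.
rewrite a0//; [exact: cmap_img|exact: chart_supp_compl nz dz].
Qed.

Lemma smooth_chart_form k q (a : 'rV[R]_n -> 'M[R]_(k, n) -> R) (K : set 'rV[R]_n) :
  compact K -> K `<=` img q -> fform (img q) a ->
  (forall y E, img q y -> ~ K y -> a y E = 0) -> smooth_form (chart_form q a).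
Proof.
move=> cK Kq fa a0; apply/smooth_formP => p; have [clK Kd] := chart_image_closed cK Kq.
have H y E : ov p q y -> local_form (chart_form q a) p y E = fpull (transition p q) a y E.
  move=> oy; rewrite (local_form_ov _ _ oy) /fpull local_chart_form//.
  exact: transition_img.
have fp : fform (ov p q) (local_form (chart_form q a) p).
  apply: (@fform_eq _ _ _ _ (fpull (transition p q) a)); first exact: ov_open.
    by move=> y E /H.
  apply: (fpull_fform (ov_open p q) (img_open q) (@transition_img p q)) => // j.
  exact: Ck_transition.
have Z y : img p y -> ~ (ci q @` K) (ci p y) -> forall E, local_form (chart_form q a) p y E = 0.
  move=> iy ny E; rewrite /local_form /chart_form; case: pselect => // dz.
  by rewrite a0//; [exact: cmap_img|exact: chart_supp_compl ny dz].
split=> [y iy|y iy|E j].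
- have [dq|dq] := pselect (dom q (ci p y)); first exact: (fform_ml fp).
  move=> i A B C b c _ _ _; rewrite !Z ?mulr0 ?addr0//; by move/Kd.
- have [dq|dq] := pselect (dom q (ci p y)); first exact: (fform_alt fp).
  by move=> E i l _ _; rewrite Z//; move/Kd.
- apply: Ck_local => y iy; have [dq|dq] := pselect (dom q (ci p y)).
    by exists (ov p q); split=> //; exact: fform_Ck fp.
  exists [set z | img p z /\ (~` (ci q @` K)) (ci p z)]; split; first by split=> // /Kd.
  have oO : open [set z | img p z /\ (~` (ci q @` K)) (ci p z)].
    by apply: open_preimage; [exact: img_open|exact: cinv_continuous|exact: closed_openC].
  apply: (@Ck_eq _ _ _ _ _ (fun=> 0)) => //; last exact: Ck_cst.
  by move=> z [iz nz]; rewrite Z.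
Qed.

Definition fscale k (f : X -> R) (w : diff_form X k) : diff_form X k := fun x E => f x * w x E.
Definition fadd k (w w' : diff_form X k) : diff_form X k := fun x E => w x E + w' x E.
Definition fsc k (c : R) (w : diff_form X k) : diff_form X k := fun x E => c * w x E.
Definition fzero k : diff_form X k := fun _ _ => 0.

Lemma fform_scale k (U : set 'rV[R]_n) (f : 'rV[R]_n -> R) (a : 'rV[R]_n -> 'M[R]_(k, n) -> R) :
  open U -> (forall j, Ck j U f) -> fform U a -> fform U (fun y E => f y * a y E).
Proof.
move=> oU Cf fa; split=> [y Uy|y Uy|E j].
- move=> i A B C b c rA rB rC; rewrite (fform_ml fa Uy rA rB rC); ring.
- by move=> A i l il Ail; rewrite (fform_alt fa Uy il Ail) mulr0.
- by apply: CkM => //; exact: fform_Ck fa.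
Qed.

Lemma fform_add k (U : set 'rV[R]_n) (a b : 'rV[R]_n -> 'M[R]_(k, n) -> R) :
  open U -> fform U a -> fform U b -> fform U (fun y E => a y E + b y E).
Proof.
move=> oU fa fb; split=> [y Uy|y Uy|E j].
- move=> i A B C c d rA rB rC; rewrite (fform_ml fa Uy rA rB rC) (fform_ml fb Uy rA rB rC); ring.
- by move=> A i l il Ail; rewrite (fform_alt fa Uy il Ail) (fform_alt fb Uy il Ail) addr0.
- by apply: CkD => //; [exact: fform_Ck fa|exact: fform_Ck fb].
Qed.

Lemma smooth_fscale k (f : X -> R) (w : diff_form X k) :
  smooth_fun f -> smooth_form w -> smooth_form (fscale f w).
Proof.
move=> sf /smooth_formP sw; apply/smooth_formP => q.
apply: (@fform_scale _ _ (f \o ci q)) => //; first exact: img_open.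
by move=> j; exact: (smooth_funP f).1.
Qed.

Lemma smooth_fun_cst (c : R) : smooth_fun (fun _ : X => c).
Proof. by apply/smooth_funP => q k; exact: Ck_cst. Qed.

Lemma smooth_fsc k c (w : diff_form X k) : smooth_form w -> smooth_form (fsc c w).
Proof. by move=> sw; apply: (@smooth_fscale _ (fun=> c)) => //; exact: smooth_fun_cst. Qed.

Lemma smooth_fadd k (w w' : diff_form X k) :
  smooth_form w -> smooth_form w' -> smooth_form (fadd w w').
Proof.
move=> /smooth_formP sw /smooth_formP sw'; apply/smooth_formP => q.
by apply: fform_add => //; exact: img_open.
Qed.

Lemma smooth_fzero k : smooth_form (@fzero k).
Proof.
split=> [x|x|q E]; first by move=> i A B C b c _ _ _; rewrite !mulr0 addr0.
  by move=> A i j.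
by apply/smooth_onP => j; exact: Ck_cst.
Qed.

Lemma smooth_fsum k (I : Type) (s : seq I) (w : I -> diff_form X k) :
  (forall i, smooth_form (w i)) -> smooth_form (fun x E => \sum_(i <- s) w i x E).
Proof.
move=> sw; elim: s => [|i s IH].
  rewrite (_ : (fun _ _ => _) = @fzero k); first exact: smooth_fzero.
  by apply/funext => x; apply/funext => E; rewrite big_nil.
rewrite (_ : (fun _ _ => _) = fadd (w i) (fun x E => \sum_(j <- s) w j x E)).
  by apply: smooth_fadd; [exact: sw|exact: IH].
by apply/funext => x; apply/funext => E; rewrite big_cons.
Qed.

Lemma smooth_funD (f g : X -> R) : smooth_fun f -> smooth_fun g -> smooth_fun (fun x => f x + g x).
Proof.
move=> /smooth_funP sf /smooth_funP sg; apply/smooth_funP => q k.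
by apply: CkD; [exact: img_open|exact: sf|exact: sg].
Qed.

Lemma smooth_funM (f g : X -> R) : smooth_fun f -> smooth_fun g -> smooth_fun (fun x => f x * g x).
Proof.
move=> /smooth_funP sf /smooth_funP sg; apply/smooth_funP => q k.
by apply: CkM; [exact: img_open|exact: sf|exact: sg].
Qed.

Lemma smooth_funB1 (f : X -> R) : smooth_fun f -> smooth_fun (fun x => 1 - f x).
Proof.
move=> /smooth_funP sf; apply/smooth_funP => q k.
by apply: CkB; [exact: img_open|exact: Ck_cst|exact: sf].
Qed.

Lemma smooth_fun_sum (I : Type) (s : seq I) (f : I -> X -> R) :
  (forall i, smooth_fun (f i)) -> smooth_fun (fun x => \sum_(i <- s) f i x).
Proof.
move=> sf; apply/smooth_funP => q k; apply: Ck_sum; first exact: img_open.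
by move=> i _; exact: (smooth_funP _).1.
Qed.

Lemma smooth_fun_prod (I : Type) (s : seq I) (f : I -> X -> R) :
  (forall i, smooth_fun (f i)) -> smooth_fun (fun x => \prod_(i <- s) f i x).
Proof.
move=> sf; apply/smooth_funP => q k; apply: Ck_prod; first exact: img_open.
by move=> i _; exact: (smooth_funP _).1.
Qed.

Definition csupp (U : set X) (f : X -> R) :=
  exists2 K, compact K /\ K `<=` U & forall x, ~ K x -> f x = 0.

Lemma closed_ball_compact (y : 'rV[R]_n) r : compact [set z : 'rV[R]_n | `|z - y| <= r].
Proof.
apply: bounded_closed_compact.
  exists (`|y| + r); split; first exact: num_real.
  move=> e ye z /= zr; rewrite (le_trans _ (ltW ye))// -{1}(subrK y z) addrC.
  by rewrite (le_trans (ler_normD _ _))// lerD2l.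
have -> : [set z : 'rV[R]_n | `|z - y| <= r] = (fun z : 'rV[R]_n => `|z - y|) @^-1` [set t | t <= r] by [].
apply: closed_comp; last exact: closed_le.
move=> z _; apply: (@continuous_comp _ _ _ (fun z : 'rV[R]_n => z - y) (fun z => `|z|)).
  have C : Ck 0 setT (fun z : 'rV[R]_n => z - y).
    by apply: CkB; [exact: openT|exact: Ck_id|exact: Ck_cst].
  exact: Ck_continuous C I.
exact: norm_continuous.
Qed.

Lemma point_cutoff (x : X) (U : set X) : open U -> U x ->
  exists2 f : X -> R, smooth_fun f /\ (forall y, 0 <= f y <= 1) &
    (exists2 V, open V /\ V x & forall y, V y -> f y = 1) /\ csupp U f.
Proof.
move=> oU Ux; have xx := mem_chart_at x.
have oO : open [set y | img x y /\ U (ci x y)].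
  by apply: open_preimage; [exact: img_open|exact: cinv_continuous|].
have Ox : [set y | img x y /\ U (ci x y)] (cm x x).
  by split; [exact: cmap_img|rewrite cmapK].
have [r r0 B] := open_ball oO Ox.
pose d := r / 3; have d0 : 0 < d by rewrite divr_gt0.
pose K := [set z : 'rV[R]_n | `|z - cm x x| <= 2 * d].
have cK : compact K by exact: closed_ball_compact.
have KB y : K y -> img x y /\ U (ci x y).
  move=> Ky; apply: B; rewrite mx_ballE distrC (le_lt_trans Ky)// /d; lra.
have Kq : K `<=` img x by move=> y /KB[].
have b0 y : ~ K y -> cubebump (cm x x) d y = 0.
  by move=> nK; apply: bump_0 => //; rewrite leNgt; apply/negP => /ltW.
exists (chart_fun x (cubebump (cm x x) d)).
  split.
    apply: smooth_chart_fun cK Kq _ _ => [k|y _]; last exact: b0.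
    by apply: Ck_sub (Ck_bump _ _ _).
  by move=> y; rewrite /chart_fun; case: pselect => [?|?]; rewrite ?bump01 ?lexx ?ler01.
split.
  exists [set y | dom x y /\ ball (cm x x) d (cm x y)].
    split; last by split=> //; exact: ballxx.
    by apply: open_preimage; [exact: cdom_open|exact: cmap_continuous|exact: ball_open].
  move=> y [dy]; rewrite mx_ballE distrC => /ltW yd.
  by rewrite chart_fun_in// bump_1.
exists (ci x @` K).
  split; first by apply: compact_image => // y /Kq; exact: cinv_continuous.
  by move=> _ [y /KB[_ Uy] <-].
move=> y ny; rewrite /chart_fun; case: pselect => // dy.
by rewrite b0//; exact: chart_supp_compl ny dy.
Qed.

Lemma csupp_compactU (s : seq X) (U : set X) (K : X -> set X) :
  (forall x, x \in s -> compact (K x) /\ K x `<=` U) ->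
  compact [set y | exists2 x, x \in s & K x y] /\ [set y | exists2 x, x \in s & K x y] `<=` U.
Proof.
move=> H; split; last by move=> y [x /H[_]]; apply.
elim: s H => [|x s IH] H.
  rewrite (_ : [set y | _] = set0); first exact: compact0.
  by apply/seteqP; split => // y [].
rewrite (_ : [set y | _] = K x `|` [set y | exists2 x, x \in s & K x y]).
  apply: compactU; first by have [] := H x (mem_head _ _).
  by apply: IH => z zs; apply: H; rewrite inE zs orbT.
apply/seteqP; split => y.
  by move=> [z]; rewrite inE => /orP[/eqP->|zs] Kz; [left|right; exists z].
by move=> [Kx|[z zs Kz]]; [exists x; rewrite ?mem_head|exists z; rewrite ?inE ?zs ?orbT].
Qed.

(** With finitely many point cut-offs, one minus the product of the complements [1 - f] equals 1
    where some [f] is 1 and vanishes where all of them do. *)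
Lemma cutoff (K U : set X) : compact K -> open U -> K `<=` U ->
  exists2 f : X -> R, smooth_fun f /\ (forall y, 0 <= f y <= 1) &
    (exists2 V, open V /\ K `<=` V & forall y, V y -> f y = 1) /\ csupp U f.
Proof.
move=> cK oU KU.
have H x : exists fV : (X -> R) * set X, K x ->
   [/\ smooth_fun fV.1, forall y, 0 <= fV.1 y <= 1, open fV.2 /\ fV.2 x,
     forall y, fV.2 y -> fV.1 y = 1 & csupp U fV.1].
  have [Kx|nK] := pselect (K x); last by exists (fun=> 0, set0).
  have [f [sf f01] [[V [oV Vx] fV] cf]] := point_cutoff oU (KU _ Kx).
  by exists (f, V).
have /choice[fV HfV] := H.
have [|s [sK cov]] := compact_finite_cover (P := fun x => (fV x).2) cK.
  by move=> x /HfV[].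
(* The chosen functions are controlled only at points of [K]; replacing the others by 0 gives a
   family smooth for every index. *)
have sf x : smooth_fun (if x \in s then (fV x).1 else fun=> 0).
  by case: ifPn => [/sK/HfV[]//|_]; exact: smooth_fun_cst.
exists (fun y => 1 - \prod_(x <- s) (1 - (if x \in s then (fV x).1 else fun=> 0) y)).
  split; first by apply: smooth_funB1; apply: smooth_fun_prod => x; exact: smooth_funB1.
  move=> y; rewrite subr_ge0 gerBl.
  suff /andP[-> ->] : 0 <= \prod_(x <- s) (1 - (if x \in s then (fV x).1 else fun=> 0) y) <= 1 by [].
  elim/big_ind : _ => [|a b /andP[a0 a1] /andP[b0 b1]|x _].
  - by rewrite ler01 lexx.
  - by rewrite mulr_ge0// mulr_ile1.
  - case: ifPn => [/sK/HfV[_ /(_ y) f01 _ _ _]|_]; last by rewrite subr0 ler01 lexx.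
    by case/andP: f01 => f0 f1; rewrite subr_ge0 f1 gerBl f0.
split.
  exists (\bigcup_(x in [set` s]) (fV x).2).
    split; first by apply: bigcup_open => x /= /sK/HfV[_ _ []].
    by move=> y /cov[x xs Vy]; exists x.
  move=> y [x /= xs Vy]; rewrite (big_rem x)//= xs.
  by have [_ _ _ -> //] := HfV _ (sK _ xs); rewrite subrr mul0r subr0.
have H2 x : exists K', x \in s -> (compact K' /\ K' `<=` U) /\ forall y, ~ K' y -> (fV x).1 y = 0.
  have [xs|xs] := boolP (x \in s); last by exists set0.
  by have [_ _ _ _ [K' ? ?]] := HfV _ (sK _ xs); exists K'.
have /choice[K' HK'] := H2.
exists [set y | exists2 x, x \in s & K' x y].
  by apply: csupp_compactU => x /HK'[].
move=> y ny; rewrite big_seq big1 ?subrr// => x xs.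
rewrite xs; have [_ ->] := HK' _ xs; first by rewrite subr0.
by move=> Ky; apply: ny; exists x.
Qed.

End Mfd.

Arguments img_open {R n X} q _ : rename.
Arguments ov_open {R n X} p q _ : rename.

(** * Currents *)

Lemma compact_bound (R : realType) (T : topologicalType) (K : set T) (f : T -> R) :
  compact K -> (forall x, K x -> {for x, continuous f}) ->
  exists2 M : R, 0 < M & forall x, K x -> `|f x| <= M.
Proof.
move=> cK cf; have := compact_bounded (compact_image cf cK).
move=> [M [_ HM]]; exists (Num.max 1 (M + 1)); first by rewrite lt_max ltr01.
move=> x Kx; apply: HM; last by exists x.
by rewrite lt_max ltrDl ltr01 orbT.
Qed.

Lemma filter_finite_set (I J : Type) (F : set_system I) (FF : Filter F) (L : set J) (P : J -> set I) :
  finite_set L -> (forall j, L j -> F (P j)) -> F [set i | forall j, L j -> P j i].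
Proof.
move=> /(@finite_seqP {classic J}) [s ->] {L}.
elim: s => [|j s IH] HP; first by apply: filterS filterT => i _ j.
apply: filterS2 (IH _) (HP j _) => [i Hi Pj k /=|k ks|]; last by rewrite /= mem_head.
  by rewrite inE => /orP[/eqP->//|ks]; exact: Hi.
by apply: HP; rewrite /= inE (ks : k \in s) orbT.
Qed.

(** * Convergence to zero in the C^infinity topology *)

Section NullFamilies.
Context {R : realType} {I : Type} (F : set_system I) {FF : Filter F}.

Section Def.
Context {V : normedModType R}.

(* Families of functions tending to 0 along F, with derivatives of order at
   most [j], uniformly on the compact subsets of [U]. *)
Fixpoint null (j : nat) (U : set V) (f : I -> V -> R) : Prop :=
  (forall (K : set V) (e : R), compact K -> K `<=` U -> 0 < e ->
     F [set i | forall y, K y -> `|f i y| < e]) /\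
  (if j is j'.+1 then forall v, null j' U (fun i => 'D_v (f i)) else True).

Definition smoothF (U : set V) (f : I -> V -> R) := F [set i | forall k, Ck k U (f i)].

Lemma null0 j U f : null j U f -> forall (K : set V) (e : R), compact K -> K `<=` U -> 0 < e ->
     F [set i | forall y, K y -> `|f i y| < e].
Proof. by case: j => [|j] []. Qed.

Lemma null_derive j U f v : null j.+1 U f -> null j U (fun i => 'D_v (f i)).
Proof. by case=> _; apply. Qed.

Lemma nullW j U f : null j.+1 U f -> null j U f.
Proof.
elim: j f => [|j IH] f [H0 HD]; first by split.
by split=> // v; apply: IH; exact: HD.
Qed.

Lemma nullP U f : (forall j, null j U f) <->
  forall (vs : seq V) (K : set V) (e : R), compact K -> K `<=` U -> 0 < e ->
     F [set i | forall y, K y -> `|iter_derive vs (f i) y| < e].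
Proof.
have rE vs v g : iter_derive (rcons vs v) g = iter_derive vs ('D_v g) :> (V -> R).
  by rewrite /iter_derive foldr_rcons.
split=> [Nf vs|H j].
  elim/last_ind: vs f Nf => [|vs v IH] f Nf; first exact: null0 (Nf 0%N).
  move=> K e cK KU e0.
  apply: filterS (IH (fun i => 'D_v (f i)) (fun j => null_derive v (Nf j.+1)) K e cK KU e0) => i Hi y Ky.
  by rewrite rE; exact: Hi.
elim: j f H => [|j IH] f H; first by split=> //; exact: (H [::]).
split; first exact: (H [::]).
move=> v; apply: IH => vs K e cK KU e0; apply: filterS (H (rcons vs v) K e cK KU e0) => i Hi y Ky.
by rewrite -rE; exact: Hi.
Qed.

Lemma null_near j U f g : open U -> F [set i | forall y, U y -> f i y = g i y] ->
  null j U f -> null j U g.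
Proof.
move=> oU; elim: j f g => [|j IH] f g fg [H0 HD]; split=> //.
- move=> K e cK KU e0; apply: filterS2 fg (H0 K e cK KU e0) => i fg fK y Ky.
  by rewrite -fg; [exact: fK|exact: KU].
- move=> K e cK KU e0; apply: filterS2 fg (H0 K e cK KU e0) => i fg fK y Ky.
  by rewrite -fg; [exact: fK|exact: KU].
move=> v; apply: IH (HD v); apply: filterS fg => i fg y Uy.
exact: derive_nearE fg.
Qed.

Lemma null_eq j U f g : (forall i y, f i y = g i y) -> null j U f -> null j U g.
Proof. by move=> fg; rewrite (_ : f = g)//; apply/funext => i; apply/funext => y. Qed.

Lemma smoothF_derive U f v : smoothF U f -> smoothF U (fun i => 'D_v (f i)).
Proof. by apply: filterS => i Cf k; exact: Ck_derive. Qed.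

Lemma null_cst0 j U : null j U (fun _ _ => 0).
Proof.
elim: j => [|j IH]; split=> //.
- by move=> K e _ _ e0; apply: filterS filterT => i _ y _; rewrite normr0.
- by move=> K e _ _ e0; apply: filterS filterT => i _ y _; rewrite normr0.
move=> v; apply: null_eq IH => i y.
by apply: esym; exact: derive_cst.
Qed.

Lemma nullD j U f g : open U -> smoothF U f -> smoothF U g ->
  null j U f -> null j U g -> null j U (fun i y => f i y + g i y).
Proof.
move=> oU; elim: j f g => [|j IH] f g sf sg Nf Ng.
  split=> // K e cK KU e0; have e2 : 0 < e / 2 by rewrite divr_gt0.
  apply: filterS2 (null0 Nf cK KU e2) (null0 Ng cK KU e2) => i fK gK y Ky.
  by rewrite (le_lt_trans (ler_normD _ _))// [ltRHS]splitr ltrD ?fK ?gK.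
split.
  move=> K e cK KU e0; have e2 : 0 < e / 2 by rewrite divr_gt0.
  apply: filterS2 (null0 Nf cK KU e2) (null0 Ng cK KU e2) => i fK gK y Ky.
  by rewrite (le_lt_trans (ler_normD _ _))// [ltRHS]splitr ltrD ?fK ?gK.
move=> v; apply: (null_near oU _ (IH _ _ (smoothF_derive v sf) (smoothF_derive v sg)
  (null_derive v Nf) (null_derive v Ng))).
apply: filterS2 sf sg => i Cf Cg y Uy.
apply: esym; apply: deriveD; [exact: Ck_derivable (Cf 1%N) Uy|exact: Ck_derivable (Cg 1%N) Uy].
Qed.

Lemma smoothFD U f g : open U -> smoothF U f -> smoothF U g -> smoothF U (fun i y => f i y + g i y).
Proof. by move=> oU; apply: filterS2 => i Cf Cg k; exact: CkD. Qed.

Lemma smoothFM U (g : V -> R) f : open U -> (forall k, Ck k U g) -> smoothF U f ->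
  smoothF U (fun i y => g y * f i y).
Proof. by move=> oU Cg; apply: filterS => i Cf k; exact: CkM. Qed.

Lemma nullM j U (g : V -> R) f : open U -> (forall k, Ck k U g) -> smoothF U f ->
  null j U f -> null j U (fun i y => g y * f i y).
Proof.
move=> oU; have N0 (g' : V -> R) f' : (forall k, Ck k U g') -> null 0 U f' -> forall (K : set V) (e : R), compact K -> K `<=` U -> 0 < e ->
     F [set i | forall y, K y -> `|g' y * f' i y| < e].
  move=> Cg Nf K e cK KU e0.
  have [M M0 HM] := @compact_bound _ _ K g' cK (fun y Ky => Ck_continuous (Cg 0%N) (KU y Ky)).
  have eM : 0 < e / M by rewrite divr_gt0.
  apply: filterS (null0 Nf cK KU eM) => i fK y Ky.
  rewrite normrM (@le_lt_trans _ _ (M * `|f' i y|))// ?ler_wpM2r ?HM//.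
  by rewrite mulrC -ltr_pdivlMr// fK.
elim: j g f => [|j IH] g f Cg sf Nf; first by split=> //; exact: N0.
split; first by apply: N0 => //; elim: j {IH} f Nf {sf} => [f [+ _]|j IH f /nullW]//; exact: IH.
move=> v.
have sDf := smoothF_derive v sf.
have CDg k : Ck k U ('D_v g) by exact: Ck_derive.
have S1 : smoothF U (fun i y => g y * 'D_v (f i) y) by exact: smoothFM.
have S2 : smoothF U (fun i y => 'D_v g y * f i y) by exact: smoothFM.
apply: (null_near oU _ (nullD oU S1 S2 (IH _ _ Cg sDf (null_derive v Nf)) (IH _ _ CDg sf (nullW Nf)))).
apply: filterS sf => i Cf y Uy; apply: esym.
have /= := deriveM (Ck_derivable (Cg 1%N) Uy : derivable g y v) (Ck_derivable (Cf 1%N) Uy).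
by rewrite [X in _ = _ + X -> _]mulrC; apply.
Qed.

Lemma null_sum j U (J : Type) (s : seq J) (f : J -> I -> V -> R) : open U ->
  (forall k, smoothF U (f k)) -> (forall k, null j U (f k)) ->
  null j U (fun i y => \sum_(k <- s) f k i y) /\ smoothF U (fun i y => \sum_(k <- s) f k i y).
Proof.
move=> oU sf Nf; elim: s => [|k s [IH1 IH2]].
  split; first by apply: null_eq (null_cst0 _ _) => i y; rewrite big_nil.
  apply: filterS filterT => i _ k; apply: Ck_eq (Ck_cst _ _ 0) => // y _.
  by rewrite big_nil.
split.
  by apply: null_eq (nullD oU (sf k) IH2 (Nf k) IH1) => i y; rewrite big_cons.
apply: filterS (smoothFD oU (sf k) IH2) => i C l; apply: Ck_eq (C l) => // y _.
by rewrite big_cons.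
Qed.

(** A compact subset of [U] meets the complement of [U2] in a compact subset of [U1]. This serves
    coefficients extended by zero. *)
Lemma null_local j U U1 U2 f : open U1 -> open U2 -> U `<=` U1 `|` U2 ->
  null j U1 f -> F [set i | forall y, U2 y -> f i y = 0] -> null j U f.
Proof.
move=> o1 o2 U12 N1 Z; elim: j f N1 Z => [|j IH] f N1 Z.
  split=> // K e cK KU e0.
  have cK1 : compact (K `&` ~` U2) by apply: compact_closedI => //; exact: open_closedC.
  have K1 : K `&` ~` U2 `<=` U1 by move=> y [/KU/U12[]].
  apply: filterS2 (null0 N1 cK1 K1 e0) Z => i fK Zi y Ky.
  by have [U2y|nU2] := pselect (U2 y); [rewrite Zi// normr0|exact: fK].
split.
  move=> K e cK KU e0.
  have cK1 : compact (K `&` ~` U2) by apply: compact_closedI => //; exact: open_closedC.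
  have K1 : K `&` ~` U2 `<=` U1 by move=> y [/KU/U12[]].
  apply: filterS2 (null0 N1 cK1 K1 e0) Z => i fK Zi y Ky.
  by have [U2y|nU2] := pselect (U2 y); [rewrite Zi// normr0|exact: fK].
move=> v; apply: IH; first exact: null_derive.
apply: filterS Z => i Zi y U2y; apply: etrans (derive_nearE v o2 U2y Zi) _.
exact: derive_cst.
Qed.

End Def.

Lemma null_comp (V : normedModType R) b j (U : set V) (O : set 'rV[R]_b)
    (f : I -> 'rV[R]_b -> R) (G : V -> 'rV[R]_b) : open U -> open O ->
  (forall y, U y -> O (G y)) -> (forall k, Ck k U G) -> smoothF O f -> null j O f ->
  null j U (fun i y => f i (G y)).
Proof.
move=> oU oO UO CG; have N0 f' : null 0 O f' -> forall (K : set V) (e : R), compact K -> K `<=` U -> 0 < e ->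
     F [set i | forall y, K y -> `|f' i (G y)| < e].
  move=> Nf K e cK KU e0.
  have cGK : compact (G @` K).
    by apply: compact_image cK => y Ky; exact: Ck_continuous (CG 0%N) (KU _ Ky).
  have GKO : G @` K `<=` O by move=> _ [y Ky <-]; apply: UO; exact: KU.
  by apply: filterS (null0 Nf cGK GKO e0) => i fK y Ky; apply: fK; exists y.
elim: j f => [|j IH] f sf Nf; first by split=> //; exact: N0.
split; first by apply: N0; elim: j {IH} f Nf {sf} => [f [+ _]|j IH f /nullW]//; exact: IH.
move=> v.
have CDG c k : Ck k U ('D_v (fun y => G y 0 c)).
  by apply: Ck_derive; exact: (Ck_mx _ _ oU).1 (CG k.+1) _ _.
have sDf c := smoothF_derive (er c) sf.
have sc c : smoothF U (fun i y => 'D_(er c) (f i) (G y)).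
  apply: filterS (sDf c) => i C k.
  exact: (@Ck_comp _ k V b U O ('D_(er c) (f i)) G oU oO UO (C k) (CG k)).
have S c : smoothF U (fun i y => 'D_v (fun y => G y 0 c) y * 'D_(er c) (f i) (G y)).
  by apply: smoothFM.
have N c : null j U (fun i y => 'D_v (fun y => G y 0 c) y * 'D_(er c) (f i) (G y)).
  by apply: nullM => //; exact: (IH (fun i => 'D_(er c) (f i)) (sDf c) (null_derive (er c) Nf)).
have [Ns _] := null_sum (index_enum 'I_b) oU S N.
apply: (null_near oU _ Ns); apply: filterS sf => i Cf y Uy; apply: esym.
exact: (@C1_deriveE_chain _ V b U O (f i) G y v oO (Cf 1%N) (UO _ Uy) (Ck_derivable (CG 1%N) Uy)).
Qed.

Lemma null_rint n j (U : set 'rV[R]_n) (W : set 'rV[R]_(1 + n)) (f : I -> 'rV[R]_(1 + n) -> R) :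
  open U -> open W -> (forall t y, 0 <= t <= 1 -> U y -> W (pr t y)) ->
  smoothF W f -> null j W f -> null j U (fun i y => rint 0 1 (fun t => f i (pr t y))).
Proof.
move=> oU oW UW; have N0 f' : smoothF W f' -> null 0 W f' ->
    forall (K : set 'rV[R]_n) (e : R), compact K -> K `<=` U -> 0 < e ->
    F [set i | forall y, K y -> `|rint 0 1 (fun t => f' i (pr t y))| < e].
  move=> sf Nf K e cK KU e0; have e2 : 0 < e / 2 by rewrite divr_gt0.
  (* All the points at which the integrand is evaluated form one compact subset of [W]. *)
  pose K' := (fun ty : R * 'rV[R]_n => pr ty.1 ty.2) @` (`[0, 1]%classic `*` K).
  have cK' : compact K'.
    apply: compact_image; last by apply: compact_setX => //; exact: segment_compact.
    move=> [t y] [_ Ky] /=; apply/cvgrPdist_lt => /= d d0.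
    exists (ball t d, ball y d); first by split; exact: nbhsx_ballx.
    by move=> [t' y'] [/= tt' yy']; have := pr_ball d0 tt' yy'; rewrite mx_ballE.
  have K'W : K' `<=` W.
    by move=> _ [[t y] [/= + Ky] <-]; rewrite in_itv/= => t01; apply: UW => //; exact: KU.
  apply: filterS2 sf (null0 Nf cK' K'W e2) => i Cf fK y Ky.
  apply: (@le_lt_trans _ _ (e / 2)); last by rewrite ltr_pdivrMr// ltr_pMr// ltr1n.
  rewrite -[leRHS]mulr1 -[X in _ * X](subr0 1).
  apply: rint_norm_le; first exact: ler01.
    exact: (cc_pr UW (Cf 0%N) (KU _ Ky)).
  by move=> t t01; apply/ltW/fK; exists (t, y) => //; split=> //=; rewrite in_itv.
elim: j f => [|j IH] f sf Nf; first by split=> //; exact: N0.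
split; first by apply: N0 => //; elim: j {IH} f Nf {sf} => [f [+ _]|j IH f /nullW]//; exact: IH.
move=> v.
have sDf := smoothF_derive (pr 0 v) sf.
have := IH (fun i => 'D_(pr 0 v) (f i)) sDf (null_derive (pr 0 v) Nf).
apply: (null_near oU); apply: filterS sf => i Cf y Uy; apply: esym.
by have [_] := rint_param_derive oU ltr01 UW v (Cf 1%N) Uy.
Qed.

Lemma null_form n k j (V : normedModType R) (U : set V) (O : set 'rV[R]_n)
    (w : I -> 'rV[R]_n -> 'M[R]_(k, n) -> R) (G : V -> 'rV[R]_n) (M : V -> 'M[R]_(k, n)) :
  open U -> open O -> (forall y, U y -> O (G y)) -> (forall l, Ck l U G) -> (forall l, Ck l U M) ->
  F [set i | fform O (w i)] -> (forall E, null j O (fun i y => w i y E)) ->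
  null j U (fun i y => w i (G y) (M y)).
Proof.
move=> oU oO UO CG CM fw Nw.
have CMrc r c l : Ck l U (fun y => M y r c) by exact: (Ck_mx _ _ oU).1 (CM l) _ _.
have sw E : smoothF O (fun i y => w i y E).
  by apply: filterS fw => i fi l; exact: fform_Ck fi.
have CP (J : {ffun 'I_k -> 'I_n}) l : Ck l U (fun y => \prod_r M y r (J r)).
  by apply: Ck_prod => // r _.
have sJ (J : {ffun 'I_k -> 'I_n}) : smoothF U (fun i y => w i (G y) ((deltaI J : 'M[R]_(k, n)))).
  apply: filterS (sw ((deltaI J : 'M[R]_(k, n)))) => i C l.
  exact: (@Ck_comp _ l V n U O (fun y => w i y ((deltaI J : 'M[R]_(k, n)))) G oU oO UO (C l) (CG l)).
have S (J : {ffun 'I_k -> 'I_n}) : smoothF U (fun i y => \prod_r M y r (J r) * w i (G y) ((deltaI J : 'M[R]_(k, n)))).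
  exact: smoothFM.
have N (J : {ffun 'I_k -> 'I_n}) : null j U (fun i y => \prod_r M y r (J r) * w i (G y) ((deltaI J : 'M[R]_(k, n)))).
  apply: nullM => //.
  exact: (null_comp oU oO UO CG (sw ((deltaI J : 'M[R]_(k, n)))) (Nw ((deltaI J : 'M[R]_(k, n))))).
have [Ns _] := null_sum (index_enum {ffun 'I_k -> 'I_n}) oU S N.
apply: (null_near oU _ Ns); apply: filterS fw => i fi y Uy.
by rewrite [RHS](multilinear_expand _ (fform_ml fi (UO _ Uy))).
Qed.

Lemma null_fpull n b k j (U : set 'rV[R]_n) (O : set 'rV[R]_b) (G : 'rV[R]_n -> 'rV[R]_b)
    (w : I -> 'rV[R]_b -> 'M[R]_(k, b) -> R) E :
  open U -> open O -> (forall y, U y -> O (G y)) -> (forall l, Ck l U G) ->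
  F [set i | fform O (w i)] -> (forall E, null j O (fun i y => w i y E)) ->
  null j U (fun i y => fpull G (w i) y E).
Proof.
move=> oU oO UO CG fw Nw; apply: (null_form oU oO) => // l.
apply: Ck_mulmx => //; first exact: Ck_cst.
by apply/(Ck_mx _ _ oU) => r c; exact: Ck_jacobian.
Qed.

Lemma null_fd n k j (U : set 'rV[R]_n) (w : I -> 'rV[R]_n -> 'M[R]_(k, n) -> R) E :
  open U -> F [set i | fform U (w i)] -> (forall E, null j.+1 U (fun i y => w i y E)) ->
  null j U (fun i y => fd (w i) y E).
Proof.
move=> oU fw Nw.
have sw E' : smoothF U (fun i y => w i y E').
  by apply: filterS fw => i fi l; exact: fform_Ck fi.
have S (r : 'I_k.+1) : smoothF U (fun i y => (-1) ^+ r * 'D_(row r E) (fun z => w i z (row' r E)) y).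
  by apply: smoothFM => // [l|]; [exact: Ck_cst|exact: (smoothF_derive (row r E) (sw (row' r E)))].
have N (r : 'I_k.+1) : null j U (fun i y => (-1) ^+ r * 'D_(row r E) (fun z => w i z (row' r E)) y).
  apply: nullM => // [l| |]; first exact: Ck_cst.
    exact: (smoothF_derive (row r E) (sw (row' r E))).
  exact: (null_derive (row r E) (Nw (row' r E))).
by have [] := null_sum (index_enum 'I_k.+1) oU S N.
Qed.

Lemma null_hop n b k j (U : set 'rV[R]_n) (W : set 'rV[R]_(1 + n)) (O : set 'rV[R]_b)
    (h : 'rV[R]_(1 + n) -> 'rV[R]_b) (w : I -> 'rV[R]_b -> 'M[R]_(1 + k, b) -> R) E :
  open U -> open W -> (forall t y, 0 <= t <= 1 -> U y -> W (pr t y)) ->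
  open O -> (forall z, W z -> O (h z)) -> (forall l, Ck l W h) ->
  F [set i | fform O (w i)] -> (forall E, null j O (fun i y => w i y E)) ->
  null j U (fun i y => hop h (w i) y E).
Proof.
move=> oU oW UW oO WO Ch fw Nw; rewrite /hop /fint.
apply: (@null_rint n j U W (fun i z => fpull h (w i) z (blk E))) => //.
  by apply: filterS fw => i fi l; exact: (fform_Ck l (blk E) (fpull_fform oW oO WO Ch fi)).
exact: (null_fpull (blk E) oW oO WO Ch fw Nw).
Qed.

End NullFamilies.

(** * Continuous operations on currents and compactness of supports *)

Section Currents.
Context {R : realType} {n : nat} {X : manifold R n}.

Local Notation dom p := (cdom (chart_at p)).
Local Notation img p := (cimg (chart_at p)).
Local Notation cm p := (cmap (chart_at p)).
Local Notation ci p := (cinv (chart_at p)).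

Implicit Types p q x : X.

(** Regarding the neighbourhoods of 0 as a filter reduces the continuity of operators on forms to
    the calculus of [null] families. *)
Definition cinf k : set_system (diff_form X k) := fun A => cinfty_nbhs0 A.

Global Instance cinf_filter k : Filter (@cinf k).
Proof.
split.
- exists set0, 1; split=> //; exact: finite_set0.
- move=> A B [LA [dA [fA KA dA0 HA]]] [LB [dB [fB KB dB0 HB]]].
  exists (LA `|` LB), (Num.min dA dB); split.
  + by rewrite finite_setU.
  + by move=> q K vs E [/KA|/KB].
  + by rewrite lt_min dA0.
  + move=> w sw Hw; split; [apply: HA|apply: HB] => // q K vs E L y Ky.
      by have := Hw q K vs E (or_introl L) y Ky; rewrite lt_min => /andP[].
    by have := Hw q K vs E (or_intror L) y Ky; rewrite lt_min => /andP[].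
- move=> A B AB [L [d [fL KL d0 HL]]]; exists L, d; split=> // w sw Hw.
  by apply: AB; exact: HL.
Qed.

Lemma cinf_smooth k : @cinf k [set w | smooth_form w].
Proof. by exists set0, 1; split=> //; exact: finite_set0. Qed.

Lemma cinf_seminorm k q (K : set 'rV[R]_n) vs (E : 'M[R]_(k, n)) e : compact K -> K `<=` img q -> 0 < e ->
  cinf [set w : diff_form X k | forall y, K y -> `|iter_derive vs (fun z => local_form w q z E) y| < e].
Proof.
move=> cK Kq e0; exists [set (q, K, vs, E)], e; split=> //.
  by move=> q' K' vs' E' [-> -> _ _].
by move=> w sw Hw y Ky; exact: Hw.
Qed.

Lemma null_local_form k q (E : 'M[R]_(k, n)) j :
  null (@cinf k) j (img q) (fun w y => local_form w q y E).
Proof.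
by move: j; apply/nullP => vs K e cK KU e0; exact: cinf_seminorm.
Qed.

Lemma cinf_fform k q : cinf [set w : diff_form X k | fform (img q) (local_form w q)].
Proof. by apply: filterS (cinf_smooth k) => w sw; exact: (smooth_formP w).1. Qed.

Definition form_linear k (T : diff_form X k -> R) :=
  forall (a : R) psi eta, smooth_form psi -> smooth_form eta ->
    T (fun x E => a * psi x E + eta x E) = a * T psi + T eta.

Lemma smooth_lin k a (psi eta : diff_form X k) : smooth_form psi -> smooth_form eta ->
  smooth_form (fun x E => a * psi x E + eta x E).
Proof. by move=> sp se; exact: (smooth_fadd (smooth_fsc a sp) se). Qed.

Section FormLinear.
Variables (k : nat) (T : diff_form X k -> R).
Hypothesis lT : form_linear T.

Lemma form_linear0 : T (@fzero R n X k) = 0.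
Proof.
have := lT (-1) (smooth_fzero k) (smooth_fzero k).
rewrite (_ : (fun _ _ => _) = @fzero R n X k); first by rewrite mulN1r addNr.
by apply/funext => x; apply/funext => E; rewrite /fzero; ring.
Qed.

Lemma form_linearD psi eta : smooth_form psi -> smooth_form eta ->
  T (fadd psi eta) = T psi + T eta.
Proof.
move=> sp se; rewrite -[T psi]mul1r -lT//; congr (T _).
by apply/funext => x; apply/funext => E; rewrite mul1r.
Qed.

Lemma form_linearZ a psi : smooth_form psi -> T (fsc a psi) = a * T psi.
Proof.
move=> sp; have := lT a sp (smooth_fzero k); rewrite form_linear0 addr0 => <-.
by congr (T _); apply/funext => x; apply/funext => E; rewrite /fzero addr0.
Qed.

End FormLinear.

Lemma current_linear k (T : diff_form X k -> R) : current T -> form_linear T.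
Proof. by case. Qed.

(** Composition with a continuous linear operator on forms; boundaries, multiplication by functions
    and chart homotopies all act on currents in this way. *)
Lemma current_comp k l (A : diff_form X k -> diff_form X l) (T : diff_form X l -> R) :
  (forall w, smooth_form w -> smooth_form (A w)) ->
  (forall a psi eta, smooth_form psi -> smooth_form eta ->
     A (fun x E => a * psi x E + eta x E) = (fun x E => a * A psi x E + A eta x E)) ->
  (forall q E j, null (@cinf k) j (img q) (fun w y => local_form (A w) q y E)) ->
  current T -> current (fun w => T (A w)).
Proof.
move=> sA lA nA [lT cT]; split=> [a psi eta sp se|e e0].
  by rewrite lA// lT//; exact: sA.
have [L [d [fL KL d0 HL]]] := cT e e0.
have := @filter_finite_set _ _ (@cinf k) _ L (fun c => [set w | forall y, c.1.1.2 y ->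
  `|iter_derive c.1.2 (fun z => local_form (A w) c.1.1.1 z c.2) y| < d]) fL.
case=> [[[[q K] vs] E] /= Lc|L' [d' [fL' KL' d0' HL']]].
  by have [cK Kq] := KL _ _ _ _ Lc; exact: (nullP _ _).1 (nA q E) vs K d cK Kq d0.
exists L', d'; split=> // w sw Hw; apply: HL; first exact: sA.
by move=> q K vs E Lc; exact: (HL' w sw Hw (q, K, vs, E) Lc).
Qed.

Lemma ext_deriv_lin k a (psi eta : diff_form X k) : smooth_form psi -> smooth_form eta ->
  ext_deriv (fun x E => a * psi x E + eta x E) = (fun x E => a * ext_deriv psi x E + ext_deriv eta x E).
Proof.
move=> sp se; apply/funext => x; apply/funext => E.
have ix : img x (cm x x) by apply: cmap_img; exact: mem_chart_at.
rewrite !ext_derivE /fd mulr_sumr -big_split/=; apply: eq_bigr => i _.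
have D (w : diff_form X k) F v : smooth_form w -> derivable (fun y => local_form w x y F) (cm x x) v.
  by move=> /smooth_formP sw; exact: Ck_derivable (fform_Ck 1%N F (sw x)) ix.
have H : 'D_(row i E) (fun y => a * local_form psi x y (row' i E) + local_form eta x y (row' i E)) (cm x x)
  = a * 'D_(row i E) (fun y => local_form psi x y (row' i E)) (cm x x)
    + 'D_(row i E) (fun y => local_form eta x y (row' i E)) (cm x x).
  apply: etrans (deriveD _ _) _; first exact: derivableZ (D psi _ _ sp).
    exact: D.
  by congr (_ + _); exact: deriveZ (D psi _ _ sp).
apply: etrans (f_equal (fun z => (-1) ^+ i * z) H) _.
by rewrite mulrDr mulrCA.
Qed.

Lemma current_boundary k (T : diff_form X k.+1 -> R) : current T -> current (boundary T).
Proof.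
apply: current_comp => [w|a psi eta|q E j]; [exact: smooth_ext_deriv|exact: ext_deriv_lin|].
apply: (@null_near _ _ (@cinf k) _ _ _ _ (fun w y => fd (local_form w q) y E)); first exact: img_open.
  by apply: filterS (cinf_smooth k) => w sw y iy; rewrite local_ext_deriv.
by apply: null_fd; [exact: img_open|exact: cinf_fform|move=> F; exact: null_local_form].
Qed.

Lemma fscale_lin k f a (psi eta : diff_form X k) :
  fscale f (fun x E => a * psi x E + eta x E) = (fun x E => a * fscale f psi x E + fscale f eta x E).
Proof. by apply/funext => x; apply/funext => E; rewrite /fscale; ring. Qed.

Lemma current_fscale k f (T : diff_form X k -> R) : smooth_fun f -> current T ->
  current (fun w => T (fscale f w)).
Proof.
move=> sf; apply: current_comp => [w|a psi eta _ _|q E j]; [exact: smooth_fscale|exact: fscale_lin|].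
apply: nullM; [exact: img_open|exact: (smooth_funP f).1| |exact: null_local_form].
by apply: filterS (cinf_fform k q) => w fw l; exact: fform_Ck fw.
Qed.

Lemma chart_form_lin k p a (u v : 'rV[R]_n -> 'M[R]_(k, n) -> R) :
  chart_form p (fun y E => a * u y E + v y E) = (fun x E => a * chart_form p u x E + chart_form p v x E).
Proof.
apply/funext => x; apply/funext => E; rewrite /chart_form.
by case: (pselect (dom p x)) => dx //=; rewrite mulr0 addr0.
Qed.

Lemma null_chart_form k l p (K : set 'rV[R]_n) (a : diff_form X k -> 'rV[R]_n -> 'M[R]_(l, n) -> R) :
  compact K -> K `<=` img p -> cinf [set w | fform (img p) (a w)] ->
  (forall w y E, img p y -> ~ K y -> a w y E = 0) ->
  (forall E j, null (@cinf k) j (img p) (fun w y => a w y E)) ->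
  forall q E j, null (@cinf k) j (img q) (fun w y => local_form (chart_form p (a w)) q y E).
Proof.
move=> cK Kp fa a0 Na q E j; have [clK Kd] := chart_image_closed cK Kp.
apply: (@null_local _ _ (@cinf k) _ _ _ (img q) (ov q p) [set z | img q z /\ (~` (ci p @` K)) (ci q z)]).
- exact: ov_open.
- by apply: open_preimage; [exact: img_open|exact: cinv_continuous|exact: closed_openC].
- move=> y iy; have [dq|dq] := pselect (dom p (ci q y)); first by left.
  by right; split=> // /Kd.
- apply: (@null_near _ _ (@cinf k) _ _ _ _ (fun w y => fpull (transition q p) (a w) y E)); first exact: ov_open.
    apply: filterS filterT => w _ y oy.
    rewrite (local_form_ov _ _ oy) /fpull local_chart_form//; exact: transition_img.
  apply: (@null_fpull _ _ (@cinf k) _ _ _ _ _ _ (img p)) => //; [exact: ov_open|exact: img_open|exact: transition_img|].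
  by move=> i; exact: Ck_transition.
apply: filterS filterT => w _ y [iy ny].
rewrite /local_form /chart_form; case: pselect => // dz.
by rewrite a0//; [exact: cmap_img|exact: chart_supp_compl ny dz].
Qed.

Lemma current_eval k x (E : 'M[R]_(k, n)) : current (fun w : diff_form X k => w x E).
Proof.
split=> // e e0.
have ix : img x (cm x x) by apply: cmap_img; exact: mem_chart_at.
have ix1 : [set cm x x] `<=` img x by move=> y ->.
apply: filterS (@cinf_seminorm k x [set cm x x] [::] E e (@compact_set1 _ _) ix1 e0) => w /(_ _ erefl).
by rewrite /= local_form_center.
Qed.

(** The finitely many seminorms that control [T] see only the compact set [C]. They vanish on every
    multiple of a form that is zero near [C], and rescaling that form would otherwise bring [T w] to
    absolute value 1. *)
Lemma current_compact_supp k (T : diff_form X k -> R) : current T ->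
  exists2 C : set X, compact C & forall (w : diff_form X k) U, smooth_form w -> open U -> C `<=` U ->
    (forall x E, U x -> w x E = 0) -> T w = 0.
Proof.
move=> cT; have [lT /(_ 1 ltr01)[L [d [fL KL d0 HL]]]] := cT.
have [C cC HC] : exists2 C, compact C & forall q K vs E, L (q, K, vs, E) -> ci q @` K `<=` C.
  have [s Ls] := (@finite_seqP {classic (X * set 'rV[R]_n * seq 'rV[R]_n * 'M[R]_(k, n))%type} L).1 fL.
  have Ls' c : L c -> c \in s by rewrite Ls.
  have {}Ls c : c \in s -> L c by rewrite Ls.
  suff [C cC HC] : exists2 C, compact C & forall c, c \in s -> ci c.1.1.1 @` c.1.1.2 `<=` C.
    by exists C => // q K vs E /Ls'; exact: HC.
  elim: s Ls {Ls'} => [|c s IH] Ls; first by exists set0; [exact: compact0|].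
  have [|C cC HC] := IH; first by move=> c0 cs; apply: Ls; rewrite inE cs orbT.
  have := Ls _ (mem_head _ _); case: c Ls => -[[q K] vs] E Ls Lc.
  have [cK Kq] := KL _ _ _ _ Lc.
  exists (ci q @` K `|` C).
    by apply: compactU => //; apply: compact_image => // y /Kq; exact: cinv_continuous.
  move=> c; rewrite inE => /orP[/eqP->|/HC H]; first by move=> y; left.
  by move=> y /H; right.
exists C => // w U sw oU CU w0.
have Z c q K vs E y : L (q, K, vs, E) -> K y ->
    iter_derive vs (fun z => local_form (fsc c w) q z E) y = 0.
  move=> Lc Ky; have [cK Kq] := KL _ _ _ _ Lc.
  have oO : open [set z | img q z /\ U (ci q z)].
    by apply: open_preimage; [exact: img_open|exact: cinv_continuous|].
  have : [set z | img q z /\ U (ci q z)] y.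
    by split; [exact: Kq|apply: CU; apply: (HC _ _ _ _ Lc); exists y].
  move: y {Ky} => y; elim: vs {Lc} y => [|v vs IH] y Oy.
    by case: Oy => _ Uy; rewrite /= /local_form /fsc w0// mulr0.
  by apply: etrans (derive_nearE v oO Oy IH) _; exact: derive_cst.
apply/eqP/negPn/negP => Tw0.
have := HL (fsc (`|T w|^-1) w) (smooth_fsc _ sw).
rewrite /= (form_linearZ lT)// normrM normfV normr_id mulVf ?normr_eq0// ltxx => H.
suff : false by []. by apply: H => q K vs E y Lc Ky; rewrite (Z _ q K vs E)// normr0.
Qed.

End Currents.

(** * Homotopy operators cut off inside a chart *)

Section ChartHomotopy.
Context {R : realType} {n : nat} {X : manifold R n}.

Local Notation dom p := (cdom (chart_at p)).
Local Notation img p := (cimg (chart_at p)).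
Local Notation cm p := (cmap (chart_at p)).
Local Notation ci p := (cinv (chart_at p)).

(* Data cutting off, inside the chart of [p], the homotopy operator of [h]. *)
Record hop_data (p : X) (h : 'rV[R]_(1 + n) -> 'rV[R]_n) (U : set 'rV[R]_n) (W : set 'rV[R]_(1 + n))
    (s : 'rV[R]_n -> R) (K : set 'rV[R]_n) : Prop := HopData {
  hd_oU : open U;
  hd_oW : open W;
  hd_UW : forall t y, 0 <= t <= 1 -> U y -> W (pr t y);
  hd_WO : forall z, W z -> img p (h z);
  hd_Ch : forall j, Ck j W h;
  hd_Ui : U `<=` img p;
  hd_cK : compact K;
  hd_KU : K `<=` U;
  hd_Cs : forall k, Ck k setT s;
  hd_s0 : forall y, ~ K y -> s y = 0 }.

Definition chop k p h (s : 'rV[R]_n -> R) (w : diff_form X (1 + k)) : diff_form X k :=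
  chart_form p (fun y E => s y * hop h (local_form w p) y E).

Section Data.
Context {p : X} {h : 'rV[R]_(1 + n) -> 'rV[R]_n} {U : set 'rV[R]_n} {W : set 'rV[R]_(1 + n)}.
Context {s : 'rV[R]_n -> R} {K : set 'rV[R]_n}.
Hypothesis H : hop_data p h U W s K.

Lemma chop_fform k (w : diff_form X (1 + k)) : smooth_form w ->
  fform (img p) (fun y E => s y * hop h (local_form w p) y E).
Proof.
case: H => oU oW UW WO Ch Ui cK KU Cs s0 /smooth_formP sw.
have f1 : fform U (fun y E => s y * hop h (local_form w p) y E).
  apply: fform_scale => // [j|]; first by apply: Ck_sub (Cs j).
  exact: (hop_fform oU oW UW (img_open p) WO Ch (sw p)).
have cl : open (~` K) by apply: closed_openC; apply: compact_closed => //; exact: norm_hausdorff.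
split=> [y iy|y iy|E j].
- have [Ky|nK] := pselect (K y); first by exact: (fform_ml f1 (KU _ Ky)).
  by move=> i A B C b c _ _ _; rewrite s0// !mul0r !mulr0 addr0.
- have [Ky|nK] := pselect (K y); first by exact: (fform_alt f1 (KU _ Ky)).
  by move=> E i l _ _; rewrite s0// mul0r.
apply: Ck_local => y iy; have [Ky|nK] := pselect (K y).
  by exists U; split=> //; [exact: KU|exact: (fform_Ck j E f1)].
exists (~` K); split=> //; apply: (@Ck_eq _ _ _ _ _ (fun=> 0)) => //; last exact: Ck_cst.
by move=> z nz; rewrite s0// mul0r.
Qed.

Lemma smooth_chop k (w : diff_form X (1 + k)) : smooth_form w -> smooth_form (chop p h s w).
Proof.
move=> sw; apply: (smooth_chart_form (hd_cK H)) (chop_fform sw) _ => [y Ky|y E iy nK].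
  exact: (hd_Ui H (hd_KU H Ky)).
by rewrite (hd_s0 H)// mul0r.
Qed.

Lemma chop_lin k a (psi eta : diff_form X (1 + k)) : smooth_form psi -> smooth_form eta ->
  chop p h s (fun x E => a * psi x E + eta x E) = (fun x E => a * chop p h s psi x E + chop p h s eta x E).
Proof.
move=> /smooth_formP sp /smooth_formP se; rewrite -chart_form_lin.
apply/funext => x; apply/funext => E; rewrite /chop /chart_form.
case: (pselect (dom p x)) => dx //=; set y := cm p x; set F := _ *m _.
have [Ky|nK] := pselect (K y); last by rewrite (hd_s0 H)// !mul0r mulr0 addr0.
have cch (w : diff_form X (1 + k)) G : (forall q, fform (img q) (local_form w q)) ->
    cc 0 1 (fun t => fpull h (local_form w p) (pr t y) G).
  move=> sw; have fp := fpull_fform (hd_oW H) (img_open p) (hd_WO H) (hd_Ch H) (sw p).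
  by apply: (cc_pr (hd_UW H) (fform_Ck 0%N G fp)); exact: (hd_KU H).
rewrite /hop /fint mulrCA -mulrDr; congr (_ * _).
rewrite -rintZ; last exact: cch.
by rewrite -rintD//; [apply: ccM; [exact: cc_cst|exact: cch]|exact: cch].
Qed.

Lemma current_chop k (S : diff_form X k -> R) : current S -> current (fun w : diff_form X (1 + k) => S (chop p h s w)).
Proof.
apply: current_comp => [w|a psi eta|q E j]; [exact: smooth_chop|exact: chop_lin|].
case: H => oU oW UW WO Ch Ui cK KU Cs s0.
apply: (null_chart_form cK) => [y /KU/Ui//| |w y F iy nK|F i].
- by apply: filterS (cinf_smooth (1 + k)) => w; exact: chop_fform.
- by rewrite s0// mul0r.
have sh : smoothF (@cinf R n X (1 + k)) U (fun w y => hop h (local_form w p) y F).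
  apply: filterS (cinf_fform (1 + k) p) => w fw l.
  exact: (fform_Ck l F (hop_fform oU oW UW (img_open p) WO Ch fw)).
apply: (@null_local _ _ (@cinf R n X (1 + k)) _ _ _ (img p) U (~` K)) => //.
- by apply: closed_openC; apply: compact_closed => //; exact: norm_hausdorff.
- by move=> y iy; have [/KU|] := pselect (K y); [left|right].
- apply: nullM => // [l|]; first by apply: Ck_sub (Cs l).
  apply: (null_hop F oU oW UW (img_open p) WO Ch); first exact: cinf_fform.
  by move=> G; exact: null_local_form.
by apply: filterS filterT => w _ y nK; rewrite s0// mul0r.
Qed.

(** The point is confined to a region where the cut-off [s] is 1, since elsewhere its differential
    would enter. *)
Lemma chop_formula k (w : diff_form X k.+1) (O : set 'rV[R]_n) x E :
  smooth_form w -> open O -> O `<=` U -> (forall y, O y -> s y = 1) -> dom p x -> O (cm p x) ->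
  ext_deriv (@chop k p h s w) x E + @chop k.+1 p h s (ext_deriv w) x E =
  fpull (h \o pr 1) (local_form w p) (cm p x) (E *m jacobian (transition x p) (cm x x)) -
  fpull (h \o pr 0) (local_form w p) (cm p x) (E *m jacobian (transition x p) (cm x x)).
Proof.
move=> sw oO OU s1 dx Ox; have sw' := (smooth_formP w).1 sw.
rewrite (form_local (ext_deriv _) E dx); set y := cm p x; set F := E *m _.
have iy : img p y by exact: cmap_img.
rewrite -(hop_formula (hd_oU H) (hd_oW H) (hd_UW H) (img_open p) (hd_WO H) (hd_Ch H) F (sw' p) (OU _ Ox)).
rewrite local_ext_deriv//; last exact: smooth_chop.
have E1 : fd (local_form (@chop k p h s w) p) y F = fd (hop h (local_form w p)) y F.
  apply: (fd_near _ oO Ox) => z G Oz.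
  by rewrite local_chart_form ?s1 ?mul1r//; exact: (hd_Ui H (OU _ Oz)).
rewrite E1; congr (_ + _); rewrite /chop chart_form_in// s1// mul1r.
apply: eq_rint => t t01; apply: local_ext_deriv => //.
by apply: (hd_WO H); apply: (hd_UW H) => //; exact: OU.
Qed.

End Data.
End ChartHomotopy.

(** * Closed forms from the dual complex of currents *)

Section DeRham.
Context {R : realType} {n : nat} {X : manifold R n}.

Local Notation dom p := (cdom (chart_at p)).
Local Notation img p := (cimg (chart_at p)).
Local Notation cm p := (cmap (chart_at p)).
Local Notation ci p := (cinv (chart_at p)).

Implicit Types p q x : X.

Definition res k (f : X -> R) (T : diff_form X k -> R) : diff_form X k -> R :=
  fun w => T (fscale f w).

(* Linear functionals on currents (no continuity is assumed); smooth forms act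
   by evaluation, and these are the cochains of the dual complex. *)
Definition cochain k (l : (diff_form X k -> R) -> R) :=
  (forall a S T, current S -> current T -> l (fun w => a * S w + T w) = a * l S + l T) /\
  (forall S T, current S -> current T -> eq_current S T -> l S = l T).

(** The germ of the cochain at [x] is zero. As a cochain has no values at points, this is tested on
    currents cut off near [x]. *)
Definition vanish k x (l : (diff_form X k -> R) -> R) :=
  exists2 U, open U /\ U x & forall f T, smooth_fun f -> csupp U f -> current T -> l (res f T) = 0.

Lemma current_res k f (T : diff_form X k -> R) : smooth_fun f -> current T -> current (res f T).
Proof. exact: current_fscale. Qed.

Lemma current_lin k a (S T : diff_form X k -> R) : current S -> current T ->
  current (fun w => a * S w + T w).
Proof.
move=> [lS cS] [lT cT]; split=> [b psi eta sp se|e e0]; first by rewrite lS// lT//; ring.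
have a1 : 0 < `|a| + 1 by rewrite ltr_wpDl.
have e1 : 0 < e / 2 / (`|a| + 1) by rewrite !divr_gt0.
have e2 : 0 < e / 2 by rewrite divr_gt0.
suff : cinf [set w | `|a * S w + T w| < e] by [].
apply: filterS2 (cS _ e1 : cinf _) (cT _ e2 : cinf _) => w /= Sw Tw.
rewrite (le_lt_trans (ler_normD _ _))// [ltRHS]splitr ler_ltD// normrM.
rewrite (@le_trans _ _ ((`|a| + 1) * `|S w|))//; first by rewrite ler_wpM2r// lerDl.
by rewrite mulrC -ler_pdivlMr// ltW.
Qed.

Lemma current0 k : current (fun _ : diff_form X k => 0 : R).
Proof.
split=> [a psi eta _ _|e e0]; first by rewrite mulr0 addr0.
suff : cinf [set _ : diff_form X k | `|0 : R| < e] by [].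
by apply: filterS filterT => w _; rewrite /= normr0.
Qed.

Section Cochain.
Variables (k : nat) (l : (diff_form X k -> R) -> R).
Hypothesis cl : cochain l.

Lemma cochain0 S : current S -> (forall w, smooth_form w -> S w = 0) -> l S = 0.
Proof.
move=> cS S0; have H : eq_current S (fun w => (-1) * S w + S w).
  by move=> w sw; rewrite (S0 w sw) mulr0 addr0.
by rewrite (cl.2 _ _ cS (current_lin (-1) cS cS) H) (cl.1 (-1) S S cS cS) mulN1r addNr.
Qed.

Lemma cochain_res f : smooth_fun f -> cochain (fun T => l (res f T)).
Proof.
move=> sf; split=> [a S T cS cT|S T cS cT ST].
  by rewrite -cl.1//; exact: current_res.
by apply: cl.2; [exact: current_res|exact: current_res|move=> w sw; apply: ST; exact: smooth_fscale].
Qed.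

Lemma cochain_bd : cochain (fun T => l (boundary T)).
Proof.
split=> [a S T cS cT|S T cS cT ST].
  by rewrite -cl.1//; exact: current_boundary.
by apply: cl.2; [exact: current_boundary|exact: current_boundary|move=> w sw; apply: ST; exact: smooth_ext_deriv].
Qed.

Lemma cochain_lin a l' : cochain l' -> cochain (fun T => a * l T + l' T).
Proof.
move=> cl'; split=> [b S T cS cT|S T cS cT ST]; first by rewrite cl.1// cl'.1//; ring.
by rewrite (cl.2 S T)// (cl'.2 S T).
Qed.

End Cochain.

Lemma cochain_form k (w : diff_form X k) : smooth_form w -> cochain (fun T => T w).
Proof. by move=> sw; split=> // S T _ _; apply. Qed.

Lemma cochain_cst0 k : cochain (fun _ : diff_form X k -> R => 0).
Proof. by split=> // a S T _ _; rewrite mulr0 addr0. Qed.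

Lemma csupp_sub (U V : set X) (f : X -> R) : U `<=` V -> csupp U f -> csupp V f.
Proof. by move=> UV [K [cK KU] f0]; exists K => //; split=> //; exact: subset_trans UV. Qed.

Section Vanish.
Variables (k : nat) (x : X).
Implicit Types l : (diff_form X k -> R) -> R.

Lemma vanish_ext l l' : (forall T, current T -> l T = l' T) -> vanish x l -> vanish x l'.
Proof.
move=> ll [U oU lU]; exists U => // f T sf cf cT.
by rewrite -ll ?lU//; exact: current_res.
Qed.

Lemma vanish_lin a l l' : vanish x l -> vanish x l' -> vanish x (fun T => a * l T + l' T).
Proof.
move=> [U [oU Ux] lU] [V [oV Vx] lV]; exists (U `&` V); first by split=> //; exact: openI.
move=> f T sf cf cT; rewrite lU// ?lV// ?mulr0 ?addr0//; apply: csupp_sub cf => y []//.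
Qed.

Lemma vanish0 : vanish x (fun _ : diff_form X k -> R => 0).
Proof. by exists setT => //; split=> //; exact: openT. Qed.

Lemma vanish_mul l f : smooth_fun f -> vanish x l -> vanish x (fun T => l (res f T)).
Proof.
move=> sf [U oU lU]; exists U => // g T sg cg cT.
rewrite -(lU g (res f T))//; last exact: current_res.
congr (l _); apply/funext => w; rewrite /res; congr (T _).
by apply/funext => y; apply/funext => E; rewrite /fscale; ring.
Qed.

Lemma vanish_mul0 l f V : cochain l -> smooth_fun f -> open V -> V x ->
  (forall y, V y -> f y = 0) -> vanish x (fun T => l (res f T)).
Proof.
move=> cl sf oV Vx f0; exists V => // g T sg [C [_ CV] g0] cT.
apply: cochain0 => // [|w sw]; first by do 2 apply: current_res => //.
rewrite /res -(form_linear0 cT.1); congr (T _).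
apply/funext => y; apply/funext => E; rewrite /fscale /fzero.
by have [/CV/f0->|/g0->] := pselect (C y); rewrite !(mul0r, mulr0).
Qed.

(** The test current is evaluation at [x], which a cut-off equal to 1 at [x] leaves unchanged. *)
Lemma vanish_form (w : diff_form X k) E : vanish x (fun T => T w) -> w x E = 0.
Proof.
move=> [U [oU Ux] lU].
have [f [sf _] [[V [_ Vx] fV] cf]] := point_cutoff oU Ux.
by have := lU f _ sf cf (current_eval x E); rewrite /res /fscale fV// mul1r.
Qed.

End Vanish.

Lemma vanish_open k (l : (diff_form X k -> R) -> R) : open [set x | vanish x l].
Proof.
rewrite openE => x [U [oU Ux] lU]; apply: filterS (open_nbhs_nbhs (conj oU Ux)) => y Uy.
by exists U.
Qed.

Lemma ext_deriv_near k (w w' : diff_form X k) U x E : open U -> U x ->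
  (forall y F, U y -> w y F = w' y F) -> ext_deriv w x E = ext_deriv w' x E.
Proof.
move=> oU Ux ww; rewrite !ext_derivE.
have oO : open [set z | img x z /\ U (ci x z)].
  by apply: open_preimage; [exact: img_open|exact: cinv_continuous|].
apply: (fd_near _ oO) => [|z F [iz Uz]]; last exact: ww.
by have dx := mem_chart_at x; split; [exact: cmap_img|rewrite cmapK].
Qed.

(** The boundary of a current cut off by [f] lives on the support of [f], so a further cut-off [g]
    equal to 1 near that support does not change it. *)
Lemma vanish_bd k x (l : (diff_form X k -> R) -> R) : cochain l -> vanish x l ->
  vanish x (fun T => l (boundary T)).
Proof.
move=> cl [U [oU Ux] lU]; exists U => // f T sf [C [cC CU] f0] cT.
have [g [sg _] [[V [oV CV] gV] cg]] := cutoff cC oU CU.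
have cfT := current_res sf cT.
rewrite (cl.2 _ (res g (boundary (res f T)))).
- by apply: lU => //; exact: current_boundary.
- exact: current_boundary.
- by apply: current_res => //; exact: current_boundary.
move=> w sw; rewrite /res /boundary; congr (T _).
apply/funext => y; apply/funext => E; rewrite /fscale.
have [Cy|/f0->] := pselect (C y); last by rewrite !mul0r.
congr (_ * _); apply: (ext_deriv_near _ oV) => [|z F Vz]; first exact: CV.
by rewrite gV// mul1r.
Qed.

(** Finitely many [g], each annihilated by [l], cover the support of [f]. Multiplying a current by
    the product of the [1 - g] leaves [l] unchanged, yet this product kills the current cut off by
    [f]. *)
Lemma vanish_global k (l : (diff_form X k -> R) -> R) V f T : cochain l -> open V ->
  (forall y, V y -> vanish y l) -> smooth_fun f -> csupp V f -> current T -> l (res f T) = 0.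
Proof.
move=> cl oV vl sf [C [cC CV] f0] cT.
have H y : exists gU : (X -> R) * set X, C y ->
    [/\ smooth_fun gU.1, open gU.2 /\ gU.2 y, forall z, gU.2 z -> gU.1 z = 1 &
     forall S, current S -> l (res gU.1 S) = 0].
  have [Cy|nC] := pselect (C y); last by exists (fun=> 0, set0).
  have [U [oU Uy] lU] := vl _ (CV _ Cy).
  have [g [sg _] [[W [oW Wy] gW] cg]] := point_cutoff oU Uy.
  by exists (g, W) => _; split=> // S cS; exact: lU.
have /choice[g Hg] := H.
have [|s [sC cov]] := compact_finite_cover (P := fun x => (g x).2) cC.
  by move=> x /Hg[].
pose P s y := \prod_(x <- s) (1 - (g x).1 y).
suff H2 S : current S -> smooth_fun (P s) /\ l (res (P s) S) = l S.
  have [sP <-] := H2 _ (current_res sf cT).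
  apply: cochain0 => // [|w sw]; first by do 2 apply: current_res => //.
  rewrite /res -(form_linear0 cT.1); congr (T _).
  apply/funext => y; apply/funext => E; rewrite /fscale /fzero.
  have [Cy|/f0->] := pselect (C y); last by rewrite mul0r.
  have [x xs gx] := cov _ Cy; have [_ _ g1 _] := Hg _ (sC _ xs).
  by rewrite /P (big_rem x)//= g1// subrr !mul0r mulr0.
elim: s sC {cov} => [|x s IH] sC cS.
  have -> : P [::] = fun=> 1 by apply/funext => y; rewrite /P big_nil.
  split; first exact: smooth_fun_cst.
  congr (l _); apply/funext => w; rewrite /res; congr (S _).
  by apply/funext => y; apply/funext => E; rewrite /fscale mul1r.
have [|sP lP] := IH _ cS; first by move=> z zs; apply: sC; rewrite inE zs orbT.
have [sg _ _ lg] := Hg _ (sC _ (mem_head _ _)).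
have PE : P (x :: s) = fun y => (1 - (g x).1 y) * P s y.
  by apply/funext => y; rewrite /P big_cons.
have sPx : smooth_fun (P (x :: s)) by rewrite PE; exact: (smooth_funM (smooth_funB1 sg) sP).
split=> //; have cPS := current_res sP cS.
have cgPS := current_res sg cPS.
have HE : eq_current (res (P (x :: s)) S) (fun w => (-1) * res (g x).1 (res (P s) S) w + res (P s) S w).
  move=> w sw; rewrite /res PE -(cS.1 (-1) _ _ (smooth_fscale sP (smooth_fscale sg sw)) (smooth_fscale sP sw)).
  congr (S _); apply/funext => y; apply/funext => E; rewrite /fscale; ring.
rewrite (cl.2 _ _ (current_res sPx cS) (current_lin (-1) cgPS cPS) HE).
by rewrite (cl.1 (-1) _ _ cgPS cPS) lP (lg _ cPS) mulr0 add0r.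
Qed.

(** The coboundary of a cochain of degree [k.-1]. In degree 0 it is zero, there being nothing below,
    which allows statements uniform in the degree. *)
Definition cobp k : ((diff_form X k.-1 -> R) -> R) -> (diff_form X k -> R) -> R :=
  match k return ((diff_form X k.-1 -> R) -> R) -> (diff_form X k -> R) -> R with
  | 0 => fun _ _ => 0
  | k'.+1 => fun v T => v (@boundary _ _ _ k' T)
  end.
Arguments cobp : clear implicits.

Lemma cochain_cobp k v : cochain v -> cochain (cobp k v).
Proof. by case: k v => [|k] v cv; [exact: cochain_cst0|exact: cochain_bd]. Qed.

Lemma vanish_cobp k x v : cochain v -> vanish x v -> vanish x (cobp k v).
Proof. by case: k v => [|k] v cv vv; [exact: vanish0|exact: vanish_bd]. Qed.

Lemma cobp_bd k v T : cochain v -> current T -> cobp k v (boundary T) = 0.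
Proof.
case: k v T => [|k] v T cv cT //=; apply: cochain0 => //.
  by do 2 apply: current_boundary.
move=> w sw; rewrite /boundary -(form_linear0 cT.1); congr (T _).
by apply/funext => y; apply/funext => E; rewrite ext_deriv2.
Qed.

(** Near [A] the cochain is cohomologous to a smooth form. This is the local statement that
    Mayer-Vietoris globalizes. *)
Definition good k (l : (diff_form X k -> R) -> R) (A : set X) :=
  exists c v, [/\ smooth_form c, cochain v &
    forall x, A x -> vanish x (fun T => l T - (T c + cobp k v T))].

(** The coboundary of [l] is allowed to be any smooth form rather than zero: the difference of two
    primitives satisfies just such an equation in the degree below, and the induction on the degree
    needs this generality. *)
Definition rham k := forall l phi (K : set X), cochain l -> smooth_form phi -> compact K ->
  (forall x, K x -> vanish x (fun T : diff_form X k.+1 -> R => l (boundary T) - T phi)) -> good l K.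

(* Two primitives of the same cochain near [K] can be made to agree near [K]
   without changing the cochain they define. *)
Lemma primitive_correct k c1 v1 c2 v2 (K : set X) :
  (if k is k'.+1 then rham k' else True) ->
  smooth_form c1 -> cochain v1 -> smooth_form c2 -> cochain v2 -> compact K ->
  (forall x, K x -> vanish x (fun T => (T c1 + cobp k v1 T) - (T c2 + cobp k v2 T))) ->
  exists c v, [/\ smooth_form c, cochain v,
    forall T, current T -> T c + cobp k v T = T c2 + cobp k v2 T &
    forall x, K x -> vanish x (fun T => T c1 - T c) /\ vanish x (fun S => v1 S - v S)].
Proof.
case: k c1 v1 c2 v2 => [|k] c1 v1 c2 v2 IH s1 cv1 s2 cv2 cK H.
  exists c2, v1; split=> // x Kx; split.
    by apply: vanish_ext (H x Kx) => T _ /=; rewrite !addr0.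
  by apply: vanish_ext (vanish0 _ _) => T _; rewrite subrr.
have sphi := smooth_lin (-1) s2 s1.
have cl := cochain_lin cv1 (-1) cv2.
(* The difference of the two potentials is a cochain of lower degree whose coboundary is, near [K],
   the difference of the two forms. *)
have [|c [v [sc cv vK]]] := IH _ _ K cl sphi cK.
  move=> x Kx; apply: vanish_ext (vanish_lin (-1) (H x Kx) (vanish0 _ _)) => T cT /=.
  rewrite (cT.1 (-1) c2 c1)//; ring.
have sdc := smooth_ext_deriv sc.
(* The differential of [c] is added to the form, and [c] with a coboundary is subtracted from the
   potential. The two changes cancel because [boundary T] applied to [c] is [T] applied to
   [ext_deriv c]. *)
exists (fun x E => 1 * c2 x E + ext_deriv c x E), (fun S => (-1) * (1 * S c + cobp k v S) + v2 S).
have E T : current T -> T (fun x E => 1 * c2 x E + ext_deriv c x E) +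
    ((-1) * (1 * boundary T c + cobp k v (boundary T)) + v2 (boundary T)) = T c2 + v2 (boundary T).
  move=> cT; rewrite cT.1// cobp_bd// /boundary; ring.
have V x : K x -> vanish x (fun S => v1 S - (-1 * (1 * S c + cobp k v S) + v2 S)).
  move=> Kx; apply: vanish_ext (vanish_lin (-1) (vK x Kx) (vanish0 _ _)) => S cS; ring.
split; [exact: (smooth_lin 1 s2 sdc)| |exact: E|].
  exact: (cochain_lin (cochain_lin (cochain_form sc) 1 (cochain_cobp cv)) (-1) cv2).
move=> x Kx; split; last exact: V.
have cw : cochain (fun S => v1 S - (-1 * (1 * S c + cobp k v S) + v2 S)).
  have := cochain_lin (cochain_lin (cochain_lin (cochain_form sc) 1 (cochain_cobp cv)) (-1) cv2) (-1) cv1.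
  by rewrite (_ : (fun _ => _) = (fun S => v1 S - (-1 * (1 * S c + cobp k v S) + v2 S)))//; apply/funext => S; ring.
have := vanish_lin (-1) (vanish_bd cw (V x Kx)) (H x Kx).
apply: vanish_ext => T cT /=; have := E T cT; lra.
Qed.


Lemma res_compl k f (T : diff_form X k -> R) w : smooth_fun f -> current T -> smooth_form w ->
  res (fun x => 1 - f x) T w = (-1) * res f T w + T w.
Proof.
move=> sf cT sw; rewrite /res -(cT.1 (-1) _ _ (smooth_fscale sf sw) sw).
by congr (T _); apply/funext => x; apply/funext => E; rewrite /fscale; ring.
Qed.

Lemma cochain_res_compl k (l : (diff_form X k -> R) -> R) f T : cochain l -> smooth_fun f -> current T ->
  l (res (fun x => 1 - f x) T) = (-1) * l (res f T) + l T.
Proof.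
move=> cl sf cT; have crT := current_res sf cT; rewrite -(cl.1 (-1) _ _ crT cT).
apply: cl.2; [exact: current_res (smooth_funB1 sf) cT|exact: current_lin|].
by move=> w sw; exact: res_compl.
Qed.

(** Mayer-Vietoris: once [primitive_correct] makes the two primitives agree near the intersection,
    both the forms and the potentials are glued by a cut-off. *)
Lemma good_union k l (K L : set X) : (if k is k'.+1 then rham k' else True) ->
  cochain l -> compact K -> compact L -> good (k := k) l K -> good l L -> good l (K `|` L).
Proof.
move=> IH cl cK cL [c1 [v1 [s1 cv1 H1]]] [c2 [v2 [s2 cv2 H2]]].
have hX : hausdorff_space X by exact: mtop_hausdorff.
have clK := compact_closed hX cK; have clL := compact_closed hX cL.
have [||c [v [sc cv E V]]] := @primitive_correct k c1 v1 c2 v2 (K `&` L) IH s1 cv1 s2 cv2.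
- by apply: compact_closedI.
- move=> x [Kx Lx]; apply: vanish_ext (vanish_lin (-1) (H1 x Kx) (H2 x Lx)) => T cT; ring.
have {}H2 x : L x -> vanish x (fun T => l T - (T c + cobp k v T)).
  move=> Lx; apply: vanish_ext (H2 x Lx) => T cT; by rewrite E.
(* On [W] the primitives coincide, so any interpolation is harmless there. The cut-off has only to
   be 1 near the rest of [K] and 0 near the rest of [L], and these are disjoint. *)
pose W := [set x | vanish x (fun T : diff_form X k -> R => T c1 - T c)] `&`
          [set x | vanish x (fun S => v1 S - v S)].
have oW : open W by apply: openI; exact: vanish_open.
have cKW : compact (K `&` ~` W) by apply: compact_closedI => //; exact: open_closedC.
have oLW : open (~` (L `&` ~` W)).
  by apply: closed_openC; apply: closedI => //; exact: open_closedC.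
have [|f [sf _] [[V1 [oV1 KV1] f1] [C [cC CL] f0]]] := cutoff cKW oLW.
  by move=> x [Kx nW] [Lx _]; apply: nW; have [] := V x (conj Kx Lx).
have sg := smooth_funB1 sf.
pose cc := fun x E => 1 * fscale f c1 x E + fscale (fun x => 1 - f x) c x E.
pose vv := fun S : diff_form X k.-1 -> R => 1 * v1 (res f S) + v (res (fun x => 1 - f x) S).
exists cc, vv; split.
- exact: (smooth_lin 1 (smooth_fscale sf s1) (smooth_fscale sg sc)).
- exact: (cochain_lin (cochain_res cv1 sf) 1 (cochain_res cv sg)).
have cd := cochain_lin (cochain_form sc) (-1) (cochain_form s1).
have cw := cochain_lin cv (-1) cv1.
have Wv x : W x -> vanish x (fun T : diff_form X k -> R => (-1) * T c + T c1) /\ vanish x (fun S => (-1) * v S + v1 S).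
  by move=> [Wc Wv]; split; [apply: vanish_ext Wc|apply: vanish_ext Wv] => T _; ring.
have ccE T : current T -> T cc = res f T c1 + ((-1) * res f T c + T c).
  move=> cT; rewrite -(res_compl sf cT sc) -[res f T c1]mul1r.
  exact: (cT.1 1 _ _ (smooth_fscale sf s1) (smooth_fscale sg sc)).
have vvE T : current T -> vv T = v1 (res f T) + ((-1) * v (res f T) + v T).
  by move=> cT; rewrite -(cochain_res_compl cv sf cT) -[v1 _]mul1r.
have cobE T : current T -> cobp k vv T = cobp k v T + cobp k (fun S => (-1) * v (res f S) + v1 (res f S)) T.
  move=> cT; move: vvE; case: (k) (v) (vv) (v1) T cT => [|k'] v0 vv0 v10 T cT vvE /=; first by rewrite addr0.
  rewrite vvE; [ring|exact: current_boundary].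
have cres := cochain_lin (cochain_res cv sf) (-1) (cochain_res cv1 sf).
have cresg := cochain_lin (cochain_res cv sg) (-1) (cochain_res cv1 sg).
have H2' x : L x -> vanish x (fun T => (-1) * res f T c + res f T c1) ->
    vanish x (fun S => (-1) * v (res f S) + v1 (res f S)) ->
    vanish x (fun T => l T - (T cc + cobp k vv T)).
  move=> Lx A B; have := vanish_lin 1 (H2 x Lx) (vanish_lin (-1) A (vanish_lin (-1) (vanish_cobp cres B) (vanish0 _ _))).
  apply: vanish_ext => T cT; rewrite (ccE _ cT) (cobE _ cT); ring.
have H1' x : K x -> vanish x (fun T => (-1) * res (fun x => 1 - f x) T c + res (fun x => 1 - f x) T c1) ->
    vanish x (fun S => (-1) * v (res (fun x => 1 - f x) S) + v1 (res (fun x => 1 - f x) S)) ->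
    vanish x (fun T => l T - (T cc + cobp k vv T)).
  move=> Kx A B.
  have := vanish_lin 1 (H1 x Kx) (vanish_lin 1 A (vanish_lin 1 (vanish_cobp cresg B) (vanish0 _ _))).
  apply: vanish_ext => T cT.
  have -> : cobp k (fun S => (-1) * v (res (fun x => 1 - f x) S) + v1 (res (fun x => 1 - f x) S)) T =
      cobp k v1 T - cobp k v T - cobp k (fun S => (-1) * v (res f S) + v1 (res f S)) T.
    have := cochain_res_compl cv sf; have := cochain_res_compl cv1 sf.
    case: (k) (v) (v1) T cT => [|k'] v0 v10 T cT /= E1 E0; first by ring.
    have cbT := current_boundary cT; rewrite (E1 _ cbT) (E0 _ cbT); ring.
  rewrite (ccE _ cT) (cobE _ cT) (res_compl sf cT sc) (res_compl sf cT s1); ring.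
move=> x [Kx|Lx].
  have [/Wv[A B]|nW] := pselect (W x).
    by apply: H1' => //; [exact: (vanish_mul sg A)|exact: (vanish_mul sg B)].
  have V1x : V1 x by exact: KV1.
  by apply: H1' => //; [apply: (vanish_mul0 cd sg oV1 V1x)|apply: (vanish_mul0 cw sg oV1 V1x)] => y /f1->; rewrite subrr.
have [/Wv[A B]|nW] := pselect (W x).
  by apply: H2' => //; [exact: (vanish_mul sf A)|exact: (vanish_mul sf B)].
have oC : open (~` C) by apply: closed_openC; exact: compact_closed.
have nC : (~` C) x by move=> /CL; apply; split.
by apply: H2' => //; [apply: (vanish_mul0 cd sf oC nC)|apply: (vanish_mul0 cw sf oC nC)] => y /f0.
Qed.

End DeRham.
Arguments cobp {R n X} k v T.

(** For functions the homotopy formula has a single term on the left and is the fundamental theorem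
    along the curve followed by [y]. *)
Lemma hop_formula0 (R : realType) n b (U : set 'rV[R]_n) (W : set 'rV[R]_(1 + n)) (O : set 'rV[R]_b)
    (h : 'rV[R]_(1 + n) -> 'rV[R]_b) (w : 'rV[R]_b -> 'M[R]_(0, b) -> R) y (E : 'M[R]_(0, n)) :
  open U -> open W -> (forall t y, 0 <= t <= 1 -> U y -> W (pr t y)) -> open O ->
  (forall z, W z -> O (h z)) -> (forall j, Ck j W h) -> fform O w -> U y ->
  @hop R n 0 b h (fd w) y E = w (h (pr 1 y)) 0 - w (h (pr 0 y)) 0.
Proof.
move=> oU oW UW oO WO Ch fw Uy.
have fp : fform W (fpull h w) by exact: (fpull_fform oW oO WO Ch fw).
have Cf j : Ck j W (fun z => w (h z) 0).
  by apply: (@Ck_comp _ _ _ _ W O (fun z => w z 0) h) => //; exact: fform_Ck fw.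
pose f z := w (h z) 0.
have E1 t : pr t y = pr 0 y + t *: pr 1 0 :> 'rV[R]_(1 + n).
  by rewrite prZ prD mulr1 add0r scaler0 addr0.
rewrite /hop /fint -[RHS](@rint_FTC _ 0 1 (fun t => 'D_(pr 1 0) f (pr t y)) (fun t => f (pr t y))) //.
- apply: eq_rint => t t01.
  apply: etrans (esym (fd_pull (blk E) oW oO WO (Ch 2) fw (UW _ _ t01 Uy))) _.
  rewrite /fd big_ord1 expr0 mul1r row0_blk.
  apply: (f_equal (fun g => 'D_(pr 1 0) g (pr t y))); apply/funext => z.
  by rewrite [row' _ _]flatmx0 /fpull mul0mx.
- exact: (cc_pr UW (Ck_derive _ (Cf 1%N)) Uy).
move=> t t01.
have -> : (fun t => f (pr t y)) = (fun t => f (pr 0 y + t *: pr 1 0)).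
  by apply/funext => s; rewrite E1.
rewrite (E1 t); apply: is_derive1_dir; rewrite -(E1 t).
exact: Ck_derivable (Cf 1%N) (UW _ _ t01 Uy).
Qed.

(** * Poincare lemma by cones, exhaustion by compact sets and closed representatives *)

Section Rham.
Context {R : realType} {n : nat}.

Definition cone (c : 'rV[R]_n) (z : 'rV[R]_(1 + n)) : 'rV[R]_n := c + z 0 ord0 *: (rsubmx z - c).

Lemma rsubmx_pr t (y : 'rV[R]_n) : rsubmx (pr t y) = y.
Proof. exact: row_mxKr. Qed.

Lemma cone_pr c t y : cone c (pr t y) = c + t *: (y - c).
Proof. by rewrite /cone rsubmx_pr pr0. Qed.

Lemma Ck_cone c j : Ck j setT (cone c).
Proof.
apply/Ck_mx; first exact: openT.
move=> i k; apply: (@Ck_eq _ _ _ _ _ (fun z : 'rV[R]_(1 + n) => c 0 k + z 0 ord0 * (z 0 (rshift 1 k) - c 0 k))).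
- exact: openT.
- by move=> z _; rewrite !mxE !(ord1 i).
apply: CkD; [exact: openT|exact: Ck_cst|apply: CkM; [exact: openT|exact: Ck_coord|]].
by apply: CkB; [exact: openT|exact: Ck_coord|exact: Ck_cst].
Qed.

Lemma jacobian_cst k (c : 'rV[R]_k) (y : 'rV[R]_n) : jacobian (fun=> c) y = 0.
Proof.
apply/matrixP => i j; rewrite (jacobian_coord _ _ openT (Ck_cst 1 setT c) I) mxE.
exact: derive_cst.
Qed.

Context {X : manifold R n}.

Local Notation dom p := (cdom (chart_at p)).
Local Notation img p := (cimg (chart_at p)).
Local Notation cm p := (cmap (chart_at p)).
Local Notation ci p := (cinv (chart_at p)).

Implicit Types p q x : X.

Definition one_form0 : diff_form X 0 := fun _ _ => 1.

Lemma smooth_one_form0 : smooth_form one_form0.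
Proof.
split=> [x i|x E i|q E]; [by case: i|by case: i|].
by apply/smooth_onP => j; exact: Ck_cst.
Qed.

(** Poincare lemma for cochains. The cone contraction gives an operator [A] with dA + Ad = id near
    the centre; by duality [l], on currents cut off there, becomes the form [A phi] plus the
    coboundary of [l] precomposed with [A]. *)
Lemma good_local k l phi x V : cochain l -> smooth_form phi -> open V -> V x ->
  (forall y, V y -> vanish y (fun T : diff_form X k.+1 -> R => l (boundary T) - T phi)) ->
  exists O N, [/\ open O /\ O x, compact N, O `<=` N & good (k := k) l N].
Proof.
move=> cl sphi oV Vx Vl; have xx := mem_chart_at x.
have [c cE] : exists c, c = cm x x by exists (cm x x).
have oV' : open [set y | img x y /\ V (ci x y)].
  by apply: open_preimage; [exact: img_open|exact: cinv_continuous|].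
have Vc : [set y | img x y /\ V (ci x y)] c.
  by rewrite cE; split; [exact: cmap_img|rewrite cmapK].
have [r r0 B] := open_ball oV' Vc.
pose d := r / 3; have d0 : 0 < d by rewrite divr_gt0.
have d2r : 2 * d < r by rewrite /d; lra.
pose U := ball c r; have oU : open U by exact: ball_open.
pose W := [set z | U (cone c z)].
have oW : open W.
  have := @open_preimage _ _ setT (cone c) U openT (fun z _ => Ck_continuous (Ck_cone c 0) I) oU.
  by rewrite (_ : [set z | setT z /\ U (cone c z)] = W)//; apply/seteqP; split=> z //= [].
pose K := [set y : 'rV[R]_n | `|y - c| <= 2 * d].
have cK : compact K by exact: closed_ball_compact.
have KU : K `<=` U by move=> y Ky; rewrite /U mx_ballE distrC (le_lt_trans Ky).
have Uimg : U `<=` img x by move=> y /B[].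
have bK y : ~ K y -> cubebump c d y = 0.
  by move=> nK; apply: bump_0 => //; rewrite leNgt; apply/negP => /ltW.
have Hd : hop_data x (cone c) U W (cubebump c d) K.
  split=> //.
  - move=> t y /andP[t0 t1]; rewrite /W /U !mx_ballE /= cone_pr => yr.
    rewrite mx_ballE opprD addrA subrr add0r normrN normrZ ger0_norm// distrC.
    by apply: le_lt_trans yr; rewrite distrC ler_piMl.
  - by move=> z Wz; exact: Uimg.
  - by move=> j; apply: Ck_sub (Ck_cone c j).
  - by move=> j; exact: Ck_bump.
pose A k := @chop R n X k x (cone c) (cubebump c d).
pose D := [set y : 'rV[R]_n | ball c d y].
have oD : open D by exact: ball_open.
have DU : D `<=` U.
  move=> y; rewrite /D /= /U !mx_ballE => /lt_trans; apply; rewrite /d; lra.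
have D1 y : D y -> cubebump c d y = 1.
  by rewrite /D /= mx_ballE distrC => /ltW yd; exact: bump_1.
have W1 : cone c \o pr 1 = id.
  by apply/funext => y; rewrite /= cone_pr scale1r addrC subrK.
have W0 : cone c \o pr 0 = fun=> c.
  by apply/funext => y; rewrite /= cone_pr scale0r addr0.
pose O := [set z | dom x z /\ D (cm x z)].
have oO : open O by apply: open_preimage; [exact: cdom_open|exact: cmap_continuous|].
have formula j (w : diff_form X j.+1) z E : smooth_form w -> O z ->
    ext_deriv (A j w) z E + A j.+1 (ext_deriv w) z E = w z E.
  move=> sw [dz Dz]; rewrite (chop_formula Hd E sw oD DU D1 dz Dz) W1 W0.
  rewrite /fpull jacobian_id mulmx1 -(form_local w E dz) jacobian_cst mulmx0.
  have ic : img x c by apply: Uimg; exact: ballxx.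
  have -> : local_form w x c 0 = 0.
    apply: (multilinear_row0 (i := ord0)); last exact: row0.
    exact: (fform_ml ((smooth_formP w).1 sw x) ic).
  by rewrite subr0.
have formula0 (w : diff_form X 0) z E : smooth_form w -> O z ->
    A 0%N (ext_deriv w) z E = w z E - w (ci x c) 0.
  move=> sw [dz Dz]; rewrite /A /chop chart_form_in// D1// mul1r.
  have -> : hop (cone c) (local_form (ext_deriv w) x) (cm x z) (E *m jacobian (transition z x) (cm z z)) =
      @hop R n 0 n (cone c) (fd (local_form w x)) (cm x z) (E *m jacobian (transition z x) (cm z z)).
    apply: eq_rint => t t01; apply: local_ext_deriv => //.
    by apply: (hd_WO Hd); apply: (hd_UW Hd) => //; exact: DU.
  rewrite (hop_formula0 _ oU oW (hd_UW Hd) (img_open x) (hd_WO Hd) (hd_Ch Hd) ((smooth_formP w).1 sw x) (DU _ Dz)).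
  have -> : cone c (pr 1 (cm x z)) = cm x z by rewrite cone_pr scale1r addrC subrK.
  have -> : cone c (pr 0 (cm x z)) = c by rewrite cone_pr scale0r addr0.
  congr (_ - _); last exact: (f_equal (w (ci x c)) (flatmx0 (0 *m tangent_coord x c))).
  exact: etrans (f_equal2 w (cmapK dz) (flatmx0 _)) (esym (f_equal (w z) (flatmx0 E))).
pose f2 := chart_fun x (cubebump c d).
have Kimg : K `<=` img x by move=> y /KU/Uimg.
have sf2 : smooth_fun f2.
  apply: smooth_chart_fun cK Kimg _ _ => [j|y _]; last exact: bK.
  by apply: Ck_sub (Ck_bump _ _ _).
pose V2 := [set z | dom x z /\ U (cm x z)].
have oV2 : open V2 by apply: open_preimage; [exact: cdom_open|exact: cmap_continuous|].
have V2V y : V2 y -> V y by move=> [dy /B[_]]; rewrite cmapK.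
have cf2 : csupp V2 f2.
  exists (ci x @` K).
    split; first by apply: compact_image => // y /Kimg; exact: cinv_continuous.
    by move=> _ [y Ky <-]; have iy := Kimg _ Ky; split; [exact: cinv_dom|rewrite cinvK//; exact: KU].
  move=> y ny; rewrite /f2 /chart_fun; case: pselect => // dy.
  by rewrite bK//; exact: chart_supp_compl ny dy.
(* Segments towards the centre stay in the ball where [f2] is 1, so inserting [f2] before
   contracting changes nothing. *)
have locA j (w : diff_form X (1 + j)) f : csupp O f ->
    fscale f (A j (fscale f2 w)) = fscale f (A j w).
  move=> [C [_ CO] f0]; apply/funext => z; apply/funext => E; rewrite /fscale.
  have [/CO[dz Dz]|/f0->] := pselect (C z); last by rewrite !mul0r.
  congr (_ * _); rewrite /A /chop !chart_form_in//; congr (_ * _).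
  apply: eq_rint => t t01; rewrite /fpull /local_form.
  have iz : img x (cone c (pr t (cm x z))).
    by apply: (hd_WO Hd); apply: (hd_UW Hd) => //; exact: DU.
  rewrite /f2 chart_fun_in; last exact: cinv_dom.
  rewrite cinvK// bump_1 ?mul1r// cone_pr addrAC subrr add0r normrZ.
  move: Dz t01; rewrite /D /= mx_ballE distrC => /ltW yd /andP[t0 t1].
  by rewrite ger0_norm// (le_trans _ yd)// ler_piMl.
have cob : cochain (fun T : diff_form X k.+1 -> R => (-1) * T phi + l (boundary T)).
  exact: (@cochain_lin R n X k.+1 (fun T => T phi) (cochain_form sphi) (-1) (fun T => l (boundary T)) (cochain_bd cl)).
(* The equation for [l] is only local. By [locA] the contracted current is unchanged when cut off by
   [f2], so [vanish_global] makes the equation valid for it. *)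
have key T f : current T -> smooth_fun f -> csupp O f ->
    l (boundary (fun w : diff_form X k.+1 => res f T (A k w))) = res f T (A k phi).
  move=> cT sf cf; have crT := current_res sf cT; have cA := current_chop Hd crT.
  have E0 : eq_current (fun w : diff_form X k.+1 => res f T (A k w)) (res f2 (fun w : diff_form X k.+1 => res f T (A k w))).
    by move=> w sw; rewrite /res locA.
  have HV y : V2 y -> vanish y (fun T : diff_form X k.+1 -> R => (-1) * T phi + l (boundary T)).
    by move=> /V2V/Vl; apply: vanish_ext => S cS; rewrite mulN1r addrC.
  have Z := vanish_global cob oV2 HV sf2 cf2 cA.
  rewrite -(cob.2 _ _ cA (current_res sf2 cA) E0) in Z.
  by apply/eqP; rewrite -subr_eq0 addrC -mulN1r; apply/eqP.
have oOx : O x by split=> //; rewrite -cE; exact: ballxx.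
pose N := [set z | dom x z /\ `|cm x z - c| <= d / 2].
pose K2 := [set y : 'rV[R]_n | `|y - c| <= d / 2].
have K2D : K2 `<=` D.
  move=> y; rewrite /K2 /D /= mx_ballE distrC => /le_lt_trans; apply.
  by rewrite ltr_pdivrMr// ltr_pMr// ltr1n.
have K2img : K2 `<=` img x by move=> y /K2D/DU/Uimg.
have cK2 : compact K2 by exact: closed_ball_compact.
exists [set z | dom x z /\ ball c (d / 2) (cm x z)], (ci x @` K2); split.
- split; first by apply: open_preimage; [exact: cdom_open|exact: cmap_continuous|exact: ball_open].
  by split=> //; rewrite -cE; apply: ballxx; rewrite divr_gt0.
- by apply: compact_image => // y /K2img; exact: cinv_continuous.
- move=> z [dz]; rewrite mx_ballE distrC => /ltW zd; exists (cm x z) => //; exact: cmapK.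
have sAphi := smooth_chop Hd sphi.
have NO y : (ci x @` K2) y -> O y.
  by move=> [z Kz <-]; have iz := K2img _ Kz; split; [exact: cinv_dom|rewrite cinvK//; exact: K2D].
case: k l phi cl sphi Vl cob key sAphi => [|k] l phi cl sphi Vl cob key sAphi.
  have ce := @current_eval R n X 0 (ci x c) 0.
  (* In degree 0 the contraction leaves the value at the centre of the cone; evaluation there
     contributes the constant function [b]. *)
  pose b := l (fun w : diff_form X 0 => w (ci x c) 0).
  exists (fun x E => b * one_form0 x E + A 0%N phi x E), (fun=> 0); split.
  - exact: smooth_lin smooth_one_form0 sAphi.
  - exact: cochain_cst0.
  move=> y /NO Oy; exists O => // f T sf cf cT /=; have crT := current_res sf cT.
  have cH := current_boundary (current_chop Hd crT).
  rewrite addr0 (crT.1 b _ _ smooth_one_form0 sAphi) -(key T f cT sf cf).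
  have HE : eq_current (res f T) (fun w => res f T one_form0 * w (ci x c) 0 +
      boundary (fun w : diff_form X 1 => res f T (A 0%N w)) w).
    move=> w sw; have -> : res f T one_form0 * w (ci x c) 0 = res f T (fsc (w (ci x c) 0) one_form0).
      by rewrite (form_linearZ crT.1 _ smooth_one_form0) mulrC.
    rewrite /boundary -(form_linearD crT.1 (smooth_fsc _ smooth_one_form0)); last first.
      exact: (smooth_chop Hd (smooth_ext_deriv sw)).
    rewrite /res; congr (T _); apply/funext => z; apply/funext => E; rewrite /fscale.
    case: cf => C [_ CO] f0; have [/CO Oz|/f0->] := pselect (C z); last by rewrite !mul0r.
    by rewrite /fadd /fsc formula0// /one_form0 mulr1 addrC subrK.
  rewrite (cl.2 _ _ crT (current_lin _ ce cH) HE) (cl.1 _ _ _ ce cH) -/b; ring.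
pose v (S : diff_form X k -> R) := l (fun w : diff_form X k.+1 => S (A k w)).
exists (A k.+1 phi), v; split=> //.
- split=> [a S T cS cT|S T cS cT ST]; rewrite /v.
    exact: (cl.1 a _ _ (current_chop Hd cS) (current_chop Hd cT)).
  apply: (cl.2 _ _ (current_chop Hd cS) (current_chop Hd cT)) => w sw.
  by apply: ST; exact: (smooth_chop Hd sw).
move=> y /NO Oy; exists O => // f T sf cf cT /=; have crT := current_res sf cT.
have cb := current_boundary crT.
have c1 := current_chop Hd cb.
have c2 := current_boundary (current_chop Hd crT).
have HE : eq_current (res f T) (fun w => 1 * boundary (res f T) (A k w) +
    boundary (fun w : diff_form X k.+2 => res f T (A k.+1 w)) w).
  move=> w sw; rewrite mul1r /boundary.
  have s1 := smooth_ext_deriv (smooth_chop Hd sw); have s2 := smooth_chop Hd (smooth_ext_deriv sw).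
  rewrite -(form_linearD crT.1 s1 s2).
  rewrite /res; congr (T _); apply/funext => z; apply/funext => E; rewrite /fscale.
  case: cf => C [_ CO] f0; have [/CO Oz|/f0->] := pselect (C z); last by rewrite !mul0r.
  by rewrite /fadd formula.
rewrite (cl.2 _ _ crT (current_lin 1 c1 c2) HE) (cl.1 1 _ _ c1 c2) -(key T f cT sf cf) /v; ring.
Qed.

Lemma good_sub k l (A B : set X) : B `<=` A -> good (k := k) l A -> good l B.
Proof. by move=> BA [c [v [sc cv H]]]; exists c, v; split=> // x /BA; exact: H. Qed.

Lemma rham_step k : (if k is k'.+1 then @rham R n X k' else True) -> @rham R n X k.
Proof.
move=> IH l phi K cl sphi cK Kl.
pose V := [set y | vanish y (fun T : diff_form X k.+1 -> R => l (boundary T) - T phi)].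
have H x : exists ON : set X * set X, K x ->
    [/\ open ON.1 /\ ON.1 x, compact ON.2, ON.1 `<=` ON.2 & good (k := k) l ON.2].
  have [Kx|nK] := pselect (K x); last by exists (set0, set0).
  have HG := @good_local k l phi x V cl sphi (vanish_open _) (Kl x Kx) (fun y Vy => Vy).
  have [Q [Nq HON]] := HG.
  by exists (Q, Nq).
have /choice[ON HON] := H.
have [|s [sK cov]] := compact_finite_cover (P := fun x => (ON x).1) cK.
  by move=> x /HON[].
suff [_ G] : compact [set y | exists2 x, x \in s & (ON x).2 y] /\ good l [set y | exists2 x, x \in s & (ON x).2 y].
  apply: good_sub G => y /cov[x xs Oy]; exists x => //.
  by have [_ _ ON12 _] := HON x (sK x xs); exact: ON12.
elim: s sK {cov} => [|x s IHs] sK.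
  have -> : [set y | exists2 x, x \in [::] & (ON x).2 y] = set0 by apply/seteqP; split=> // y [].
  split; first exact: compact0.
  exists (@fzero R n X k), (fun=> 0); split=> //; [exact: smooth_fzero|exact: cochain_cst0].
have [|c G] := IHs; first by move=> y ys; apply: sK; rewrite inE ys orbT.
have [_ cN _ GN] := HON x (sK x (mem_head _ _)).
have -> : [set y | exists2 z, z \in x :: s & (ON z).2 y] = (ON x).2 `|` [set y | exists2 x, x \in s & (ON x).2 y].
  apply/seteqP; split => y.
    by move=> [z]; rewrite inE => /orP[/eqP->|zs] Kz; [left|right; exists z].
  by move=> [Kx|[z zs Kz]]; [exists x; rewrite ?mem_head|exists z; rewrite ?inE ?zs ?orbT].
by split; [exact: compactU|exact: good_union].
Qed.

Lemma rhamP k : @rham R n X k.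
Proof. by elim: k => [|k IH]; exact: rham_step. Qed.

(** Of a countable base only the members contained in a compact set are kept; closed balls in charts
    show that these still cover. Unions of the first ones give the exhaustion. *)
Lemma exhaustion : exists K U : nat -> set X,
  (forall j, [/\ compact (K j), open (U j), U j `<=` K j, K j `<=` K j.+1 & U j `<=` U j.+1]) /\
  (forall x, exists j, U j x).
Proof.
have [B cB [oB HB]] := mtop_second_countable X.
have /countable_injP[f fI] := cB.
pose B' := [set b | B b /\ exists2 K, compact K & b `<=` K].
have H i : exists bK : set X * set X, [/\ open bK.1, compact bK.2, bK.1 `<=` bK.2 &
    forall b, B' b -> f b = i -> b = bK.1].
  have [[b [[Bb [K cK bK]] fb]]|nb] := pselect (exists b, B' b /\ f b = i).
    exists (b, K); split=> //; first exact: oB.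
    by move=> b' [Bb' _] fb'; apply: fI; rewrite ?inE// fb'.
  by exists (set0, set0); split=> //; [exact: open0|exact: compact0|move=> b Bb fb; exfalso; apply: nb; exists b].
have /choice[bK HbK] := H.
exists (fun j => [set x | exists2 i, (i <= j)%N & (bK i).2 x]), (fun j => [set x | exists2 i, (i <= j)%N & (bK i).1 x]).
split=> [j|x].
  split.
  - elim: j => [|j IH].
      rewrite (_ : [set x | _] = (bK 0%N).2); first by case: (HbK 0%N).
      by apply/seteqP; split=> x; [move=> [i]; rewrite leqn0 => /eqP->|exists 0%N].
    rewrite (_ : [set x | _] = (bK j.+1).2 `|` [set x | exists2 i, (i <= j)%N & (bK i).2 x]).
      by apply: compactU => //; case: (HbK j.+1).
    apply/seteqP; split=> x.
      by move=> [i]; rewrite leq_eqVlt => /orP[/eqP->|ij] Kx; [left|right; exists i].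
    by move=> [Kx|[i ij Kx]]; [exists j.+1|exists i => //; exact: leqW].
  - rewrite (_ : [set x | _] = \bigcup_(i in [set i | (i <= j)%N]) (bK i).1); last first.
      by apply/seteqP; split=> x [i ij ?]; exists i.
    by apply: bigcup_open => i _; case: (HbK i).
  - by move=> x [i ij bx]; exists i => //; case: (HbK i) => _ _ + _; apply.
  - by move=> x [i ij bx]; exists i => //; exact: leqW.
  - by move=> x [i ij bx]; exists i => //; exact: leqW.
have xx := mem_chart_at x.
have ix : img x (cm x x) by exact: cmap_img.
have [r r0 Br] := open_ball (img_open x) ix.
pose K2 := [set y : 'rV[R]_n | `|y - cm x x| <= r / 2].
have K2img : K2 `<=` img x.
  move=> y /= yr; apply: Br; by rewrite mx_ballE distrC (le_lt_trans yr)// ltr_pdivrMr// ltr_pMr// ltr1n.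
pose O := [set z | dom x z /\ ball (cm x x) (r / 2) (cm x z)].
have oO : open O by apply: open_preimage; [exact: cdom_open|exact: cmap_continuous|exact: ball_open].
have Ox : O x by split=> //; apply: ballxx; rewrite divr_gt0.
have [b [Bb bx] bO] := HB x O (open_nbhs_nbhs (conj oO Ox)).
have B'b : B' b.
  split=> //; exists (ci x @` K2).
    by apply: compact_image; [move=> y /K2img; exact: cinv_continuous|exact: closed_ball_compact].
  move=> z /bO[dz]; rewrite mx_ballE distrC => /ltW zd; exists (cm x z) => //; exact: cmapK.
by exists (f b), (f b) => //; have [_ _ _ bE] := HbK (f b); rewrite -(bE b B'b erefl).
Qed.

(* Cocycles of the dual complex are given by closed forms, on cycles. *)
Theorem dual_closed_form k (l : (diff_form X k.+1 -> R) -> R) : cochain l ->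
  (forall S, current S -> l (boundary S) = 0) ->
  exists phi : diff_form X k.+1, [/\ smooth_form phi, forall x E, ext_deriv phi x E = 0 &
    forall T, current T -> (forall w, smooth_form w -> boundary T w = 0) -> l T = T phi].
Proof.
move=> cl l0; have [K [U [HKU cov]]] := exhaustion.
have K0 j : forall x, K j x -> vanish x (fun T : diff_form X k.+2 -> R => l (boundary T) - T (@fzero R n X k.+2)).
  move=> x _; apply: vanish_ext (vanish0 _ _) => T cT.
  by rewrite l0// (form_linear0 cT.1) subr0.
have cK j : compact (K j) by case: (HKU j).
pose P j (cv : diff_form X k.+1 * ((diff_form X k -> R) -> R)) :=
  [/\ smooth_form cv.1, cochain cv.2 & forall x, K j x -> vanish x (fun T => l T - (T cv.1 + cobp k.+1 cv.2 T))].
have P0 : exists cv, P 0%N cv.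
  have [c [v Hcv]] := rhamP cl (smooth_fzero _) (cK 0%N) (K0 0%N); by exists (c, v).
(* A primitive over the next compact set is corrected so that its form agrees with the previous one
   near [K j]; the forms then stabilize on each [U j]. *)
have PS j cv : exists cv', P j cv -> P j.+1 cv' /\ forall x, K j x -> vanish x (fun T => T cv.1 - T cv'.1).
  have [Pj|] := pselect (P j cv); last by exists cv.
  have [c2 [v2 [s2 cv2 H2]]] := rhamP cl (smooth_fzero _) (cK j.+1) (K0 j.+1).
  case: cv Pj => c1 v1 [/= s1 cv1 H1].
  have [|c [v [sc cv E V]]] := @primitive_correct R n X k.+1 c1 v1 c2 v2 (K j) (@rhamP k) s1 cv1 s2 cv2 (cK j).
    move=> x Kx; have [_ _ _ KK _] := HKU j.
    by apply: vanish_ext (vanish_lin (-1) (H1 x Kx) (H2 x (KK _ Kx))) => T cT /=; ring.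
  exists (c, v) => _; split; last by move=> x /V[].
  split=> // x Kx; apply: vanish_ext (H2 x Kx) => T cT; by rewrite E.
have [cv0 Pcv0] := P0.
have /choice[F HF] : forall jcv : nat * (diff_form X k.+1 * ((diff_form X k -> R) -> R)),
    exists cv', P jcv.1 jcv.2 -> P jcv.1.+1 cv' /\ forall x, K jcv.1 x -> vanish x (fun T => T jcv.2.1 - T cv'.1).
  by move=> [j cv]; exact: PS.
pose G := fix G j := if j is j'.+1 then F (j', G j') else cv0.
have PG j : P j (G j) by elim: j => [//|j IH]; exact: (HF (j, G j) IH).1.
have GS j x E : K j x -> (G j.+1).1 x E = (G j).1 x E.
  move=> Kx; have := (HF (j, G j) (PG j)).2 x Kx.
  have [s1 _ _] := PG j; have [s2 _ _] := PG j.+1.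
  move=> V; have := @vanish_form _ _ _ _ x (fun x E => (-1) * (G j.+1).1 x E + (G j).1 x E) E.
  move=> /(_ _)/eqP; rewrite mulN1r addrC subr_eq0 => H; apply/esym/eqP/H.
  by apply: vanish_ext V => T cT; rewrite (cT.1 (-1) _ _ s2 s1) /=; ring.
clearbody G.
have UK j : U j `<=` K j by case: (HKU j).
have Gm i j x E : (i <= j)%N -> U i x -> (G j).1 x E = (G i).1 x E.
  move=> + Ux; elim: j => [|j IH]; first by rewrite leqn0 => /eqP->.
  rewrite leq_eqVlt => /orP[/eqP->//|ij]; rewrite GS ?IH//.
  by elim: j ij {IH} => [|j IHj]; [rewrite ltnS leqn0 => /eqP<-; exact: UK|
    rewrite ltnS leq_eqVlt => /orP[/eqP<-|/IHj]; [exact: UK|by case: (HKU j) => _ _ _ + _; apply]].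
have /choice[J HJ] := cov.
pose phi : diff_form X k.+1 := fun x E => (G (J x)).1 x E.
have phiE j x E : U j x -> phi x E = (G j).1 x E.
  move=> Ux; rewrite /phi; have [ij|/ltnW ij] := leqP (J x) j.
    by rewrite (Gm _ _ _ _ ij (HJ x)).
  by rewrite (Gm _ _ _ _ ij Ux).
clearbody phi.
have oU j : open (U j) by case: (HKU j).
have sphi : smooth_form phi.
  apply/smooth_formP => q; split=> [y iy|y iy|E i].
  - have [j Uj] := cov (ci q y); have [s1 _ _] := PG j.
    have -> : local_form phi q y = local_form (G j).1 q y by apply/funext => E; exact: phiE.
    exact: (fform_ml ((smooth_formP _).1 s1 q) iy).
  - have [j Uj] := cov (ci q y); have [s1 _ _] := PG j.
    have -> : local_form phi q y = local_form (G j).1 q y by apply/funext => E; exact: phiE.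
    exact: (fform_alt ((smooth_formP _).1 s1 q) iy).
  apply: Ck_local => y iy; have [j Uj] := cov (ci q y); have [s1 _ _] := PG j.
  have oO : open [set z | img q z /\ U j (ci q z)].
    by apply: open_preimage; [exact: img_open|exact: cinv_continuous|].
  exists [set z | img q z /\ U j (ci q z)]; split=> //.
  apply: (@Ck_eq _ _ _ _ _ (fun z => local_form (G j).1 q z E)) => //; first by move=> z [_ Uz]; rewrite /local_form (phiE j).
  by apply: Ck_sub (fform_Ck i E ((smooth_formP _).1 s1 q)) => z [].
exists phi; split=> //.
  (* Near [x] the form differs from [l] by a coboundary. Since [l] kills boundaries, so does the
     form near [x], and testing on an evaluation current gives closedness. *)
  move=> x E; have [j Uj] := cov x; have [s1 c1 H1] := PG j.
  rewrite (ext_deriv_near E (oU j) Uj (phiE j)); apply: vanish_form.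
  have cd : cochain (fun T : diff_form X k.+1 -> R => (-1) * (T (G j).1 + cobp k.+1 (G j).2 T) + l T).
    have := cochain_lin (cochain_lin (cochain_form s1) 1 (cochain_cobp (k := k.+1) c1)) (-1) cl.
    by rewrite (_ : (fun _ => _) = (fun T => (-1) * (T (G j).1 + cobp k.+1 (G j).2 T) + l T))//; apply/funext => T; rewrite mul1r.
  have V : vanish x (fun T : diff_form X k.+1 -> R => (-1) * (T (G j).1 + cobp k.+1 (G j).2 T) + l T).
    by apply: vanish_ext (H1 x (UK _ _ Uj)) => T cT; ring.
  apply: vanish_ext (vanish_lin (-1) (vanish_bd cd V) (vanish0 _ _)) => T cT.
  by rewrite l0// (cobp_bd (k := k.+1))// /boundary; ring.
(* A single current lives in some [U j], where [l] is the form plus the coboundary of a potential,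
   and that coboundary vanishes on a cycle. *)
move=> T cT T0; have [C cC HC] := current_compact_supp cT.
have [j CU] : exists j, C `<=` U j.
  have [|s [_ scov]] := compact_finite_cover (P := fun x => U (J x)) cC.
    by move=> x _; split; [exact: oU|exact: HJ].
  exists (\max_(x <- s) J x) => x Cx; have [y ys Uy] := scov x Cx.
  have : (J y <= \max_(x <- s) J x)%N by exact: leq_bigmax_seq.
  elim: (\max_(x <- s) J x) => [|i IH]; first by rewrite leqn0 => /eqP Jy; rewrite Jy in Uy.
  by rewrite leq_eqVlt => /orP[/eqP<-//|/IH]; case: (HKU i) => _ _ _ _; apply.
have [f [sf _] [[V [oV CV] f1] cf]] := cutoff cC (oU j) CU.
have TE w : smooth_form w -> T w = res f T w.
  move=> sw; apply/eqP; rewrite -subr_eq0 addrC -mulN1r /res.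
  rewrite -(cT.1 (-1) _ _ (smooth_fscale sf sw) sw); apply/eqP.
  have Z x E : V x -> (-1) * fscale f w x E + w x E = 0.
    by move=> Vx; rewrite /fscale f1// mul1r mulN1r addNr.
  exact: (HC _ V (smooth_lin (-1) (smooth_fscale sf sw) sw) oV CV Z).
have [s1 c1 H1] := PG j; have crT := current_res sf cT.
have cd : cochain (fun T : diff_form X k.+1 -> R => (-1) * (T (G j).1 + cobp k.+1 (G j).2 T) + l T).
  have := cochain_lin (cochain_lin (cochain_form s1) 1 (cochain_cobp (k := k.+1) c1)) (-1) cl.
  by rewrite (_ : (fun _ => _) = (fun T => (-1) * (T (G j).1 + cobp k.+1 (G j).2 T) + l T))//; apply/funext => S; rewrite mul1r.
have : (-1) * (T (G j).1 + cobp k.+1 (G j).2 T) + l T = 0.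
  rewrite (cd.2 T (res f T))//; apply: (vanish_global cd (oU j)) => // x Ux.
  by apply: vanish_ext (H1 x (UK _ _ Ux)) => S cS; ring.
have -> : cobp k.+1 (G j).2 T = 0 := cochain0 c1 (current_boundary cT) T0.
have -> : T phi = T (G j).1.
  rewrite (TE _ sphi) (TE _ s1) /res; congr (T _); apply/funext => x; apply/funext => E.
  rewrite /fscale; case: cf => C' [_ CU'] f0.
  by have [/CU'/phiE->//|/f0->] := pselect (C' x); rewrite !mul0r.
lra.
Qed.

End Rham.

(** By Zorn's lemma there is a maximal subspace containing [W] and missing [v]; it has codimension
    one, and [L] reads off the coefficient of [v]. Stating the predicate for the union with [W]
    takes care of the empty chain. *)
Lemma separation (R : realType) (T : Type) (W : set (T -> R)) (v : T -> R) :
  W (fun=> 0) -> (forall a u w, W u -> W w -> W (fun t => a * u t + w t)) -> ~ W v ->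
  exists L : (T -> R) -> R, [/\ forall a u w, L (fun t => a * u t + w t) = a * L u + L w,
    forall w, W w -> L w = 0 & L v = 1].
Proof.
move=> W0 Wl nWv.
pose sub (A : set (T -> R)) := forall a u w, A u -> A w -> A (fun t => a * u t + w t).
pose P A := sub (A `|` W) /\ ~ (A `|` W) v.
have [A [[Al nAv] Amax]] : exists A, P A /\ forall B, A `<` B -> ~ P B.
  apply: Zorn_bigcup => F FP Ft; split.
    move=> a u w [[A FA Au]|Wu] [[B FB Bw]|Ww].
    - have [AB|BA] := Ft _ _ FA FB.
        by have [|] := (FP _ FB).1 a u w (or_introl (AB _ Au)) (or_introl Bw); [left; exists B|right].
      by have [|] := (FP _ FA).1 a u w (or_introl Au) (or_introl (BA _ Bw)); [left; exists A|right].
    - by have [|] := (FP _ FA).1 a u w (or_introl Au) (or_intror Ww); [left; exists A|right].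
    - by have [|] := (FP _ FB).1 a u w (or_intror Wu) (or_introl Bw); [left; exists B|right].
    - by right; exact: Wl.
  by move=> [[B FB Bv]|//]; case: (FP _ FB) => _; apply; left.
set B := A `|` W in Al nAv.
have B0 : B (fun=> 0) by right.
have Bz a u : B u -> B (fun t => a * u t).
  move=> Bu; have := Al a u _ Bu B0; congr B.
  by apply/funext => t; rewrite addr0.
have H u : exists c, B (fun t => u t - c * v t).
  have [Bu|nBu] := pselect (B u).
    by exists 0; move: Bu; congr B; apply/funext => t; rewrite mul0r subr0.
  pose A' := [set w | exists b z, B z /\ w = (fun t => b * u t + z t)].
  have AA' : A `<` A'.
    split; first by move=> w Aw; exists 0, w; split; [left|apply/funext => t; rewrite mul0r add0r].
    move=> /(_ u) A'A; apply: nBu; left; apply: A'A.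
    by exists 1, (fun=> 0); split=> //; apply/funext => t; rewrite mul1r addr0.
  have WA' : A' `|` W = A'.
    apply/seteqP; split=> [w [//|Ww]|w]; last by left.
    by exists 0, w; split; [right|apply/funext => t; rewrite mul0r add0r].
  have : ~ P A' by exact: Amax.
  rewrite /P WA' => nP; have [[b [z [Bz' vE]]]|nA'] := pselect (A' v); last first.
    exfalso; apply: nP; split=> // a w1 w2 [b1 [z1 [Bz1 ->]]] [b2 [z2 [Bz2 ->]]].
    exists (a * b1 + b2), (fun t => a * z1 t + z2 t); split; first exact: Al.
    by apply/funext => t; ring.
  have b0 : b != 0.
    apply/eqP => b0; apply: nAv; move: Bz'; congr B; rewrite vE; apply/funext => t.
    by rewrite b0 mul0r add0r.
  exists b^-1; have := Bz (- b^-1) z Bz'; congr B; rewrite vE; apply/funext => t.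
  by rewrite mulrDr mulKf// opprD addrA subrr add0r mulNr.
have uniq u c d : B (fun t => u t - c * v t) -> B (fun t => u t - d * v t) -> c = d.
  move=> Bc Bd; apply/eqP/negPn/negP => cd; apply: nAv.
  have := Bz (d - c)^-1 _ (Al (-1) _ _ Bd Bc); congr B; apply/funext => t.
  have -> : -1 * (u t - d * v t) + (u t - c * v t) = (d - c) * v t by ring.
  by rewrite mulKf// subr_eq0 eq_sym.
have /choice[L HL] := H.
exists L; split.
- move=> a u w; apply: (uniq (fun t => a * u t + w t)); first exact: HL.
  by have := Al a _ _ (HL u) (HL w); congr B; apply/funext => t; ring.
- move=> w Ww; apply: (uniq w); first exact: HL.
  by right; move: Ww; congr W; apply/funext => t; rewrite mul0r subr0.
apply: (uniq v); first exact: HL.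
by move: B0; congr B; apply/funext => t; rewrite mul1r subrr.
Qed.

Theorem closed_form_of_cycle (R : realType) n (X : manifold R n) k (C : diff_form X k.+1 -> R) :
  current C -> (forall w, smooth_form w -> boundary C w = 0) -> ~ homologous C (fun=> 0) ->
  exists phi : diff_form X k.+1,
    [/\ smooth_form phi, forall x E, ext_deriv phi x E = 0 & C phi = 1].
Proof.
move=> cC dC nC.
(* Agreement is required on smooth forms only, so [L] ignores the irrelevant values of a functional,
   as a cochain must. *)
pose W := [set T : diff_form X k.+1 -> R | exists2 S, current S & forall w, smooth_form w -> T w = S (ext_deriv w)].
have W0 : W (fun=> 0) by exists (fun=> 0) => //; exact: current0.
have Wl a u w : W u -> W w -> W (fun t => a * u t + w t).
  move=> [S cS uS] [S' cS' wS']; exists (fun w => a * S w + S' w); first exact: current_lin.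
  by move=> z sz; rewrite uS// wS'.
have nWC : ~ W C.
  by move=> [S cS CS]; apply: nC; exists S; split=> // w sw; rewrite subr0 CS.
have [L [Ll L0 L1]] := separation W0 Wl nWC.
have cL : cochain L.
  split=> [a S T _ _|S T _ _ ST]; first exact: Ll.
  apply/eqP; rewrite -subr_eq0 addrC -mulN1r -Ll; apply/eqP/L0.
  by exists (fun=> 0); [exact: current0|move=> w sw; rewrite ST// mulN1r addNr].
have LB S : current S -> L (boundary S) = 0 by move=> cS; apply: L0; exists S.
have [phi [sphi dphi LT]] := dual_closed_form cL LB.
by exists phi; split=> //; rewrite -LT.
Qed.

(** * Inverse functions, retractions onto the submanifold *)

(** No iteration: the distance from [x] to [T x] attains its minimum on the compact ball, and a
    positive minimum at [c] would be halved at [T c]. *)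
Lemma ball_fixed_point (R : realType) m (T : 'rV[R]_m -> 'rV[R]_m) x0 r (U : set 'rV[R]_m) : 0 <= r -> open U -> Ck 0 U T ->
  (forall x, `|x - x0| <= r -> U x) ->
  (forall x, `|x - x0| <= r -> `|T x - x0| <= r) ->
  (forall x y, `|x - x0| <= r -> `|y - x0| <= r -> `|T x - T y| <= 2^-1 * `|x - y|) ->
  exists2 x, `|x - x0| <= r & T x = x.
Proof.
move=> r0 oU CT BU TS TL; pose B := [set x : 'rV[R]_m | `|x - x0| <= r].
have B0 : B !=set0 by exists x0; rewrite /B /= subrr normr0.
have cf : {within B, continuous (fun x => `|T x - x|)}.
  apply: continuous_in_subspaceT => x; rewrite inE => Bx.
  apply: (@continuous_comp _ _ _ (fun x => T x - x) (fun x => `|x|)); last exact: norm_continuous.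
  have C : Ck 0 U (fun x => T x - x) by apply: CkB => //; exact: Ck_id.
  exact: Ck_continuous C (BU _ Bx).
have cB : compact B by exact: closed_ball_compact.
have [c] := compact_EVT_min B0 cB cf.
rewrite inE => Bc cmin; exists c => //; apply/eqP/negPn/negP => nc.
have n0 : 0 < `|T c - c| by rewrite normr_gt0 subr_eq0.
have Tc : T c \in B by rewrite inE; exact: TS.
have := le_trans (cmin _ Tc) (TL _ _ (TS _ Bc) Bc); lra.
Qed.

Lemma scaler_diffE (R : fieldType) (V : lmodType R) (t : R) (a b : V) : t != 0 ->
  a - t^-1 *: b = t^-1 *: (t *: a - b).
Proof. by move=> t0; rewrite scalerBr scalerA mulVf// scale1r. Qed.

Lemma normr_scaleV_lt (R : realType) m (t : R) (z : 'rV[R]_m) e : t != 0 ->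
  `|z| < `|t| * e -> `|t^-1 *: z| < e.
Proof. by move=> t0 H; rewrite normrZ normfV ltr_pdivrMl// normr_gt0. Qed.

Section InverseFunction.
Context {R : realType}.

Lemma Ck_invmx k (V : normedModType R) m (U : set V) (A : V -> 'M[R]_m) i j : open U ->
  (forall x, U x -> A x \in unitmx) -> Ck k U A -> Ck k U (fun x => invmx (A x) i j).
Proof.
move=> oU uA CA; have CAij := (Ck_mx _ _ oU).1 CA.
apply: (@Ck_eq _ _ _ _ _ (fun x => (\det (A x))^-1 * ((-1) ^+ (j + i) * \det (row' j (col' i (A x)))))) => //.
  by move=> x Ux; rewrite /invmx uA// !mxE.
apply: CkM => //.
  apply: CkV => //; last exact: Ck_det.
  by move=> x Ux; rewrite -unitfE -unitmxE uA.
apply: CkM => //; first exact: Ck_cst.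
apply: Ck_det => //; apply/(Ck_mx _ _ oU) => a b.
by apply: (Ck_eq oU _ (CAij (lift j a) (lift i b))) => x Ux; rewrite !mxE.
Qed.

Lemma mulmx_bound m n (A : 'M[R]_(m, n)) (v : 'rV[R]_m) : `|v *m A| <= m%:R * `|A| * `|v|.
Proof.
apply: mx_norm_le => [|i j]; first by rewrite !mulr_ge0.
rewrite mxE (le_trans (ler_norm_sum _ _ _))// -mulrA.
apply: (@le_trans _ _ (\sum_(k < m) (`|A| * `|v|))); last first.
  by rewrite sumr_const card_ord mulr_natl.
by apply: ler_sum => k _; rewrite normrM mulrC ler_pM// coord_le_norm.
Qed.

Lemma continuous_norm_le m n (U : set 'rV[R]_n) (A : 'rV[R]_n -> 'M[R]_(m, n)) x0 (e : R) : open U -> U x0 -> 0 < e ->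
  (forall i j, Ck 0 U (fun x => A x i j)) -> A x0 = 0 ->
  exists2 r, 0 < r & forall x, `|x - x0| <= r -> U x /\ `|A x| <= e.
Proof.
move=> oU Ux0 e0 CA A0.
have cA : {for x0, continuous A} by apply/continuous_mxP => i j; exact: Ck_continuous (CA i j) Ux0.
have [r1 r10 H1] := continuous_ball cA e0; have [r2 r20 H2] := open_ball oU Ux0.
exists (Num.min r1 r2 / 2); first by rewrite divr_gt0// lt_min r10.
move=> x xr; have : `|x - x0| < Num.min r1 r2.
  by rewrite (le_lt_trans xr)// ltr_pdivrMr ?ltr0n// ltr_pMr ?lt_min ?r10// ltr1n.
rewrite lt_min distrC => /andP[x1 x2]; split; first by apply: H2; rewrite mx_ballE.
have := H1 x; rewrite mx_ballE A0 sub0r normrN => /(_ x1); exact: ltW.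
Qed.

Lemma small_jacobian_lipschitz n m (f : 'rV[R]_n -> 'rV[R]_m) (U : set 'rV[R]_n) x0 r (e : R) : open U ->
  Ck 1 U f -> 0 <= e -> (forall x, `|x - x0| <= r -> U x /\ n%:R * `|jacobian f x| <= e) ->
  forall x y, `|x - x0| <= r -> `|y - x0| <= r -> `|f x - f y| <= e * `|x - y|.
Proof.
move=> oU Cf e0 H x y xr yr; apply: mx_norm_le => [|i j]; first by rewrite mulr_ge0.
rewrite (ord1 i) !mxE.
have B t : 0 <= t <= 1 -> `|y + t *: (x - y) - x0| <= r.
  move=> /andP[t0 t1]; have -> : y + t *: (x - y) - x0 = t *: (x - x0) + (1 - t) *: (y - x0).
    apply/rowP => k; rewrite !mxE; ring.
  rewrite (le_trans (ler_normD _ _))// !normrZ ger0_norm// ger0_norm ?subr_ge0//.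
  have : t * `|x - x0| + (1 - t) * `|y - x0| <= t * r + (1 - t) * r.
    by apply: lerD; apply: ler_wpM2l => //; rewrite subr_ge0.
  by have -> : t * r + (1 - t) * r = r by ring.
have Cj : Ck 1 U (fun z => f z 0 j) by exact: (Ck_mx _ _ oU).1.
have [t t01] := @MVT_dir R _ (fun z => f z 0 j) y (x - y) (fun t t01 => Ck_derivable Cj (H _ (B t t01)).1).
rewrite (addrC y) subrK => E; have [Uz zE] := H _ (B t t01).
apply: (@le_trans _ _ `|(x - y) *m jacobian f (y + t *: (x - y))|).
  have <- : ((x - y) *m jacobian f (y + t *: (x - y))) 0 j = f x 0 j - f y 0 j.
    rewrite E -(C1_jacobianE _ oU Cf Uz) derive_mx; last exact: Ck_derivable Cf Uz.
    by rewrite mxE.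
  exact: coord_le_norm.
by rewrite (le_trans (mulmx_bound _ _))// ler_wpM2r.
Qed.

Lemma jacobian_mulmxr n m p (U : set 'rV[R]_n) (F : 'rV[R]_n -> 'rV[R]_m) (A : 'M[R]_(m, p)) x :
  open U -> Ck 1 U F -> U x -> jacobian (fun x => F x *m A) x = jacobian F x *m A.
Proof.
move=> oU CF Ux; apply/matrixP => i j.
have CFA : Ck 1 U (fun x => F x *m A) by apply: Ck_mulmx => //; exact: Ck_cst.
rewrite (jacobian_coord _ _ oU CFA Ux) mxE.
have D k : is_derive x (er i) (fun y => A k j * F y 0 k) (A k j * 'D_(er i) (fun y => F y 0 k) x).
  apply: is_derive_scale.
  exact: (Ck_derivable ((Ck_mx _ _ oU).1 CF 0 k) Ux).
have [_ E] := @is_derive_bigsum _ _ _ _ (index_enum 'I_m) predT (fun k y => A k j * F y 0 k) x (er i) (fun k _ => @ex_derive _ _ _ _ _ _ _ (D k)).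
apply: etrans (etrans (f_equal (fun g => 'D_(er i) g x) _) E) _.
  by apply/funext => y; rewrite mxE; apply: eq_bigr => k _; exact: mulrC.
apply: eq_bigr => k _; rewrite (jacobian_coord i k oU CF Ux) mulrC.
exact: (@derive_val _ _ _ _ _ _ _ (D k)).
Qed.

Lemma jacobianB n m (U : set 'rV[R]_n) (F G : 'rV[R]_n -> 'rV[R]_m) x :
  open U -> Ck 1 U F -> Ck 1 U G -> U x -> jacobian (fun x => F x - G x) x = jacobian F x - jacobian G x.
Proof.
move=> oU CF CG Ux; apply/matrixP => i j; rewrite (jacobian_coord i j oU (CkB oU CF CG) Ux).
have CFj : Ck 1 U (fun y => F y 0 j) by exact: (Ck_mx _ _ oU).1.
have CGj : Ck 1 U (fun y => G y 0 j) by exact: (Ck_mx _ _ oU).1.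
have E (A B : 'M[R]_(n, m)) : (A - B) i j = A i j - B i j by rewrite !mxE.
apply: etrans _ (esym (E _ _)).
apply: etrans _ (f_equal2 (fun a b => a - b) (esym (jacobian_coord i j oU CF Ux)) (esym (jacobian_coord i j oU CG Ux))).
apply: etrans (deriveB (Ck_derivable CFj Ux) (Ck_derivable CGj Ux)).
by apply: (f_equal (fun g => 'D_(er i) g x)); apply/funext => y; rewrite !mxE.
Qed.

Lemma C1_increment_mx n m (U : set 'rV[R]_n) (F : 'rV[R]_n -> 'rV[R]_m) x (e : R) : open U -> Ck 1 U F -> U x -> 0 < e ->
  exists2 d, 0 < d & forall h, `|h| < d -> `|F (x + h) - F x - h *m jacobian F x| <= e * `|h|.
Proof.
move=> oU CF Ux e0; have CFj j := (Ck_mx _ _ oU).1 CF 0 j.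
pose P (j : 'I_m) (h : 'rV[R]_n) : Prop :=
  `|F (x + h) 0 j - F x 0 j - rdot (\row_i 'D_(er i) (fun y => F y 0 j) x) h| <= e * `|h|.
have nP j : \forall h \near (0 : 'rV[R]_n), P j h by exact: (C1_increment oU (CFj j) Ux e0).
have /nbhs_ballP[d d0 Hd] := filter_forall (nbhs_filter (0 : 'rV[R]_n)) nP.
exists d => // h hd; apply: mx_norm_le => [|i j].
  by rewrite mulr_ge0// ltW.
have E (a b : 'rV[R]_m) (J : 'M[R]_(n, m)) :
    (a - b - h *m J) 0 j = a 0 j - b 0 j - \sum_k h 0 k * J k j by rewrite !mxE.
rewrite (ord1 i) E; have := Hd h _ j; rewrite mx_ballE sub0r normrN /P => /(_ hd).
have -> : rdot (\row_i 'D_(er i) (fun y => F y 0 j) x) h = \sum_k h 0 k * jacobian F x k j.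
  apply: eq_bigr => k _; apply: (f_equal (fun z => h 0 k * z)).
  apply: etrans _ (esym (jacobian_coord k j oU CF Ux)).
  by rewrite mxE.
by [].
Qed.

(** With [A] inverse to the Jacobian at [x0], the map [f x = x - F x *m A] has zero Jacobian there
    and is a contraction on a small ball. Solving [F x = y] means finding a fixed point of [f]
    translated by [y *m A]. *)
Theorem inverse_function m (U : set 'rV[R]_m) (F : 'rV[R]_m -> 'rV[R]_m) x0 :
  open U -> U x0 -> (forall k, Ck k U F) -> jacobian F x0 \in unitmx ->
  exists G O r, [/\ 0 < r, open O /\ O (F x0), forall k, Ck k O G,
    forall y, O y -> [/\ `|G y - x0| <= r, U (G y) & F (G y) = y] &
    forall x x', `|x - x0| <= r -> `|x' - x0| <= r -> F x = F x' -> x = x'].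
Proof.
move=> oU Ux0 CF uJ; pose A := invmx (jacobian F x0).
have CJ k i j : Ck k U (fun x => jacobian F x i j) by exact: Ck_jacobian.
pose f x := x - F x *m A.
have CFA k : Ck k U (fun x => F x *m A) by apply: Ck_mulmx => //; exact: Ck_cst.
have Cf k : Ck k U f by apply: CkB => //; exact: Ck_id.
have Jf x : U x -> jacobian f x = 1%:M - jacobian F x *m A.
  move=> Ux; rewrite (jacobianB oU (@Ck_id _ 1 _ U) (CFA 1%N) Ux) jacobian_id.
  by rewrite (jacobian_mulmxr _ oU (CF 1%N) Ux).
have Jf0 : jacobian f x0 = 0 by rewrite Jf// mulmxV// subrr.
(* The square turns invertibility of the Jacobian into membership in an open half-line. *)
pose d2 x := \det (jacobian F x) * \det (jacobian F x).
pose U1 := [set x | U x /\ [set t : R | 0 < t] (d2 x)].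
have CJm k : Ck k U (jacobian F) by apply/(Ck_mx _ _ oU) => i j; exact: CJ.
have oU1 : open U1.
  have op : open [set t : R | 0 < t] by exact: open_gt.
  apply: (open_preimage oU _ op) => x Ux.
  exact: Ck_continuous (CkM oU (Ck_det oU (CJm 0%N)) (Ck_det oU (CJm 0%N))) Ux.
have uU1 x : U1 x -> jacobian F x \in unitmx.
  move=> [_ dx]; rewrite unitmxE unitfE; apply/eqP => d0.
  by move: dx; rewrite /= /d2 d0 mul0r ltxx.
have U1U x : U1 x -> U x by case.
have U1x0 : U1 x0.
  by split=> //; rewrite /= /d2 -expr2 lt_def sqr_ge0 sqrf_eq0 -unitfE -unitmxE uJ.
(* The product of a row by a matrix loses a factor m in the max norm, and 1/2 is the contraction
   ratio wanted; [m.+1] is nonzero even for m = 0. *)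
have e0 : 0 < (2^-1 / m.+1%:R : R) by rewrite divr_gt0// invr_gt0.
have [r r0 Hr] := continuous_norm_le oU1 U1x0 e0
  (fun i j => Ck_sub U1U (Ck_jacobian i j oU (Cf 1%N))) Jf0.
have h0 : 0 <= (2^-1 : R) by rewrite invr_ge0.
have lip : forall x y, `|x - x0| <= r -> `|y - x0| <= r -> `|f x - f y| <= 2^-1 * `|x - y|.
  apply: (small_jacobian_lipschitz oU (Cf 1%N) h0) => x xr.
  have [[Ux _] Jx] := Hr x xr; split=> //.
  rewrite (@le_trans _ _ (m.+1%:R * `|jacobian f x|))//.
    by rewrite ler_wpM2r// ler_nat.
  by rewrite mulrC -ler_pdivlMr.
have inj2 x y : `|x - x0| <= r -> `|y - x0| <= r -> `|x - y| <= 2 * `|(F x - F y) *m A|.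
  move=> xr yr; have := lip x y xr yr.
  have E : x - y = (f x - f y) + (F x - F y) *m A.
    by rewrite mulmxBl /f; apply/rowP => i; rewrite !mxE; ring.
  have := ler_normD (f x - f y) ((F x - F y) *m A); rewrite -E; lra.
pose K := m%:R * `|A|; have K0 : 0 <= K by rewrite mulr_ge0.
(* On the ball of radius [r] the contraction moves away from its value at [x0] by at most [r / 2],
   which leaves [r / 2] for the translation. *)
pose O := [set y | `|(y - F x0) *m A| < r / 2].
have oO : open O.
  have C : Ck 0 setT (fun y => (y - F x0) *m A).
    apply: Ck_mulmx; [exact: openT| |exact: Ck_cst].
    by apply: CkB; [exact: openT|exact: Ck_id|exact: Ck_cst].
  have oL : open [set t : R | t < r / 2] by exact: open_lt.
  have := @open_preimage _ _ setT (fun y : 'rV[R]_m => `|(y - F x0) *m A|) [set t | t < r / 2] openT _ oL.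
  rewrite (_ : [set _ | _] = O); last by apply/seteqP; split=> y //= [].
  apply=> y _; apply: (@continuous_comp _ _ _ (fun y : 'rV[R]_m => (y - F x0) *m A) (fun x => `|x|)).
    exact: Ck_continuous C I.
  exact: norm_continuous.
have H y : exists x, O y -> `|x - x0| <= r /\ F x = y.
  have [Oy|nO] := pselect (O y); last by exists 0.
  have [||||x xr xE] := @ball_fixed_point R m (fun x => f x + y *m A) x0 r U (ltW r0) oU.
  - exact: (CkD oU (Cf 0%N) (Ck_cst 0 U (y *m A))).
  - by move=> x xr; have [[]] := Hr x xr.
  - move=> x xr; have -> : f x + y *m A - x0 = (f x - f x0) + (y - F x0) *m A.
      by rewrite mulmxBl /f; apply/rowP => i; rewrite !mxE; ring.
    have x0r : `|x0 - x0| <= r by rewrite subrr normr0 ltW.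
    have := lip x x0 xr x0r; have := ler_normD (f x - f x0) ((y - F x0) *m A).
    by move: Oy; rewrite /O /=; lra.
  - by move=> x z xr zr; rewrite opprD addrACA subrr addr0; exact: lip.
  exists x => _; split=> //.
  have E : F x *m A = y *m A.
    by apply/eqP; rewrite -subr_eq0 -(subrr x) -{3}xE /f; apply/eqP/rowP => i; rewrite !mxE; ring.
  by have := congr1 (fun z => z *m jacobian F x0) E; rewrite /A !mulmxKV.
have /choice[G HG] := H.
have lipG y y' : O y -> O y' -> `|G y - G y'| <= 2 * K * `|y - y'|.
  move=> /HG[yr Fy] /HG[yr' Fy']; rewrite (le_trans (inj2 _ _ yr yr'))// Fy Fy' -mulrA.
  by rewrite ler_wpM2l// mulmx_bound.
have cG y : O y -> {for y, continuous G}.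
  move=> Oy; apply: ball_continuous => e e1.
  have [d d0 BO] := open_ball oO Oy.
  have K1 : 0 < 2 * K + 1 by rewrite ltr_wpDl// mulr_ge0.
  exists (Num.min d (e / (2 * K + 1))); first by rewrite lt_min d0 divr_gt0.
  move=> z; rewrite mx_ballE lt_min => /andP[zd ze].
  have Oz : O z by apply: BO; rewrite mx_ballE.
  rewrite (le_lt_trans (lipG _ _ Oy Oz))//.
  rewrite (@le_lt_trans _ _ ((2 * K + 1) * `|y - z|))//; first by rewrite ler_wpM2r// lerDl.
  by rewrite mulrC -ltr_pdivlMr.
have dG y v : O y -> is_derive y v G (v *m invmx (jacobian F (G y))).
  move=> Oy; have [yr Fy] := HG y Oy; have U1y := Hr _ yr.
  have Uy : U (G y) by apply: U1U; case: U1y.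
  have uy : jacobian F (G y) \in unitmx by apply: uU1; case: U1y.
  set x := G y in yr Fy Uy uy *; set B := invmx (jacobian F x).
  suff cv : (fun t : R => t^-1 *: (G (t *: v + y) - G y)) @ 0^' --> v *m B.
    by split; [apply/cvg_ex; exists (v *m B)|exact: cvg_lim cv].
  apply/cvgrPdist_lt => e e1.
  (* [M] collects the losses from multiplying by [B] and from the Lipschitz constant [2 * K] of [G];
     the 1 keeps it positive. *)
  pose M := m%:R * `|B| * (2 * K * `|v|) + 1.
  have M0 : 0 < M by rewrite ltr_wpDl// !mulr_ge0.
  have e2 : 0 < e / M by rewrite divr_gt0.
  have [d d0 Hd] := C1_increment_mx oU (CF 1%N) Uy e2.
  have [dO dO0 BO] := open_ball oO Oy.
  have N0 : 0 < `|v| + 1 by rewrite ltr_wpDl.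
  have K1 : 0 < 2 * K + 1 by rewrite ltr_wpDl// mulr_ge0.
  pose dd := Num.min dO (d / (2 * K + 1)) / (`|v| + 1).
  have dd0 : 0 < dd by rewrite divr_gt0// lt_min dO0 divr_gt0.
  exists dd => //= t; rewrite /ball_ /= sub0r normrN => td t0.
  have tv : `|t *: v| < Num.min dO (d / (2 * K + 1)).
    rewrite normrZ; apply: (@le_lt_trans _ _ (`|t| * (`|v| + 1))); first by rewrite ler_wpM2l// lerDl.
    by rewrite -ltr_pdivlMr.
  move: tv; rewrite lt_min => /andP[tv1 tv2].
  have Oty : O (t *: v + y) by apply: BO; rewrite mx_ballE opprD addrCA subrr addr0 normrN.
  pose h := G (t *: v + y) - x.
  have hle : `|h| <= 2 * K * `|t *: v|.
    by rewrite (le_trans (lipG _ _ Oty Oy))// addrK.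
  have hd : `|h| < d.
    rewrite (le_lt_trans hle)// (@le_lt_trans _ _ ((2 * K + 1) * `|t *: v|))//; first by rewrite ler_wpM2r// lerDl.
    by rewrite mulrC -ltr_pdivlMr.
  have [_ Fty] := HG _ Oty.
  have tvE : F (x + h) - F x = t *: v by rewrite /h (addrC x) subrK Fty Fy addrK.
  have := Hd h hd; rewrite tvE => hJ.
  have hE : t *: (v *m B) - h = (t *: v - h *m jacobian F x) *m B.
    by rewrite mulmxBl mulmxK// scalemxAl.
  have t0' : 0 < `|t| by rewrite normr_gt0.
  have : `|t *: (v *m B) - h| < `|t| * e.
    rewrite hE (le_lt_trans (mulmx_bound _ _))//.
    apply: (@le_lt_trans _ _ (m%:R * `|B| * (e / M * (2 * K * (`|t| * `|v|))))).
      rewrite ler_wpM2l ?mulr_ge0// (le_trans hJ)// ler_wpM2l ?(ltW e2)//.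
      by rewrite -normrZ.
    have -> : m%:R * `|B| * (e / M * (2 * K * (`|t| * `|v|))) = `|t| * (e / M) * (m%:R * `|B| * (2 * K * `|v|)) by ring.
    have EM : e / M * M = e by rewrite mulfVK ?gt_eqF.
    by rewrite -mulrA ltr_pM2l// -[ltRHS]EM ltr_pM2l// /M ltrDl.
  have -> : v *m B - t^-1 *: (G (t *: v + y) - x) = t^-1 *: (t *: (v *m B) - h).
    exact: scaler_diffE.
  exact: normr_scaleV_lt.
have GU y : O y -> U (G y) by move=> /HG[/Hr[[]]].
exists G, O, r; split=> //.
- by split=> //; rewrite /O /= subrr mul0mx normr0 divr_gt0.
(* Bootstrap: the derivative of [G] is the inverse Jacobian of [F] composed with [G], so it is as
   regular as [G], which thus gains one order. *)
- elim=> [|k IH]; first by split=> //; exact: cG.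
  split; first exact: cG; split; first by move=> y v Oy; have [] := dG y v Oy.
  move=> v; apply: (@Ck_eq _ _ _ _ _ (fun y => v *m invmx (jacobian F (G y)))) => //.
    by move=> y Oy; have [_ ->] := dG y v Oy.
  apply: Ck_mulmx => //; first exact: Ck_cst.
  have CA : Ck k O (fun y => jacobian F (G y)).
    exact: (@Ck_comp_mx _ _ _ _ _ _ O U (jacobian F) G oO oU GU (CJm k) IH).
  have uA y : O y -> jacobian F (G y) \in unitmx by move=> /HG[/Hr[U1y _] _]; exact: uU1.
  by apply/(Ck_mx _ _ oO) => i j; exact: (Ck_invmx i j oO uA CA).
- by move=> y Oy; have [yr Fy] := HG y Oy; split=> //; exact: GU.
move=> x x' xr xr' FF; have := inj2 x x' xr xr'.
by rewrite FF subrr mul0mx normr0 mulr0 normr_le0 subr_eq0 => /eqP.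
Qed.

End InverseFunction.

(** * Smooth maps between manifolds and pullback of forms *)

Section SmoothMap.
Context {R : realType} {n m : nat} {X : manifold R n} {M : manifold R m} {f : M -> X}.
Hypothesis sf : smooth_map f.

Local Notation dom p := (cdom (chart_at p)).
Local Notation img p := (cimg (chart_at p)).
Local Notation cm p := (cmap (chart_at p)).
Local Notation ci p := (cinv (chart_at p)).

Definition mloc (p : M) (q : X) : 'rV[R]_m -> 'rV[R]_n := cm q \o f \o ci p.
Definition mdom (p : M) (q : X) : set 'rV[R]_m := [set y | img p y /\ dom q (f (ci p y))].

Lemma mdom_open p q : open (mdom p q).
Proof.
apply: open_preimage; [exact: img_open| |exact: cdom_open].
move=> y iy; apply: (@continuous_comp _ _ _ (ci p) f); first exact: cinv_continuous.
exact: sf.1.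
Qed.

Arguments mdom_open : clear implicits.

Lemma Ck_mloc k p q : Ck k (mdom p q) (mloc p q).
Proof. by apply: (smooth_onP _ _).1; exact: sf.2. Qed.

Lemma mloc_img p q y : mdom p q y -> img q (mloc p q y).
Proof. by move=> [_ dy]; exact: cmap_img. Qed.

Lemma jacobian_mloc p q p' q' y : mdom p q y -> dom p' (ci p y) -> dom q' (f (ci p y)) ->
  jacobian (mloc p q) y = jacobian (transition p p') y *m
    (jacobian (mloc p' q') (transition p p' y) *m jacobian (transition q' q) (cm q' (f (ci p y)))).
Proof.
move=> [iy dqy] dp' dq'.
pose O1 := ov p p' `&` (mdom p q `&` mdom p q').
have oO1 : open O1 by apply: openI; [exact: ov_open|apply: openI; exact: mdom_open].
pose O2 := mdom p' q' `&` mdom p' q.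
have oO2 : open O2 by apply: openI; exact: mdom_open.
have O1y : O1 y by [].
have T z : O1 z -> O2 (transition p p' z).
  move=> [oz [[_ zq] [_ zq']]].
  by split; split; rewrite ?cinv_transition//; exact: transition_img.
have T2 z : O2 z -> ov q' q (mloc p' q' z).
  move=> [[iz zq'] [_ zq]]; split; first exact: mloc_img.
  by rewrite /mloc /= cmapK.
have C12 : Ck 1 O1 (transition p p') by apply: Ck_sub (Ck_transition 1 p p') => z [].
have C2 : Ck 1 O2 (mloc p' q') by apply: Ck_sub (Ck_mloc 1 p' q') => z [].
have E1 : jacobian (mloc p' q \o transition p p') y = jacobian (mloc p q) y.
  apply: (jacobian_near oO1 _ O1y) => [|z [oz _]].
    by apply: Ck_sub (Ck_mloc 1 p q) => z [_ []].
  by rewrite /mloc /= cinv_transition.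
have O2y := T _ O1y.
have E2 : jacobian (transition q' q \o mloc p' q') (transition p p' y) = jacobian (mloc p' q) (transition p p' y).
  apply: (jacobian_near oO2 _ O2y) => [|z [[iz zq'] _]].
    by apply: Ck_sub (Ck_mloc 1 p' q) => z [_ h].
  by rewrite /transition /mloc /= cmapK.
rewrite -E1 (jacobian_comp oO1 oO2 C12 _ O1y O2y); last by apply: Ck_sub (Ck_mloc 1 p' q) => z [].
congr (_ *m _); rewrite -E2.
rewrite (jacobian_comp oO2 (ov_open q' q) C2 (Ck_transition 1 q' q) O2y (T2 _ O2y)).
have Ez : mloc p' q' (transition p p' y) = cm q' (f (ci p y)).
  by case: O1y => oy _; rewrite /mloc /= cinv_transition.
exact: (f_equal (fun z => _ *m jacobian (transition q' q) z) Ez).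
Qed.

Lemma local_pullback k (w : diff_form X k) p q y E : mdom p q y ->
  local_form (pullback f w) p y E = fpull (mloc p q) (local_form w q) y E.
Proof.
move=> my; have [iy dy] := my; have xx := mem_chart_at (f (ci p y)).
rewrite /local_form /pullback (form_local w _ dy) /fpull; congr (local_form w q _ _).
have ss := mem_chart_at (ci p y); rewrite -!mulmxA; congr (_ *m _).
by rewrite (jacobian_mloc my ss xx) -/(tangent_coord p y).
Qed.

Lemma smooth_pullback k (w : diff_form X k) : smooth_form w -> smooth_form (pullback f w).
Proof.
move=> sw; have sw' := (smooth_formP w).1 sw.
apply/smooth_formP => p; have H q : fform (mdom p q) (local_form (pullback f w) p).
  apply: (@fform_eq _ _ _ _ (fpull (mloc p q) (local_form w q))); first exact: mdom_open.
    by move=> y E my; rewrite (local_pullback w E my).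
  exact: (fpull_fform (mdom_open p q) (img_open q) (@mloc_img p q) (fun l => Ck_mloc l p q) (sw' q)).
have my y : img p y -> mdom p (f (ci p y)) y by move=> iy; split=> //; exact: mem_chart_at.
split=> [y iy|y iy|E j].
- exact: (fform_ml (H _) (my y iy)).
- exact: (fform_alt (H _) (my y iy)).
by apply: Ck_local => y iy; exists (mdom p (f (ci p y))); split; [exact: my|exact: fform_Ck (H _)].
Qed.

Lemma pullback_ext_deriv k (w : diff_form X k) : smooth_form w ->
  pullback f (ext_deriv w) = ext_deriv (pullback f w).
Proof.
move=> sw; apply/funext => p; apply/funext => E.
rewrite -local_form_center -[RHS]local_form_center.
set y := cm p p; have ip : img p y by apply: cmap_img; exact: mem_chart_at.
have my : mdom p (f p) y by split=> //; rewrite /y cmapK; exact: mem_chart_at.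
rewrite local_ext_deriv//; last exact: smooth_pullback.
rewrite (local_pullback (ext_deriv w) E my).
have E1 : fpull (mloc p (f p)) (local_form (ext_deriv w) (f p)) y E =
    fpull (mloc p (f p)) (fd (local_form w (f p))) y E.
  by apply: local_ext_deriv => //; exact: mloc_img.
rewrite E1 -(fd_pull E (mdom_open p (f p)) (img_open (f p)) (@mloc_img p (f p)) (Ck_mloc 2 p (f p))
   ((smooth_formP w).1 sw (f p)) my).
by apply: (fd_near _ (mdom_open p (f p)) my) => z F mz; rewrite (local_pullback w F mz).
Qed.

Lemma pullback_lin k a (w w' : diff_form X k) :
  pullback f (fun x E => a * w x E + w' x E) = (fun x E => a * pullback f w x E + pullback f w' x E).
Proof. by []. Qed.

End SmoothMap.

Arguments mdom_open {R n m X M f} sf p q _ : rename.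

(** * Local retractions onto an embedded submanifold *)

Section Retraction.
Context {R : realType} {n m : nat} {X : manifold R n} {M : manifold R m} {f : M -> X}.
Hypothesis emb : embedding f.

Local Notation dom p := (cdom (chart_at p)).
Local Notation img p := (cimg (chart_at p)).
Local Notation cm p := (cmap (chart_at p)).
Local Notation ci p := (cinv (chart_at p)).

Let sf : smooth_map f. Proof. by case: emb. Qed.

(* A retraction of a chart domain onto the submanifold, in the charts of [p] and [f p]. *)
Record retraction (p : M) (D : set 'rV[R]_n) (r : 'rV[R]_n -> 'rV[R]_m) : Prop := Retraction {
  rt_open : open D;
  rt_center : D (cm (f p) (f p));
  rt_img : D `<=` img (f p);
  rt_Ck : forall k, Ck k D r;
  rt_dom : forall z, D z -> mdom (f := f) p (f p) (r z);
  rt_inv : forall s z, D z -> f s = ci (f p) z -> dom p s /\ cm p s = r z;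
  rt_seg : forall z t, D z -> 0 <= t <= 1 ->
    img (f p) (mloc (f := f) p (f p) (r z) + t *: (z - mloc (f := f) p (f p) (r z))) }.

Lemma mdom_center p : mdom (f := f) p (f p) (cm p p).
Proof.
have pp := mem_chart_at p; split; first exact: cmap_img.
by rewrite cmapK//; exact: mem_chart_at.
Qed.

(** An immersion has a right inverse [B] of its Jacobian at the centre, so the inverse function
    theorem applies to [i] followed by [B]; the retraction is [B] followed by that local inverse. *)
Lemma retraction_exists p : exists D r, retraction p D r.
Proof.
set q := f p; set i := mloc (f := f) p q; set y0 := cm p p.
have my0 : mdom (f := f) p q y0 := mdom_center p.
have [_ finj ffree ftop] := emb.
have /row_freeP[B JB] : row_free (jacobian i y0) by exact: ffree p.
have oU : open (mdom (f := f) p q) by exact: mdom_open.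
have Ci k : Ck k (mdom (f := f) p q) i by exact: Ck_mloc.
have CiB k : Ck k (mdom (f := f) p q) (fun y => i y *m B) by apply: Ck_mulmx => //; exact: Ck_cst.
have uJ : jacobian (fun y => i y *m B) y0 \in unitmx.
  by rewrite (jacobian_mulmxr B oU (Ci 1%N) my0) JB unitmx1.
have [G [V1 [d [d0 [oV1 V1y0] CG GV1 inj]]]] := inverse_function oU my0 CiB uJ.
have pp := mem_chart_at p.
pose V := [set s | dom p s /\ ball y0 d (cm p s)].
have oV : open V by apply: open_preimage; [exact: cdom_open|exact: cmap_continuous|exact: ball_open].
(* The topological embedding enters here: points of the submanifold that lie in [W] come from the
   chart neighbourhood [V], so no other sheet passes through the domain of the retraction. *)
have [W oW VW] := ftop V oV.
pose D1 := [set z | img q z /\ (V1 (z *m B) /\ W (ci q z))].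
have oD1 : open D1.
  have C : Ck 0 (img q) (fun z : 'rV[R]_n => z *m B).
    by apply: Ck_mulmx; [exact: img_open|exact: Ck_id|exact: Ck_cst].
  have -> : D1 = [set z | img q z /\ V1 (z *m B)] `&` [set z | img q z /\ W (ci q z)].
    by apply/seteqP; split=> z; [move=> [? [? ?]]|move=> [[? ?] [_ ?]]].
  apply: openI.
    by apply: open_preimage; [exact: img_open|move=> z iz; exact: Ck_continuous C iz|].
  by apply: open_preimage; [exact: img_open|exact: cinv_continuous|].
pose r z := G (z *m B).
have CBl k U : open U -> Ck k U (fun z : 'rV[R]_n => z *m B).
  by move=> oU'; apply: Ck_mulmx => //; [exact: Ck_id|exact: Ck_cst].
have Cr k : Ck k D1 r.
  apply: (@Ck_comp_mx _ _ _ _ _ _ D1 V1 G (fun z => z *m B)) => //; last exact: CBl.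
  by move=> z [_ []].
have rdom z : D1 z -> mdom (f := f) p q (r z) by move=> [_ [Oz _]]; have [] := GV1 _ Oz.
have rinv s z : D1 z -> f s = ci q z -> dom p s /\ cm p s = r z.
  move=> [iz [Oz Wz]] fs.
  have [s' [ds' bs'] fs'] : (f @` V) (f s) by rewrite VW; split; [rewrite fs|exists s].
  have ss' : s = s' by apply: finj; rewrite ?inE// fs'.
  rewrite -ss' in ds' bs'; split=> //.
  have [xr Ur FG] := GV1 _ Oz.
  apply: inj => //; first by move: bs'; rewrite mx_ballE distrC => /ltW.
  by rewrite FG /i /mloc /= cmapK// fs cinvK.
have z0q : img q (cm q q) by apply: cmap_img; exact: mem_chart_at.
have i0 : i y0 = cm q q by rewrite /i /mloc /= cmapK.
have D1z0 : D1 (cm q q).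
  split=> //; split; first by rewrite -i0.
  have Vp : V p by split=> //; apply: ballxx.
  rewrite cmapK; last exact: mem_chart_at.
  have Vq : (f @` V) q by exists p.
  by rewrite VW in Vq; case: Vq.
have r0 : r (cm q q) = y0.
  by have [] := rinv p (cm q q) D1z0 _; rewrite ?cmapK//; exact: mem_chart_at.
have [e e0 Be] := open_ball (img_open q) z0q.
have cir : {for cm q q, continuous (fun z => i (r z))}.
  have C := @Ck_comp_mx _ 0 _ _ _ _ D1 (mdom (f := f) p q) i r oD1 oU rdom (Ci 0%N) (Cr 0%N).
  exact: Ck_continuous C D1z0.
have [e1 e10 He1] := continuous_ball cir e0.
have [e2 e20 He2] := open_ball oD1 D1z0.
(* Both [z] and its retraction lie in the ball of radius [e] inside the chart image; convexity of
   that ball gives the segment condition. *)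
pose e3 := Num.min e (Num.min e1 e2).
have e30 : 0 < e3 by rewrite !lt_min e0 e10.
exists (ball (cm q q) e3), r.
have BB z : ball (cm q q) e3 z -> [/\ `|cm q q - z| < e, ball (cm q q) e1 z & D1 z].
  rewrite mx_ballE !lt_min => /and3P[? ? ?]; split=> //; first by rewrite mx_ballE.
  by apply: He2; rewrite mx_ballE.
split.
- exact: ball_open.
- exact: ballxx.
- by move=> z /BB[_ _ []].
- by move=> k; apply: Ck_sub (Cr k) => z /BB[].
- by move=> z /BB[_ _ /rdom].
- by move=> s z /BB[_ _]; exact: rinv.
move=> z t /BB[ze ze1 _] /andP[t0 t1]; apply: Be; rewrite mx_ballE.
have := He1 z ze1; rewrite r0 i0 => ie.
set a := mloc _ _ _.
have -> : cm q q - (a + t *: (z - a)) = (1 - t) *: (cm q q - a) + t *: (cm q q - z).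
  by apply/rowP => k; rewrite !mxE; ring.
rewrite (le_lt_trans (ler_normD _ _))// !normrZ ger0_norm ?subr_ge0// ger0_norm//.
have [->|tn1] := eqVneq t 1; first by rewrite subrr mul0r add0r mul1r.
have t1' : 0 < 1 - t by rewrite subr_gt0 lt_neqAle tn1.
have : (1 - t) * `|cm q q - a| + t * `|cm q q - z| < (1 - t) * e + t * e.
  by apply: ltr_leD; [rewrite ltr_pM2l|apply: ler_wpM2l => //; exact: ltW].
by have -> : (1 - t) * e + t * e = e by ring.
Qed.

Section Use.
Context {p : M} {D : set 'rV[R]_n} {r : 'rV[R]_n -> 'rV[R]_m}.
Hypothesis rt : retraction p D r.

Local Notation i := (mloc (f := f) p (f p)).

Lemma rt_mloc y : mdom (f := f) p (f p) y -> D (i y) -> r (i y) = y.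
Proof.
move=> [iy dy] Dy; have [|_ <-] := rt_inv rt (s := ci p y) Dy; last by rewrite cinvK.
by rewrite /mloc /= cmapK.
Qed.

Lemma rt_point s : dom (f p) (f s) -> D (cm (f p) (f s)) ->
  [/\ dom p s, r (cm (f p) (f s)) = cm p s & i (cm p s) = cm (f p) (f s)].
Proof.
move=> ds Ds; have [|dps E] := rt_inv rt (s := s) Ds; first by rewrite cmapK.
by split=> //; rewrite /mloc /= cmapK.
Qed.

Lemma rt_range z : D z -> i (r z) = z -> ci (f p) z = f (ci p (r z)).
Proof.
by move=> Dz iz; have [iy dy] := rt_dom rt Dz; rewrite -{1}iz /mloc /= cmapK.
Qed.

Lemma jacobian_rt y : mdom (f := f) p (f p) y -> D (i y) -> jacobian i y *m jacobian r (i y) = 1%:M.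
Proof.
move=> my Dy.
pose O := [set z | mdom (f := f) p (f p) z /\ D (i z)].
have oO : open O.
  apply: open_preimage; [exact: mdom_open| |exact: (rt_open rt)].
  by move=> z mz; apply: Ck_continuous (Ck_mloc sf 0 p (f p)) mz.
have Oy : O y by [].
have CiO : Ck 1 O i by apply: Ck_sub (Ck_mloc sf 1 p (f p)) => z [].
have OD z : O z -> D (i z) by case.
rewrite -(jacobian_comp oO (rt_open rt) CiO (rt_Ck rt 1) Oy Dy) -(jacobian_id y).
apply: esym; apply: (jacobian_near oO _ Oy).
  exact: (@Ck_comp_mx _ _ _ _ _ _ O D r i oO (rt_open rt) OD (rt_Ck rt 1) CiO).
by move=> z [mz Dz]; rewrite /= rt_mloc.
Qed.

End Use.
End Retraction.

Section Cutoff.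
Context {R : realType}.

Lemma Ck_cutoff j n (D K U : set 'rV[R]_n) (f : 'rV[R]_n -> R) : open D -> compact K -> K `<=` D ->
  Ck j D f -> (forall y, ~ K y -> f y = 0) -> Ck j U f.
Proof.
move=> oD cK KD Cf f0; apply: Ck_local => y _; have [Ky|nK] := pselect (K y); first by exists D; split=> //; exact: KD.
have oK : open (~` K) by apply: closed_openC; apply: compact_closed cK; exact: norm_hausdorff.
by exists (~` K); split=> //; apply: (Ck_eq oK _ (Ck_cst j _ 0)) => z nz; rewrite f0.
Qed.

Lemma fform_cutoff n k (D K U : set 'rV[R]_n) (a : 'rV[R]_n -> 'M[R]_(k, n) -> R) : open D -> compact K -> K `<=` D ->
  fform D a -> (forall y E, ~ K y -> a y E = 0) -> fform U a.
Proof.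
move=> oD cK KD fa a0; split=> [y _|y _|E j].
- have [Ky|nK] := pselect (K y); first exact: (fform_ml fa (KD y Ky)).
  by move=> l A B C b c _ _ _; rewrite !a0// !mulr0 addr0.
- have [Ky|nK] := pselect (K y); first exact: (fform_alt fa (KD y Ky)).
  by move=> E l l' _ _; rewrite a0.
by apply: (Ck_cutoff _ oD cK KD (fform_Ck j E fa)) => y; exact: a0.
Qed.

End Cutoff.

Lemma fd_scale_vanish (R : realType) n k (U : set 'rV[R]_n) (s : 'rV[R]_n -> R)
    (u : 'rV[R]_n -> 'M[R]_(k, n) -> R) z E : open U -> U z -> Ck 1 U s -> (forall E, Ck 1 U (fun y => u y E)) ->
  (forall E, u z E = 0) -> fd (fun y E => s y * u y E) z E = s z * fd u z E.
Proof.
move=> oU Uz Cs Cu u0; rewrite /fd mulr_sumr; apply: eq_bigr => i _.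
rewrite mulrCA; congr (_ * _).
have /= := deriveM (Ck_derivable Cs Uz : derivable s z (row i E)) (Ck_derivable (Cu (row' i E)) Uz : derivable (fun y => u y (row' i E)) z (row i E)).
by rewrite u0 scale0r addr0; apply.
Qed.

Lemma derive_line_cst (R : realType) (V W : normedModType R) (h : V -> W) x v :
  (forall s : R, h (s *: v + x) = h x) -> 'D_v h x = 0.
Proof.
move=> hx; rewrite /derive.
have -> : (fun t : R => t^-1 *: ((h \o shift x) (t *: v) - h x)) = fun=> 0.
  by apply/funext => t; rewrite /= hx subrr scaler0.
exact: lim_cst.
Qed.

Lemma ext_deriv_zero (R : realType) n (X : manifold R n) k (w : diff_form X k) U x E : open U -> U x ->
  (forall y F, U y -> w y F = 0) -> ext_deriv w x E = 0.
Proof.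
move=> oU Ux w0; rewrite (ext_deriv_near (w' := @fzero R n X k) E oU Ux w0) ext_derivE /fd big1// => i _.
by apply/eqP; rewrite mulf_eq0; apply/orP; right; apply/eqP; exact: derive_cst.
Qed.

(** * Extending forms from the submanifold, and forms with zero pullback *)

Section Kernel.
Context {R : realType} {n m : nat} {X : manifold R n} {M : manifold R m} {f : M -> X}.
Hypothesis emb : embedding f.

Local Notation dom p := (cdom (chart_at p)).
Local Notation img p := (cimg (chart_at p)).
Local Notation cm p := (cmap (chart_at p)).
Local Notation ci p := (cinv (chart_at p)).

Let sf : smooth_map f. Proof. by case: emb. Qed.

Section Chart.
Context {p : M} {D : set 'rV[R]_n} {r : 'rV[R]_n -> 'rV[R]_m}.
Hypothesis rt : retraction (f := f) p D r.
Local Notation q := (f p).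
Local Notation i := (mloc (f := f) p q).

(** The straight-line homotopy, in the chart, from the retraction at time 0 to the identity at time
    1. *)
Definition rhom (z : 'rV[R]_(1 + n)) : 'rV[R]_n :=
  i (r (rsubmx z)) + z 0 ord0 *: (rsubmx z - i (r (rsubmx z))).

Lemma rhom_pr t z : rhom (pr t z) = i (r z) + t *: (z - i (r z)).
Proof. by rewrite /rhom rsubmx_pr pr0. Qed.

Definition rhomW : set 'rV[R]_(1 + n) := [set z | [set z | D (rsubmx z)] z /\ img q (rhom z)].

Lemma Ck_rsubmx k (U : set 'rV[R]_(1 + n)) : open U -> Ck k U (fun z : 'rV[R]_(1 + n) => rsubmx z : 'rV[R]_n).
Proof.
move=> oU; apply/(Ck_mx _ _ oU) => a b; rewrite (ord1 a).
by apply: (Ck_eq oU _ (Ck_coord k U (rshift 1 b))) => z _; rewrite mxE.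
Qed.

Lemma rhomW0_open : open [set z : 'rV[R]_(1 + n) | D (rsubmx z)].
Proof.
have := @open_preimage _ _ setT (fun z : 'rV[R]_(1 + n) => rsubmx z : 'rV[R]_n) D openT _ (rt_open rt).
rewrite (_ : [set z | setT z /\ _] = [set z : 'rV[R]_(1 + n) | D (rsubmx z)]).
  by apply=> z _; exact: Ck_continuous (Ck_rsubmx 0 openT) I.
by apply/seteqP; split=> z //= [].
Qed.

Lemma Ck_ir k : Ck k D (fun z => i (r z)).
Proof.
exact: (@Ck_comp_mx _ k _ _ _ _ D (mdom (f := f) p q) i r (rt_open rt) (mdom_open sf p q) (rt_dom rt) (Ck_mloc sf k p q) (rt_Ck rt k)).
Qed.

Lemma Ck_rhom k : Ck k [set z : 'rV[R]_(1 + n) | D (rsubmx z)] rhom.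
Proof.
have oW := rhomW0_open.
have CI : Ck k [set z : 'rV[R]_(1 + n) | D (rsubmx z)] (fun z : 'rV[R]_(1 + n) => i (r (rsubmx z))).
  exact: (@Ck_comp_mx _ k _ _ _ _ _ D (fun z => i (r z)) (fun z : 'rV[R]_(1 + n) => rsubmx z : 'rV[R]_n) oW (rt_open rt) (fun z h => h) (Ck_ir k) (Ck_rsubmx k oW)).
apply/(Ck_mx _ _ oW) => a b; rewrite (ord1 a).
have CIb := (Ck_mx _ _ oW).1 CI 0 b; have CRb := (Ck_mx _ _ oW).1 (Ck_rsubmx k oW) 0 b.
apply: (Ck_eq oW _ (CkD oW CIb (CkM oW (Ck_coord k _ ord0) (CkB oW CRb CIb)))) => z _.
by rewrite !mxE.
Qed.

Lemma rhom_data : exists s K d, [/\ hop_data q rhom D rhomW s K, 0 < d & forall z, `|z - cm q q| < d -> s z = 1].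
Proof.
set c := cm q q; have [e e0 Be] := open_ball (rt_open rt) (rt_center rt).
pose d := e / 3; have d0 : 0 < d by rewrite divr_gt0.
pose K := [set y : 'rV[R]_n | `|y - c| <= 2 * d].
have KD : K `<=` D.
  by move=> y yd; apply: Be; rewrite mx_ballE distrC (le_lt_trans yd)// /d; lra.
exists (cubebump c d), K, d; split=> //; last by move=> z /ltW; exact: bump_1.
have oW : open rhomW.
  apply: (open_preimage rhomW0_open _ (img_open q)) => z Dz.
  exact: Ck_continuous (Ck_rhom 0) Dz.
split=> //.
- exact: (rt_open rt).
- by move=> t y t01 Dy; split; rewrite /= ?rsubmx_pr// rhom_pr; exact: (rt_seg rt).
- by move=> z [].
- by move=> j; apply: Ck_sub (Ck_rhom j) => z [].
- exact: (rt_img rt).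
- exact: closed_ball_compact.
- by move=> j; exact: Ck_bump.
by move=> y nK; apply: bump_0 => //; rewrite leNgt; apply/negP => /ltW.
Qed.

Section Data.
Context {s : 'rV[R]_n -> R} {K : set 'rV[R]_n}.
Hypothesis H : hop_data q rhom D rhomW s K.

(** Points of the submanifold do not move under the homotopy, so the time vector is mapped to a zero
    row. *)
Lemma hop_rhom_vanish k (w : 'rV[R]_n -> 'M[R]_(1 + k, n) -> R) z E : fform (img q) w -> D z -> i (r z) = z ->
  hop rhom w z E = 0.
Proof.
move=> fw Dz iz; apply: etrans _ (rint0 0 1); apply: eq_rint => t t01.
have Wz : rhomW (pr t z) := hd_UW H t01 Dz.
rewrite /fpull; apply: (multilinear_row0 (i := ord0)).
  exact: (fform_ml fw (hd_WO H Wz)).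
rewrite row_mul row0_blk -(C1_jacobianE (pr 1 0) (hd_oW H) (hd_Ch H 1%N) Wz).
apply: derive_line_cst => a.
have -> : a *: pr 1 0 + pr t z = pr (a + t) z :> 'rV[R]_(1 + n).
  by rewrite prZ prD mulr1 scaler0 add0r.
by rewrite !rhom_pr iz subrr !scaler0.
Qed.

(** The homotopy formula compares [w] with its pullback by the retraction, which factors through the
    pullback to the submanifold and is zero. The differential of the cut-off and the term in [fd w]
    drop out because the operator vanishes along the submanifold. *)
Lemma chop_rhom_range k (w : diff_form X k.+1) x E : smooth_form w ->
  (forall t F, pullback f w t F = 0) ->
  ext_deriv (@chop R n X k q rhom s w) (f x) E = fscale (chart_fun q s) w (f x) E.
Proof.
move=> sw w0; have sw' := (smooth_formP w).1 sw q.
have Kq : K `<=` img q by move=> y Ky; exact: (hd_Ui H (hd_KU H Ky)).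
have [clK Kd] := chart_image_closed (hd_cK H) Kq.
have [Kx|nK] := pselect ((ci q @` K) (f x)); last first.
  rewrite (ext_deriv_zero _ (closed_openC clK) nK) => [|y F nKy].
    rewrite /fscale /chart_fun; case: pselect => dx //; last by rewrite mul0r.
    by rewrite (hd_s0 H) ?mul0r//; exact: chart_supp_compl nK dx.
  rewrite /chop /chart_form; case: pselect => // dy.
  by rewrite (hd_s0 H) ?mul0r//; exact: chart_supp_compl nKy dy.
have dx : dom q (f x) by exact: Kd.
have Dz : D (cm q (f x)) by case: Kx => y Ky <-; rewrite cinvK; [exact: (hd_KU H)|exact: Kq].
have [dpx rz iz] := rt_point rt dx Dz; rewrite -rz in iz.
set z := cm q (f x) in Dz rz iz *.
have sc := smooth_chop H sw.
rewrite (form_local (ext_deriv _) E dx) local_ext_deriv//; last exact: (rt_img rt).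
rewrite -/z /fscale chart_fun_in// -/z (form_local w E dx) -/z; set F := E *m _.
have fu : fform D (hop rhom (local_form w q)).
  exact: (hop_fform (hd_oU H) (hd_oW H) (hd_UW H) (img_open q) (hd_WO H) (hd_Ch H) sw').
apply: (@etrans _ _ (fd (fun y E => s y * hop rhom (local_form w q) y E) z F)).
  apply: (fd_near _ (rt_open rt) Dz) => y G Dy.
  by rewrite local_chart_form//; exact: (rt_img rt).
rewrite (fd_scale_vanish _ (rt_open rt) Dz); last 3 first.
- by apply: Ck_sub (hd_Cs H 1%N).
- by move=> G; exact: (fform_Ck 1%N G fu).
- by move=> G; exact: hop_rhom_vanish.
congr (_ * _).
have := hop_formula (hd_oU H) (hd_oW H) (hd_UW H) (img_open q) (hd_WO H) (hd_Ch H) F sw' Dz.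
rewrite (@hop_rhom_vanish k.+1 (fd (local_form w q)) z F (fd_fform (img_open q) sw') Dz iz) addr0 => ->.
have -> : fpull (rhom \o pr 0) (local_form w q) z F = 0.
  have my := rt_dom rt Dz.
  have J0 : jacobian (rhom \o pr 0) z = jacobian r z *m jacobian i (r z).
    rewrite -(jacobian_comp (rt_open rt) (mdom_open sf p q) (rt_Ck rt 1) (Ck_mloc sf 1 p q) Dz my).
    apply: (jacobian_near (rt_open rt) (Ck_ir 1) Dz) => y _.
    by rewrite /= rhom_pr scale0r addr0.
  rewrite /fpull J0 mulmxA /= rhom_pr scale0r addr0.
  have := local_pullback sf w (F *m jacobian r z) my; rewrite /fpull => <-.
  by rewrite /local_form w0.
rewrite subr0 /fpull.
have -> : jacobian (rhom \o pr 1) z = 1%:M.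
  rewrite -(jacobian_id z); apply: (jacobian_near (rt_open rt) (@Ck_id _ 1 _ D) Dz) => y _.
  by rewrite /= rhom_pr scale1r addrC subrK.
by rewrite mulmx1 /= rhom_pr scale1r addrC subrK.
Qed.

(** The extension is the pullback by the retraction, damped by [s]; [jacobian_rt] says that
    restricting it again gives back [w]. *)
Lemma chart_extension k (w : diff_form M k) : smooth_form w ->
  exists2 psi : diff_form X k, smooth_form psi &
    forall x E, pullback f psi x E = chart_fun q s (f x) * w x E.
Proof.
move=> sw; have sw' := (smooth_formP w).1 sw p.
have Kq : K `<=` img q by move=> y Ky; exact: (hd_Ui H (hd_KU H Ky)).
have [clK Kd] := chart_image_closed (hd_cK H) Kq.
pose a z (E : 'M[R]_(k, n)) := s z * fpull r (local_form w p) z E.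
have rimg z : D z -> img p (r z) by move=> /(rt_dom rt)[].
have fD : fform D a.
  apply: fform_scale; [exact: (rt_open rt)|by move=> j; apply: Ck_sub (hd_Cs H j)|].
  exact: (fpull_fform (rt_open rt) (img_open p) rimg (rt_Ck rt) sw').
have a0 y E : ~ K y -> a y E = 0 by move=> nK; rewrite /a (hd_s0 H)// mul0r.
have fa : fform (img q) a := fform_cutoff _ (rt_open rt) (hd_cK H) (hd_KU H) fD a0.
exists (chart_form q a).
  by apply: smooth_chart_form (hd_cK H) Kq fa _ => y E _; exact: a0.
move=> x E.
have [Kx|nK] := pselect ((ci q @` K) (f x)); last first.
  rewrite /pullback /chart_form /chart_fun; case: pselect => dx; last by rewrite mul0r.
  by rewrite a0 ?(hd_s0 H) ?mul0r//; exact: chart_supp_compl nK dx.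
have dx : dom q (f x) by exact: Kd.
have Dz : D (cm q (f x)) by case: Kx => y Ky <-; rewrite cinvK; [exact: (hd_KU H)|exact: Kq].
have [dpx rz iz] := rt_point rt dx Dz.
have my : mdom (f := f) p q (cm p x) by split; [exact: cmap_img|rewrite cmapK].
rewrite (form_local (pullback f _) E dpx) (form_local w E dpx); set F := E *m _.
rewrite (local_pullback sf _ F my) /fpull iz local_chart_form; last exact: cmap_img.
have := jacobian_rt emb rt my; rewrite iz => /(_ Dz) J1.
by rewrite /a /fpull rz -mulmxA J1 mulmx1 chart_fun_in.
Qed.

End Data.
End Chart.

Lemma range_compact : compact [set: M] -> compact (range f).
Proof. by move=> cM; apply: compact_image => // x _; exact: sf.1. Qed.

Section Global.
Hypothesis cM : compact [set: M].

(** Everything that one retraction chart supplies, so that the two gluing arguments that follow need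
    no coordinates. *)
Definition chart_cut (p : M) (g : X -> R) :=
  [/\ smooth_fun g, exists2 V, open V /\ V (f p) & forall y, V y -> g y = 1,
   forall k (w : diff_form X k.+1), smooth_form w -> (forall t F, pullback f w t F = 0) ->
     exists2 eta : diff_form X k, smooth_form eta &
       forall x E, ext_deriv eta (f x) E = fscale g w (f x) E &
   forall k (w : diff_form M k), smooth_form w ->
     exists2 psi : diff_form X k, smooth_form psi & forall x E, pullback f psi x E = g (f x) * w x E].

Lemma chart_cut_exists p : exists g, chart_cut p g.
Proof.
have [D [r rt]] := retraction_exists emb p.
have [s [K [d [H d0 s1]]]] := rhom_data rt.
have Kq : K `<=` img (f p) by move=> y Ky; exact: (hd_Ui H (hd_KU H Ky)).
exists (chart_fun (f p) s); split.
- apply: smooth_chart_fun (hd_cK H) Kq _ _ => [j|y _]; last exact: (hd_s0 H).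
  by apply: Ck_sub (hd_Cs H j).
- exists [set y | dom (f p) y /\ ball (cm (f p) (f p)) d (cm (f p) y)].
    split; first by apply: open_preimage; [exact: cdom_open|exact: cmap_continuous|exact: ball_open].
    by split; [exact: mem_chart_at|exact: ballxx].
  by move=> y [dy]; rewrite mx_ballE distrC => yd; rewrite chart_fun_in// s1.
- move=> k w sw w0; exists (@chop R n X k (f p) (rhom (p := p) (r := r)) s w); first exact: (smooth_chop H sw).
  by move=> x E; exact: (chop_rhom_range rt H).
by move=> k w sw; exact: (chart_extension rt H).
Qed.

Theorem form_extension k (w : diff_form M k) : smooth_form w ->
  exists2 psi : diff_form X k, smooth_form psi & forall x E, pullback f psi x E = w x E.
Proof.
have /choice[g Hg] := chart_cut_exists.
have H p : exists V, [/\ open V, V p & forall x, V x -> g p (f x) = 1].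
  have [_ [V [oV Vp] V1] _ _] := Hg p; exists [set x | setT x /\ V (f x)]; split=> //.
    by apply: open_preimage; [exact: openT|move=> x _; exact: sf.1|].
  by move=> x [_ Vx]; exact: V1.
have /choice[V HV] := H.
have [|t [_ cov]] := compact_finite_cover (P := V) cM; first by move=> x _; case: (HV x).
(* Covering is required only where [w] is nonzero: this survives the induction, in which [w] is
   multiplied by [1 - g] and a point leaves the list. *)
have {cov} : forall x E, w x E != 0 -> exists2 p, p \in t & V p x by move=> x E _; exact: cov.
elim: t w => [|p t IH] w cov sw.
  exists (@fzero R n X k); first exact: smooth_fzero.
  move=> x E; apply/esym/eqP/negPn/negP => wx; have [p] := cov _ _ wx; by rewrite in_nil.
have [sg _ _ /(_ _ _ sw)[psi spsi psiE]] := Hg p.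
have sgf : smooth_fun (g p \o f).
  apply/smooth_funP => a j; apply: Ck_local => y iy.
  have my : mdom (f := f) a (f (ci a y)) y by split=> //; exact: mem_chart_at.
  exists (mdom (f := f) a (f (ci a y))); split=> //.
  have := @Ck_comp _ j _ _ _ _ (g p \o ci (f (ci a y))) (mloc (f := f) a (f (ci a y)))
    (mdom_open sf a (f (ci a y))) (img_open (f (ci a y))) (fun z mz => mloc_img mz)
    ((smooth_funP _).1 sg _ _) (Ck_mloc sf j a _).
  apply: Ck_eq; first exact: (mdom_open sf).
  by move=> z [iz dz]; rewrite /mloc /= cmapK.
have [||psi' spsi' psiE'] := IH (fscale (fun x => 1 - g p (f x)) w).
- move=> x E; rewrite /fscale mulf_eq0 negb_or => /andP[gx wx].
  have [p'] := cov x E wx; rewrite inE => /orP[/eqP->|]; last by exists p'.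
  by case: (HV p) => _ _ g1 Vx; rewrite g1// subrr eqxx in gx.
- exact: (smooth_fscale (smooth_funB1 sgf) sw).
exists (fadd psi psi'); first exact: smooth_fadd.
move=> x E; rewrite /fadd {1}/pullback -/(pullback f psi x E) -/(pullback f psi' x E) psiE psiE' /fscale; ring.
Qed.

(** A form with zero pullback, multiplied by a chart cut-off, equals an exact form at the points of
    the submanifold. [L] vanishes on the exact form and on the difference, so finitely many cut-offs
    can be peeled off. *)
Theorem kernel_pullback k (L : diff_form X k.+1 -> R) (w : diff_form X k.+1) : form_linear L ->
  (forall eta, smooth_form eta -> L (ext_deriv eta) = 0) ->
  (forall w, smooth_form w -> (forall x E, w (f x) E = 0) -> L w = 0) ->
  smooth_form w -> (forall x E, pullback f w x E = 0) -> L w = 0.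
Proof.
move=> lL Ld Lv sw w0.
have /choice[g Hg] := chart_cut_exists.
have step p v : smooth_form v -> (forall x E, pullback f v x E = 0) -> L (fscale (g p) v) = 0.
  move=> sv v0; have [sg _ /(_ _ _ sv v0)[eta seta etaE] _] := Hg p.
  have := lL (-1) _ _ (smooth_ext_deriv seta) (smooth_fscale sg sv).
  rewrite (Ld _ seta) mulr0 add0r => <-; apply: Lv.
    exact: (smooth_lin (-1) (smooth_ext_deriv seta) (smooth_fscale sg sv)).
  by move=> x E; rewrite etaE mulN1r addNr.
have H p : exists V, [/\ open V, V p & forall x, V x -> g p (f x) = 1].
  have [_ [V [oV Vp] V1] _ _] := Hg p; exists [set x | setT x /\ V (f x)]; split=> //.
    by apply: open_preimage; [exact: openT|move=> x _; exact: sf.1|].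
  by move=> x [_ Vx]; exact: V1.
have /choice[V HV] := H.
have [|t [_ cov]] := compact_finite_cover (P := V) cM; first by move=> x _; case: (HV x).
have {cov} : forall x E, w (f x) E != 0 -> exists2 p, p \in t & V p x by move=> x E _; exact: cov.
elim: t w sw w0 => [|p t IH] w sw w0 cov.
  apply: Lv => // x E; apply/eqP/negPn/negP => wx; have [p] := cov _ _ wx; by rewrite in_nil.
have [sg _ _ _] := Hg p; have sg1 := smooth_funB1 sg.
have <- : L (fscale (fun x => 1 - g p x) w) = L w.
  have := lL (-1) _ _ (smooth_fscale sg sw) sw; rewrite (step p w sw w0) mulr0 add0r => <-.
  by congr (L _); apply/funext => x; apply/funext => E; rewrite /fscale; ring.
apply: IH; first exact: (smooth_fscale sg1 sw).
  by move=> x E; rewrite /pullback /fscale -/(pullback f w x E) w0 mulr0.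
move=> x E; rewrite /fscale mulf_eq0 negb_or => /andP[gx wx].
have [p'] := cov x E wx; rewrite inE => /orP[/eqP->|]; last by exists p'.
by case: (HV p) => _ _ g1 Vx; rewrite g1// subrr eqxx in gx.
Qed.

End Global.
End Kernel.

(** * Integration over R^n and change of variables *)

Section Bump.
Context {R : realType}.

Definition stepr (r t : R) : R := smoothstep (t / r + 2^-1).

(** For r > 0, an even function supported in [[-r, r]] with integral 1; as a derivative it has an
    evident integral. *)
Definition theta (r t : R) : R := 'D_1 (stepr r) t.

Lemma Ck_stepr r k : Ck k setT (stepr r).
Proof.
apply: (@Ck_comp1 _ k _ _ setT smoothstep) => //; [exact: openT|exact: Ck_smoothstep|].
apply: CkD; [exact: openT| |exact: Ck_cst].
by apply: CkM; [exact: openT|exact: Ck_id|exact: Ck_cst].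
Qed.

Lemma Ck_theta r k : Ck k setT (theta r).
Proof. by apply: Ck_derive; exact: Ck_stepr. Qed.

Lemma is_derive_stepr r t : is_derive t (1 : R) (stepr r) (theta r t).
Proof. by split=> //; exact: Ck_derivable (Ck_stepr r 1) I. Qed.

Lemma smoothstepN x : smoothstep (1 - x) = 1 - smoothstep x :> R.
Proof.
have d0 : flat_exp 0 x + flat_exp 0 (1 - x) != 0 by rewrite gt_eqF// smoothstep_den.
rewrite /smoothstep subKr [X in _ / X = _]addrC; field; exact: d0.
Qed.

Lemma thetaN r t : theta r (- t) = theta r t.
Proof.
have H : is_derive t (1 : R) (fun s => 1 - stepr r (- s)) (theta r (- t)).
  have D : is_derive t (1 : R) (fun s => stepr r (- s)) (- theta r (- t)).
    have /= D := derivable_comp1 (g := stepr r) (s := fun s : R => - s) (x := t) (v := 1)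
      (@ex_derive _ _ _ _ _ _ _ (is_derive_stepr r (- t))) (derivableN (@derivable_id _ _ t 1)).
    have -> : - theta r (- t) = 'D_1 (stepr r) (- t) * 'D_1 (fun s : R => - s) t.
      have -> : 'D_1 (fun s : R => - s) t = -1.
        by have := deriveN (@derivable_id R R t 1); rewrite derive_id.
      by rewrite mulrN1.
    exact: D.
  by have := is_deriveB (is_derive_cst (1 : R) t (1 : R)) D; rewrite sub0r opprK.
have [_ <-] := H.
rewrite /theta; apply: (f_equal (fun g => 'D_1 g t)); apply/funext => s.
by rewrite /stepr -smoothstepN; congr smoothstep; rewrite mulNr; lra.
Qed.

Lemma theta0 r t : 0 < r -> r <= `|t| -> theta r t = 0.
Proof.
move=> r0 tr; have U0 : open [set s : R | r / 2 < s] by exact: open_gt.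
have U1 : open [set s : R | s < - (r / 2)] by exact: open_lt.
have r2 : r / 2 < r by rewrite ltr_pdivrMr// ltr_pMr// ltr1n.
have [t0|t0] := leP 0 t.
  have tU : r / 2 < t by rewrite (lt_le_trans r2)// -(ger0_norm t0).
  have E s : r / 2 < s -> stepr r s = 1.
    move=> sr; apply: smoothstep_1; have : 2^-1 < s / r by rewrite ltr_pdivlMr// mulrC.
    by lra.
  exact: etrans (derive_nearE (1 : R) U0 tU E) (derive_cst (1 : R) t (1 : R)).
have tU : t < - (r / 2) by move: tr; rewrite ltr0_norm//; lra.
have E s : s < - (r / 2) -> stepr r s = 0.
  move=> sr; apply: smoothstep_0; have : s / r < - 2^-1 by rewrite ltr_pdivrMr// mulNr mulrC.
  by lra.
exact: etrans (derive_nearE (1 : R) U1 tU E) (derive_cst (0 : R) t (1 : R)).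
Qed.

Lemma rint_theta r : 0 < r -> rint (- r) r (theta r) = 1.
Proof.
move=> r0; have r0' : r != 0 by rewrite gt_eqF.
have rr : - r < r by rewrite gtrN.
apply: etrans (rint_FTC (F := stepr r) rr _ _) _.
- by move=> t _; exact: Ck_continuous (Ck_theta r 0) I.
- by move=> t _; exact: is_derive_stepr.
- rewrite /stepr mulNr divff// [smoothstep (-1 + _)]smoothstep_0 ?smoothstep_1 ?subr0//; lra.
Qed.

End Bump.

(** * Iterated integrals and functionals that vanish on partial derivatives *)

Section IteratedIntegral.
Context {R : realType}.

Definition smooth0 n (f : 'rV[R]_n -> R) := forall j, Ck j setT f.

Definition csm (r : R) n (f : 'rV[R]_n -> R) := smooth0 f /\ forall y, r <= `|y| -> f y = 0.

(* The first coordinate is the innermost one here, and the outermost one in [integral_rV]. *)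
Fixpoint jint (r : R) n : ('rV[R]_n -> R) -> R :=
  match n with
  | 0 => fun f => f 0
  | n'.+1 => fun f => jint r (fun y : 'rV[R]_n' => rint (- r) r (fun t => f (pr t y)))
  end.

Definition chi (r : R) n (y : 'rV[R]_n) : R := \prod_(j < n) theta r (y 0 j).

Lemma er_ord0 n : er (ord0 : 'I_(1 + n)) = pr 1 0 :> 'rV[R]_(1 + n).
Proof.
by apply/rowP => j; case: (unliftP ord0 j) => [c ->|->]; rewrite ?prl ?pr0 !mxE eqxx.
Qed.

Lemma er_lift n (c : 'I_n) : er (lift ord0 c : 'I_(1 + n)) = pr 0 (er c) :> 'rV[R]_(1 + n).
Proof.
apply/rowP => j; case: (unliftP ord0 j) => [c' ->|->]; rewrite ?prl ?pr0 !mxE eqxx ?(inj_eq lift_inj) //.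
Qed.

Lemma pr_norm n t (y : 'rV[R]_n) : `|t| <= `|pr t y| /\ `|y| <= `|pr t y|.
Proof.
split; first by rewrite -{1}(pr0 t y) coord_le_norm.
by apply: mx_norm_le => // i j; rewrite (ord1 i) -(prl t y j) coord_le_norm.
Qed.

Lemma pr_eta n (z : 'rV[R]_(1 + n)) : pr (z 0 ord0) (rsubmx z) = z.
Proof.
apply/rowP => j; case: (unliftP ord0 j) => [c ->|->]; rewrite ?prl ?pr0//.
by rewrite mxE; congr (z _ _); exact/esym/lift0_rshift.
Qed.

Lemma pr_lt n t (y : 'rV[R]_n) r : `|t| < r -> `|y| < r -> `|pr t y| < r.
Proof.
move=> tr yr; have r0 : 0 < r := le_lt_trans (normr_ge0 _) tr.
apply: mx_norm_lt => // i j; rewrite (ord1 i); case: (unliftP ord0 j) => [c ->|->]; rewrite ?prl ?pr0//.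
exact: le_lt_trans (coord_le_norm _ _ _) yr.
Qed.

Lemma derive_line (V V' W : normedModType R) (h : V -> W) (g : V' -> W) x u a w :
  (forall s : R, h (s *: u + x) = g (s *: w + a)) -> 'D_u h x = 'D_w g a.
Proof.
move=> hg; rewrite /derive.
have E0 : h x = g a by have := hg 0; rewrite !scale0r !add0r.
have -> // : (fun t : R => t^-1 *: ((h \o shift x) (t *: u) - h x)) = (fun t : R => t^-1 *: ((g \o shift a) (t *: w) - g a)).
by apply/funext => t; rewrite /= hg E0.
Qed.

Section Smooth.
Context {n : nat}.

Lemma smooth0_lin a (f g : 'rV[R]_n -> R) : smooth0 f -> smooth0 g -> smooth0 (fun y => a * f y + g y).
Proof.
move=> sf sg j; apply: CkD; [exact: openT| |exact: sg].
by apply: CkM; [exact: openT|exact: Ck_cst|exact: sf].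
Qed.

Lemma smooth0_derive v (f : 'rV[R]_n -> R) : smooth0 f -> smooth0 ('D_v f).
Proof. by move=> sf j; apply: Ck_derive; exact: sf. Qed.

Lemma smooth0_cst c : smooth0 (fun _ : 'rV[R]_n => c).
Proof. by move=> j; exact: Ck_cst. Qed.

Lemma smooth0_chi r : smooth0 (chi r (n := n)).
Proof.
move=> k; apply: Ck_prod; first exact: openT.
move=> j _; apply: (@Ck_comp1 _ k _ _ setT (theta r)) => //; [exact: openT|exact: Ck_theta|exact: Ck_coord].
Qed.

Lemma chi0 r (y : 'rV[R]_n) : 0 < r -> r <= `|y| -> chi r y = 0.
Proof.
move=> r0 ry; apply/eqP; rewrite /chi prodf_seq_eq0.
have [/hasP[j _ H]|/hasPn H] := boolP (has (fun j => r <= `|y 0 j|) (index_enum 'I_n)).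
  by apply/hasP; exists j; rewrite ?mem_index_enum//= theta0.
suff : `|y| < r by rewrite ltNge ry.
by apply: mx_norm_lt => // i j; rewrite (ord1 i) ltNge H ?mem_index_enum.
Qed.

Lemma csm_chi r : 0 < r -> csm r (chi r (n := n)).
Proof. by move=> r0; split; [exact: smooth0_chi|move=> y; exact: chi0]. Qed.

Lemma csm_lin r a (f g : 'rV[R]_n -> R) : csm r f -> csm r g -> csm r (fun y => a * f y + g y).
Proof.
move=> [sf f0] [sg g0]; split; first exact: smooth0_lin.
by move=> y ry; rewrite f0// g0// mulr0 addr0.
Qed.

Lemma derive_supp0 (f : 'rV[R]_n -> R) (O : set 'rV[R]_n) v y : open O -> O y ->
  (forall z, O z -> f z = 0) -> 'D_v f y = 0.
Proof.
move=> oO Oy f0; apply: etrans (derive_nearE (g := fun=> 0) v oO Oy f0) _; exact: derive_cst.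
Qed.

Lemma open_norm_gt (r : R) : open [set y : 'rV[R]_n | r < `|y|].
Proof.
have := @open_preimage _ _ setT (fun y : 'rV[R]_n => `|y|) [set t : R | r < t] openT _ _.
rewrite (_ : [set y | setT y /\ _] = [set y : 'rV[R]_n | r < `|y|]).
  by apply; [move=> y _; exact: norm_continuous|exact: open_gt].
by apply/seteqP; split=> y //= [].
Qed.

End Smooth.

Section Param.
Context {n : nat} (r : R).
Hypothesis r0 : 0 < r.

Let rr : - r < r. Proof. by rewrite gtrN. Qed.

Lemma smooth0_rint (f : 'rV[R]_(1 + n) -> R) : smooth0 f -> smooth0 (fun y => rint (- r) r (fun t => f (pr t y))).
Proof. by move=> sf j; apply: (@Ck_rint _ n setT setT (- r) r openT rr _ j f sf). Qed.

Lemma cc_smooth0 (f : 'rV[R]_(1 + n) -> R) a b y : smooth0 f -> cc a b (fun t => f (pr t y)).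
Proof. by move=> sf; apply: (@cc_pr _ n setT setT a b _ 0 f y (sf 0%N) I). Qed.

Lemma derive_rint (f : 'rV[R]_(1 + n) -> R) y v : smooth0 f ->
  'D_v (fun y => rint (- r) r (fun t => f (pr t y))) y = rint (- r) r (fun t => 'D_(pr 0 v) f (pr t y)).
Proof.
move=> sf; have [_ E] := @rint_param_derive _ n setT setT (- r) r openT rr (fun _ _ _ _ => I) f y v (sf 1%N) I.
exact: E.
Qed.

Lemma derive_pr (f : 'rV[R]_(1 + n) -> R) t y : smooth0 f ->
  is_derive t (1 : R) (fun t => f (pr t y)) ('D_(pr 1 0) f (pr t y)).
Proof.
move=> sf; have E s : pr s y = pr 0 y + s *: pr 1 0.
  by rewrite prZ prD mulr1 add0r scaler0 addr0.
have -> : (fun t => f (pr t y)) = (fun t => f (pr 0 y + t *: pr 1 0)) by apply/funext => s; rewrite -E.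
by rewrite (E t); apply: is_derive1_dir; exact: Ck_derivable (sf 1%N) I.
Qed.

Lemma csm_rint (f : 'rV[R]_(1 + n) -> R) : csm r f -> csm r (fun y => rint (- r) r (fun t => f (pr t y))).
Proof.
move=> [sf f0]; split; first exact: smooth0_rint.
move=> y ry; apply: etrans _ (rint0 (- r) r); apply: eq_rint => t _.
by apply: f0; rewrite (le_trans ry)//; case: (pr_norm t y).
Qed.

Lemma rint_derive0 (f : 'rV[R]_(1 + n) -> R) y : csm r f -> rint (- r) r (fun t => 'D_(pr 1 0) f (pr t y)) = 0.
Proof.
move=> [sf f0]; apply: etrans (rint_FTC (F := fun t => f (pr t y)) rr _ _) _.
- exact: cc_smooth0 (smooth0_derive (pr 1 0) sf).
- by move=> t _; exact: derive_pr.
have P1 : r <= `|pr r y| by have [+ _] := pr_norm r y; rewrite gtr0_norm.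
have P2 : r <= `|pr (- r) y| by have [+ _] := pr_norm (- r) y; rewrite normrN gtr0_norm.
by rewrite (f0 _ P1) (f0 _ P2) subrr.
Qed.

End Param.

Section JInt.
Context (r : R).
Hypothesis r0 : 0 < r.

Let rr : - r < r. Proof. by rewrite gtrN. Qed.

Lemma jint_lin n a (f g : 'rV[R]_n -> R) : smooth0 f -> smooth0 g ->
  jint r (fun y => a * f y + g y) = a * jint r f + jint r g.
Proof.
elim: n f g => [|n IH] f g sf sg //=.
rewrite -IH; [|exact: smooth0_rint|exact: smooth0_rint].
congr (jint r _); apply/funext => y.
have cf := @cc_smooth0 n f (- r) r y sf; have cg := @cc_smooth0 n g (- r) r y sg.
by rewrite -rintZ// -rintD//; apply: ccM => //; exact: cc_cst.
Qed.

Lemma jint_cst0 n : jint r (fun _ : 'rV[R]_n => 0) = 0.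
Proof.
have := jint_lin (-1) (@smooth0_cst n 0) (@smooth0_cst n 0).
rewrite (_ : (fun _ => _) = (fun _ : 'rV[R]_n => 0)); first by rewrite mulN1r addNr.
by apply/funext => y; rewrite mulr0 addr0.
Qed.

Lemma jint_le n (f g : 'rV[R]_n -> R) : smooth0 f -> smooth0 g -> (forall y, f y <= g y) -> jint r f <= jint r g.
Proof.
elim: n f g => [|n IH] f g sf sg fg //=.
apply: IH; [exact: smooth0_rint|exact: smooth0_rint|move=> y].
by apply: rint_le => //; exact: cc_smooth0.
Qed.

Lemma jint_derive n (f : 'rV[R]_n -> R) j : csm r f -> jint r ('D_(er j) f) = 0.
Proof.
elim: n f j => [|n IH] f j cf; first by case: j.
have [sf _] := cf; rewrite /=; case: (unliftP ord0 j) => [c ->|->].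
  rewrite -[RHS](IH _ c (csm_rint r0 cf)); congr (jint r _); apply/funext => y.
  by rewrite (@derive_rint n r r0 f y (er c) sf) -er_lift.
rewrite -[RHS](jint_cst0 n); congr (jint r _); apply/funext => y.
by rewrite -(rint_derive0 r0 y cf) -er_ord0.
Qed.

Lemma chi_pr n t (y : 'rV[R]_n) : chi r (pr t y) = theta r t * chi r y.
Proof. by rewrite /chi big_ord_recl pr0; congr (_ * _); apply: eq_bigr => j _; rewrite prl. Qed.

Lemma rint_thetaM c : rint (- r) r (fun t => theta r t * c) = c.
Proof.
have -> : (fun t => theta r t * c) = (fun t => c * theta r t) by apply/funext => t; exact: mulrC.
rewrite rintZ ?rint_theta ?mulr1// => t _; exact: Ck_continuous (Ck_theta r 0) I.
Qed.

Lemma jint_chi n : jint r (chi r (n := n)) = 1.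
Proof.
elim: n => [|n IH]; first by rewrite /= /chi big_ord0.
rewrite -[RHS]IH /=; congr (jint r _); apply/funext => y.
rewrite -[RHS]rint_thetaM; apply: eq_rint => t _; exact: chi_pr.
Qed.

(* A primitive in the first coordinate, written so as to be visibly smooth. *)
Definition prim n (g : 'rV[R]_(1 + n) -> R) (z : 'rV[R]_(1 + n)) : R :=
  (z 0 ord0 + r) * rint 0 1 (fun v => g (pr (- r + v * (z 0 ord0 + r)) (rsubmx z))).

Lemma Ck_prs n p k (a : 'rV[R]_p -> R) (b : 'rV[R]_p -> 'rV[R]_n) : Ck k setT a -> Ck k setT b ->
  Ck k setT (fun z => pr (a z) (b z)).
Proof.
move=> Ca Cb; apply: Ck_row_mx => //; [exact: openT|apply/(Ck_mx _ _ openT) => i j].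
by apply: (Ck_eq openT _ Ca) => z _; rewrite mxE.
Qed.

(** The integrand of [prim] as one function of the integration variable and the point, the form in
    which [Ck_rint] applies. *)
Definition primQ n (g : 'rV[R]_(1 + n) -> R) (u : 'rV[R]_(1 + (1 + n))) : R :=
  g (pr (- r + u 0 ord0 * ((rsubmx u : 'rV[R]_(1 + n)) 0 ord0 + r)) (rsubmx (rsubmx u : 'rV[R]_(1 + n)))).

Lemma primQ_pr n (g : 'rV[R]_(1 + n) -> R) v z :
  primQ g (pr v z) = g (pr (- r + v * (z 0 ord0 + r)) (rsubmx z)).
Proof. by rewrite /primQ rsubmx_pr pr0. Qed.

Lemma smooth0_primQ n (g : 'rV[R]_(1 + n) -> R) : smooth0 g -> smooth0 (primQ g).
Proof.
move=> sg k; have C0 : Ck k setT (fun u : 'rV[R]_(1 + (1 + n)) => (rsubmx u : 'rV[R]_(1 + n)) 0 ord0).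
  exact: (Ck_mx _ _ openT).1 (@Ck_rsubmx R (1 + n) k setT openT) 0 ord0.
have C1 : Ck k setT (fun u : 'rV[R]_(1 + (1 + n)) => rsubmx (rsubmx u : 'rV[R]_(1 + n)) : 'rV[R]_n).
  exact: (@Ck_comp_mx _ k _ _ _ _ setT setT (fun z : 'rV[R]_(1 + n) => rsubmx z : 'rV[R]_n) (fun u => rsubmx u) openT openT (fun _ _ => I) (@Ck_rsubmx R n k setT openT) (@Ck_rsubmx R (1 + n) k setT openT)).
have C2 : Ck k setT (fun u : 'rV[R]_(1 + (1 + n)) => - r + u 0 ord0 * ((rsubmx u : 'rV[R]_(1 + n)) 0 ord0 + r)).
  have CA := CkD openT C0 (Ck_cst k setT r).
  exact: CkD openT (Ck_cst k setT (- r)) (CkM openT (Ck_coord k setT ord0) CA).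
exact: (@Ck_comp _ k _ _ setT setT g _ openT openT (fun _ _ => I) (sg k) (Ck_prs C2 C1)).
Qed.

Lemma smooth0_prim n (g : 'rV[R]_(1 + n) -> R) : smooth0 g -> smooth0 (prim g).
Proof.
move=> sg k; have sQ := smooth0_primQ sg.
have C1 : Ck k setT (fun z : 'rV[R]_(1 + n) => rint 0 1 (fun v => primQ g (pr v z))).
  exact: (@Ck_rint _ (1 + n) setT setT 0 1 openT ltr01 (fun _ _ _ _ => I) k (primQ g) sQ).
have CA := CkD openT (Ck_coord k setT (ord0 : 'I_(1 + n))) (Ck_cst k setT r).
apply: (Ck_eq openT _ (CkM openT CA C1)) => z _; rewrite /prim; congr (_ * _).
by apply: eq_rint => v _; rewrite primQ_pr.
Qed.

Lemma derive_prim n (g : 'rV[R]_(1 + n) -> R) z : smooth0 g -> 'D_(pr 1 0) (prim g) z = g z.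
Proof.
move=> sg; have sQ := smooth0_primQ sg.
pose b := z 0 ord0 + r; pose y := rsubmx z : 'rV[R]_n.
pose q v := g (pr (- r + v * b) y); pose q' v := 'D_(pr 1 0) g (pr (- r + v * b) y).
have DQ v : 'D_(pr 0 (pr 1 0)) (primQ g) (pr v z) = v * q' v.
  have [_ E] := derivableZv v (Ck_derivable (sg 1%N) I : derivable g (pr (- r + v * b) y) (pr 1 0)).
  apply: etrans _ E; apply: derive_line => s.
  have -> : s *: pr 0 (pr 1 0) + pr v z = pr v (s *: pr 1 0 + z) :> 'rV[R]_(1 + (1 + n)).
    by rewrite prZ prD mulr0 add0r.
  rewrite primQ_pr; congr (g _); rewrite -{1 2}(pr_eta z) -/y prZ prD pr0 rsubmx_pr.
  rewrite scaler0 add0r !prZ prD !scaler0 add0r; congr pr; rewrite /b; ring.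
have qE : (fun v => primQ g (pr v z)) = q by apply/funext => v; rewrite primQ_pr.
have ccq : cc 0 1 q by rewrite -qE; exact: cc_smooth0.
have cc1 : cc 0 1 (fun v => v * q' v).
  have -> : (fun v => v * q' v) = (fun v => 'D_(pr 0 (pr 1 0)) (primQ g) (pr v z)).
    by apply/funext => v; rewrite DQ.
  exact: cc_smooth0 (smooth0_derive (pr 0 (pr 1 0)) sQ).
have dq v : is_derive v (1 : R) q (q' v * b).
  have [_ E1] := derive_pr (- r + v * b) y sg.
  have D2 : is_derive v (1 : R) (fun v : R => - r + v * b) b.
    have := is_deriveD (is_derive_cst (- r) v (1 : R)) (is_deriveM (is_derive_id v (1 : R)) (is_derive_cst b v (1 : R))).
    rewrite scaler0 add0r add0r => H; apply: (is_derive_eq H).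
    exact: mulr1.
  have H := derivable_comp1 (g := fun t => g (pr t y)) (s := fun v : R => - r + v * b) (x := v) (v := 1)
    (@ex_derive _ _ _ _ _ _ _ (derive_pr (- r + v * b) y sg)) (@ex_derive _ _ _ _ _ _ _ D2).
  apply: (is_derive_eq H); congr (_ * _); first exact: E1.
  exact: (@derive_val _ _ _ _ _ _ _ D2).
have dvq v : is_derive v (1 : R) (fun v => v * q v) (v * (q' v * b) + q v).
  have := is_deriveM (is_derive_id v (1 : R)) (dq v) => H; apply: (is_derive_eq H).
  by congr (_ + _); exact: mulr1.
(* The product rule for [b] times the integral of [q] produces the derivative of [v * q v], whose
   integral is the value of [q] at 1. *)
have FT : rint 0 1 (fun v => b * (v * q' v) + q v) = g z.
  apply: etrans (rint_FTC (F := fun v => v * q v) ltr01 _ _) _.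
  - by apply: ccD => //; apply: ccM => //; exact: cc_cst.
  - by move=> v _; apply: (is_derive_eq (dvq v)); congr (_ + _); ring.
  rewrite mul1r mul0r subr0 /q mul1r /b addrC addrK; congr (g _); exact: pr_eta.
have DP : 'D_(pr 1 0) (fun z => rint 0 1 (fun v => primQ g (pr v z))) z = rint 0 1 (fun v => v * q' v).
  have [_ E] := @rint_param_derive _ (1 + n) setT setT 0 1 openT ltr01 (fun _ _ _ _ => I) (primQ g) z (pr 1 0) (sQ 1%N) I.
  by apply: etrans E _; apply: eq_rint => v _; rewrite DQ.
have CP : Ck 1 setT (fun z : 'rV[R]_(1 + n) => rint 0 1 (fun v => primQ g (pr v z))).
  exact: (@Ck_rint _ (1 + n) setT setT 0 1 openT ltr01 (fun _ _ _ _ => I) 1 (primQ g) sQ).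
have CA := CkD openT (Ck_coord 1 setT (ord0 : 'I_(1 + n))) (Ck_cst 1 setT r).
have DA : 'D_(pr 1 0) (fun z : 'rV[R]_(1 + n) => z 0 ord0 + r) z = 1.
  apply: (@etrans _ _ ('D_1 (fun t : R => t + b) 0)).
    by apply: derive_line => s; rewrite /b mxE mxE pr0 addr0 addrA; congr (_ + _ + _); exact: mulr1.
  by rewrite deriveD// derive_id derive_cst addr0.
have E : 'D_(pr 1 0) (prim g) z = b * rint 0 1 (fun v => v * q' v) + rint 0 1 q * 1.
  have -> : prim g = (fun z => (z 0 ord0 + r) * rint 0 1 (fun v => primQ g (pr v z))).
    by apply/funext => z'; rewrite /prim; congr (_ * _); apply: eq_rint => v _; rewrite primQ_pr.
  have := deriveM (Ck_derivable CA I : derivable (fun z : 'rV[R]_(1 + n) => z 0 ord0 + r) z (pr 1 0)) (Ck_derivable CP I : derivable (fun z : 'rV[R]_(1 + n) => rint 0 1 (fun v => primQ g (pr v z))) z (pr 1 0)).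
  by rewrite DP DA qE.
rewrite E mulr1 -FT rintD//; last by apply: ccM => //; exact: cc_cst.
by rewrite rintZ.
Qed.

(** The primitive starts from 0 at [- r]; a zero integral on each line is what makes it vanish again
    beyond [r]. *)
Lemma csm_prim n (g : 'rV[R]_(1 + n) -> R) : smooth0 g ->
  (forall t y, r <= `|t| \/ r <= `|y| -> g (pr t y) = 0) ->
  (forall y, rint (- r) r (fun t => g (pr t y)) = 0) -> csm r (prim g).
Proof.
move=> sg g0 gi; split=> [|z rz]; first exact: smooth0_prim.
rewrite -(pr_eta z) in rz *; set t := z 0 ord0 in rz *; set y := rsubmx z in rz *.
have sp := smooth0_prim sg.
have d s : is_derive s (1 : R) (fun s => prim g (pr s y)) (g (pr s y)).
  by apply: (is_derive_eq (derive_pr s y sp)); exact: derive_prim.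
have [ry|yr] := leP r `|y|.
  rewrite /prim rsubmx_pr (_ : rint _ _ _ = 0) ?mulr0//.
  by apply: etrans _ (rint0 0 1); apply: eq_rint => v _; apply: g0; right.
have rt : r <= `|t| by rewrite leNgt; apply/negP => tr; move: rz; rewrite leNgt pr_lt.
have [t0|t0] := leP 0 t.
  rewrite ger0_norm// in rt.
  have Pm : prim g (pr (- r) y) = 0 by rewrite /prim pr0 addNr mul0r.
  have Pr : prim g (pr r y) = 0.
    have := rint_FTC (F := fun s => prim g (pr s y)) rr (cc_smooth0 sg) (fun s _ => d s).
    by rewrite gi Pm subr0 => <-.
  have [<-|rt'] := eqVneq r t; first by [].
  have rlt : r < t by rewrite lt_neqAle rt'.
  have := rint_FTC (F := fun s => prim g (pr s y)) rlt (cc_smooth0 sg) (fun s _ => d s).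
  rewrite Pr subr0 => <-; apply: etrans _ (rint0 r t); apply: eq_rint => s /andP[rs _].
  by apply: g0; left; rewrite ger0_norm// (le_trans (ltW r0)).
rewrite /prim rsubmx_pr pr0 (_ : rint _ _ _ = 0) ?mulr0//.
apply: etrans _ (rint0 0 1); apply: eq_rint => v /andP[v0 _]; apply: g0; left.
have tr : t + r <= 0 by move: rt; rewrite ltr0_norm//; lra.
have : v * (t + r) <= 0 by rewrite mulr_ge0_le0.
move=> vt; have H : - r + v * (t + r) <= 0 by rewrite -(addr0 0) lerD// oppr_le0 ltW.
by rewrite ler0_norm// opprD opprK lerDl oppr_ge0.
Qed.

Lemma csm_theta n (w : 'rV[R]_n -> R) : csm r w -> csm r (fun z : 'rV[R]_(1 + n) => theta r (z 0 ord0) * w (rsubmx z)).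
Proof.
move=> [sw w0]; split=> [k|z rz].
  apply: CkM; [exact: openT| |].
    exact: (@Ck_comp1 _ k _ setT setT (theta r) _ openT (fun _ _ => I) (Ck_theta r k) (Ck_coord k setT ord0)).
  exact: (@Ck_comp _ k _ _ setT setT w (fun z : 'rV[R]_(1 + n) => rsubmx z) openT openT (fun _ _ => I) (sw k) (@Ck_rsubmx R n k setT openT)).
rewrite -(pr_eta z) in rz; have [ry|yr] := leP r `|rsubmx z : 'rV[R]_n|; first by rewrite w0 ?mulr0.
rewrite theta0 ?mul0r// leNgt; apply/negP => tr; move: rz; rewrite leNgt pr_lt//.
Qed.

(** Poincare lemma with compact supports in top degree. After subtracting [theta] times the integral
    over the first coordinate, the remainder has zero integral on each line and is a derivative in
    that coordinate; the subtracted part is treated by induction. *)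
Lemma csm_decomp n (f : 'rV[R]_n -> R) : csm r f ->
  exists w : 'I_n -> 'rV[R]_n -> R, (forall j, csm r (w j)) /\
    forall y, f y = jint r f * chi r y + \sum_j 'D_(er j) (w j) y.
Proof.
elim: n f => [|n IH] f cf.
  exists (fun _ _ => 0); split; first by case.
  by move=> y; rewrite big_ord0 addr0 /chi big_ord0 mulr1 /= [y]thinmx0.
pose F (y : 'rV[R]_n) := rint (- r) r (fun t => f (pr t y)).
have cF : csm r F := csm_rint r0 cf.
have [w [cw wE]] := IH F cF.
have ctF := csm_theta cF.
pose g (z : 'rV[R]_(1 + n)) := (-1) * (theta r (z 0 ord0) * F (rsubmx z)) + f z.
have cg : csm r g := csm_lin (-1) ctF cf.
have gE t y : g (pr t y) = (-1) * (theta r t * F y) + f (pr t y) by rewrite /g pr0 rsubmx_pr.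
have g0 t y : r <= `|t| \/ r <= `|y| -> g (pr t y) = 0.
  by have [P1 P2] := pr_norm t y; move=> [rt|ry]; apply: cg.2; [exact: le_trans P1|exact: le_trans P2].
have gi y : rint (- r) r (fun t => g (pr t y)) = 0.
  have -> : (fun t => g (pr t y)) = (fun t => (-1) * (theta r t * F y) + f (pr t y)) by apply/funext => t.
  have c1 : cc (- r) r (fun t => theta r t * F y).
    by apply: ccM; [move=> t _; exact: Ck_continuous (Ck_theta r 0) I|exact: cc_cst].
  have c2 : cc (- r) r (fun t => f (pr t y)) by exact: cc_smooth0 cf.1.
  rewrite rintD//; last by apply: ccM => //; exact: cc_cst.
  by rewrite rintZ// rint_thetaM mulN1r addNr.
have cW := csm_prim cg.1 g0 gi.
exists (fun j => if unlift ord0 j is Some c then (fun z : 'rV[R]_(1 + n) => theta r (z 0 ord0) * w c (rsubmx z)) else prim g).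
split=> [j|z0].
  by case: (unliftP ord0 j) => [c _|_]; [exact: csm_theta|exact: cW].
have [z ->] : exists z : 'rV[R]_(1 + n), z0 = z by exists z0.
rewrite big_ord_recl unlift_none.
have E0 : 'D_(er ord0) (prim g) z = g z by rewrite -[er ord0]/(er (ord0 : 'I_(1 + n))) er_ord0 derive_prim//; exact: cg.1.
have Ec c : 'D_(er (lift ord0 c)) (fun z : 'rV[R]_(1 + n) => theta r (z 0 ord0) * w c (rsubmx z)) z =
    theta r (z 0 ord0) * 'D_(er c) (w c) (rsubmx z).
  have [_ <-] := @is_derive_scale _ _ (w c) (theta r (z 0 ord0)) (rsubmx z) (er c) (Ck_derivable ((cw c).1 1%N) I).
  apply: derive_line => s; rewrite -[er (lift ord0 c)]/(er (lift ord0 c : 'I_(1 + n))) er_lift prZ mulr0.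
  by rewrite -{1 2}(pr_eta z) prD pr0 rsubmx_pr add0r.
rewrite (eq_bigr (fun c => theta r (z 0 ord0) * 'D_(er c) (w c) (rsubmx z))); last first.
  by move=> c _; rewrite liftK Ec.
have chz : chi r z = theta r (z 0 ord0) * chi r (rsubmx z : 'rV[R]_n) by rewrite -{1}(pr_eta z) chi_pr.
rewrite E0 -mulr_sumr chz /g (wE (rsubmx z)) -[jint r f]/(jint r F); ring.
Qed.

(** Outside the closed ball the derivative vanishes because the function does; at [|y| = r] it is a
    limit of such values. *)
Lemma csm_derive n (w : 'rV[R]_n -> R) v : csm r w -> csm r ('D_v w).
Proof.
move=> [sw w0]; split=> [|y ry]; first exact: smooth0_derive.
have O0 z : r < `|z| -> 'D_v w z = 0.
  move=> rz; exact: (@derive_supp0 n w [set y | r < `|y|] v z (@open_norm_gt n r) rz (fun u ru => w0 u (ltW ru))).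
apply/eqP/negPn/negP => n0; have e0 : 0 < `|'D_v w y| by rewrite normr_gt0.
have [d d0 H] := continuous_ball (Ck_continuous (smooth0_derive v sw 0) I : {for y, continuous ('D_v w)}) e0.
have y0 : 0 < `|y| := lt_le_trans r0 ry.
pose c := d / 2 / `|y|; have c0 : 0 < c by rewrite !divr_gt0.
have := H ((1 + c) *: y); rewrite (O0 ((1 + c) *: y)); last first.
  by rewrite normrZ ger0_norm ?addr_ge0// ?ltW// mulrDl mul1r (le_lt_trans ry)// ltrDl mulr_gt0.
rewrite subr0 ltxx mx_ballE scalerDl scale1r opprD addrA subrr add0r normrN normrZ gtr0_norm//.
move=> Hc; suff : false by [].
by apply: Hc; rewrite /c divfK ?gt_eqF// ltr_pdivrMr// ltr_pMr// ltr1n.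
Qed.

Lemma csm_cst0 n : csm r (fun _ : 'rV[R]_n => 0).
Proof. by split=> //; exact: smooth0_cst. Qed.

(** A linear functional that kills partial derivatives is determined by its value on [chi]. This
    single fact stands in for Fubini's theorem, for linear changes of variables preserving [chi] and
    for the line of top cohomology. *)
Lemma csm_functional n (L : ('rV[R]_n -> R) -> R) :
  (forall a f g, csm r f -> csm r g -> L (fun y => a * f y + g y) = a * L f + L g) ->
  (forall j w, csm r w -> L ('D_(er j) w) = 0) ->
  forall f, csm r f -> L f = jint r f * L (chi r (n := n)).
Proof.
move=> Ll Ld f cf; have [w [cw fE]] := csm_decomp cf.
have L0 : L (fun=> 0) = 0.
  have := Ll (-1) _ _ (csm_cst0 n) (csm_cst0 n).
  rewrite (_ : (fun _ => _) = (fun _ : 'rV[R]_n => 0)); first by rewrite mulN1r addNr.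
  by apply/funext => y; rewrite mulr0 addr0.
have [cs Ls] : csm r (fun y => \sum_j 'D_(er j) (w j) y) /\ L (fun y => \sum_j 'D_(er j) (w j) y) = 0.
  elim: (index_enum _) => [|j s [IH1 IH2]].
    rewrite (_ : (fun _ => _) = (fun _ : 'rV[R]_n => 0)); first by split=> //; exact: csm_cst0.
    by apply/funext => y; rewrite big_nil.
  have -> : (fun y => \sum_(i <- j :: s) 'D_(er i) (w i) y) = (fun y => 1 * 'D_(er j) (w j) y + \sum_(i <- s) 'D_(er i) (w i) y).
    by apply/funext => y; rewrite big_cons mul1r.
  have cD := csm_derive (er j) (cw j).
  by split; [exact: csm_lin|rewrite Ll// IH2 Ld// mulr0 addr0].
have -> : f = (fun y => jint r f * chi r y + \sum_j 'D_(er j) (w j) y) by apply/funext.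
by rewrite Ll ?Ls ?addr0 -?fE//; [congr (jint r _ * _); apply/funext|exact: csm_chi].
Qed.

(** A parameter has to be moved past the innermost integration variable before one can differentiate
    under that integral. *)
Definition swapG n (f : 'rV[R]_(1 + (1 + n)) -> R) (u : 'rV[R]_(1 + (1 + n))) : R :=
  f (pr ((rsubmx u : 'rV[R]_(1 + n)) 0 ord0) (pr (u 0 ord0) (rsubmx (rsubmx u : 'rV[R]_(1 + n))))).

Lemma swapG_pr n (f : 'rV[R]_(1 + (1 + n)) -> R) s t y : swapG f (pr s (pr t y)) = f (pr t (pr s y)).
Proof. by rewrite /swapG rsubmx_pr !pr0 rsubmx_pr. Qed.

Lemma smooth0_swapG n (f : 'rV[R]_(1 + (1 + n)) -> R) : smooth0 f -> smooth0 (swapG f).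
Proof.
move=> sf k; have C0 : Ck k setT (fun u : 'rV[R]_(1 + (1 + n)) => (rsubmx u : 'rV[R]_(1 + n)) 0 ord0).
  exact: (Ck_mx _ _ openT).1 (@Ck_rsubmx R (1 + n) k setT openT) 0 ord0.
have C1 : Ck k setT (fun u : 'rV[R]_(1 + (1 + n)) => rsubmx (rsubmx u : 'rV[R]_(1 + n)) : 'rV[R]_n).
  exact: (@Ck_comp_mx _ k _ _ _ _ setT setT (fun z : 'rV[R]_(1 + n) => rsubmx z : 'rV[R]_n) (fun u => rsubmx u) openT openT (fun _ _ => I) (@Ck_rsubmx R n k setT openT) (@Ck_rsubmx R (1 + n) k setT openT)).
have C2 := Ck_prs C0 (Ck_prs (Ck_coord k setT ord0) C1).
exact: (@Ck_comp _ k _ _ setT setT f _ openT openT (fun _ _ => I) (sf k) C2).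
Qed.

Lemma jint_param n (f : 'rV[R]_(1 + n) -> R) t : smooth0 f ->
  is_derive t (1 : R) (fun t => jint r (fun y => f (pr t y))) (jint r (fun y => 'D_(pr 1 0) f (pr t y))).
Proof.
elim: n f t => [|n IH] f t sf; first exact: derive_pr.
have sG := smooth0_swapG sf; have sF := smooth0_rint r0 sG.
have E s : jint r (fun y => f (pr s y)) = jint r (fun y => rint (- r) r (fun u => swapG f (pr u (pr s y)))).
  rewrite /=; congr (jint r _); apply/funext => y; apply: eq_rint => u _.
  by rewrite swapG_pr.
have -> : (fun t => jint r (fun y => f (pr t y))) = (fun t => jint r (fun y => rint (- r) r (fun u => swapG f (pr u (pr t y))))).
  by apply/funext => s; rewrite E.
apply: (is_derive_eq (IH _ t sF)); rewrite /=; congr (jint r _); apply/funext => y.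
apply: etrans (derive_rint r0 (pr t y) (pr 1 0) sG) _; apply: eq_rint => u _.
apply: derive_line => s; rewrite !prZ !prD !mulr0 !scaler0 !add0r mulr1.
by rewrite swapG_pr.
Qed.

Lemma csm_slice n (f : 'rV[R]_(1 + n) -> R) t : csm r f -> csm r (fun y => f (pr t y)).
Proof.
move=> [sf f0]; split=> [k|y ry].
  exact: (@Ck_comp _ k _ _ setT setT f _ openT openT (fun _ _ => I) (sf k) (Ck_prs (Ck_cst k setT t) (@Ck_id _ k _ setT))).
by apply: f0; rewrite (le_trans ry)//; case: (pr_norm t y).
Qed.

Lemma Rint_supp (g : R -> R) : (forall t, r <= `|t| -> g t = 0) -> \int[lebesgue_measure]_t g t = rint (- r) r g.
Proof.
move=> g0; rewrite /rint [RHS]Rintegral_mkcond; congr (Rintegral _ _ _); apply/funext => t.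
rewrite patchE; case: ifPn => //; rewrite notin_setE /= in_itv/= => /negP.
by rewrite -ler_norml -ltNge => /ltW; exact: g0.
Qed.

(** The two orders of integration are compared without Fubini: integrating the first coordinate last
    also kills partial derivatives and gives 1 on [chi]. *)
Lemma integral_rV_jint n (f : 'rV[R]_n -> R) : csm r f -> integral_rV f = jint r f.
Proof.
elim: n f => [//|n IH] f cf.
have cS g t : csm r g -> csm r (fun y : 'rV[R]_n => g (pr t y)) by exact: csm_slice.
pose T g t := jint r (fun y : 'rV[R]_n => g (pr t y)).
have -> : integral_rV f = rint (- r) r (T f).
  rewrite -Rint_supp => [|t rt].
    by rewrite /=; congr (Rintegral _ _ _); apply/funext => t; rewrite IH//; exact: cS.
  rewrite -[RHS](jint_cst0 n); congr (jint r _); apply/funext => y.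
  by apply: cf.2; rewrite (le_trans rt)//; case: (pr_norm t y).
have ccT g : csm r g -> cc (- r) r (T g).
  move=> [sg _] t _; have [d _] := jint_param t sg.
  by apply: differentiable_continuous; apply/derivable1_diffP.
have := @csm_functional n.+1 (fun g => rint (- r) r (T g)) _ _ f cf; rewrite /= => ->.
- rewrite [X in _ * X](_ : _ = 1) ?mulr1//.
  rewrite -(rint_theta r0); apply: eq_rint => t _; rewrite /T.
  rewrite -[RHS]mulr1 -(jint_chi n).
  have := jint_lin (theta r t) (@smooth0_chi n r) (@smooth0_cst n 0); rewrite jint_cst0 addr0 => <-.
  by congr (jint r _); apply/funext => y; rewrite chi_pr addr0.
- move=> a g h cg ch; rewrite -rintZ; last exact: ccT.
  rewrite -rintD; [|by apply: ccM; [exact: cc_cst|exact: ccT]|exact: ccT].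
  apply: eq_rint => t _; rewrite /T -jint_lin//; first exact: (cS g t cg).1.
  exact: (cS h t ch).1.
move=> j w cw; case: (unliftP ord0 j) => [c ->|->].
  apply: etrans _ (rint0 (- r) r); apply: eq_rint => t _; rewrite /T.
  rewrite -(jint_derive c (cS w t cw)); congr (jint r _); apply/funext => y.
  rewrite -[er (lift ord0 c)]/(er (lift ord0 c : 'I_(1 + n))) er_lift.
  by apply: derive_line => s; rewrite prZ prD mulr0 add0r.
have Tw0 t : r <= `|t| -> T w t = 0.
  move=> rt; rewrite -(jint_cst0 n); congr (jint r _); apply/funext => y.
  by apply: cw.2; rewrite (le_trans rt)//; case: (pr_norm t y).
apply: etrans (rint_FTC (F := T w) rr _ _) _.
- exact: ccT (csm_derive _ cw).
- move=> t _; apply: (is_derive_eq (jint_param t cw.1)); rewrite /T.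
  by rewrite -[er ord0]/(er (ord0 : 'I_(1 + n))) er_ord0.
by rewrite !Tw0 ?subrr// ?normrN gtr0_norm.
Qed.

End JInt.

End IteratedIntegral.

(** * Stokes' formula in R^n and homotopy invariance of the integral *)

Section CompactlySupported.
Context {R : realType}.

Definition csmc n (f : 'rV[R]_n -> R) := exists2 r, 0 < r & csm r f.

Lemma csm_mono n (f : 'rV[R]_n -> R) r r' : r <= r' -> csm r f -> csm r' f.
Proof. by move=> rr [sf f0]; split=> // y ry; apply: f0; exact: le_trans ry. Qed.

Lemma csmc2 n (f g : 'rV[R]_n -> R) : csmc f -> csmc g -> exists r, [/\ 0 < r, csm r f & csm r g].
Proof.
move=> [r r0 cf] [r' r'0 cg]; exists (Num.max r r'); split; first by rewrite lt_max r0.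
  by apply: csm_mono cf; rewrite le_max lexx.
by apply: csm_mono cg; rewrite le_max lexx orbT.
Qed.

Lemma csmc_lin n a (f g : 'rV[R]_n -> R) : csmc f -> csmc g -> csmc (fun y => a * f y + g y).
Proof. by move=> cf cg; have [r [r0 cf' cg']] := csmc2 cf cg; exists r => //; exact: csm_lin. Qed.

Lemma integral_lin n a (f g : 'rV[R]_n -> R) : csmc f -> csmc g ->
  integral_rV (fun y => a * f y + g y) = a * integral_rV f + integral_rV g.
Proof.
move=> cf cg; have [r [r0 cf' cg']] := csmc2 cf cg.
rewrite !(integral_rV_jint r0) ?(jint_lin r0)//; [exact: cf'.1|exact: cg'.1|exact: csm_lin].
Qed.

Lemma integral_le n (f g : 'rV[R]_n -> R) : csmc f -> csmc g -> (forall y, f y <= g y) ->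
  integral_rV f <= integral_rV g.
Proof.
move=> cf cg fg; have [r [r0 cf' cg']] := csmc2 cf cg.
rewrite !(integral_rV_jint r0)//; apply: (jint_le r0) => //; [exact: cf'.1|exact: cg'.1].
Qed.

Lemma csmc_cst0 n : csmc (fun _ : 'rV[R]_n => 0).
Proof. by exists 1 => //; exact: csm_cst0. Qed.

Lemma integral_cst0 n : integral_rV (fun _ : 'rV[R]_n => 0) = 0.
Proof. by rewrite (integral_rV_jint ltr01) ?(jint_cst0 ltr01)//; exact: csm_cst0. Qed.

Lemma csmc_derive n v (f : 'rV[R]_n -> R) : csmc f -> csmc ('D_v f).
Proof. by move=> [r r0 cf]; exists r => //; exact: csm_derive. Qed.

Lemma integral_derive n j (f : 'rV[R]_n -> R) : csmc f -> integral_rV ('D_(er j) f) = 0.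
Proof.
by move=> [r r0 cf]; rewrite (integral_rV_jint r0) ?(jint_derive r0)//; exact: csm_derive.
Qed.

Lemma csmc_sum n (I : eqType) (s : seq I) (f : I -> 'rV[R]_n -> R) : (forall i, i \in s -> csmc (f i)) ->
  csmc (fun y => \sum_(i <- s) f i y) /\
  integral_rV (fun y => \sum_(i <- s) f i y) = \sum_(i <- s) integral_rV (f i).
Proof.
elim: s => [|i s IH] cf.
  rewrite big_nil (_ : (fun _ => _) = (fun=> 0)); first by split; [exact: csmc_cst0|exact: integral_cst0].
  by apply/funext => y; rewrite big_nil.
have [IH1 IH2] := IH (fun j js => cf j (mem_behead (s := i :: s) js)).
have -> : (fun y => \sum_(j <- i :: s) f j y) = (fun y => 1 * f i y + \sum_(j <- s) f j y).
  by apply/funext => y; rewrite big_cons mul1r.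
have ci := cf i (mem_head _ _).
by split; [exact: csmc_lin|rewrite integral_lin// IH2 big_cons mul1r].
Qed.

Lemma csmc_functional n (L : ('rV[R]_n -> R) -> R) :
  (forall a f g, csmc f -> csmc g -> L (fun y => a * f y + g y) = a * L f + L g) ->
  (forall j w, csmc w -> L ('D_(er j) w) = 0) ->
  forall f r, 0 < r -> csm r f -> L f = integral_rV f * L (chi r (n := n)).
Proof.
move=> Ll Ld f r r0 cf; rewrite (integral_rV_jint r0)//; apply: (csm_functional r0) => //.
  by move=> a g h cg ch; apply: Ll; exists r.
by move=> j w cw; apply: Ld; exists r.
Qed.

Lemma csm_patch n (g : 'rV[R]_n -> R) (U K : set 'rV[R]_n) : open U -> (forall k, Ck k U g) ->
  compact K -> K `<=` U -> (forall y, U y -> ~ K y -> g y = 0) -> csmc (g \_ U).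
Proof.
move=> oU Cg cK KU g0.
have [r r0 Kr] := @compact_bound _ _ K (fun y : 'rV[R]_n => `|y|) cK (fun y _ => @norm_continuous _ _ y).
have z y : ~ K y -> (g \_ U) y = 0.
  by move=> nK; rewrite patchE; case: ifPn => //; rewrite inE => Uy; exact: g0.
exists (r + 1); first by rewrite addr_gt0.
split=> [k|y ry]; last first.
  apply: z => Ky; have := Kr y Ky; rewrite normr_id => yr.
  by move: ry; rewrite leNgt (le_lt_trans yr)// ltrDl.
apply: Ck_local => y _; have [Ky|nK] := pselect (K y).
  exists U; split; first exact: KU.
  by apply: (Ck_eq oU _ (Cg k)) => u Uu; rewrite patchE mem_set.
have oK : open (~` K) by apply: closed_openC; apply: compact_closed cK; exact: norm_hausdorff.
exists (~` K); split=> //; apply: (Ck_eq oK _ (Ck_cst k _ 0)) => u nu; by rewrite z.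
Qed.

Lemma patch_comb (T : Type) (U : set T) (a b c : T -> R) : (forall y, U y -> a y = - b y + c y) ->
  a \_ U = (fun y => -1 * (b \_ U) y + (c \_ U) y).
Proof.
move=> abc; apply/funext => y; rewrite !patchE; case: ifPn => [|_]; last by rewrite mulr0 addr0.
by rewrite inE mulN1r; exact: abc.
Qed.

(** Each term is, up to sign, a partial derivative of a compactly supported function; the support
    condition makes this true on all of R^n after extension by zero. *)
Lemma integral_fd k (U K : set 'rV[R]_k.+1) (w : 'rV[R]_k.+1 -> 'M[R]_(k, k.+1) -> R) : open U -> compact K -> K `<=` U ->
  fform U w -> (forall y E, U y -> ~ K y -> w y E = 0) ->
  csmc ((fun y => fd w y 1%:M) \_ U) /\ integral_rV ((fun y => fd w y 1%:M) \_ U) = 0.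
Proof.
move=> oU cK KU fw w0.
pose w1 E := (fun y => w y E) \_ U.
have cw E : csmc (w1 E) by apply: (csm_patch oU) cK KU _ => [j|y]; [exact: fform_Ck fw|exact: w0].
have oK : open (~` K) by apply: closed_openC; apply: compact_closed cK; exact: norm_hausdorff.
have E1 : (fun y => fd w y 1%:M) \_ U = (fun y => \sum_(i < k.+1) (-1) ^+ i * 'D_(er i) (w1 (row' i 1%:M)) y).
  apply/funext => y; rewrite patchE; case: ifPn => [|].
    rewrite inE => Uy; apply: eq_bigr => i _; congr (_ * _); rewrite row1.
    by apply: (derive_nearE _ oU Uy) => u Uu; rewrite /w1 patchE mem_set.
  rewrite notin_setE => nU; rewrite big1// => i _.
  have nK : (~` K) y by move=> /KU.
  rewrite (derive_supp0 (er i) oK nK) ?mulr0// => u nu; rewrite /w1 patchE.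
  by case: ifPn => //; rewrite inE => Uu; exact: w0.
have cD (i : 'I_k.+1) : csmc (fun y => (-1) ^+ i * 'D_(er i) (w1 (row' i 1%:M)) y).
  have := csmc_lin ((-1) ^+ i) (csmc_derive (er i) (cw (row' i 1%:M))) (csmc_cst0 k.+1).
  by rewrite (_ : (fun _ => _) = (fun y => (-1) ^+ i * 'D_(er i) (w1 (row' i 1%:M)) y))//; apply/funext => y; rewrite addr0.
rewrite E1; have [H1 H2] := @csmc_sum _ 'I_k.+1 (index_enum 'I_k.+1) _ (fun i _ => cD i); split=> //.
rewrite H2 big1// => i _.
have := integral_lin ((-1) ^+ i) (csmc_derive (er i) (cw (row' i 1%:M))) (csmc_cst0 k.+1).
rewrite (_ : (fun _ => _) = (fun y => (-1) ^+ i * 'D_(er i) (w1 (row' i 1%:M)) y)).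
  by move=> ->; rewrite integral_derive// mulr0 integral_cst0 addr0.
by apply/funext => y; rewrite addr0.
Qed.

Lemma multilinear_det n : multilinear (fun E : 'M[R]_n => \det E).
Proof. by move=> i A B C b c rA rB rC; apply: (determinant_multilinear (i0 := i)). Qed.

Lemma alternating_det n : alternating (fun E : 'M[R]_n => \det E).
Proof.
move=> A i j ij rij; apply: (determinant_alternate ij) => l.
by have := congr1 (fun v : 'rV[R]_n => v 0 l) rij; rewrite !mxE.
Qed.

Lemma fform_top n (U : set 'rV[R]_n) (f : 'rV[R]_n -> R) : open U -> (forall k, Ck k U f) ->
  fform U (fun y (E : 'M[R]_n) => f y * \det E).
Proof.
move=> oU Cf; apply: (@fform_scale _ _ _ U f (fun _ E => \det E)) => //.
split=> [y _|y _|E j]; [exact: multilinear_det|exact: alternating_det|exact: Ck_cst].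
Qed.

Lemma alternating_high k n (a : 'M[R]_(k, n) -> R) E : (n < k)%N -> multilinear a -> alternating a -> a E = 0.
Proof.
move=> nk ma aa; rewrite (multilinear_expand _ ma) /mexp big1// => J _.
have /injectivePn[i [j ij Jij]] : ~~ injectiveb J.
  by apply/injectiveP => Jinj; have := leq_card J Jinj; rewrite !card_ord leqNgt nk.
rewrite (aa (deltaI J) i j ij) ?mulr0//.
by apply/rowP => c; rewrite !mxE Jij.
Qed.

(** The integrand is the coefficient of the pullback of the top form [w]. The differential of a top
    form vanishes, so the homotopy formula exhibits the difference of the two ends as exact, with
    support in [K]. *)
Lemma integral_homotopy k (U K : set 'rV[R]_k.+1) (W : set 'rV[R]_(1 + k.+1)) (h : 'rV[R]_(1 + k.+1) -> 'rV[R]_k.+1)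
    (f : 'rV[R]_k.+1 -> R) : open U -> open W -> (forall t y, 0 <= t <= 1 -> U y -> W (pr t y)) ->
  (forall j, Ck j W h) -> smooth0 f -> compact K -> K `<=` U ->
  (forall t y, 0 <= t <= 1 -> U y -> ~ K y -> f (h (pr t y)) = 0) ->
  forall t, (t = 0 \/ t = 1) ->
  csmc ((fun y => f (h (pr t y)) * \det (jacobian (h \o pr t) y)) \_ U) /\
  integral_rV ((fun y => f (h (pr t y)) * \det (jacobian (h \o pr t) y)) \_ U) =
  integral_rV ((fun y => f (h (pr 0 y)) * \det (jacobian (h \o pr 0) y)) \_ U).
Proof.
move=> oU oW UW Ch sf cK KU f0.
pose w (y : 'rV[R]_k.+1) (E : 'M[R]_k.+1) := f y * \det E.
have fw : fform setT w by apply: fform_top => //; exact: openT.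
pose phi t y := f (h (pr t y)) * \det (jacobian (h \o pr t) y).
have phiE t y : fpull (h \o pr t) w y 1%:M = phi t y by rewrite /fpull mul1mx.
have WT z : W z -> [set: 'rV[R]_k.+1] (h z) by [].
have CP t j : 0 <= t <= 1 -> Ck j U (phi t).
  move=> t01; have Cht i : Ck i U (h \o pr t).
    exact: (@Ck_comp_mx _ i _ _ _ _ U W h (pr t) oU oW (fun y => UW t y t01) (Ch i) (@Ck_pr _ _ U oU i t)).
  have fp := fpull_fform oU openT (fun _ _ => I) Cht fw.
  by apply: (Ck_eq oU _ (fform_Ck j 1%:M fp)) => y _; rewrite phiE.
have Z t y : 0 <= t <= 1 -> U y -> ~ K y -> phi t y = 0.
  by move=> t01 Uy nK; rewrite /phi f0// mul0r.
have t0 : 0 <= (0 : R) <= 1 by rewrite lexx ler01.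
have t1 : 0 <= (1 : R) <= 1 by rewrite lexx ler01.
have c t : 0 <= t <= 1 -> csmc (phi t \_ U).
  by move=> t01; apply: (csm_patch oU) cK KU _ => [j|y]; [exact: CP|exact: Z].
move=> t tt; have t01 : 0 <= t <= 1 by case: tt => ->.
split; first exact: c.
case: tt => ->; first reflexivity.
pose eta := @hop R k.+1 k k.+1 h w.
have feta : fform U eta := hop_fform oU oW UW openT WT Ch fw.
have eta0 y E : U y -> ~ K y -> eta y E = 0.
  move=> Uy nK; apply: etrans _ (rint0 0 1); apply: eq_rint => s s01.
  by rewrite /fpull /w f0// mul0r.
have [_ I0] := integral_fd oU cK KU feta eta0.
have E : (fun y => fd eta y 1%:M) \_ U = (fun y => (-1) * (phi 0 \_ U) y + (phi 1 \_ U) y).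
  apply: patch_comb => y Uy.
  have := hop_formula oU oW UW openT WT Ch 1%:M fw Uy.
  have -> : @hop R k.+1 k.+1 k.+1 h (fd w) y 1%:M = 0.
    apply: etrans _ (rint0 0 1); apply: eq_rint => s s01; rewrite /fpull.
    exact: (alternating_high _ (ltnSn _) (fd_multilinear openT I fw) (fd_alternating openT I fw)).
  by rewrite addr0 !phiE => ->; rewrite addrC.
move: I0; rewrite E integral_lin; [|exact: c|exact: c].
by move=> /eqP; rewrite mulN1r addrC subr_eq0 => /eqP.
Qed.

Lemma integral_homotopy_eq k (U K : set 'rV[R]_k.+1) (W : set 'rV[R]_(1 + k.+1)) (h : 'rV[R]_(1 + k.+1) -> 'rV[R]_k.+1)
    (f : 'rV[R]_k.+1 -> R) (a : R -> 'rV[R]_k.+1 -> R) : open U -> open W -> (forall t y, 0 <= t <= 1 -> U y -> W (pr t y)) ->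
  (forall j, Ck j W h) -> smooth0 f -> compact K -> K `<=` U ->
  (forall t y, 0 <= t <= 1 -> U y -> ~ K y -> f (h (pr t y)) = 0) ->
  (forall t y, (t = 0 \/ t = 1) -> U y -> a t y = f (h (pr t y)) * \det (jacobian (h \o pr t) y)) ->
  (forall t y, (t = 0 \/ t = 1) -> ~ U y -> a t y = 0) ->
  csmc (a 1) /\ integral_rV (a 1) = integral_rV (a 0).
Proof.
move=> oU oW UW Ch sf cK KU f0 aU aN.
have E t : (t = 0 \/ t = 1) -> (fun y => f (h (pr t y)) * \det (jacobian (h \o pr t) y)) \_ U = a t.
  move=> tt; apply/funext => y; rewrite patchE; case: ifPn => [|]; last by rewrite notin_setE => nU; rewrite aN.
  by rewrite inE => Uy; rewrite aU.
have [H1 H2] := integral_homotopy oU oW UW Ch sf cK KU f0 (or_intror (erefl 1)).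
split; first by rewrite -(E 1 (or_intror erefl)).
by apply: etrans (etrans _ H2) _; [rewrite (E 1 (or_intror erefl))|rewrite (E 0 (or_introl erefl))].
Qed.

End CompactlySupported.

(** * Linear and local changes of variables *)

Section LinearChange.
Context {R : realType}.

Lemma Ck_scalemx k (V : normedModType R) m n (U : set V) (a : V -> R) (F : V -> 'M[R]_(m, n)) :
  open U -> Ck k U a -> Ck k U F -> Ck k U (fun x => a x *: F x).
Proof.
move=> oU Ca CF; apply/(Ck_mx _ _ oU) => i j.
by apply: (Ck_eq oU _ (CkM oU Ca ((Ck_mx _ _ oU).1 CF i j))) => z _; rewrite mxE.
Qed.

Lemma csmc_mulmx n (A : 'M[R]_n) f : A \in unitmx -> csmc f -> csmc (fun y => f (y *m A)).
Proof.
move=> uA [r r0 [sf f0]].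
have sA j : Ck j setT (fun y : 'rV[R]_n => y *m A) by apply: Ck_mulmx; [exact: openT|exact: Ck_id|exact: Ck_cst].
pose c := n%:R * `|invmx A|; have c0 : 0 <= c by rewrite mulr_ge0.
exists (c * r + 1); first by rewrite ltr_wpDl// mulr_ge0// ltW.
split=> [j|y ry]; first exact: (@Ck_comp R j _ _ _ setT f _ openT openT (fun _ _ => I) (sf j) (sA j)).
apply: f0; rewrite leNgt; apply/negP => yA.
move: ry; rewrite leNgt => /negP; apply.
rewrite -(mulmxK uA y); apply: le_lt_trans (mulmx_bound _ _) _.
by apply: (@le_lt_trans _ _ (c * r)); [rewrite ler_wpM2l// ltW|rewrite ltrDl].
Qed.

Lemma integral_deriveE n v (f : 'rV[R]_n -> R) : csmc f -> integral_rV ('D_v f) = 0.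
Proof.
move=> cf; have [r r0 [sf _]] := cf.
have -> : 'D_v f = (fun y => \sum_j (v 0 j * 'D_(er j) f y + 0)).
  by apply/funext => y; rewrite (C1_deriveE v openT (sf 1%N) I); apply: eq_bigr => j _; rewrite addr0.
have c j := csmc_lin (v 0 j) (csmc_derive (er j) cf) (csmc_cst0 n).
have [_ ->] := @csmc_sum _ _ 'I_n (index_enum 'I_n) _ (fun i _ => c i); rewrite big1// => j _.
by rewrite (integral_lin _ (csmc_derive (er j) cf) (csmc_cst0 n)) integral_derive// integral_cst0 mulr0 addr0.
Qed.

Definition scales_integral n (A : 'M[R]_n) := A \in unitmx /\
  forall f, csmc f -> `|\det A| * integral_rV (fun y => f (y *m A)) = integral_rV f.

Lemma scales_integral_mul n (A B : 'M[R]_n) : scales_integral A -> scales_integral B -> scales_integral (A *m B).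
Proof.
move=> [uA IA] [uB IB]; split=> [|f cf]; first by rewrite unitmx_mul uA.
rewrite det_mulmx normrM -(IB f cf) -(IA _ (csmc_mulmx uB cf)) mulrCA mulrA.
by congr (_ * integral_rV _); apply/funext => y; rewrite mulmxA.
Qed.

Lemma scales_integral_inv n (A : 'M[R]_n) : scales_integral A -> scales_integral (invmx A).
Proof.
move=> [uA IA]; have uV : invmx A \in unitmx by rewrite unitmx_inv.
split=> // f cf; rewrite -(IA _ (csmc_mulmx uV cf)) mulrA det_inv normfV mulVf ?mul1r.
  by congr integral_rV; apply/funext => y; rewrite mulmxK.
by rewrite normr_eq0 -unitfE -unitmxE.
Qed.

(* By [csmc_functional] it suffices to test one function, [chi]. *)
Lemma scales_integral_chi n (A : 'M[R]_n) : `|\det A| = 1 ->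
  (forall r y, chi r (y *m A) = chi r y) -> scales_integral A.
Proof.
move=> dA chA; have uA : A \in unitmx by rewrite unitmxE unitfE -normr_eq0 dA oner_eq0.
split=> // f [r r0 cf]; rewrite dA mul1r.
have := csmc_functional (L := fun f => integral_rV (fun y => f (y *m A))) _ _ r0 cf.
rewrite (_ : (fun y => chi r (y *m A)) = chi r (n := n)); last by apply/funext => y.
rewrite (integral_rV_jint r0 (csm_chi (n := n) r0)) (jint_chi r0) mulr1; apply.
- by move=> a g h cg ch; exact: (integral_lin a (csmc_mulmx uA cg) (csmc_mulmx uA ch)).
- move=> j w cw; rewrite (_ : (fun y => _) = 'D_(er j *m invmx A) (fun y => w (y *m A))).
    by apply: integral_deriveE; exact: csmc_mulmx.
  apply/funext => y; apply/esym; apply: derive_line => s.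
  by rewrite mulmxDl -scalemxAl mulmxKV.
Qed.

Lemma scales_integral_perm n (s : 'S_n) : scales_integral (perm_mx s : 'M[R]_n).
Proof.
apply: scales_integral_chi => [|r y]; first by rewrite det_perm normrX normrN1 expr1n.
rewrite -[s]invgK -col_permE /chi (reindex_inj (@perm_inj _ s)); apply: eq_bigr => j _.
by rewrite !mxE permK.
Qed.

Lemma scales_integral_sign n (d : 'rV[R]_n) : (forall j, `|d 0 j| = 1) -> scales_integral (diag_mx d).
Proof.
move=> d1; apply: scales_integral_chi => [|r y].
  by rewrite det_diag normr_prod big1.
rewrite mul_mx_diag /chi; apply: eq_bigr => j _; rewrite !mxE.
have /eqP := d1 j; rewrite eqr_norml => /andP[/orP[]/eqP -> _]; first by rewrite mulr1.
by rewrite mulrN1 thetaN.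
Qed.

(** Homotopy invariance along the segment from the identity to [A]. The inverse matrices are bounded
    on the segment, so the supports stay in a fixed compact set. *)
Lemma scales_integral_path k (A : 'M[R]_k.+1) :
  (forall t, 0 <= t <= 1 -> 0 < \det (1%:M + t *: (A - 1%:M))) -> scales_integral A.
Proof.
move=> dA; pose B t := 1%:M + t *: (A - 1%:M).
have B1 : B 1 = A by rewrite /B scale1r addrC subrK.
have B0 : B 0 = 1%:M by rewrite /B scale0r addr0.
have dA1 : 0 < \det A by have := dA 1; rewrite -/(B 1) B1; apply; rewrite ler01 lexx.
have uA : A \in unitmx by rewrite unitmxE unitfE gt_eqF.
split=> // f cf; have [r r0 [sf f0]] := cf.
have CB (V : normedModType R) (a : V -> R) j : Ck j setT a -> Ck j setT (fun z => B (a z)).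
  move=> Ca; apply/(Ck_mx _ _ openT) => i l.
  apply: (Ck_eq openT _ (CkD openT (Ck_cst j setT ((1%:M : 'M[R]_k.+1) i l)) (CkM openT Ca (Ck_cst j setT ((A - 1%:M) i l))))).
  by move=> z _; rewrite /B !mxE.
pose G := [set t : R | \det (B t) != 0].
have oG : open G.
  have := @open_preimage _ _ setT (fun t => \det (B t)) [set~ 0] openT _ _.
  rewrite (_ : [set x | _] = G); last by apply/seteqP; split=> [t [_ /eqP]|t /eqP].
  apply.
  - by move=> t _; apply: (Ck_continuous (k := 0) (U := setT)) => //; apply: Ck_det; [exact: openT|exact: CB (Ck_id _ _)].
  - by apply: closed_openC; exact: closed_eq.
have uB t : G t -> B t \in unitmx by rewrite unitmxE unitfE.
have GI t : 0 <= t <= 1 -> G t by move=> t01; rewrite /G/= gt_eqF// dA.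
have [c c0 Hc] : exists2 c : R, 0 < c & forall t, 0 <= t <= 1 -> `|invmx (B t)| <= c.
  have CiB : Ck 0 G (fun t => invmx (B t)).
    apply/(Ck_mx _ _ oG) => i j; apply: (Ck_invmx i j oG uB).
    by apply: (Ck_sub _ (CB _ _ _ (@Ck_id R 0 R setT))).
  have sc : compact [set t : R | 0 <= t <= 1] by rewrite -set_itvcc; exact: segment_compact.
  have nc t : 0 <= t <= 1 -> {for t, continuous (fun t => `|invmx (B t)|)}.
    move=> t01; apply: cvg_norm; exact: (Ck_continuous CiB (GI t t01)).
  have [c c0 Hc] := compact_bound sc nc.
  by exists c => // t t01; have := Hc t t01; rewrite normr_id.
pose h (z : 'rV[R]_(1 + k.+1)) := rsubmx z *m B (z 0 ord0) : 'rV[R]_k.+1.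
have hpr t y : h (pr t y) = y *m B t by rewrite /h rsubmx_pr pr0.
have Ch j : Ck j setT h.
  apply: Ck_mulmx; [exact: openT|exact: (Ck_rsubmx _ openT)|].
  exact: (CB _ (fun z : 'rV[R]_(1 + k.+1) => z 0 ord0) j (Ck_coord j setT ord0)).
pose K := [set y : 'rV[R]_k.+1 | `|y - 0| <= k.+1%:R * c * r].
have hK t y : 0 <= t <= 1 -> [set: 'rV[R]_k.+1] y -> ~ K y -> f (h (pr t y)) = 0.
  move=> t01 _ nK; rewrite hpr; apply: f0; rewrite leNgt; apply/negP => yr; apply: nK.
  rewrite /K /= subr0 -(mulmxK (uB _ (GI t t01)) y); apply: le_trans (mulmx_bound _ _) _.
  by apply: ler_pM => //; [rewrite ler_wpM2l// Hc|exact: ltW].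
have E t y : (t = 0 \/ t = 1) -> setT y -> \det (B t) * f (y *m B t) = f (h (pr t y)) * \det (jacobian (h \o pr t) y).
  move=> _ _; rewrite hpr mulrC; congr (_ * \det _).
  have -> : h \o pr t = (fun y => id y *m B t) by apply/funext => z; exact: hpr.
  by rewrite (jacobian_mulmxr _ openT (@Ck_id R 1 _ setT) I) jacobian_id mul1mx.
have := integral_homotopy_eq openT openT (fun _ _ _ _ => I) Ch sf (@closed_ball_compact _ _ _ _) (fun _ _ => I) hK E _.
rewrite B1 B0 det1 => -[t y _ /(_ I)[]|_].
rewrite (_ : (fun y => 1 * f (y *m 1%:M)) = f); last by apply/funext => y; rewrite mul1r mulmx1.
move=> <-; rewrite (gtr0_norm dA1).
have := integral_lin (\det A) (csmc_mulmx uA cf) (csmc_cst0 k.+1).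
rewrite integral_cst0 addr0 => <-; congr integral_rV.
by apply/funext => y; rewrite addr0.
Qed.

(** On the segment to the identity the matrix remains triangular with positive diagonal, hence of
    positive determinant. *)
Lemma scales_integral_trig k (A : 'M[R]_k.+1) : is_trig_mx A \/ is_trig_mx A^T ->
  (forall i, 0 < A i i) -> scales_integral A.
Proof.
move=> tA A0; apply: scales_integral_path => t /andP[t0 t1].
pose B := 1%:M + t *: (A - 1%:M).
have -> : \det (1%:M + t *: (A - 1%:M)) = \prod_i B i i.
  case: tA => /is_trig_mxP tA; last rewrite -det_tr -/B.
    apply: det_trig; apply/is_trig_mxP => i j ij.
    by rewrite !mxE tA// -(inj_eq val_inj) ltn_eqF// !mulr0n subr0 mulr0 addr0.
  rewrite (_ : \prod_i B i i = \prod_i B^T i i); last by apply: eq_bigr => i _; rewrite [in RHS]mxE.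
  apply: det_trig; apply/is_trig_mxP => i j ij.
  have := tA i j ij; rewrite !mxE => ->.
  by rewrite -(inj_eq val_inj) gtn_eqF// !mulr0n subr0 mulr0 addr0.
apply: prodr_gt0 => i _; rewrite !mxE eqxx mulr1n.
have := A0 i; nra.
Qed.

(** LUP decomposition. The signs on the diagonal of the upper factor are split off as a diagonal
    matrix, which leaves permutations, signs and triangular matrices with positive diagonal. *)
Lemma scales_integral_unitmx k (A : 'M[R]_k.+1) : A \in unitmx -> scales_integral A.
Proof.
move=> uA; have := cormen_lup_correct A; have := @cormen_lup_lower _ _ A.
have := @cormen_lup_upper _ _ A; have := cormen_lup_perm A; have := cormen_lup_detL A.
case: (cormen_lup A) => [[P L] V] /= dL /is_perm_mxP[s Ps] V0 L0 E.
have uP : P \in unitmx by rewrite Ps unitmx_perm.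
have dV : \det V != 0.
  have := congr1 determinant E; rewrite !det_mulmx dL mul1r => <-.
  by rewrite mulf_neq0// -unitfE -unitmxE.
have tV : is_trig_mx V^T by apply/is_trig_mxP => i j ij; rewrite mxE V0.
have Vi i : V i i != 0.
  move: dV; rewrite -det_tr det_trig// => /prodf_neq0/(_ i isT).
  by rewrite mxE.
pose d : 'rV[R]_k.+1 := \row_i Num.sg (V i i).
have dd : diag_mx d *m (diag_mx d *m V) = V.
  apply/matrixP => i j; rewrite !mul_diag_mx !mxE mulrA -expr2 sqr_sg.
  by rewrite Vi mul1r.
have -> : A = invmx P *m (L *m (diag_mx d *m (diag_mx d *m V))).
  by rewrite dd -[L *m V]E mulKmx.
apply: scales_integral_mul; first by apply: scales_integral_inv; rewrite Ps; exact: scales_integral_perm.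
apply: scales_integral_mul.
  apply: scales_integral_trig => [|i]; last by rewrite (L0 i i (leqnn i)) eqxx ltr01.
  by left; apply/is_trig_mxP => i j ij; rewrite (L0 i j (ltnW ij)); have /negPf -> : i != j by rewrite -(inj_eq val_inj) ltn_eqF.
apply: scales_integral_mul.
  by apply: scales_integral_sign => j; rewrite mxE normr_sg Vi.
apply: scales_integral_trig => [|i].
  by right; apply/is_trig_mxP => i j ij; rewrite mxE mul_diag_mx mxE V0// mulr0.
by rewrite mul_diag_mx !mxE -normrEsg normr_gt0.
Qed.

Lemma jacobian_affine n m (A : 'M[R]_(n, m)) c x : jacobian (fun y : 'rV[R]_n => y *m A + c) x = A.
Proof.
have CA : Ck 1 setT (fun y : 'rV[R]_n => y *m A) by apply: Ck_mulmx; [exact: openT|exact: Ck_id|exact: Ck_cst].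
have -> : (fun y : 'rV[R]_n => y *m A + c) = (fun y => y *m A - (fun=> - c) y) by apply/funext => y; rewrite opprK.
rewrite (jacobianB openT CA (Ck_cst 1 setT (- c)) I) jacobian_cst subr0.
by rewrite (jacobian_mulmxr A openT (@Ck_id R 1 _ setT) I) jacobian_id mul1mx.
Qed.

Lemma integral_translate k (f : 'rV[R]_k.+1 -> R) v : csmc f ->
  csmc (fun y => f (y + v)) /\ integral_rV (fun y => f (y + v)) = integral_rV f.
Proof.
move=> [r r0 [sf f0]].
pose h (z : 'rV[R]_(1 + k.+1)) := rsubmx z *m 1%:M + z 0 ord0 *: v : 'rV[R]_k.+1.
have hpr t y : h (pr t y) = y *m 1%:M + t *: v by rewrite /h rsubmx_pr pr0.
have Ch j : Ck j setT h.
  apply: CkD; [exact: openT|apply: Ck_mulmx; [exact: openT|exact: (Ck_rsubmx _ openT)|exact: Ck_cst]|].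
  exact: (Ck_scalemx openT (Ck_coord j setT ord0) (Ck_cst j setT v)).
pose K := [set y : 'rV[R]_k.+1 | `|y - 0| <= r + `|v|].
have hK t y : 0 <= t <= 1 -> [set: 'rV[R]_k.+1] y -> ~ K y -> f (h (pr t y)) = 0.
  move=> /andP[t0 t1] _ nK; rewrite hpr mulmx1; apply: f0; rewrite leNgt; apply/negP => yr; apply: nK.
  rewrite /K /= subr0 -[y](addrK (t *: v)); apply: le_trans (ler_normB _ _) _.
  by apply: lerD; [exact: ltW|rewrite normrZ ger0_norm// ler_piMl].
have E t y : (t = 0 \/ t = 1) -> setT y -> f (y + t *: v) = f (h (pr t y)) * \det (jacobian (h \o pr t) y).
  move=> _ _; rewrite hpr.
  have -> : h \o pr t = (fun y => y *m 1%:M + t *: v) by apply/funext => z; exact: hpr.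
  by rewrite jacobian_affine det1 mulr1 mulmx1.
have := integral_homotopy_eq openT openT (fun _ _ _ _ => I) Ch sf (@closed_ball_compact _ _ _ _) (fun _ _ => I) hK E _.
rewrite scale1r scale0r => -[t y _ /(_ I)[]|H1 ->]; split; first exact: H1.
by congr integral_rV; apply/funext => y; rewrite addr0.
Qed.

(* The map is deformed to its affine approximation, whose linear part is
   covered by [scales_integral_unitmx]. *)
Lemma change_of_variables k (U : set 'rV[R]_k.+1) (F : 'rV[R]_k.+1 -> 'rV[R]_k.+1) x0 :
  open U -> (forall j, Ck j U F) -> U x0 -> 0 < \det (jacobian F x0) ->
  exists e d, [/\ 0 < e, 0 < d, ball x0 e `<=` U &
    forall f, smooth0 f -> (forall y, d <= `|y - F x0| -> f y = 0) ->
    csmc ((fun x => f (F x) * \det (jacobian F x)) \_ (ball x0 e)) /\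
    integral_rV ((fun x => f (F x) * \det (jacobian F x)) \_ (ball x0 e)) = integral_rV f].
Proof.
move=> oU CF Ux0.
move: (fun r (r0 : 0 < r) => C1_increment_mx oU (CF 1%N) Ux0 r0).
move: (jacobian F x0) => A inc dA.
have uA : A \in unitmx by rewrite unitmxE unitfE gt_eqF.
pose c := k.+1%:R * `|invmx A| + 1.
have c0 : 0 < c by rewrite ltr_wpDl// mulr_ge0.
have Hc (h : 'rV[R]_k.+1) : `|h| <= c * `|h *m A|.
  rewrite -{1}(mulmxK uA h); apply: le_trans (mulmx_bound _ _) _.
  by rewrite ler_wpM2r// lerDl.
pose y0 := F x0; pose b := y0 - x0 *m A.
have /nbhs_ballP[e1 e10 He1] : nbhs x0 U by exact: open_nbhs_nbhs.
(* The affine map moves [x] away from [F x0] by at least [|x - x0| / c]. An error of half this size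
   keeps the whole homotopy at distance at least [|x - x0| / (2 * c)] from [F x0]. *)
have e2 : 0 < (2 * c)^-1 by rewrite invr_gt0 mulr_gt0.
have [e2' e20 He2] := inc _ e2.
pose e := Num.min e1 e2'; have e0 : 0 < e by rewrite lt_min e10.
have eU : ball x0 e `<=` U.
  by move=> x; rewrite mx_ballE lt_min => /andP[xe _]; apply: He1; rewrite mx_ballE.
(* By that lower bound, a function vanishing at distance [d] and beyond pulls back to one supported
   in the closed ball of radius [e / 2], at every time. *)
pose d := e / 2 / (2 * c); have d0 : 0 < d by rewrite !divr_gt0// mulr_gt0.
exists e, d; split=> // f sf f0.
pose U0 := ball x0 e; have oU0 : open U0 by exact: ball_open.
pose aff (x : 'rV[R]_k.+1) := x *m A + b.
pose h (z : 'rV[R]_(1 + k.+1)) : 'rV[R]_k.+1 := aff (rsubmx z) + z 0 ord0 *: (F (rsubmx z) - aff (rsubmx z)).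
have hpr t x : h (pr t x) = aff x + t *: (F x - aff x) by rewrite /h rsubmx_pr pr0.
pose W := [set z : 'rV[R]_(1 + k.+1) | setT z /\ U0 (rsubmx z)].
have oW : open W.
  apply: (open_preimage openT _ oU0).
  by move=> z _; exact: (Ck_continuous (Ck_rsubmx 0 openT) I).
have UW t x : 0 <= t <= 1 -> U0 x -> W (pr t x) by move=> _ Ux; split=> //; rewrite rsubmx_pr.
have Caff j : Ck j setT aff by apply: CkD; [exact: openT|apply: Ck_mulmx; [exact: openT|exact: Ck_id|exact: Ck_cst]|exact: Ck_cst].
have Ch j : Ck j W h.
  have Cr : Ck j W (fun z : 'rV[R]_(1 + k.+1) => rsubmx z : 'rV[R]_k.+1).
    exact: (Ck_sub (@subsetT _ W) (Ck_rsubmx j openT)).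
  have C1 : Ck j W (fun z => aff (rsubmx z)).
    exact: (@Ck_comp_mx _ j _ _ _ _ W setT aff _ oW openT (fun _ _ => I) (Caff j) Cr).
  have C2 : Ck j W (fun z => F (rsubmx z)).
    exact: (@Ck_comp_mx _ j _ _ _ _ W U F _ oW oU (fun z Wz => eU _ Wz.2) (CF j) Cr).
  exact: (CkD oW C1 (Ck_scalemx oW (Ck_coord j W ord0) (CkB oW C2 C1))).
have affE x : aff x - y0 = (x - x0) *m A by rewrite /aff /b mulmxBl addrA addrAC addrK.
have far x : c^-1 * `|x - x0| <= `|(x - x0) *m A| by rewrite ler_pdivrMl.
have hB t x : 0 <= t <= 1 -> U0 x -> `|x - x0| / (2 * c) <= `|h (pr t x) - y0|.
  move=> /andP[t0 t1]; rewrite /U0 mx_ballE distrC lt_min => /andP[_ xe].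
  have := He2 (x - x0) xe; rewrite (addrC x0) subrK -/y0 -affE.
  rewrite (_ : F x - y0 - (aff x - y0) = F x - aff x); last by rewrite opprB addrA subrK.
  move=> H; rewrite hpr addrAC; have Hf := far x; rewrite -affE in Hf.
  have H3 : `|t *: (F x - aff x)| <= (2 * c)^-1 * `|x - x0|.
    by apply: le_trans H; rewrite normrZ ger0_norm// ler_piMl.
  have H4 := lerB_dist (aff x - y0) (- (t *: (F x - aff x))).
  rewrite opprK normrN in H4; apply: le_trans _ H4.
  have E : c^-1 = (2 * c)^-1 + (2 * c)^-1 by field; rewrite gt_eqF.
  have E2 : `|x - x0| / (2 * c) = (2 * c)^-1 * `|x - x0| by rewrite mulrC.
  rewrite E2; move: Hf H3; rewrite E mulrDl.
  move: ((2 * c)^-1 * `|x - x0|) `|aff x - y0| `|t *: (F x - aff x)| => u v w; lra.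
pose K := [set x : 'rV[R]_k.+1 | `|x - x0| <= e / 2].
have cK : compact K by exact: closed_ball_compact.
have KU : K `<=` U0.
  move=> x; rewrite /K /= /U0 mx_ballE distrC => H; apply: le_lt_trans H _.
  by rewrite ltr_pdivrMr// ltr_pMr// ltr1n.
have hK t x : 0 <= t <= 1 -> U0 x -> ~ K x -> f (h (pr t x)) = 0.
  move=> t01 Ux nK; apply: f0; apply: le_trans (hB t x t01 Ux); rewrite ler_pM2r//.
  by rewrite leNgt; apply/negP => /ltW.
pose a (t : R) x := if t == 1 then ((fun x => f (F x) * \det (jacobian F x)) \_ U0) x else \det A * f (aff x).
have J0 x : jacobian aff x = A by exact: jacobian_affine.
have aU t x : (t = 0 \/ t = 1) -> U0 x -> a t x = f (h (pr t x)) * \det (jacobian (h \o pr t) x).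
  case=> -> Ux; rewrite /a ?eqxx ?[0 == 1]eq_sym ?oner_eq0.
    have -> : h \o pr 0 = aff by apply/funext => z /=; rewrite hpr scale0r addr0.
    by rewrite hpr scale0r addr0 J0 mulrC.
  have -> : h \o pr 1 = F by apply/funext => z /=; rewrite hpr scale1r addrC subrK.
  by rewrite hpr scale1r (addrC (aff x)) subrK patchE mem_set.
have aN t x : (t = 0 \/ t = 1) -> ~ U0 x -> a t x = 0.
  case=> -> nU; rewrite /a ?eqxx ?[0 == 1]eq_sym ?oner_eq0; last by rewrite patchE memNset.
  rewrite f0 ?mulr0// -/y0 affE; apply: le_trans (far x).
  have xe : e <= `|x - x0| by move: nU; rewrite /U0 mx_ballE distrC => /negP; rewrite -leNgt.
  have c2 : 0 < c^-1 by rewrite invr_gt0.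
  have E : d = c^-1 * (e / 4) by rewrite /d; field; rewrite gt_eqF.
  by rewrite E ler_pM2l//; apply: le_trans xe; rewrite ler_pdivrMr// ler_pMr// ler1n.
have := integral_homotopy_eq oU0 oW UW Ch sf cK KU hK aU aN.
have cf : csmc f.
  exists (d + `|y0|); first by rewrite ltr_wpDr.
  split=> // y dy; apply: f0; rewrite -(lerD2r `|y0|); apply: le_trans dy _.
  by rewrite -{1}[y](subrK y0); exact: ler_normD.
rewrite (_ : a 1 = (fun x => f (F x) * \det (jacobian F x)) \_ U0); last by rewrite /a eqxx.
rewrite (_ : a 0 = fun x => \det A * f (aff x)); last by rewrite /a [0 == 1]eq_sym oner_eq0.
move=> [H1 H2]; split; first exact: H1.
apply: etrans H2 _.
have [cb <-] := integral_translate b cf.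
have [_ /(_ _ cb) <-] := scales_integral_unitmx uA; rewrite (gtr0_norm dA).
have := integral_lin (\det A) (csmc_mulmx uA cb) (csmc_cst0 k.+1).
rewrite integral_cst0 addr0 => <-; congr integral_rV.
by apply/funext => y; rewrite addr0.
Qed.

End LinearChange.

(** * Integration over manifolds *)

Lemma patch_eq (R : realType) (T : Type) (U V : set T) (a b : T -> R) :
  (forall y, U y -> V y -> a y = b y) -> (forall y, U y -> ~ V y -> a y = 0) ->
  (forall y, ~ U y -> V y -> b y = 0) -> a \_ U = b \_ V.
Proof.
move=> UV U0 V0; apply/funext => y; rewrite !patchE.
by case: ifPn; rewrite ?inE ?notin_setE => Uy; case: ifPn; rewrite ?inE ?notin_setE => Vy //; [exact: UV|exact: U0|rewrite V0].
Qed.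

Section Localization.
Context {R : realType} {n : nat} {X : manifold R n}.

Local Notation dom p := (cdom (chart_at p)).
Local Notation img p := (cimg (chart_at p)).
Local Notation cm p := (cmap (chart_at p)).
Local Notation ci p := (cinv (chart_at p)).

Definition fsupp k (U : set X) (w : diff_form X k) :=
  exists2 K, compact K /\ K `<=` U & forall x E, ~ K x -> w x E = 0.

Lemma fsuppS k U U' (w : diff_form X k) : U `<=` U' -> fsupp U w -> fsupp U' w.
Proof. by move=> UU [K [cK KU] w0]; exists K => //; split=> // x /KU/UU. Qed.

Lemma fsupp_fscale k U f (w : diff_form X k) : csupp U f -> fsupp U (fscale f w).
Proof. by move=> [K cK f0]; exists K => // x E nK; rewrite /fscale f0// mul0r. Qed.

Lemma fsupp_fscaler k U f (w : diff_form X k) : fsupp U w -> fsupp U (fscale f w).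
Proof. by move=> [K cK w0]; exists K => // x E nK; rewrite /fscale w0// mulr0. Qed.

Lemma fsuppI k U U' (w : diff_form X k) : fsupp U w -> fsupp U' w -> fsupp (U `&` U') w.
Proof.
move=> [K [cK KU] w0] [K' [cK' KU'] w0']; exists (K `&` K').
  split; last by move=> x [/KU ? /KU' ?].
  by apply: compact_closedI => //; apply: compact_closed cK'; exact: mtop_hausdorff.
by move=> x E nK; have [Kx|/w0//] := pselect (K x); apply: w0' => K'x; exact: nK.
Qed.

(** Induction principle in place of partitions of unity: a property stable under sums need be
    checked only on forms with small support. The form is split as [f w + (1 - f) w] along a finite
    cover of its support. *)
Lemma localize k (U : set X) (P : diff_form X k -> Prop) :
  (forall w w', smooth_form w -> smooth_form w' -> fsupp U w -> fsupp U w' -> P w -> P w' -> P (fadd w w')) ->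
  P (@fzero R n X k) ->
  (forall x, U x -> exists O, [/\ open O, O x & forall w, smooth_form w -> fsupp U w -> fsupp O w -> P w]) ->
  forall w, smooth_form w -> fsupp U w -> P w.
Proof.
move=> PD P0 PL w sw suw; have [K [cK KU] w0] := suw.
have H x : exists fV : (X -> R) * set X, U x ->
   [/\ smooth_fun fV.1, open fV.2 /\ fV.2 x, forall y, fV.2 y -> fV.1 y = 1 &
       forall w, smooth_form w -> fsupp U w -> P (fscale fV.1 w)].
  have [Ux|nU] := pselect (U x); last by exists ((fun=> 0), setT) => /nU.
  have [B [oB Bx PB]] := PL x Ux.
  have [f [sf _] [[V oV V1] sO]] := point_cutoff oB Bx.
  exists (f, V) => _; split=> // w' sw' sU.
  by apply: PB; [exact: smooth_fscale|exact: fsupp_fscaler|exact: fsupp_fscale].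
have [g Hg] := choice H.
have [s [sK sc]] : exists s : seq X, (forall x, x \in s -> K x) /\ forall y, K y -> exists2 x, x \in s & (g x).2 y.
  by apply: compact_finite_cover => // x /KU/Hg[].
have : forall y E, (forall x, x \in s -> ~ (g x).2 y) -> w y E = 0.
  by move=> y E ns; apply: w0 => /sc[x xs]; exact: ns.
have sU x : x \in s -> U x by move=> /sK/KU.
elim: s sU {sK sc w0} w sw suw => [|x s IH] sU w sw suw w0.
  by rewrite (_ : w = @fzero R n X k)//; apply/funext => y; apply/funext => E; exact: w0.
have [sf _ f1 Pf] := Hg x (sU x (mem_head _ _)); set f := (g x).1 in sf f1 Pf.
have s1 := smooth_funB1 sf.
have -> : w = fadd (fscale f w) (fscale (fun x => 1 - f x) w).
  by apply/funext => y; apply/funext => E; rewrite /fadd /fscale -mulrDl addrC subrK mul1r.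
apply: PD; [exact: smooth_fscale|exact: smooth_fscale|exact: fsupp_fscaler|exact: fsupp_fscaler|exact: Pf|].
apply: IH; [by move=> z zs; apply: sU; rewrite in_cons zs orbT|exact: smooth_fscale|exact: fsupp_fscaler|].
move=> y E ns; rewrite /fscale; have [Vy|nV] := pselect ((g x).2 y); first by rewrite f1// subrr mul0r.
by rewrite w0 ?mulr0// => z; rewrite in_cons => /orP[/eqP->//|/ns].
Qed.

Lemma pou_exists (W : X -> set X) : compact [set: X] -> (forall x, [/\ open (W x), W x x & W x `<=` dom x]) ->
  exists2 s, partition_of_unity X s & forall c, c \in s -> csupp (W c.1) c.2.
Proof.
move=> cX HW; have H x : exists fV : (X -> R) * set X,
   [/\ smooth_fun fV.1, forall y, 0 <= fV.1 y <= 1, open fV.2 /\ fV.2 x, forall y, fV.2 y -> fV.1 y = 1 &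
       csupp (W x) fV.1].
  have [oW Wx _] := HW x; have [f [sf f01] [[V oV V1] sO]] := point_cutoff oW Wx.
  by exists (f, V).
have [g Hg] := choice H.
have [s [_ sc]] : exists s : seq X, (forall x, x \in s -> [set: X] x) /\ forall y, [set: X] y -> exists2 x, x \in s & (g x).2 y.
  by apply: compact_finite_cover => // x _; have [] := Hg x.
(* Each new function multiplies the earlier ones by its complement, so the sum telescopes; where
   some cut-off equals 1 the product vanishes and the sum is 1. *)
have [t [Ht St]] : exists t : seq (X * (X -> R)),
    (forall c, c \in t -> [/\ csupp (W c.1) c.2, smooth_fun c.2 & forall y, 0 <= c.2 y]) /\
    forall y, \sum_(c <- t) c.2 y = 1 - \prod_(x <- s) (1 - (g x).1 y).
  elim: s {sc} => [|x s [t [Ht St]]]; first by exists [::]; split=> // y; rewrite !big_nil subrr.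
  have [sf f01 _ _ sW] := Hg x; have s1 := smooth_funB1 sf.
  exists ((x, (g x).1) :: [seq (c.1, fun y => (1 - (g x).1 y) * c.2 y) | c <- t]); split; last first.
    move=> y; rewrite !big_cons big_map /= -mulr_sumr St.
    by move: (\prod_(_ <- _) _) ((g x).1 y) => a b; ring.
  move=> c; rewrite in_cons => /orP[/eqP->/=|/mapP[c' /Ht[sc' smc' c'0] ->/=]].
    by split=> // y; case/andP: (f01 y).
  split; [|exact: smooth_funM|by move=> y; rewrite mulr_ge0// subr_ge0; case/andP: (f01 y)].
  by have [K cK z] := sc'; exists K => // y nK; rewrite z// mulr0.
exists t => [|c /Ht[]//]; split=> [q rho /Ht[/= [K [cK KW] z] smr r0]|y].
  split=> //; have clK : closed K by apply: compact_closed cK; exact: mtop_hausdorff.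
  have [_ _ Wd] := HW q; apply: subset_trans (subset_trans KW Wd).
  rewrite [X in _ `<=` X]((closure_id K).1 clK); apply: closure_subset => x /= /eqP nz.
  by apply: contrapT => /z.
rewrite St; have [x xs Vy] := sc y I; have [_ _ _ f1 _] := Hg x.
by rewrite (big_rem x)//= f1// subrr mul0r subr0.
Qed.

End Localization.

(** * Integration of top forms and Stokes' theorem on compact oriented manifolds *)

Section ChartIntegral.
Context {R : realType} {k : nat} {M : manifold R k.+1}.

Local Notation dom p := (cdom (chart_at p)).
Local Notation img p := (cimg (chart_at p)).
Local Notation cm p := (cmap (chart_at p)).
Local Notation ci p := (cinv (chart_at p)).

Implicit Types (p q : M) (w : diff_form M k.+1).

Definition top_coef p w := (fun y => local_form w p y 1%:M) \_ (img p).

Definition chart_integral p w := integral_rV (top_coef p w).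

Lemma csmc_top_coef p w : smooth_form w -> fsupp (dom p) w -> csmc (top_coef p w).
Proof.
move=> /smooth_formP sw [K [cK Kd] w0].
apply: (csm_patch (img_open p) (fun j => fform_Ck j 1%:M (sw p)) (K := cm p @` K)).
- by apply: compact_image cK => x /Kd; exact: cmap_continuous.
- by move=> _ [x /Kd dx <-]; exact: cmap_img.
- by move=> y iy nK; apply: w0 => Ky; apply: nK; exists (ci p y) => //; exact: cinvK.
Qed.

Lemma top_coef_lin p a w w' : top_coef p (fun x E => a * w x E + w' x E) = (fun y => a * top_coef p w y + top_coef p w' y).
Proof.
apply/funext => y; rewrite /top_coef !patchE; case: ifPn => // _.
by rewrite mulr0 addr0.
Qed.

Lemma chart_integral_lin p a w w' : smooth_form w -> smooth_form w' -> fsupp (dom p) w -> fsupp (dom p) w' ->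
  chart_integral p (fun x E => a * w x E + w' x E) = a * chart_integral p w + chart_integral p w'.
Proof.
by move=> sw sw' fw fw'; rewrite /chart_integral top_coef_lin integral_lin//; exact: csmc_top_coef.
Qed.

Lemma chart_integral_add p w w' : smooth_form w -> smooth_form w' -> fsupp (dom p) w -> fsupp (dom p) w' ->
  chart_integral p (fadd w w') = chart_integral p w + chart_integral p w'.
Proof.
move=> sw sw' fw fw'; have := chart_integral_lin 1 sw sw' fw fw'; rewrite mul1r => <-.
by congr chart_integral; apply/funext => x; apply/funext => E; rewrite mul1r.
Qed.

Hypothesis oM : oriented M.

(** [change_of_variables] holds only on small balls, so the form is first cut by [localize]; the
    orientation provides the positive Jacobian. *)
Lemma chart_integral_change p q w : smooth_form w -> fsupp (dom p `&` dom q) w ->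
  chart_integral p w = chart_integral q w.
Proof.
have sp (v : diff_form M k.+1) : fsupp (dom p `&` dom q) v -> fsupp (dom p) v by apply: fsuppS => x [].
have sq (v : diff_form M k.+1) : fsupp (dom p `&` dom q) v -> fsupp (dom q) v by apply: fsuppS => x [].
move: w; apply: localize => [w w' sw sw' fw fw' E E'||x [px qx]].
- apply: etrans (chart_integral_add sw sw' (sp _ fw) (sp _ fw')) _.
  by apply: etrans _ (esym (chart_integral_add sw sw' (sq _ fw) (sq _ fw'))); rewrite E E'.
- congr integral_rV; apply/funext => y; rewrite /top_coef !patchE.
  by case: ifP => _; case: ifP.
have o0 := ov_cmap px qx.
have [e [d [e0 d0 eU HF]]] := change_of_variables (ov_open p q) (fun j => Ck_transition j p q) o0 (oM o0.1 o0.2).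
rewrite (transition_cmap q px) in HF.
exists ([set z | dom p z /\ ball (cm p x) e (cm p z)] `&` [set z | dom q z /\ ball (cm q x) d (cm q z)]); split.
- by apply: openI; (apply: open_preimage; [exact: cdom_open|exact: cmap_continuous|exact: ball_open]).
- by split; split=> //; exact: ballxx.
move=> w sw sU [K [cK KO] w0].
have cq := csmc_top_coef sw (sq _ sU); have [r r0 [sf _]] := cq.
have [|_ I1] := HF (top_coef q w) sf _.
  move=> y dy; rewrite /top_coef patchE; case: ifPn => //; rewrite inE => iy.
  apply: w0 => /KO[_ [_]]; rewrite cinvK// mx_ballE distrC => yd.
  by move: dy; rewrite leNgt yd.
apply: etrans _ I1; apply: (congr1 (@integral_rV R k.+1)); apply: patch_eq => y.
- move=> iy By; have oy := eU y By; have iq := transition_img oy.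
  rewrite /top_coef patchE (mem_set iq) (local_form_ov _ _ oy) /fpull mul1mx mulrC.
  have [ml al _] := (smooth_formP w).1 sw q.
  by rewrite -[jacobian _ _]mulmx1 (alternating_mulmx _ _ (ml _ iq) (al _ iq)) mulmx1.
- by move=> iy nB; apply: w0 => /KO[[_]]; rewrite cinvK.
- by move=> nI /eU[].
Qed.

Lemma partition_sum p w (s : seq (M * (M -> R))) : partition_of_unity M s -> smooth_form w -> fsupp (dom p) w ->
  chart_integral p w = \sum_(c <- s) chart_integral p (fscale c.2 w).
Proof.
move=> [Hs s1] sw fw.
have cs c : c \in s -> csmc (top_coef p (fscale c.2 w)).
  case: c => q rho /Hs[sr _ _]; apply: csmc_top_coef; [exact: smooth_fscale|exact: fsupp_fscaler].
have [_ <-] := csmc_sum cs; congr integral_rV; apply/funext => y.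
rewrite /top_coef patchE; case: ifPn => iy; last first.
  by rewrite big1// => c _; rewrite patchE (negPf iy).
rewrite -[LHS]mul1r -(s1 (ci p y)) mulr_suml; apply: eq_bigr => c _.
by rewrite patchE iy.
Qed.

Hypothesis cM : compact [set: M].

Lemma closed_fsupp (U F : set M) w : closed F -> F `<=` U -> (forall x E, ~ F x -> w x E = 0) -> fsupp U w.
Proof.
by move=> cF FU w0; exists F => //; split=> //; apply: subclosed_compact cM _.
Qed.

Lemma fsuppT w : fsupp setT w.
Proof. by exists setT => // x E nT; case: nT. Qed.

Lemma fsupp_pou s c w : partition_of_unity M s -> c \in s -> fsupp (dom c.1) (fscale c.2 w).
Proof.
case: c => q rho [Hs _] /Hs[_ _ cl]; apply: (closed_fsupp (@closed_closure _ _) cl) => x E nK.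
suff rx : rho x = 0 by rewrite -[LHS]/(rho x * w x E) rx mul0r.
by apply: contrapT => /eqP rx; apply: nK; exact: subset_closure.
Qed.

Lemma integral_pouE s w : integral_pou s w = \sum_(c <- s) chart_integral c.1 (fscale c.2 w).
Proof. by []. Qed.

Lemma integral_pou_lin s : partition_of_unity M s -> form_linear (integral_pou s).
Proof.
move=> ps a w w' sw sw'; rewrite !integral_pouE mulr_sumr -big_split /= !big_seq.
apply: eq_bigr => c cs; have sc : smooth_fun c.2 by case: c cs => q rho /(ps.1)[].
rewrite fscale_lin; apply: chart_integral_lin; [exact: smooth_fscale|exact: smooth_fscale| |]; exact: fsupp_pou cs.
Qed.

Lemma integral_pou_chart s w p : partition_of_unity M s -> smooth_form w -> fsupp (dom p) w ->
  integral_pou s w = chart_integral p w.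
Proof.
move=> ps sw fw; apply: etrans _ (esym (partition_sum ps sw fw)); apply: eq_big_seq => c cs.
have sc : smooth_fun c.2 by case: c cs => q rho /(ps.1)[].
apply: chart_integral_change; first exact: smooth_fscale.
by apply: fsuppI; [exact: fsupp_pou cs|exact: fsupp_fscaler].
Qed.

(** Independence of the partition chosen by [xget]: integrals for two partitions are additive, and
    on a form supported in one chart both equal the integral in that chart. *)
Lemma integral_form_pou s w : partition_of_unity M s -> smooth_form w -> integral_form w = integral_pou s w.
Proof.
move=> ps sw; rewrite /integral_form; case: xgetP => [v _ [t pt ->]|/(_ (integral_pou s w))[]]; last by exists s.
move: w sw (fsuppT w); apply: localize => [w w' sw sw' _ _ E E'||x _].
- by rewrite !(form_linearD (integral_pou_lin _))// E E'.
- by rewrite !(form_linear0 (integral_pou_lin _)).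
exists (dom x); split; [exact: cdom_open|exact: mem_chart_at|move=> w sw _ fw].
by rewrite !(integral_pou_chart (p := x)).
Qed.

Lemma pou_ex : exists s, partition_of_unity M s.
Proof.
have [|s ps _] := @pou_exists R k.+1 M (fun x => dom x) cM; last by exists s.
by move=> x; split; [exact: cdom_open|exact: mem_chart_at|].
Qed.

Lemma integral_form_lin : form_linear (@integral_form R k.+1 M).
Proof.
have [s ps] := pou_ex; move=> a w w' sw sw'.
apply: etrans (integral_form_pou ps (smooth_lin a sw sw')) _; apply: etrans (integral_pou_lin ps a sw sw') _.
by rewrite (integral_form_pou ps sw) (integral_form_pou ps sw').
Qed.

Lemma integral_form_chart w p : smooth_form w -> fsupp (dom p) w -> integral_form w = chart_integral p w.
Proof. by move=> sw fw; have [s ps] := pou_ex; rewrite (integral_form_pou ps)// (integral_pou_chart ps sw fw). Qed.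

Lemma integral_form_le w w' : smooth_form w -> smooth_form w' ->
  (forall p y, img p y -> local_form w p y 1%:M <= local_form w' p y 1%:M) -> integral_form w <= integral_form w'.
Proof.
move=> sw sw' ww; have [s ps] := pou_ex; rewrite (integral_form_pou ps sw) (integral_form_pou ps sw') !integral_pouE big_seq [leRHS]big_seq.
apply: ler_sum => c cs; have [sc c0 _] : [/\ smooth_fun c.2, forall x, 0 <= c.2 x & closure [set x | c.2 x != 0] `<=` dom c.1].
  by case: c cs => q rho /(ps.1).
apply: integral_le; [| |move=> y; rewrite /top_coef !patchE; case: ifPn => //; rewrite inE => iy].
- by apply: csmc_top_coef; [exact: smooth_fscale|exact: fsupp_pou cs].
- by apply: csmc_top_coef; [exact: smooth_fscale|exact: fsupp_pou cs].
- by apply: ler_wpM2l; [exact: c0|exact: ww].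
Qed.

Lemma fsupp_ext_deriv j U (w : diff_form M j) : fsupp U w -> fsupp U (ext_deriv w).
Proof.
move=> [K cK w0]; exists K => // x E nK.
have oK : open (~` K) by apply: closed_openC; apply: compact_closed cK.1; exact: mtop_hausdorff.
exact: (ext_deriv_zero E oK nK w0).
Qed.

(** [ext_deriv] does not enlarge supports, so after localization [integral_fd] in a single chart is
    enough. *)
Theorem stokes (w : diff_form M k) : smooth_form w -> integral_form (ext_deriv w) = 0.
Proof.
have fT : fsupp setT w by exists setT => // x E nT; case: nT.
move=> sw; move: w sw fT; apply: localize => [w w' sw sw' _ _ E E'||x _].
- have -> : ext_deriv (fadd w w') = (fun x E => 1 * ext_deriv w x E + ext_deriv w' x E).
    rewrite -ext_deriv_lin//; congr ext_deriv.
    by apply/funext => x; apply/funext => F; rewrite mul1r.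
  rewrite integral_form_lin ?E ?E' ?mulr0 ?addr0//; exact: smooth_ext_deriv.
- have -> : ext_deriv (@fzero R k.+1 M k) = @fzero R k.+1 M k.+1.
    by apply/funext => x; apply/funext => F; exact: (ext_deriv_zero F openT I).
  exact: (form_linear0 integral_form_lin).
exists (dom x); split; [exact: cdom_open|exact: mem_chart_at|move=> w sw _ fw].
rewrite (integral_form_chart (smooth_ext_deriv sw) (fsupp_ext_deriv fw)).
have [K [cK Kd] w0] := fw.
have [_ I0] := integral_fd (img_open x) (compact_image (f := cm x) (fun z Kz => cmap_continuous (Kd z Kz)) cK)
  (fun y '(ex_intro2 z Kz e) => eq_ind _ (img x) (cmap_img (Kd z Kz)) _ e) ((smooth_formP w).1 sw x)
  (fun y E iy nK => w0 _ _ (fun Ky => nK (ex_intro2 _ _ _ Ky (cinvK iy)))).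
apply: etrans _ I0; apply: (congr1 (@integral_rV R k.+1)).
apply: patch_eq => y; [by move=> iy _; exact: local_ext_deriv|by move=> iy []|by move=> ni /ni].
Qed.

End ChartIntegral.

(** * Top cohomology of a compact connected oriented manifold *)

Section TopForms.
Context {R : realType} {k : nat} {M : manifold R k.+1}.
Hypotheses (oM : oriented M) (cM : compact [set: M]).

Local Notation dom p := (cdom (chart_at p)).
Local Notation img p := (cimg (chart_at p)).
Local Notation cm p := (cmap (chart_at p)).
Local Notation ci p := (cinv (chart_at p)).

Lemma top_form_det (a : 'M[R]_k.+1 -> R) E : multilinear a -> alternating a -> a E = \det E * a 1%:M.
Proof. by move=> ma aa; rewrite -[in LHS](mulmx1 E); exact: alternating_mulmx. Qed.

Lemma det_col'_row' (i j : 'I_k.+1) : \det (col' j (row' i (1%:M : 'M[R]_k.+1))) = (i == j)%:R.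
Proof.
have [<-|ij] := eqVneq i j.
  have -> : col' i (row' i (1%:M : 'M[R]_k.+1)) = 1%:M.
    by apply/matrixP => a b; rewrite !mxE (inj_eq lift_inj).
  exact: det1.
have [l ->|e] := unliftP i j; last by rewrite e eqxx in ij.
rewrite (expand_det_row _ l) big1// => b _.
have -> : col' (lift i l) (row' i (1%:M : 'M[R]_k.+1)) l b = 0 by rewrite !mxE (negPf (neq_lift _ _)).
by rewrite mul0r.
Qed.

Lemma fform_minor (U : set 'rV[R]_k.+1) (a : 'rV[R]_k.+1 -> R) (j : 'I_k.+1) : open U -> (forall l, Ck l U a) ->
  fform U (fun y (E : 'M[R]_(k, k.+1)) => a y * \det (col' j E)).
Proof.
move=> oU Ca; apply: (@fform_scale _ _ _ U a (fun _ E => \det (col' j E)) oU Ca).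
split=> [y _|y _|E l]; last exact: Ck_cst.
  move=> i A B C b c rA rB rC; apply: (determinant_multilinear (i0 := i)).
  - by apply/rowP => l; have := congr1 (fun v : 'rV[R]_k.+1 => v 0 (lift j l)) rA; rewrite !mxE.
  - by apply/matrixP => s l; have := congr1 (fun v : 'M[R]_(k.-1, k.+1) => v s (lift j l)) rB; rewrite !mxE.
  - by apply/matrixP => s l; have := congr1 (fun v : 'M[R]_(k.-1, k.+1) => v s (lift j l)) rC; rewrite !mxE.
move=> A i1 i2 i12 rij; apply: (determinant_alternate i12) => l.
by have := congr1 (fun v : 'rV[R]_k.+1 => v 0 (lift j l)) rij; rewrite !mxE.
Qed.

Section Box.
Context {x : M} {y0 : 'rV[R]_k.+1} {r : R}.
Hypotheses (r0 : 0 < r) (Kx : [set y | `|y - y0| <= r] `<=` img x).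
Let K := [set y : 'rV[R]_k.+1 | `|y - y0| <= r].
Let cK : compact K. Proof. exact: closed_ball_compact. Qed.

Definition box_form (f : 'rV[R]_k.+1 -> R) : diff_form M k.+1 :=
  chart_form x (fun y E => f (y - y0) * \det E).

Lemma Ck_shift j (f : 'rV[R]_k.+1 -> R) U : open U -> smooth0 f -> Ck j U (fun y => f (y - y0)).
Proof.
move=> oU sf; apply: (Ck_comp (O := setT) oU openT (fun _ _ => I) (sf j)).
by apply: CkB; [exact: oU|exact: Ck_id|exact: Ck_cst].
Qed.

Lemma shift0 (f : 'rV[R]_k.+1 -> R) y : csm r f -> ~ K y -> f (y - y0) = 0.
Proof. by move=> [_ f0] nK; apply: f0; rewrite leNgt; apply/negP => /ltW. Qed.

Lemma smooth_box_form f : csm r f -> smooth_form (box_form f).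
Proof.
move=> cf; apply: (smooth_chart_form cK Kx).
  by apply: fform_top; [exact: img_open|move=> j; apply: Ck_shift cf.1; exact: img_open].
by move=> y E iy nK; rewrite shift0// mul0r.
Qed.

Lemma box_form0 f z E : csm r f -> ~ (ci x @` K) z -> box_form f z E = 0.
Proof.
move=> cf nK; have [dz|nd] := pselect (dom x z); last by rewrite /box_form /chart_form; case: pselect.
rewrite /box_form (chart_form_in _ _ dz) shift0 ?mul0r//.
exact: chart_supp_compl Kx nK dz.
Qed.

Lemma fsupp_box_form f U : csm r f -> ci x @` K `<=` U -> fsupp U (box_form f).
Proof.
move=> cf KU; exists (ci x @` K); last by move=> z E; exact: box_form0.
by split=> //; apply: compact_image cK => y /Kx; exact: cinv_continuous.
Qed.

Lemma integral_box_form f : csm r f -> integral_form (box_form f) = integral_rV f.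
Proof.
move=> cf; have fs : fsupp (dom x) (box_form f).
  by apply: fsupp_box_form cf _ => _ [y /Kx iy <-]; exact: cinv_dom.
rewrite (integral_form_chart oM cM (smooth_box_form cf) fs) /chart_integral.
have [_ <-] := integral_translate (- y0) (ex_intro2 _ _ r r0 cf).
apply: (congr1 (@integral_rV R k.+1)); apply/funext => y.
rewrite /top_coef patchE; case: ifPn => [|]; rewrite ?inE ?notin_setE => iy.
  by rewrite local_chart_form// det1 mulr1.
by rewrite shift0// => /Kx.
Qed.

Lemma box_form_derive j g : csm r g -> exists2 eta : diff_form M k, smooth_form eta & box_form ('D_(er j) g) = ext_deriv eta.
Proof.
(* The primitive is [g] times the product of all coordinate differentials except the one of index
   [j], which is the minor [col' j]; the sign compensates that of the term [j] in [fd]. *)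
move=> cg; pose a y := (-1) ^+ j * g (y - y0).
have Ca l U : open U -> Ck l U a by move=> oU; apply: CkM; [exact: oU|exact: Ck_cst|exact: Ck_shift oU cg.1].
pose b y (E : 'M[R]_(k, k.+1)) := a y * \det (col' j E).
have fb : fform (img x) b by apply: fform_minor; [exact: img_open|move=> l; apply: Ca; exact: img_open].
have b0 y E : img x y -> ~ K y -> b y E = 0 by move=> iy nK; rewrite /b /a shift0// mulr0 mul0r.
exists (chart_form x b); first exact: (smooth_chart_form cK Kx fb b0).
have sb := smooth_chart_form cK Kx fb b0.
have cD := csm_derive r0 (er j) cg.
apply/funext => z; apply/funext => E; have [dz|nd] := pselect (dom x z); last first.
  have nK : ~ (ci x @` K) z by move=> [y /Kx iy e]; apply: nd; rewrite -e; exact: cinv_dom.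
  have oK : open (~` (ci x @` K)) by apply: closed_openC; have [] := chart_image_closed cK Kx.
  rewrite (box_form0 _ cD nK); apply: esym; apply: (ext_deriv_zero E oK nK) => u F nu.
  have [du|nu'] := pselect (dom x u); last by rewrite /chart_form; case: pselect.
  by rewrite chart_form_in// b0//; [exact: cmap_img|exact: chart_supp_compl Kx nu du].
have iz : img x (cm x z) by exact: cmap_img.
rewrite !(form_local _ E dz) (local_ext_deriv _ sb iz); move: (E *m _) => F.
rewrite (fd_near F (img_open x) iz (b := b)); last by move=> y G iy; rewrite local_chart_form.
rewrite (top_form_det F (fd_multilinear (img_open x) iz fb) (fd_alternating (img_open x) iz fb)).
apply: etrans (local_chart_form _ _ iz) _; rewrite mulrC; apply: (f_equal (fun s => \det F * s)).
rewrite /fd (bigD1 j)//= [X in _ = _ + X]big1 ?addr0; last first.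
  move=> i ij; apply/eqP; rewrite mulf_eq0; apply/orP; right; apply/eqP.
  apply: etrans _ (derive_cst (0 : R) (cm x z) (row i 1%:M)); apply: (f_equal (fun h => 'D_(row i 1%:M) h (cm x z))).
  by apply/funext => y; rewrite /b det_col'_row' (negPf ij) mulr0.
rewrite row1 (_ : (fun y => b y _) = a); last by apply/funext => y; rewrite /b det_col'_row' eqxx mulr1.
have dg : derivable (fun y => g (y - y0)) (cm x z) (er j) by exact: Ck_derivable (Ck_shift 1 openT cg.1) I.
rewrite /a (deriveZ _ dg) mulrA -expr2 sqrr_sign mul1r.
by apply: derive_line => s; rewrite addrA.
Qed.

(* Each form supported in the box is a [box_form], so [csm_functional] applies. *)
Lemma functional_box (l : diff_form M k.+1 -> R) : form_linear l ->
  (forall eta, smooth_form eta -> l (ext_deriv eta) = 0) ->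
  exists c, forall w, smooth_form w -> fsupp [set z | dom x z /\ ball y0 r (cm x z)] w -> l w = c * integral_form w.
Proof.
move=> ll ld; exists (l (box_form (chi r (n := k.+1)))) => w sw [C [cC CB] w0].
pose f y := top_coef x w (y + y0).
have fd : fsupp (dom x) w by exists C => //; split=> // z /CB[].
have cf : csm r f.
  have [[r' _ [sf _]] _] := integral_translate y0 (csmc_top_coef sw fd).
  split=> // y ry; rewrite /f /top_coef patchE; case: ifPn => //; rewrite inE => iy.
  apply: w0 => /CB[_]; rewrite cinvK// mx_ballE opprD addrCA subrr addr0 normrN ltNge => /negP; exact.
have wE : w = box_form f.
  apply/funext => z; apply/funext => E; have [dz|nd] := pselect (dom x z); last first.
    by rewrite w0 => [|/CB[]//]; rewrite /box_form /chart_form; case: pselect.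
  have iz : img x (cm x z) by exact: cmap_img.
  rewrite /box_form chart_form_in// /f subrK /top_coef patchE (mem_set iz) mulrC (form_local _ E dz).
  have [ml al _] := (smooth_formP w).1 sw x.
  exact: top_form_det (ml _ iz) (al _ iz).
have lf : l (box_form f) = jint r f * l (box_form (chi r (n := k.+1))).
  apply: (csm_functional r0 (L := fun f => l (box_form f))) cf => [a g h cg ch|j g cg].
    rewrite -(ll a _ _ (smooth_box_form cg) (smooth_box_form ch)); congr l.
    rewrite /box_form -chart_form_lin; congr chart_form; apply/funext => y; apply/funext => E.
    by rewrite mulrDl mulrA.
  by have [eta seta ->] := box_form_derive j cg; exact: ld.
by rewrite wE lf (integral_box_form cf) (integral_rV_jint r0 cf) mulrC.
Qed.

End Box.

Lemma box_exists (U : set M) x : open U -> U x ->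
  exists2 r, 0 < r & [set y | `|y - cm x x| <= r] `<=` [set y | img x y /\ U (ci x y)].
Proof.
move=> oU Ux; have dx := mem_chart_at x.
have oV : open [set y | img x y /\ U (ci x y)].
  by apply: open_preimage; [exact: img_open|exact: cinv_continuous|].
have Vx : [set y | img x y /\ U (ci x y)] (cm x x) by split; [exact: cmap_img|rewrite cmapK].
have /nbhs_ballP[e e0 He] := open_nbhs_nbhs (conj oV Vx).
exists (e / 2); first by rewrite divr_gt0.
move=> y ye; apply: He; rewrite mx_ballE distrC; apply: le_lt_trans ye _.
by rewrite ltr_pdivrMr// ltr_pMr// ltr1n.
Qed.

Lemma unit_mass_form (U : set M) x : open U -> U x -> exists w, [/\ smooth_form w, fsupp U w & integral_form w = 1].
Proof.
move=> oU Ux; have [r r0 HK] := box_exists oU Ux.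
have Kx : [set y | `|y - cm x x| <= r] `<=` img x by move=> y /HK[].
have cf := csm_chi (n := k.+1) r0.
exists (box_form (x := x) (y0 := cm x x) (chi r (n := k.+1))); split; first exact: (smooth_box_form Kx cf).
  by apply: (fsupp_box_form Kx cf) => _ [y /HK[_ Uy] <-].
by rewrite (integral_box_form r0 Kx cf) (integral_rV_jint r0 cf) jint_chi.
Qed.

(** In each box [l] is a multiple of the integral. Overlapping boxes share a form of integral 1, so
    the multiple is locally constant, and connectedness makes it constant. *)
Theorem functional_constancy (l : diff_form M k.+1 -> R) : connected [set: M] -> form_linear l ->
  (forall eta, smooth_form eta -> l (ext_deriv eta) = 0) ->
  exists c, forall w, smooth_form w -> l w = c * integral_form w.
Proof.
move=> kM ll ld.
have H x : exists c, exists O, [/\ open O, O x & forall w, smooth_form w -> fsupp O w -> l w = c * integral_form w].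
  have [r r0 HK] := @box_exists setT x openT I.
  have Kx : [set y | `|y - cm x x| <= r] `<=` img x by move=> y /HK[].
  have [c Hc] := functional_box r0 Kx ll ld; exists c.
  exists [set z | dom x z /\ ball (cm x x) r (cm x z)]; split=> //.
    by apply: open_preimage; [exact: cdom_open|exact: cmap_continuous|exact: ball_open].
  by split; [exact: mem_chart_at|exact: ballxx].
have /choice[c /choice[V HV]] := H.
have cV x z : V x z -> c z = c x.
  have [oVx _ Hx] := HV x; have [oVz Vz Hz] := HV z => Vxz.
  have [w [sw [K [cK KV] w0] Iw]] := unit_mass_form (openI oVx oVz) (conj Vxz Vz).
  have fx : fsupp (V x) w by exists K => //; split=> // y /KV[].
  have fz : fsupp (V z) w by exists K => //; split=> // y /KV[].
  by have := Hx w sw fx; rewrite (Hz w sw fz) Iw !mulr1.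
have oc (A : set R) : open [set x | A (c x)].
  rewrite openE => x Ax; have [oV Vx _] := HV x.
  by apply: filterS (open_nbhs_nbhs (conj oV Vx)) => z Vz; rewrite /= (cV x).
(* The empty set counts as connected; there every form is the zero form. *)
have [[x0 _]|nM] := pselect (exists x : M, True); last first.
  exists 0 => w sw; rewrite mul0r; suff -> : w = @fzero R k.+1 M k.+1 by exact: form_linear0 ll.
  by apply/funext => x; case: nM; exists x.
have cE x : c x = c x0.
  have : [set x | c x = c x0] = setT.
    apply: kM; first by exists x0.
    - by exists [set x | c x = c x0]; [exact: (oc [set t | t = c x0])|rewrite setTI].
    - exists [set x | c x = c x0]; last by rewrite setTI.
      by rewrite -[X in closed X]setCK; apply: open_closedC; exact: (oc [set t | t <> c x0]).
  by move=> /seteqP[_ /(_ x I)].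
exists (c x0) => w sw; move: w sw (fsuppT cM w); apply: localize => [w w' sw sw' _ _ E E'||x _].
- by rewrite !(form_linearD _ sw sw')//; [rewrite E E' mulrDr|exact: integral_form_lin].
- by rewrite !form_linear0 ?mulr0//; exact: integral_form_lin.
by have [oV Vx HVx] := HV x; exists (V x); split=> // w sw _ fw; rewrite (HVx w)// cE.
Qed.

End TopForms.

(** Comparison with a multiple of a bump function equal to 1 on a ball containing [K], whose
    integral is the constant [B]. *)
Lemma integral_bound (R : realType) n (K : set 'rV[R]_n) : compact K ->
  exists2 B : R, 0 <= B & forall f e, csmc f -> (forall y, K y -> `|f y| <= e) -> (forall y, ~ K y -> f y = 0) ->
    0 <= e -> `|integral_rV f| <= e * B.
Proof.
move=> cK.
have [r r0 Kr] := @compact_bound _ _ K (fun y : 'rV[R]_n => `|y|) cK (fun y _ => @norm_continuous _ _ y).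
pose b := cubebump (0 : 'rV[R]_n) r.
have cb : csmc b.
  exists (2 * r); first by rewrite mulr_gt0.
  by split=> [j|y ry]; [exact: Ck_bump|apply: bump_0 => //; rewrite subr0].
have b0 y : 0 <= b y by case/andP: (bump01 (0 : 'rV[R]_n) r y).
exists (integral_rV b); first by rewrite -(integral_cst0 n); apply: integral_le => //; exact: csmc_cst0.
move=> f e cf fe f0 e0.
have fb y : `|f y| <= e * b y.
  have [Ky|nK] := pselect (K y); last by rewrite f0// normr0 mulr_ge0.
  rewrite /b bump_1 ?mulr1//; first exact: fe.
  by have := Kr y Ky; rewrite normr_id subr0.
have I (s : R) : integral_rV (fun y => s * b y + 0) = s * integral_rV b.
  by rewrite (integral_lin s cb (csmc_cst0 n)) integral_cst0 addr0.
have H1 := integral_le cf (csmc_lin e cb (csmc_cst0 n)); rewrite I in H1.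
have H2 := integral_le (csmc_lin (- e) cb (csmc_cst0 n)) cf; rewrite I in H2.
rewrite ler_norml -mulNr H1 ?H2// => y; have := fb y; rewrite ler_norml addr0.
  by rewrite mulNr => /andP[].
by move=> /andP[].
Qed.

(** * The current of integration and functionals concentrated on the submanifold *)

Section IntegrationCurrent.
Context {R : realType} {n k : nat} {X : manifold R n} {M : manifold R k.+1} {f : M -> X}.
Hypotheses (oM : oriented M) (cM : compact [set: M]).

Local Notation dom p := (cdom (chart_at p)).
Local Notation img p := (cimg (chart_at p)).
Local Notation cm p := (cmap (chart_at p)).
Local Notation ci p := (cinv (chart_at p)).

Section Smooth.
Hypothesis sf : smooth_map f.

Lemma chart_integral_small (p : M) (q : X) (rho : M -> R) e : smooth_fun rho ->
  csupp [set x | dom p x /\ dom q (f x)] rho -> 0 < e ->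
  cinf [set psi : diff_form X k.+1 | `|chart_integral p (fscale rho (pullback f psi))| < e].
Proof.
move=> sr [K [cK KW] r0] e0; pose K' := cm p @` K.
have cK' : compact K' by apply: compact_image cK => x /KW[dx _]; exact: cmap_continuous.
have KU : K' `<=` mdom (f := f) p q.
  by move=> _ [x /KW[dx dq] <-]; split; [exact: cmap_img|rewrite cmapK].
have [B B0 HB] := integral_bound cK'.
have e1 : 0 < e / (B + 1) by rewrite divr_gt0// ltr_wpDl.
have Cr l : Ck l (mdom (f := f) p q) (rho \o ci p).
  by apply: (Ck_sub _ ((smooth_funP _).1 sr p l)) => y [].
have oU := mdom_open sf p q.
have sF : smoothF (@cinf R n X k.+1) (mdom (f := f) p q) (fun psi y => fpull (mloc (f := f) p q) (local_form psi q) y 1%:M).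
  apply: filterS (cinf_fform k.+1 q) => psi fpsi l.
  exact: fform_Ck (fpull_fform oU (img_open q) (@mloc_img _ _ _ _ _ f p q) (fun j => Ck_mloc sf j p q) fpsi).
have N0 := @null_fpull _ _ _ (@cinf_filter R n X k.+1) _ _ _ 0 _ _ _ _ 1%:M oU (img_open q) (@mloc_img _ _ _ _ _ f p q) (fun j => Ck_mloc sf j p q)
  (cinf_fform k.+1 q) (fun E => null_local_form q E 0).
have N1 := null0 (nullM oU Cr sF N0) cK' KU e1.
apply: filterS2 (N1 (@cinf_filter R n X k.+1)) (cinf_smooth k.+1) => psi small spsi.
have sw := smooth_fscale sr (smooth_pullback sf spsi).
have fw : fsupp (dom p) (fscale rho (pullback f psi)).
  by exists K; [split=> // x /KW[]|move=> x E nK; rewrite /fscale r0// mul0r].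
apply: le_lt_trans (HB _ (e / (B + 1)) (csmc_top_coef sw fw) _ _ (ltW e1)) _.
- move=> y Ky; have my := KU y Ky; rewrite /top_coef patchE (mem_set my.1).
  rewrite -[local_form _ _ _ _]/(rho (ci p y) * local_form (pullback f psi) p y 1%:M) (local_pullback sf psi _ my).
  exact: ltW (small y Ky).
- move=> y nK; rewrite /top_coef patchE; case: ifPn => //; rewrite inE => iy.
  rewrite -[LHS]/(rho (ci p y) * local_form (pullback f psi) p y 1%:M) r0 ?mul0r// => Ky.
  by apply: nK; exists (ci p y) => //; exact: cinvK.
- by rewrite mulrAC ltr_pdivrMr ?ltr_wpDl// ltr_pM2l// ltrDl.
Qed.

Lemma integration_current_current : current (integration_current f).
Proof.
(* The partition is also subordinate to preimages of charts of [X], so that each piece is controlled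
   by seminorms in a single chart of [X]. *)
have [W oW] : exists2 s, partition_of_unity M s & forall c, c \in s -> csupp [set x | dom c.1 x /\ dom (f c.1) (f x)] c.2.
  apply: (pou_exists (W := fun p => [set x | dom p x /\ dom (f p) (f x)]) cM) => p; split=> [||x []//].
    apply: open_preimage; [exact: cdom_open|move=> x _; exact: sf.1|exact: cdom_open].
  by split; exact: mem_chart_at.
move=> Hs; split=> [a psi eta spsi seta|e e0].
  rewrite /integration_current pullback_lin.
  by apply: (integral_form_lin oM cM); exact: smooth_pullback.
have H s : (forall c, c \in s -> csupp [set x | dom c.1 x /\ dom (f c.1) (f x)] c.2 /\ smooth_fun c.2) ->
  forall e, 0 < e -> cinf [set psi : diff_form X k.+1 | `|\sum_(c <- s) chart_integral c.1 (fscale c.2 (pullback f psi))| < e].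
  elim: s => [_ r r0|c s IH Hc r r0]; first by apply: filterS filterT => psi _; rewrite /= big_nil normr0.
  have r2 : 0 < r / 2 by rewrite divr_gt0.
  have [sc smc] := Hc c (mem_head _ _).
  apply: filterS2 (chart_integral_small smc sc r2) (IH (fun d ds => Hc d (mem_behead (s := c :: s) ds)) _ r2) => psi /= h1 h2.
  by rewrite big_cons [r]splitr; apply: le_lt_trans (ler_normD _ _) _; exact: ltrD.
have sW c : c \in W -> csupp [set x | dom c.1 x /\ dom (f c.1) (f x)] c.2 /\ smooth_fun c.2.
  by move=> cW; split; [exact: Hs|case: c cW => q rho /(oW.1)[]].
apply: filterS2 (H W sW e e0) (cinf_smooth k.+1) => psi /= small spsi.
by rewrite /integration_current (integral_form_pou oM cM oW (smooth_pullback sf spsi)).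
Qed.

Lemma integration_current_exact (eta : diff_form X k) : smooth_form eta -> integration_current f (ext_deriv eta) = 0.
Proof.
move=> se; rewrite /integration_current pullback_ext_deriv//.
by apply: (stokes oM cM); exact: smooth_pullback.
Qed.

End Smooth.

Hypotheses (emb : embedding f) (kM : connected [set: M]).

Let sf : smooth_map f. Proof. by case: emb. Qed.

(** By [kernel_pullback] the value of [L] depends only on the pullback, so [L] descends along
    extensions to a functional on top forms of the submanifold, where [functional_constancy]
    applies. *)
Theorem functional_on_submanifold (L : diff_form X k.+1 -> R) : form_linear L ->
  (forall eta, smooth_form eta -> L (ext_deriv eta) = 0) ->
  (forall w, smooth_form w -> (forall x E, w (f x) E = 0) -> L w = 0) ->
  exists c, forall psi, smooth_form psi -> L psi = c * integration_current f psi.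
Proof.
move=> lL Ld Lv.
have H j (w : diff_form M j) : exists psi : diff_form X j, smooth_form w -> smooth_form psi /\ pullback f psi = w.
  have [sw|nsw] := pselect (smooth_form w); last by exists (@fzero R n X j) => /nsw.
  have [psi sp E] := form_extension emb cM sw; exists psi => _; split=> //.
  by apply/funext => x; apply/funext => F; exact: E.
have /choice[ext Hext] := H k.+1.
have uniq psi psi' : smooth_form psi -> smooth_form psi' -> pullback f psi = pullback f psi' -> L psi = L psi'.
  move=> sp sp' pp; have H0 : L (fun x E => (-1) * psi x E + psi' x E) = 0.
    apply: (kernel_pullback emb cM lL Ld Lv) => [|x E]; first exact: smooth_lin.
    by rewrite pullback_lin pp mulN1r addNr.
  by move: H0; rewrite lL// mulN1r addrC => /eqP; rewrite subr_eq0 => /eqP.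
have [a w w' sw sw'|eta se|c Hc] := functional_constancy oM cM (l := fun w => L (ext w)) kM.
- have [s1 e1] := Hext w sw; have [s2 e2] := Hext w' sw'; have [s3 e3] := Hext _ (smooth_lin a sw sw').
  apply: etrans _ (lL a _ _ s1 s2); apply: (uniq _ _ s3 (smooth_lin a s1 s2)).
  by apply: etrans e3 _; rewrite pullback_lin e1 e2.
- have [psi /(_ se)[sp e]] := H k eta; have [s1 e1] := Hext _ (smooth_ext_deriv se).
  apply: etrans _ (Ld psi sp); apply: (uniq _ _ s1 (smooth_ext_deriv sp)).
  by apply: etrans e1 _; rewrite (pullback_ext_deriv sf sp) e.
exists c => psi sp; have sp' := smooth_pullback sf sp; rewrite -(Hc _ sp').
by have [s1 e1] := Hext _ sp'; apply: (uniq _ _ sp s1); rewrite e1.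
Qed.

(** By duality: a functional separating [psi] from the exact forms along the submanifold would be a
    multiple of the integration current, which vanishes on [psi]. *)
Lemma exact_on_submanifold (psi : diff_form X k.+1) : smooth_form psi -> integration_current f psi = 0 ->
  exists2 eta : diff_form X k, smooth_form eta & forall x E, psi (f x) E = ext_deriv eta (f x) E.
Proof.
(* The restriction keeps the values on all frames of [X] at points of the submanifold, not only on
   tangent ones. *)
move=> sp p0; pose res (w : diff_form X k.+1) := fun t : M * 'M[R]_(k.+1, n) => w (f t.1) t.2.
pose W := [set v | exists2 eta : diff_form X k, smooth_form eta & v = res (ext_deriv eta)].
have [[eta se e]|nW] := pselect (W (res psi)).
  by exists eta => // x E; exact: (congr1 (fun v => v (x, E)) e).
have W0 : W (fun=> 0).
  exists (@fzero R n X k); first exact: smooth_fzero.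
  by apply/funext => t; apply: esym; exact: (ext_deriv_zero _ openT I).
have Wl a u w : W u -> W w -> W (fun t => a * u t + w t).
  move=> [eta se ->] [eta' se' ->]; exists (fun x E => a * eta x E + eta' x E); first exact: smooth_lin.
  by rewrite ext_deriv_lin.
have [L [Ll LW L1]] := separation W0 Wl nW.
have [a w w' _ _|eta se|w sw w0|c Hc] := @functional_on_submanifold (fun w => L (res w)).
- exact: Ll.
- by apply: LW; exists eta.
- rewrite (_ : res w = (fun t => (-1) * (fun=> 0) t + (fun=> 0) t)); first by rewrite Ll mulN1r addNr.
  by apply/funext => t; rewrite mulr0 addr0; exact: w0.
by move: L1; rewrite (Hc psi sp) p0 mulr0 => /eqP; rewrite eq_sym oner_eq0.
Qed.

End IntegrationCurrent.

(** * The conformal metric *)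

Section Orthonormal.
Context {R : realType} {n : nat} (G : 'M[R]_n).
Hypotheses (Gsym : G^T = G) (Gpos : forall v : 'rV[R]_n, v != 0 -> 0 < (v *m G *m v^T) 0 0).

Lemma metric_unitmx : G \in unitmx.
Proof.
rewrite -row_free_unit -kermx_eq0; apply/rowV0P => v /sub_kermxP vG.
by apply/eqP; apply: contraT => /Gpos; rewrite vG mul0mx mxE ltxx.
Qed.

Lemma gram_swap a b (A : 'M[R]_(a, n)) (B : 'M[R]_(b, n)) : (A *m G *m B^T)^T = B *m G *m A^T.
Proof. by rewrite !trmx_mul trmxK Gsym mulmxA. Qed.

Lemma orthonormal_free j (B : 'M[R]_(j, n)) : B *m G *m B^T = 1%:M -> row_free B.
Proof. by move=> BB; apply/row_freeP; exists (G *m B^T); rewrite mulmxA. Qed.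

(** Gram-Schmidt, by induction on the missing rank. The injection records where the rows of [B] sit,
    which avoids casts between matrix sizes. *)
Lemma orthonormal_extend s (V : 'M[R]_(s, n)) j (B : 'M[R]_(j, n)) : B *m G *m B^T = 1%:M -> (B <= V)%MS ->
  exists r (A : 'M[R]_(r, n)) (f : 'I_j -> 'I_r),
    [/\ A *m G *m A^T = 1%:M, injective f, rowsub f A = B & (A :=: V)%MS].
Proof.
move: {2}(\rank V - j)%N (leqnn (\rank V - j)) => d; elim: d j B => [|d IH] j B Hd BB BV.
  have rB : \rank B = j by apply/eqP; exact: orthonormal_free BB.
  exists j, B, id; split=> //; first by apply/matrixP => a b; rewrite mxE.
  by apply/eqmxP; rewrite -(geq_leqif (mxrank_leqif_eq BV)) rB -subn_eq0 -leqn0.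
have [VB|nVB] := boolP (V <= B)%MS.
  exists j, B, id; split=> //; first by apply/matrixP => a b; rewrite mxE.
  by apply/eqmxP; rewrite BV VB.
have [i ni] : exists i, ~~ (row i V <= B)%MS by apply/row_subPn.
pose u := row i V - row i V *m G *m B^T *m B.
have uV : (u <= V)%MS.
  by rewrite addmx_sub ?row_sub// eqmx_opp (submx_trans _ BV)// submxMl.
have u0 : u != 0.
  apply: contra ni; rewrite subr_eq0 => /eqP ->; exact: submxMl.
have uB : u *m G *m B^T = 0 by rewrite /u !mulmxBl -!mulmxA (mulmxA B) BB mulmx1 subrr.
have n0 := Gpos u0; set c := (u *m G *m u^T) 0 0 in n0.
pose u' := (Num.sqrt c)^-1 *: u.
have uc : u' *m G *m u'^T = 1%:M.
  rewrite /u' linearZ/= -!scalemxAl -scalemxAr scalerA [_ *m _]mx11_scalar -/c scale_scalar_mx.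
  rewrite -invfM -expr2 sqr_sqrtr ?ltW// mulVf ?gt_eqF//.
have u'B : u' *m G *m B^T = 0 by rewrite /u' -!scalemxAl uB scaler0.
have Bu' : B *m G *m u'^T = 0 by rewrite -gram_swap u'B trmx0.
have B1 : col_mx B u' *m G *m (col_mx B u')^T = 1%:M.
  by rewrite mul_col_mx tr_col_mx mul_col_row BB uc Bu' u'B -scalar_mx_block.
have B1V : (col_mx B u' <= V)%MS.
  by rewrite col_mx_sub BV /= scalemx_sub.
have [|r [A [f [AA fi fA AV]]]] := IH _ _ _ B1 B1V.
  have rB1 : \rank (col_mx B u') = (j + 1)%N by apply/eqP; exact: orthonormal_free B1.
  by move: Hd; rewrite addn1 subnS; case: (\rank V - j)%N.
exists r, A, (f \o lshift 1); split=> //; first by move=> a b /fi/lshift_inj.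
rewrite rowsub_comp fA; apply/matrixP => a b; rewrite mxE; exact: col_mxEu.
Qed.

Lemma orthonormal_basis_of m (E : 'M[R]_(m, n)) : row_free E ->
  exists (T : 'M[R]_m) (A : 'M[R]_(m, n)), [/\ E = T *m A, A *m G *m A^T = 1%:M & \det (E *m G *m E^T) = \det T ^+ 2].
Proof.
move=> /eqP fE; have B0 : (0 : 'M[R]_(0, n)) *m G *m 0^T = 1%:M by rewrite [LHS]flatmx0 [RHS]flatmx0.
have [r [A [_ [AA _ _ AE]]]] := orthonormal_extend B0 (sub0mx _ E).
have rA : r = m by rewrite -fE -AE; apply/esym/eqP; exact: orthonormal_free AA.
subst r; exists (E *m pinvmx A), A.
have EA : E = E *m pinvmx A *m A by rewrite mulmxKpV// AE.
split=> //; rewrite {1 2}EA trmx_mul; set T := E *m _.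
have -> : T *m A *m G *m (A^T *m T^T) = T *m (A *m G *m A^T) *m T^T by rewrite !mulmxA.
by rewrite AA mulmx1 det_mulmx det_tr expr2.
Qed.

(** The last identity is the completeness relation of the frame; it turns contractions with the
    inverse metric into sums over frame vectors. *)
Lemma frame_exists m (A1 : 'M[R]_(m, n)) : A1 *m G *m A1^T = 1%:M ->
  exists r (A : 'M[R]_(r, n)) (f : 'I_m -> 'I_r),
    [/\ A *m G *m A^T = 1%:M, injective f, rowsub f A = A1 & A^T *m A = invmx G].
Proof.
move=> A11; have [r [A [f [AA fi fA AV]]]] := orthonormal_extend A11 (submx1 A1).
exists r, A, f; split=> //; have uG := metric_unitmx.
have /row_fullP[B BA] : row_full A by rewrite /row_full AV mxrank1.
have H : (A^T *m A *m G - 1%:M) *m A^T = 0.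
  by rewrite mulmxBl mul1mx -!mulmxA (mulmxA A) AA mulmx1 subrr.
have /eqP : (A^T *m A *m G - 1%:M) *m A^T *m B^T = 0 by rewrite H mul0mx.
rewrite -mulmxA -trmx_mul BA trmx1 mulmx1 subr_eq0 => /eqP E.
by rewrite -[LHS](mulmxK uG) E mul1mx.
Qed.

(** The polarized Hilbert-Schmidt norm, as a contraction with the inverse metric, so that no smooth
    choice of frames is required. All index maps are summed, hence the division by m!. *)
Definition normsq m (a b : 'M[R]_(m, n) -> R) : R := (m`!%:R)^-1 *
  \sum_(I : {ffun 'I_m -> 'I_n}) \sum_(J : {ffun 'I_m -> 'I_n})
    (\prod_l invmx G (I l) (J l)) * (a (deltaI I) * b (deltaI J)).

Lemma rowsub_expand m r (A : 'M[R]_(r, n)) (a : 'M[R]_(m, n) -> R) (L : {ffun 'I_m -> 'I_r}) : multilinear a ->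
  a (rowsub L A) = \sum_(I : {ffun 'I_m -> 'I_n}) (\prod_l A (L l) (I l)) * a (deltaI I).
Proof.
move=> ma; rewrite (multilinear_expand _ ma); apply: eq_bigr => I _; congr (_ * _).
by apply: eq_bigr => l _; rewrite mxE.
Qed.

Lemma normsq_frame m r (A : 'M[R]_(r, n)) (a b : 'M[R]_(m, n) -> R) : A^T *m A = invmx G ->
  multilinear a -> multilinear b ->
  normsq a b = (m`!%:R)^-1 * \sum_(L : {ffun 'I_m -> 'I_r}) a (rowsub L A) * b (rowsub L A).
Proof.
move=> AG ma mb; congr (_ * _).
transitivity (\sum_(I : {ffun 'I_m -> 'I_n}) \sum_(J : {ffun 'I_m -> 'I_n}) \sum_(L : {ffun 'I_m -> 'I_r})
    (\prod_l A (L l) (I l) * a (deltaI I)) * (\prod_l A (L l) (J l) * b (deltaI J))).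
  apply: eq_bigr => I _; apply: eq_bigr => J _.
  rewrite (_ : \prod_l invmx G (I l) (J l) = \sum_(L : {ffun 'I_m -> 'I_r}) \prod_l (A (L l) (I l) * A (L l) (J l))).
    by rewrite mulr_suml; apply: eq_bigr => L _; rewrite big_split /= mulrACA.
  rewrite -(bigA_distr_bigA (fun l s => A s (I l) * A s (J l))); apply: eq_bigr => l _.
  by rewrite -AG mxE; apply: eq_bigr => s _; rewrite mxE.
under eq_bigr => I _ do rewrite exchange_big /=.
rewrite exchange_big /=; apply: eq_bigr => L _.
rewrite (rowsub_expand A L ma) (rowsub_expand A L mb) mulr_suml; apply: eq_bigr => I _.
by rewrite mulr_sumr.
Qed.

Lemma rowsub_perm m r (A : 'M[R]_(r, n)) (A1 : 'M[R]_(m, n)) (f : 'I_m -> 'I_r) (s : 'S_m) (L : {ffun 'I_m -> 'I_r}) :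
  rowsub f A = A1 -> (forall i, L i = f (s i)) -> rowsub L A = perm_mx s *m A1.
Proof.
by move=> <- Lf; rewrite -row_permE; apply/matrixP => i j; rewrite !mxE Lf.
Qed.

Lemma normsqDZl m (a a' b : 'M[R]_(m, n) -> R) t : normsq (fun E => t * a E + a' E) b = t * normsq a b + normsq a' b.
Proof.
rewrite /normsq mulrCA -mulrDr; congr (_ * _); rewrite mulr_sumr -big_split; apply: eq_bigr => I _ /=.
by rewrite mulr_sumr -big_split; apply: eq_bigr => J _ /=; rewrite mulrDl mulrDr -!mulrA mulrCA.
Qed.

Lemma normsqC m (a b : 'M[R]_(m, n) -> R) : normsq a b = normsq b a.
Proof.
rewrite /normsq exchange_big; congr (_ * _); apply: eq_bigr => I _; apply: eq_bigr => J _.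
rewrite (mulrC (a _)); congr (_ * _); apply: eq_bigr => l _.
by rewrite -[in LHS](trmxK (invmx G)) mxE trmx_inv Gsym.
Qed.

Lemma normsq_ge0 m (a : 'M[R]_(m, n) -> R) : multilinear a -> 0 <= normsq a a.
Proof.
move=> ma; have B0 : (0 : 'M[R]_(0, n)) *m G *m 0^T = 1%:M by rewrite [LHS]flatmx0 [RHS]flatmx0.
have [r [A [_ [_ _ _ AG]]]] := frame_exists B0.
by rewrite (normsq_frame AG ma ma) mulr_ge0 ?invr_ge0// sumr_ge0// => L _; rewrite -expr2 sqr_ge0.
Qed.

Lemma normsqZ m t (a b : 'M[R]_(m, n) -> R) : normsq (fun E => t * a E) b = t * normsq a b.
Proof.
have := normsqDZl a (fun=> 0) b t; rewrite [normsq (fun=> 0) b]/normsq big1 => [|I _].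
  by rewrite mulr0 addr0 => <-; congr normsq; apply/funext => E; rewrite addr0.
by rewrite big1// => J _; rewrite mul0r mulr0.
Qed.

Lemma multilinear_gram m (B : 'M[R]_(n, m)) :
  multilinear (fun E : 'M[R]_(m, n) => \det (E *m B)) /\ alternating (fun E : 'M[R]_(m, n) => \det (E *m B)).
Proof.
have r' i (A : 'M[R]_(m, n)) : row' i (A *m B) = row' i A *m B by rewrite !row'Esub mul_rowsub_mx.
split=> [i A C D b c rA rC rD|A i j ij rij].
  by apply: (multilinear_det (i := i)); [rewrite !row_mul rA mulmxDl -!scalemxAl|rewrite !r' rC|rewrite !r' rD].
by apply: (alternating_det ij); rewrite !row_mul rij.
Qed.

Section Dual.
Context {m : nat} {A1 : 'M[R]_(m, n)}.
Hypothesis A11 : A1 *m G *m A1^T = 1%:M.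

(** The first argument is the volume form of the span of [A1] after orthogonal projection. In a
    frame extending [A1] it is nonzero only on permutations of the rows of [A1], each of which
    contributes [b A1]. *)
Lemma normsq_dual (b : 'M[R]_(m, n) -> R) : multilinear b -> alternating b ->
  normsq (fun E => \det (E *m (G *m A1^T))) b = b A1.
Proof.
move=> mb ab; have [r [A [f [AA fi fA AG]]]] := frame_exists A11.
have [mn an] := multilinear_gram (G *m A1^T).
rewrite (normsq_frame AG mn mb).
have P (L : {ffun 'I_m -> 'I_r}) i j : (rowsub L A *m (G *m A1^T)) i j = (L i == f j)%:R.
  transitivity ((A *m G *m A^T) (L i) (f j)); last by rewrite AA mxE.
  rewrite -fA -mulmxA !mxE; apply: eq_bigr => s _; rewrite !mxE; congr (_ * _).
  by apply: eq_bigr => t _; rewrite !mxE.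
pose h (s : 'S_m) := [ffun i => f (s i)].
have hE s : rowsub (h s) A = perm_mx s *m A1 by apply: rowsub_perm fA _ => i; rewrite ffunE.
transitivity ((m`!%:R)^-1 * \sum_(s : 'S_m) \sum_(L : {ffun 'I_m -> 'I_r})
    (-1) ^+ s * ((\prod_i (L i == f (s i))%:R) * b (rowsub L A))).
  rewrite exchange_big; congr (_ * _); apply: eq_bigr => L _ /=.
  rewrite /determinant mulr_suml; apply: eq_bigr => s _; rewrite -!mulrA; congr (_ * (_ * _)).
  by apply: eq_bigr => i _; exact: P.
rewrite (eq_bigr (fun _ : 'S_m => b A1)).
  by rewrite sumr_const card_Sn -[b A1 *+ _]mulr_natl mulrA mulVf ?mul1r// pnatr_eq0 -lt0n fact_gt0.
move=> s _; rewrite (bigD1 (h s))//= [X in _ + X]big1 ?addr0 => [|L Lh].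
  rewrite big1 ?mul1r; last by move=> i _; rewrite ffunE eqxx.
  by rewrite hE (alternating_mulmx _ _ mb ab) det_perm mulrA -expr2 sqrr_sign mul1r.
have [i Li] : exists i, L i != h s i.
  apply/existsP; apply: contraR Lh; rewrite negb_exists => /forallP H.
  by apply/eqP/ffunP => i; apply/eqP; have := H i; rewrite negbK.
by rewrite (bigD1 i)//= -[f (s i)](ffunE (fun i => f (s i))) (negPf Li) !mul0r mulr0.
Qed.

(** Bessel's inequality: removing from [a] its component along the unit form [nu] leaves a form of
    squared norm [normsq a a - a A1 ^+ 2]. *)
Lemma normsq_orthonormal (a : 'M[R]_(m, n) -> R) : multilinear a -> alternating a -> a A1 ^+ 2 <= normsq a a.
Proof.
move=> ma aa; pose nu E := \det (E *m (G *m A1^T)).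
have [mn an] := multilinear_gram (G *m A1^T).
have nb := normsq_dual ma aa; have nn := normsq_dual mn an.
have n1 : nu A1 = 1 by rewrite /nu mulmxA A11 det1.
pose d E := (- a A1) * nu E + a E.
have md : multilinear d.
  move=> i A B C b c rA rB rC; rewrite /d (ma i A B C b c)// /nu (mn i A B C b c)//; ring.
have := normsq_ge0 md; rewrite /d normsqDZl (normsqC nu) (normsqC a) !normsqDZl.
rewrite [normsq nu nu]nn [normsq nu a]nb [normsq a nu]normsqC [normsq nu a]nb -/(nu A1) n1.
by rewrite mulr1 mulrDr mulNr mulrN opprK -!expr2; lra.
Qed.

End Dual.

Lemma normsq_bound m (a : 'M[R]_(m, n) -> R) (E : 'M[R]_(m, n)) : multilinear a -> alternating a -> row_free E ->
  a E ^+ 2 <= normsq a a * \det (E *m G *m E^T).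
Proof.
move=> ma aa fE; have [T [A1 [-> A11 ->]]] := orthonormal_basis_of fE.
by rewrite (alternating_mulmx _ _ ma aa) exprMn mulrC ler_wpM2r ?sqr_ge0// normsq_orthonormal.
Qed.

(** The equality case of [normsq_bound]: [a] is a multiple of the volume form of the span of [E]. *)
Lemma normsq_simple m (a : 'M[R]_(m, n) -> R) (E : 'M[R]_(m, n)) c : row_free E ->
  (forall F, a F = c * \det (F *m G *m E^T)) ->
  a E ^+ 2 = normsq a a * \det (E *m G *m E^T) /\ 0 < \det (E *m G *m E^T).
Proof.
move=> fE aE; have [T [A1 [ET A11 dE]]] := orthonormal_basis_of fE.
have dT : \det T != 0.
  rewrite -unitfE -unitmxE -row_free_unit /row_free eqn_leq rank_leq_row /=.
  by rewrite -{1}(eqP fE) ET mxrankM_maxl.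
have [mn an] := multilinear_gram (G *m A1^T).
have aN : a = (fun F => (c * \det T) * \det (F *m (G *m A1^T))).
  apply/funext => F; rewrite aE ET trmx_mul !mulmxA det_mulmx det_tr; ring.
have N : normsq a a = (c * \det T) ^+ 2.
  rewrite [in LHS]aN normsqZ normsqC normsqZ (normsq_dual A11 mn an) mulmxA A11 det1; ring.
split; last by rewrite dE exprn_even_gt0.
by rewrite N dE aE dE; ring.
Qed.

End Orthonormal.

Section Cutoff.
Context {R : realType}.

Lemma Ck_trmx j n a b (U : set 'rV[R]_n) (F : 'rV[R]_n -> 'M[R]_(a, b)) : open U -> Ck j U F -> Ck j U (fun y => (F y)^T).
Proof.
move=> oU CF; apply/(Ck_mx _ _ oU) => r c.
by apply: (Ck_eq oU _ ((Ck_mx _ _ oU).1 CF c r)) => y _; rewrite mxE.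
Qed.

Lemma local_lipschitz n (U : set 'rV[R]_n) (b : 'rV[R]_n -> R) z : open U -> Ck 1 U b -> U z ->
  exists d L, [/\ 0 < d, 0 <= L & forall x y, `|x - z| <= d -> `|y - z| <= d -> `|b x - b y| <= L * `|x - y|].
Proof.
move=> oU Cb Uz; have /nbhs_ballP[e e0 He] := open_nbhs_nbhs (conj oU Uz).
pose F y : 'rV[R]_1 := const_mx (b y).
have CF : Ck 1 U F by apply/(Ck_mx _ _ oU) => i j; apply: (Ck_eq oU _ Cb) => y _; rewrite mxE.
pose d := e / 2; have d0 : 0 < d by rewrite divr_gt0.
have dU y : `|y - z| <= d -> U y.
  move=> yd; apply: He; rewrite mx_ballE distrC; apply: le_lt_trans yd _.
  by rewrite ltr_pdivrMr// ltr_pMr// ltr1n.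
have CJ : Ck 0 U (jacobian F) by apply/(Ck_mx _ _ oU) => i j; exact: Ck_jacobian.
have cJ y : `|y - z| <= d -> {for y, continuous (fun y => `|jacobian F y|)}.
  by move=> yd; have H := Ck_continuous CJ (dU y yd); exact: (cvg_norm H).
have [B B0 HB] := compact_bound (closed_ball_compact (y := z) (r := d)) cJ.
exists d, (n%:R * B); split=> // [|x y xd yd]; first by rewrite mulr_ge0// ltW.
have -> : b x - b y = (F x - F y) 0 0 by rewrite !mxE.
apply: le_trans (coord_le_norm _ _ _) _.
apply: (small_jacobian_lipschitz oU CF _ _ xd yd); first by rewrite mulr_ge0// ltW.
move=> u ud; split; first exact: dU.
by rewrite ler_wpM2l//; have := HB u ud; rewrite normr_id.
Qed.

Lemma norm_sqr_le n (v : 'rV[R]_n) : `|v| ^+ 2 <= \sum_j v 0 j ^+ 2.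
Proof.
have S0 : 0 <= \sum_j v 0 j ^+ 2 by apply: sumr_ge0 => j _; exact: sqr_ge0.
rewrite -[leRHS]sqr_sqrtr// lerXn2r ?nnegrE// ?sqrtr_ge0//.
apply: mx_norm_le => [|i j]; first exact: sqrtr_ge0.
rewrite (ord1 i) -sqrtr_sqr ler_wsqrtr// (bigD1 j)//= lerDl.
by apply: sumr_ge0 => l _; exact: sqr_ge0.
Qed.

Lemma gram_change m n (E D : 'M[R]_(m, n)) (J P G : 'M[R]_n) (Q : 'M[R]_m) : J *m P = 1%:M ->
  E *m J *m (P *m G *m P^T *m (Q *m (D *m J))^T) = E *m G *m D^T *m Q^T.
Proof.
move=> JP; rewrite !trmx_mul !mulmxA -(mulmxA E) JP mulmx1.
by rewrite -(mulmxA (E *m G)) -trmx_mul JP trmx1 mulmx1.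
Qed.

End Cutoff.

(** * Local model: a tangent volume form and a squared distance near the submanifold *)

Section Tube.
Context {R : realType} {n k : nat} {X : manifold R n} {M : manifold R k.+1} {f : M -> X}.
Hypotheses (emb : embedding f) (oM : oriented M).
Context {g : X -> 'M[R]_n}.
Hypothesis gm : riemannian_metric g.

Local Notation dom p := (cdom (chart_at p)).
Local Notation img p := (cimg (chart_at p)).
Local Notation cm p := (cmap (chart_at p)).
Local Notation ci p := (cinv (chart_at p)).

Let sf : smooth_map f. Proof. by case: emb. Qed.

Lemma Ck_local_metric j (q : X) : Ck j (img q) (local_metric g q).
Proof.
have [_ _ sg] := gm; apply/(Ck_mx _ _ (img_open q)) => a b.
exact: ((smooth_onP _ _).1 (sg q a b)).
Qed.

Section Local.
Context {p : M} {D K : set 'rV[R]_n} {r : 'rV[R]_n -> 'rV[R]_k.+1} {s : 'rV[R]_n -> R}.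
Hypotheses (rt : retraction (f := f) p D r) (cK : compact K) (KD : K `<=` D).
Hypotheses (Cs : forall j, Ck j setT s) (s0 : forall z, ~ K z -> s z = 0) (s_ge0 : forall z, 0 <= s z).
Local Notation q := (f p).
Local Notation i := (mloc (f := f) p q).

Let oD := rt_open rt.
Let Kq : K `<=` img q. Proof. by move=> z /KD/(rt_img rt). Qed.
Let CsD j : Ck j D s. Proof. exact: Ck_sub (Cs j). Qed.

(** The tangent frame at the retracted point is paired with [E] through the metric at [z]. At points
    of the submanifold this is the volume of the orthogonal projection to the tangent space, up to a
    nonnegative factor. *)
Definition tube_form : diff_form X k.+1 := chart_form q (fun z E =>
  s z * \det (E *m (local_metric g q z *m (jacobian i (r z))^T))).

(** The squared Euclidean distance, in the chart, from a point to its retraction, damped by the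
    cut-off. The Euclidean sum is used because the max norm is not smooth. *)
Definition tube_dist : X -> R := chart_fun q (fun z => s z * \sum_j (z 0 j - i (r z) 0 j) ^+ 2).

Lemma smooth_tube_form : smooth_form tube_form.
Proof.
have Z y (E : 'M[R]_(k.+1, n)) : ~ K y -> s y * \det (E *m (local_metric g q y *m (jacobian i (r y))^T)) = 0.
  by move=> nK; rewrite s0// mul0r.
apply: (smooth_chart_form cK Kq); last by move=> y E _; exact: Z.
apply: (fform_cutoff _ oD cK KD) => //; apply: fform_scale => //.
split=> [y _|y _|E j].
- by have [] := @multilinear_gram R n _ (local_metric g q y *m (jacobian i (r y))^T).
- by have [] := @multilinear_gram R n _ (local_metric g q y *m (jacobian i (r y))^T).
apply: Ck_det; [exact: oD|apply: Ck_mulmx; [exact: oD|exact: Ck_cst|]].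
apply: Ck_mulmx; [exact: oD|exact: (Ck_sub (rt_img rt) (Ck_local_metric j q))|].
have oU := mdom_open sf p q; apply: Ck_trmx; first exact: oD.
have CJ : Ck j (mdom (f := f) p q) (jacobian i).
  by apply/(Ck_mx _ _ oU) => a b; apply: Ck_jacobian; [exact: oU|exact: Ck_mloc].
exact: (Ck_comp_mx oD oU (rt_dom rt) CJ (rt_Ck rt j)).
Qed.

Lemma smooth_tube_dist : smooth_fun tube_dist.
Proof.
have Z y : ~ K y -> s y * \sum_j (y 0 j - i (r y) 0 j) ^+ 2 = 0 by move=> nK; rewrite s0// mul0r.
apply: (smooth_chart_fun cK Kq) => [j|y _]; last exact: Z.
apply: (Ck_cutoff _ oD cK KD) => //; apply: CkM => //; apply: Ck_sum => // l _.
have Cd : Ck j D (fun z => z 0 l - i (r z) 0 l).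
  by apply: CkB => //; [exact: Ck_coord|exact: ((Ck_mx _ _ oD).1 (Ck_ir emb rt j))].
by apply: (Ck_eq oD _ (CkM oD Cd Cd)) => z _; rewrite expr2.
Qed.

Lemma tube_dist_ge0 x : 0 <= tube_dist x.
Proof.
rewrite /tube_dist /chart_fun; case: pselect => [dx|//].
by rewrite mulr_ge0// sumr_ge0// => j _; exact: sqr_ge0.
Qed.

Lemma tube_dist_range x : tube_dist (f x) = 0.
Proof.
rewrite /tube_dist /chart_fun; case: pselect => [dx|//].
have [Kz|nK] := pselect (K (cm q (f x))); last by rewrite s0// mul0r.
have [_ rz iz] := rt_point rt dx (KD Kz).
by rewrite big1 ?mulr0// => j _; rewrite rz iz subrr expr0n.
Qed.

Lemma tube_dist_gt0 x : dom q x -> 0 < s (cm q x) -> ~ range f x -> 0 < tube_dist x.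
Proof.
move=> dx sx nr; rewrite /tube_dist chart_fun_in// mulr_gt0//.
have Dz : D (cm q x) by apply: KD; apply: contrapT => /s0 e; rewrite e ltxx in sx.
have z0 : `|cm q x - i (r (cm q x))| != 0.
  rewrite normr_eq0 subr_eq0; apply/negP => /eqP e; apply: nr.
  exists (ci p (r (cm q x))) => //.
  by rewrite -(rt_range rt Dz (esym e)) cmapK.
apply: (@lt_le_trans _ _ (`|cm q x - i (r (cm q x))| ^+ 2)); first by rewrite exprn_gt0// lt_def z0 normr_ge0.
by apply: le_trans (norm_sqr_le _) _; apply: ler_sum => j _; rewrite !mxE.
Qed.

(** [b] vanishes at the retracted point, so a local Lipschitz bound controls it by the distance to
    that point. *)
Lemma tube_dist_growth d (b : X -> R) x : 0 < d -> (forall z, `|z - cm q q| < d -> s z = 1) ->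
  dom q (f x) -> `|cm q (f x) - cm q q| < d -> smooth_fun b -> (forall y, b (f y) = 0) ->
  exists O L, [/\ open O, O (f x), 0 <= L & forall y, O y -> b y ^+ 2 <= L * tube_dist y].
Proof.
move=> d0 s1 dx xd sb b0; set z := cm q (f x) in xd *.
have iz : img q z by exact: cmap_img.
have Dz : D z by apply: KD; apply: contrapT => /s0 e; have := s1 z xd; rewrite e => /eqP; rewrite eq_sym oner_eq0.
have [_ rz iz'] := rt_point rt dx Dz.
have [e [L [e0 L0 HL]]] := local_lipschitz (img_open q) ((smooth_funP _).1 sb q 1%N) iz.
pose B := ball z e `&` ball (cm q q) d `&` [set u | D u /\ ball z e (i (r u))].
have oB : open B.
  apply: openI; first by apply: openI; exact: ball_open.
  by apply: open_preimage; [exact: oD|move=> u Du; exact: (Ck_continuous (Ck_ir emb rt 0) Du)|exact: ball_open].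
exists [set y | dom q y /\ B (cm q y)], (L ^+ 2); split.
- by apply: open_preimage; [exact: cdom_open|exact: cmap_continuous|].
- split=> //; split; first by split; [exact: ballxx|rewrite mx_ballE distrC].
  by split=> //; rewrite rz iz'; exact: ballxx.
- exact: sqr_ge0.
move=> y [dy [[ze zd] [Dy ie]]]; set u := cm q y in ze zd Dy ie.
have H : `|b y| <= L * `|u - i (r u)|.
  have [iy dfy] := rt_dom rt Dy.
  have b2 : (b \o ci q) (i (r u)) = 0 by rewrite /mloc /= cmapK.
  move: ze ie; rewrite !mx_ballE => ze ie.
  by have := HL u (i (r u)); rewrite b2 subr0 /= /u cmapK//; apply; rewrite distrC; exact: ltW.
rewrite /tube_dist chart_fun_in// -/u s1; last by move: zd; rewrite mx_ballE distrC.
rewrite mul1r -real_normK ?num_real//; apply: le_trans (_ : (L * `|u - i (r u)|) ^+ 2 <= _).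
  by rewrite lerXn2r ?nnegrE// mulr_ge0.
rewrite exprMn ler_wpM2l ?sqr_ge0//; apply: le_trans (norm_sqr_le _) _.
by apply: ler_sum => j _; rewrite !mxE.
Qed.

Lemma tube_form_range x : exists c, [/\ 0 <= c, (dom q (f x) -> 0 < s (cm q (f x)) -> 0 < c) &
  forall E, tube_form (f x) E = c * \det (E *m g (f x) *m (differential f x)^T)].
Proof.
have [dx|nd] := pselect (dom q (f x)); last first.
  exists 0; split=> // E; rewrite mul0r /tube_form /chart_form; by case: pselect.
set z := cm q (f x).
have [Kz|nK] := pselect (K z); last first.
  exists 0; split=> // [_|E]; first by rewrite s0// ltxx.
  by rewrite mul0r /tube_form chart_form_in// s0// mul0r.
have [dpx rz iz] := rt_point rt dx (KD Kz).
have xx := mem_chart_at x; have xf := mem_chart_at (f x).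
have ip : img p (cm p x) by exact: cmap_img.
have dxp : dom x (ci p (cm p x)) by rewrite cmapK.
(* The form was built from the tangent frame of the chart of [p], while [differential f x] uses the
   chart of [x]; the orientation makes the determinant of the change positive, hence the sign of
   [c]. *)
pose Q := jacobian (transition p x) (cm p x).
have Q0 : 0 < \det Q by apply: oM.
exists (s z * \det Q); split; first by rewrite mulr_ge0// ltW.
  by move=> _ sz; rewrite mulr_gt0.
move=> E; rewrite /tube_form chart_form_in// -mulrA; apply: (f_equal (fun t => s z * t)).
have iqz : img q z by exact: cmap_img.
have ofq : ov (f x) q (cm (f x) (f x)) by exact: ov_cmap.
pose J := jacobian (transition (f x) q) (cm (f x) (f x)).
pose P := tangent_coord q z.
have JP : J *m P = 1%:M.
  rewrite /P tangent_coordE// /z cmapK//.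
  by have := jacobian_transitionK ofq; rewrite (transition_cmap q xf).
have Ji : jacobian i (r z) = Q *m (differential f x *m J).
  rewrite rz (@jacobian_mloc _ _ _ _ _ f sf p q x (f x) (cm p x)); last 3 first.
  - by split=> //; rewrite cmapK.
  - by rewrite cmapK.
  - by rewrite cmapK.
  by rewrite (transition_cmap x dpx) cmapK.
have -> : E *m J *m (local_metric g q z *m (jacobian i (r z))^T) = E *m g (f x) *m (differential f x)^T *m Q^T.
  by rewrite Ji; rewrite /local_metric -/P cmapK//; exact: gram_change.
by rewrite det_mulmx det_tr mulrC.
Qed.

End Local.
End Tube.

Section SmoothFun.
Context {R : realType} {n : nat} {X : manifold R n}.

Local Notation dom p := (cdom (chart_at p)).
Local Notation img p := (cimg (chart_at p)).
Local Notation cm p := (cmap (chart_at p)).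
Local Notation ci p := (cinv (chart_at p)).

Lemma smooth_fun_continuous (b : X -> R) : smooth_fun b -> continuous b.
Proof.
move=> sb; apply/continuousP => A oA; rewrite openE => x Ax.
have oO : open [set z | img x z /\ A ((b \o ci x) z)].
  apply: open_preimage; [exact: img_open|move=> z iz|exact: oA].
  exact: (Ck_continuous ((smooth_funP _).1 sb x 0%N) iz).
have oV : open [set y | dom x y /\ [set z | img x z /\ A ((b \o ci x) z)] (cm x y)].
  by apply: open_preimage; [exact: cdom_open|exact: cmap_continuous|].
have Vx : dom x x /\ [set z | img x z /\ A ((b \o ci x) z)] (cm x x).
  have dx := mem_chart_at x; split=> //; split; first exact: cmap_img.
  by rewrite /= cmapK.
by apply: filterS (open_nbhs_nbhs (conj oV Vx)) => y [dy [_]]; rewrite /= cmapK.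
Qed.

Context {g : X -> 'M[R]_n}.
Hypothesis gm : riemannian_metric g.

Lemma smooth_normsq m (psi eta : diff_form X m) : smooth_form psi -> smooth_form eta ->
  smooth_fun (fun x => normsq (g x) (psi x) (eta x)).
Proof.
have [gs gp _] := gm.
move=> sp se; have sp' := (smooth_formP psi).1 sp; have se' := (smooth_formP eta).1 se.
apply/smooth_funP => q j; have oI := img_open q.
have uP y : img q y -> tangent_coord q y \in unitmx.
  move=> iy; rewrite tangent_coordE//.
  exact: (mulmx1_unit (jacobian_transitionK (img_ov iy))).1.
(* Invariance under change of coordinates: an orthonormal frame becomes one for the chart metric
   after multiplication by the inverse of [P], and the sums over frames coincide. *)
have E y : img q y -> normsq (local_metric g q y) (local_form psi q y) (local_form eta q y) =
    normsq (g (ci q y)) (psi (ci q y)) (eta (ci q y)).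
  move=> iy; have [mp _ _] := sp; have [me _ _] := se; set P := tangent_coord q y.
  have B0 : (0 : 'M[R]_(0, n)) *m g (ci q y) *m 0^T = 1%:M by rewrite [LHS]flatmx0 [RHS]flatmx0.
  have [r [A [_ [_ _ _ AG]]]] := frame_exists (gs _) (gp _) B0.
  have uPy := uP y iy; rewrite -/P in uPy.
  have AG' : (A *m invmx P)^T *m (A *m invmx P) = invmx (local_metric g q y).
    have uG := metric_unitmx (gp (ci q y)).
    have uL : local_metric g q y \in unitmx by rewrite /local_metric !unitmx_mul unitmx_tr uPy uG.
    rewrite -[LHS](mulmxK uL) -[RHS]mul1mx; congr (_ *m _).
    rewrite /local_metric -/P trmx_mul trmx_inv !mulmxA -(mulmxA _ _ P) mulVmx// mulmx1.
    by rewrite -(mulmxA _ A^T) AG -(mulmxA _ (invmx _)) mulVmx// mulmx1 mulVmx// unitmx_tr.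
  rewrite (normsq_frame AG' (multilinear_mulmx _ (mp _)) (multilinear_mulmx _ (me _))) (normsq_frame AG (mp _) (me _)).
  congr (_ * _); apply: eq_bigr => L _; rewrite /local_form -/P !mul_rowsub_mx -!(mulmxA A) mulVmx// mulmx1//.
apply: (Ck_eq oI E); apply: CkM; [exact: oI|exact: Ck_cst|].
apply: Ck_sum => // I _; apply: Ck_sum => // J _; apply: CkM => //.
  apply: Ck_prod => // l _; apply: (Ck_invmx _ _ oI); last exact: Ck_local_metric.
  by move=> y iy; rewrite /local_metric !unitmx_mul unitmx_tr (uP y iy) (metric_unitmx (gp (ci q y))).
by apply: CkM => //; [exact: (fform_Ck _ _ (sp' q))|exact: (fform_Ck _ _ (se' q))].
Qed.

End SmoothFun.

Section Comass.
Context {R : realType} {n m : nat} {X : manifold R n} (G : X -> 'M[R]_n) (psi : diff_form X m) (x : X).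

Lemma comass_le c : 0 <= c -> (forall E, \det (E *m G x *m E^T) = 1 -> psi x E <= c) -> comass G psi x <= c.
Proof.
move=> c0 H; rewrite /comass; set S := image _ _.
(* If there is no frame of unit Gram determinant, the supremum of the empty set is 0, which [c0]
   covers. *)
have [S0|S0] := pselect (S !=set0); first by apply: ge_sup => // _ [E EE <-]; exact: H.
suff -> : S = set0 by rewrite sup0.
by apply/seteqP; split=> // u Su; apply: S0; exists u.
Qed.

Lemma comass_ge E : (G x)^T = G x -> (forall v : 'rV[R]_n, v != 0 -> 0 < (v *m G x *m v^T) 0 0) ->
  multilinear (psi x) -> alternating (psi x) -> \det (E *m G x *m E^T) = 1 -> psi x E <= comass G psi x.
Proof.
move=> Gs Gp mp ap E1; apply: ub_le_sup; last by exists E.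
(* The square of the value is bounded by the norm; adding 1 gives a bound on the value without a
   square root. *)
exists (1 + normsq (G x) (psi x) (psi x)) => _ [F F1 <-].
have fF : row_free F.
  apply/row_freeP; exists (G x *m F^T *m invmx (F *m G x *m F^T)).
  by rewrite !mulmxA mulmxV// unitmxE F1 unitr1.
have := normsq_bound Gs Gp mp ap fF; rewrite F1 mulr1; nra.
Qed.

End Comass.

(** * Global form and weight along a compact submanifold *)

Section Calibration.
Context {R : realType} {n k : nat} {X : manifold R n} {M : manifold R k.+1} {f : M -> X}.
Hypotheses (emb : embedding f) (oM : oriented M) (cM : compact [set: M]).
Context {g : X -> 'M[R]_n}.
Hypothesis gm : riemannian_metric g.

Local Notation dom p := (cdom (chart_at p)).
Local Notation img p := (cimg (chart_at p)).
Local Notation cm p := (cmap (chart_at p)).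
Local Notation ci p := (cinv (chart_at p)).

Let sf : smooth_map f. Proof. by case: emb. Qed.

(** The signs and the vanishing of [w] along the submanifold hold everywhere, the strict and
    quantitative properties on [V] only; such data can be added up over a finite cover. *)
Definition tube (V : set X) (nu : diff_form X k.+1) (w : X -> R) :=
  [/\ [/\ open V, smooth_form nu, smooth_fun w, forall x, 0 <= w x & forall x, w (f x) = 0],
   forall x, V x -> ~ range f x -> 0 < w x,
   forall x, exists c, [/\ 0 <= c, (V (f x) -> 0 < c) &
     forall E, nu (f x) E = c * \det (E *m g (f x) *m (differential f x)^T)] &
   forall b x, V (f x) -> smooth_fun b -> (forall y, b (f y) = 0) ->
     exists O L, [/\ open O, O (f x), 0 <= L & forall y, O y -> b y ^+ 2 <= L * w y]].

Lemma tube_exists p : exists V nu w, V (f p) /\ tube V nu w.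
Proof.
have [D [r rt]] := retraction_exists emb p; set q := f p; set z0 := cm q q.
have /nbhs_ballP[e e0 He] := open_nbhs_nbhs (conj (rt_open rt) (rt_center rt)).
pose d := e / 4; have d0 : 0 < d by rewrite divr_gt0.
pose s := cubebump z0 d; pose K := [set z | `|z - z0| <= 2 * d].
have KD : K `<=` D.
  move=> z Kz; apply: He; rewrite mx_ballE distrC; apply: le_lt_trans Kz _; rewrite /d.
  move: (e0 : 0 < e); lra.
have cK : compact K by exact: closed_ball_compact.
have Cs j : Ck j setT s by exact: Ck_bump.
have s0 z : ~ K z -> s z = 0.
  by move=> nK; apply: bump_0 => //; rewrite leNgt; apply/negP => /ltW.
have s_ge0 z : 0 <= s z by case/andP: (bump01 z0 d z).
have s1 z : `|z - z0| < d -> s z = 1 by move=> zd; apply: bump_1 => //; exact: ltW.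
exists [set x | dom q x /\ ball z0 d (cm q x)].
exists (@tube_form _ _ _ _ _ f g p r s), (@tube_dist _ _ _ _ _ f p r s).
split; first by split; [exact: mem_chart_at|exact: ballxx].
have B z : ball z0 d z -> `|z - z0| < d by rewrite mx_ballE distrC.
split; [split| | |].
- by apply: open_preimage; [exact: cdom_open|exact: cmap_continuous|exact: ball_open].
- exact: (smooth_tube_form emb gm rt cK KD Cs s0).
- exact: (smooth_tube_dist emb rt cK KD Cs s0).
- by move=> x; exact: (tube_dist_ge0 s_ge0).
- by move=> x; exact: (tube_dist_range rt KD s0).
- by move=> x [dx /B xd] nr; apply: (tube_dist_gt0 rt KD s0) => //; rewrite s1.
- move=> x; have [c [c0 c1 cE]] := tube_form_range emb oM (g := g) rt KD s0 s_ge0 x; exists c; split=> //.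
  by move=> [dx /B xd]; apply: c1 => //; rewrite s1.
- move=> b x [dx /B xd] sb b0.
  exact: (tube_dist_growth emb rt KD s0 d0 s1 dx xd sb b0).
Qed.

(** Finitely many tubes are summed. At each point of the submanifold the forms are nonnegative
    multiples of the same volume form, so no cancellation occurs. *)
Lemma calibration_data : exists (nu : diff_form X k.+1) (w : X -> R),
  [/\ [/\ smooth_form nu, smooth_fun w, forall x, 0 <= w x & forall x, w (f x) = 0],
   forall x, ~ range f x -> 0 < w x,
   forall x, exists2 c, 0 < c & forall E, nu (f x) E = c * \det (E *m g (f x) *m (differential f x)^T) &
   forall b C, smooth_fun b -> (forall y, b (f y) = 0) -> compact C ->
     exists2 L, 0 <= L & forall y, C y -> b y ^+ 2 <= L * w y].
Proof.
have H p : exists T : set X * (diff_form X k.+1 * (X -> R)), T.1 (f p) /\ tube T.1 T.2.1 T.2.2.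
  by have [V [nu [w HT]]] := tube_exists p; exists (V, (nu, w)).
have /choice[T HT] := H.
have [|l [_ lc]] := compact_finite_cover (P := fun p => [set x | setT x /\ (T p).1 (f x)]) cM.
  move=> p _; have [Tp [[oV _ _ _ _] _ _ _]] := HT p; split; last by split.
  by apply: open_preimage; [exact: openT|move=> x _; exact: sf.1|].
have cover : forall x, exists2 p, p \in l & (T p).1 (f x).
  by move=> x; have [p pl [_ Vp]] := lc x I; exists p.
pose V := [set x | exists2 p, p \in l & (T p).1 x].
have oV : open V.
  rewrite openE => x [p pl Vx]; have [_ [[oVp _ _ _ _] _ _ _]] := HT p.
  by apply: filterS (open_nbhs_nbhs (conj oVp Vx)) => y Vy; exists p.
have rV : range f `<=` V by move=> _ [x _ <-]; exact: cover.
have [chi [sc c01] [[W [oW rW] W1] [C [cC CV] c0]]] := cutoff (range_compact emb cM) oV rV.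
(* The last term makes [w] positive away from the tubes and vanishes near the submanifold. *)
pose w x := \sum_(p <- l) (T p).2.2 x + (1 - chi x).
have wp x p : p \in l -> (T p).2.2 x <= w x.
  move=> pl; rewrite /w (big_rem p)//= -addrA lerDl addr_ge0//.
    by apply: sumr_ge0 => u _; have [_ [[_ _ _ + _] _ _ _]] := HT u; exact.
  by rewrite subr_ge0; case/andP: (c01 x).
have w0 x : 0 <= w x.
  rewrite addr_ge0//; last by rewrite subr_ge0; case/andP: (c01 x).
  by apply: sumr_ge0 => u _; have [_ [[_ _ _ + _] _ _ _]] := HT u; exact.
have wf x : w (f x) = 0.
  rewrite /w (W1 (f x)); last by apply: rW; exists x.
  by rewrite subrr addr0 big1// => p _; have [_ [[_ _ _ _ ->] _ _ _]] := HT p.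
have sw : smooth_fun w.
  apply: smooth_funD; last exact: smooth_funB1.
  by apply: smooth_fun_sum => p; have [_ [[_ _ + _ _] _ _ _]] := HT p.
have wn x : ~ range f x -> 0 < w x.
  move=> nr; have [[p pl Vx]|nV] := pselect (V x).
    by apply: lt_le_trans (wp x p pl); have [_ [_ + _ _]] := HT p; exact.
  rewrite /w c0 => [|/CV//]; rewrite subr0 ltr_wpDl//.
  by apply: sumr_ge0 => u _; have [_ [[_ _ _ + _] _ _ _]] := HT u; exact.
exists (fun x E => \sum_(p <- l) (T p).2.1 x E), w; split=> //.
- split=> //; apply: smooth_fsum => p; by have [_ [[_ + _ _ _] _ _ _]] := HT p.
- move=> x; have Hc p : exists c, [/\ 0 <= c, ((T p).1 (f x) -> 0 < c) &
     forall E, (T p).2.1 (f x) E = c * \det (E *m g (f x) *m (differential f x)^T)].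
    by have [_ [_ _ + _]] := HT p; exact.
  have /choice[c cE] := Hc; exists (\sum_(p <- l) c p); last first.
    by move=> E; rewrite mulr_suml; apply: eq_bigr => p _; have [_ _] := cE p; exact.
  have [p pl Vp] := cover x; rewrite (big_rem p)//= ltr_wpDr//; last by have [_ + _] := cE p; exact.
  by apply: sumr_ge0 => u _; have [] := cE u.
move=> b K sb b0 cK.
have HL x : exists OL : set X * R, [/\ open OL.1, OL.1 x, 0 <= OL.2 & forall y, OL.1 y -> b y ^+ 2 <= OL.2 * w y].
  have [[y _ <-]|nr] := pselect (range f x).
    have [p pl Vp] := cover y; have [_ [_ _ _ /(_ b y Vp sb b0)[B [L [oB By L0 HB]]]]] := HT p.
    by exists (B, L); split=> // u Bu; apply: le_trans (HB u Bu) _; rewrite ler_wpM2l// wp.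
  (* Off the submanifold no growth estimate is required: near [x] the square of [b] is bounded and
     [w] is bounded below. *)
  have wx := wn x nr; have cb := smooth_fun_continuous (smooth_funM sb sb).
  have cw := smooth_fun_continuous sw.
  exists ([set y | setT y /\ (fun u => b u * b u) y < b x * b x + 1] `&` [set y | setT y /\ w x / 2 < w y],
    (b x * b x + 1) / (w x / 2)); split=> /=.
  - apply: openI.
      by apply: (@open_preimage _ _ setT _ [set t | t < _] openT (fun y _ => cb y)); exact: open_lt.
    by apply: (@open_preimage _ _ setT _ [set t | _ < t] openT (fun y _ => cw y)); exact: open_gt.
  - by split; split=> //; [rewrite ltrDl|rewrite ltr_pdivrMr// ltr_pMr// ltr1n].
  - by rewrite divr_ge0// ?addr_ge0// -?expr2 ?sqr_ge0// divr_ge0// ltW.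
  move=> y [[_ by1] [_ wy]]; have w2 : 0 < w x / 2 by rewrite divr_gt0.
  have b1 : 0 <= b x * b x + 1 by rewrite addr_ge0// -expr2 sqr_ge0.
  rewrite expr2 mulrAC ler_pdivlMr//.
  by apply: ler_pM => //; [rewrite -expr2 sqr_ge0|exact: ltW|exact: ltW|exact: ltW].
have /choice[OL HOL] := HL.
have [t [_ tc]] : exists t : seq X, (forall x, x \in t -> K x) /\ forall y, K y -> exists2 x, x \in t & (OL x).1 y.
  by apply: compact_finite_cover => // x _; have [] := HOL x.
exists (\sum_(x <- t) (OL x).2) => [|y /tc[x xt Oy]].
  by apply: sumr_ge0 => x _; have [] := HOL x.
have [_ _ _ /(_ y Oy) H1] := HOL x; apply: le_trans H1 _; rewrite ler_wpM2r//.
by rewrite (big_rem x)//= lerDl; apply: sumr_ge0 => u _; have [] := HOL u.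
Qed.

End Calibration.

(** * The conformal metric, calibration and uniqueness *)

Section Main.
Context {R : realType} {n k : nat} {X : manifold R n} {M : manifold R k.+1} {f : M -> X}.
Hypotheses (emb : embedding f) (oM : oriented M) (cM : compact [set: M]) (kM : connected [set: M]).
Context {g : X -> 'M[R]_n}.
Hypothesis gm : riemannian_metric g.

Local Notation dom p := (cdom (chart_at p)).
Local Notation img p := (cimg (chart_at p)).
Local Notation cm p := (cmap (chart_at p)).
Local Notation ci p := (cinv (chart_at p)).
Local Notation N a b x := (normsq (g x) (a x) (b x)).
Local Notation C := (integration_current f).

Let sf : smooth_map f. Proof. by case: emb. Qed.
Let gs x : (g x)^T = g x. Proof. by case: gm. Qed.
Let gp x (v : 'rV[R]_n) : v != 0 -> 0 < (v *m g x *m v^T) 0 0. Proof. by case: gm => _ + _; exact. Qed.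
Let cC : current C. Proof. exact: integration_current_current. Qed.

Section Conformal.
Context {Psi : X -> R}.
Hypotheses (sPsi : smooth_fun Psi) (Psi0 : forall x, 0 < Psi x).

Definition conf_factor x := Psi x `^ (k.+1%:R)^-1.
Definition conf_metric x := conf_factor x *: g x.

Lemma conf_factor_gt0 x : 0 < conf_factor x.
Proof. exact: powR_gt0. Qed.

Lemma smooth_conf_factor : smooth_fun conf_factor.
Proof.
apply/smooth_funP => q j.
exact: (Ck_comp1 (img_open q) (fun y _ => Psi0 (ci q y)) (Ck_powR j _) ((smooth_funP _).1 sPsi q j)).
Qed.

Lemma conf_metric_riemannian : riemannian_metric conf_metric.
Proof.
split=> [x|x v v0|q a b].
- by rewrite /conf_metric linearZ /= gs.
- by rewrite /conf_metric -scalemxAr -scalemxAl mxE mulr_gt0 ?conf_factor_gt0 ?gp.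
apply/smooth_onP => j; have oI := img_open q.
apply: (Ck_eq oI _ (CkM oI ((smooth_funP _).1 smooth_conf_factor q j) ((Ck_mx _ _ oI).1 (Ck_local_metric gm j q) a b))).
by move=> y _; rewrite /local_metric /conf_metric -scalemxAr -scalemxAl [RHS]mxE.
Qed.

Lemma det_conf_metric x (E : 'M[R]_(k.+1, n)) : \det (E *m conf_metric x *m E^T) = Psi x * \det (E *m g x *m E^T).
Proof.
by rewrite /conf_metric -scalemxAr -scalemxAl detZ /conf_factor -powR_mulrn ?powR_ge0// -powRrM mulVf ?powRr1 ?ltW// pnatr_eq0.
Qed.

Lemma comass_conf (psi : diff_form X k.+1) x c : smooth_form psi -> 0 <= c -> N psi psi x <= c ^+ 2 * Psi x ->
  comass conf_metric psi x <= c.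
Proof.
move=> [mp ap _] c0 Nc; apply: comass_le => // E; rewrite det_conf_metric => E1.
have D0 : \det (E *m g x *m E^T) != 0 by apply/negP => /eqP D0; move: E1; rewrite D0 mulr0 => /eqP; rewrite eq_sym oner_eq0.
have fE : row_free E.
  apply/row_freeP; exists (g x *m E^T *m invmx (E *m g x *m E^T)).
  by rewrite !mulmxA mulmxV// unitmxE unitfE.
have H := normsq_bound (gs x) (@gp x) (mp x) (ap x) fE.
have Dp : 0 <= \det (E *m g x *m E^T).
  by have := Psi0 x; move: E1; move: (\det _) => D E1 P0; nra.
have : psi x E ^+ 2 <= c ^+ 2.
  apply: le_trans H _; apply: le_trans (ler_wpM2r Dp Nc) _.
  by rewrite -mulrA E1 mulr1.
by move=> H2; rewrite leNgt; apply/negP => cp; nra.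
Qed.

End Conformal.

Lemma normsq_zero x (a : 'M[R]_(k.+1, n) -> R) : normsq (g x) a (fun=> 0) = 0.
Proof. by rewrite /normsq big1 ?mulr0// => I _; rewrite big1// => J _; rewrite !mulr0. Qed.

Lemma normsq_add x (a b : 'M[R]_(k.+1, n) -> R) t :
  normsq (g x) (fun E => t * b E + a E) (fun E => t * b E + a E) =
  normsq (g x) a a + 2 * t * normsq (g x) a b + t ^+ 2 * normsq (g x) b b.
Proof.
rewrite normsqDZl (normsqC (gs x) b) (normsqC (gs x) a) !normsqDZl (normsqC (gs x) b a); ring.
Qed.

Section Calibrated.
Context {nu Phi : diff_form X k.+1} {w : X -> R}.
Hypotheses (sPhi : smooth_form Phi) (sw : smooth_fun w) (w0 : forall x, 0 <= w x) (wf : forall x, w (f x) = 0).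
Hypothesis wn : forall x, ~ range f x -> 0 < w x.
Hypothesis nuE : forall x, exists2 c, 0 < c & forall E, nu (f x) E = c * \det (E *m g (f x) *m (differential f x)^T).
Hypothesis Phif : forall x E, Phi (f x) E = nu (f x) E.

Definition weight x := N Phi Phi x + w x.
Local Notation ghat := (conf_metric (Psi := weight)).

Let mPhi x : multilinear (Phi x). Proof. by case: sPhi. Qed.

Lemma Phi_tangent x : exists2 c, 0 < c & [/\ forall E, Phi (f x) E = c * \det (E *m g (f x) *m (differential f x)^T),
  0 < \det (differential f x *m g (f x) *m (differential f x)^T) &
  Phi (f x) (differential f x) ^+ 2 = N Phi Phi (f x) * \det (differential f x *m g (f x) *m (differential f x)^T)].
Proof.
have [c c0 cE] := nuE x; have PE E : Phi (f x) E = c * \det (E *m g (f x) *m (differential f x)^T) by rewrite Phif cE.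
have fD : row_free (differential f x) by case: emb.
by have [H1 H2] := normsq_simple (gs _) (@gp _) fD PE; exists c.
Qed.

Lemma weight_gt0 x : 0 < weight x.
Proof.
have [[y _ <-]|nr] := pselect (range f x); last exact: (ltr_wpDl (normsq_ge0 (gs x) (@gp x) (mPhi x)) (wn nr)).
have [c c0 [PE D0 P2]] := Phi_tangent y; rewrite /weight wf addr0 lt_def (normsq_ge0 (gs _) (@gp _) (mPhi _)) andbT.
apply/negP => /eqP N0; move: P2; rewrite N0 mul0r PE => /eqP.
by rewrite sqrf_eq0 mulf_eq0 !gt_eqF.
Qed.

Lemma smooth_weight : smooth_fun weight.
Proof. exact: (smooth_funD (smooth_normsq gm sPhi sPhi) sw). Qed.

Lemma comass_Phi x : comass ghat Phi x <= 1.
Proof.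
apply: (comass_conf weight_gt0 sPhi ler01).
by rewrite expr1n mul1r /weight lerDl.
Qed.

(** On tangent frames of unit volume for the new metric and positive orientation, [Phi] takes the
    value 1, the largest allowed to [psi]; the comparison of integrals is pointwise. *)
Lemma calibrated_le (psi : diff_form X k.+1) : smooth_form psi -> (forall x, comass ghat psi x <= 1) -> C psi <= C Phi.
Proof.
move=> sp c1; apply: (integral_form_le oM cM); [exact: smooth_pullback|exact: smooth_pullback|].
move=> p y iy; rewrite /local_form /pullback mul1mx; set x := ci p y; set P := tangent_coord p y.
have [mp ap _] := sp; have [_ aP _] := sPhi.
have P0 : 0 < \det P by rewrite /P tangent_coordE//; apply: oM => //; have [] := img_ov iy.
rewrite (alternating_mulmx _ _ (mp _) (ap _)) (alternating_mulmx _ _ (mPhi _) (aP _)) ler_pM2l//.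
have [c c0 [PE D0 P2]] := Phi_tangent x; set D := differential f x in PE D0 P2 *.
have v0 : 0 < Phi (f x) D by rewrite PE mulr_gt0.
set v := Phi (f x) D in v0 P2 *; clearbody v.
(* Dividing one row by [v], the value of [Phi] on the tangent frame, gives unit Gram determinant for
   the new metric: [v ^+ 2] is the weight times the old determinant by [P2]. *)
pose S : 'M[R]_k.+1 := diag_mx (\row_j if j == ord0 then v^-1 else 1).
have dS : \det S = v^-1.
  by rewrite det_diag big_ord_recl mxE eqxx big1 ?mulr1// => j _; rewrite mxE.
have [hs hp _] := conf_metric_riemannian smooth_weight weight_gt0.
have E1 : \det ((S *m D) *m ghat (f x) *m (S *m D)^T) = 1.
  rewrite (det_conf_metric weight_gt0) /weight wf addr0 trmx_mul.
  rewrite (_ : S *m D *m g (f x) *m (D^T *m S^T) = S *m (D *m g (f x) *m D^T) *m S^T); last by rewrite !mulmxA.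
  rewrite det_mulmx det_tr det_mulmx dS; move: P2.
  move: (normsq _ _ _) (\det (D *m _ *m _)) => a d P2.
  have -> : a * (v^-1 * d * v^-1) = a * d * v^-1 ^+ 2 by ring.
  by rewrite -P2 -exprMn mulfV ?expr1n// gt_eqF.
have := comass_ge (hs _) (hp _) (mp _) (ap _) E1.
rewrite (alternating_mulmx _ _ (mp _) (ap _)) dS => H.
by have := le_trans H (c1 _); rewrite ler_pdivrMl// mulr1.
Qed.

Lemma mass_submanifold : mass ghat C = (C Phi)%:E.
Proof.
apply/eqP; rewrite eq_le; apply/andP; split.
  by apply: ge_ereal_sup => _ [psi [sp c1] <-]; rewrite lee_fin; exact: calibrated_le.
by apply: ereal_sup_ubound; exists Phi => //; split=> // x; exact: comass_Phi.
Qed.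

Hypothesis growth : forall b K, smooth_fun b -> (forall y, b (f y) = 0) -> compact K ->
  exists2 L, 0 <= L & forall y, K y -> b y ^+ 2 <= L * w y.

(* Along [Phi + t psi] the comass grows only quadratically in [t], so the
   derivative of [T] in the direction [psi] vanishes. *)
Lemma minimizer_vanish (T : diff_form X k.+1 -> R) psi : current T -> T Phi = C Phi -> mass ghat T = (C Phi)%:E ->
  smooth_form psi -> (forall x E, psi (f x) E = 0) -> T psi = 0.
Proof.
move=> cT TP mT sp p0; have lT := current_linear cT.
have Tle eta : smooth_form eta -> (forall x, comass ghat eta x <= 1) -> T eta <= C Phi.
  by move=> se c1; rewrite -lee_fin -mT; apply: ereal_sup_ubound; exists eta.
have [F cF HF] := current_compact_supp cT.
(* Cutting [psi] off outside the support of [T] does not change its value and confines all estimates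
   to the compact set [K]. *)
have [s [ss _] [[V [oV FV] V1] [K [cK _] s0]]] := cutoff cF openT (@subsetT _ F).
pose psi1 := fscale s psi; have sp1 : smooth_form psi1 by exact: smooth_fscale.
have Tpsi : T psi1 = T psi.
  have : T (fun x E => (-1) * psi x E + psi1 x E) = 0.
    apply: (HF _ V (smooth_lin (-1) sp sp1) oV FV) => x E Vx.
    by rewrite /psi1 /fscale V1// mul1r mulN1r addNr.
  by rewrite lT// mulN1r addrC => /eqP; rewrite subr_eq0 => /eqP.
have p1f y : psi1 (f y) = fun=> 0 by apply/funext => E; rewrite /psi1 /fscale p0 mulr0.
have p1K y : ~ K y -> psi1 y = fun=> 0 by move=> nK; apply/funext => E; rewrite /psi1 /fscale s0// mul0r.
pose b x := N Phi psi1 x; have sb : smooth_fun b by exact: smooth_normsq.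
have b0 y : b (f y) = 0 by rewrite /b p1f normsq_zero.
have [L L0 HL] := growth sb b0 cK.
have cq : continuous (fun x => (L + N psi1 psi1 x) / weight x).
  apply: smooth_fun_continuous; apply: smooth_funM.
    by apply: smooth_funD; [exact: smooth_fun_cst|exact: smooth_normsq].
  apply/smooth_funP => q j; apply: CkV; [exact: img_open|by move=> y _; rewrite gt_eqF//; exact: weight_gt0|].
  exact: (smooth_funP _).1 smooth_weight q j.
have [B B0 HB] := compact_bound cK (fun x _ => cq x).
have NB t x : normsq (g x) (fun E => t * psi1 x E + Phi x E) (fun E => t * psi1 x E + Phi x E) <= (1 + t ^+ 2 * B) * weight x.
  have W0 := weight_gt0 x; have tB : 0 <= t ^+ 2 * B by rewrite mulr_ge0 ?sqr_ge0// ltW.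
  rewrite normsq_add; have [Kx|nK] := pselect (K x); last first.
    rewrite p1K// !normsq_zero !mulr0 !addr0.
    have : N Phi Phi x <= weight x by rewrite /weight lerDl.
    by move: (N Phi Phi x) (weight x) W0 tB => u v; nra.
  have := HB x Kx; rewrite ler_norml => /andP[_]; rewrite ler_pdivrMr// => H1.
  have := HL x Kx; rewrite -/(b x) => H2; have wx := w0 x.
  (* The inequality of arithmetic and geometric means applied to [b ^+ 2 <= L * w]: the slack [w]
     absorbs the term linear in [t]. *)
  have H3 : 2 * t * b x <= w x + t ^+ 2 * L.
    rewrite leNgt; apply/negP => H3.
    have H4 : (t * b x) ^+ 2 <= t ^+ 2 * L * w x by rewrite exprMn -mulrA ler_wpM2l ?sqr_ge0.
    have H5 : 0 <= t ^+ 2 * L by rewrite mulr_ge0 ?sqr_ge0.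
    have H6 : (w x + t ^+ 2 * L) ^+ 2 < (2 * (t * b x)) ^+ 2 by rewrite ltrXn2r// ?nnegrE; nra.
    move: H4 H6; move: (t ^+ 2 * L) (t * b x) (w x) => u v z H4 H6; have := sqr_ge0 (z - u); nra.
  have H4 : t ^+ 2 * (L + N psi1 psi1 x) <= t ^+ 2 * (B * weight x) by rewrite ler_wpM2l ?sqr_ge0.
  have W : weight x = N Phi Phi x + w x by [].
  move: H3 H4 W; move: (t ^+ 2) (weight x) (normsq _ (Phi x) (Phi x)) (normsq _ (psi1 x) (psi1 x)) (w x) (b x).
  by move=> u v a c d e; nra.
have m0 : 0 <= C Phi.
  rewrite -(form_linear0 lT); apply: Tle => [|x]; first exact: smooth_fzero.
  by apply: comass_le => // E _; exact: ler01.
have key t : t * T psi <= t ^+ 2 * B * C Phi.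
  have tB : 0 <= t ^+ 2 * B by rewrite mulr_ge0 ?sqr_ge0// ltW.
  (* Dividing by [c] itself rather than by its square root suffices, since [c] is at least 1; the
     bound stays quadratic in [t]. *)
  pose c := 1 + t ^+ 2 * B; have c1 : 1 <= c by rewrite lerDl.
  have c0 : 0 < c by exact: lt_le_trans c1.
  have sP := smooth_lin t sp1 sPhi.
  have : T (fsc c^-1 (fun x E => t * psi1 x E + Phi x E)) <= C Phi.
    apply: Tle => [|x]; first exact: smooth_fsc.
    apply: (comass_conf weight_gt0 _ ler01); first exact: smooth_fsc.
    rewrite expr1n mul1r /fsc normsqZ (normsqC (gs x)) normsqZ mulrA -expr2 exprVn ler_pdivrMl ?exprn_gt0//.
    by apply: le_trans (NB t x) _; rewrite ler_pM2r ?weight_gt0// -/c expr2 ler_peMl// ltW.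
  rewrite (form_linearZ lT _ sP) (lT t _ _ sp1 sPhi) Tpsi TP ler_pdivrMl// /c mulrDl mul1r.
  by rewrite addrC lerD2l.
apply: contrapT => /eqP a0; set a := T psi in a0 key; set beta := B * C Phi.
have be0 : 0 <= beta by rewrite mulr_ge0// ltW.
have b1 : 0 < beta + 1 by rewrite ltr_wpDl.
(* For this [t] one has [a = t * (beta + 1)], so [t * a] exceeds [t ^+ 2 * beta] by [t ^+ 2],
   against [key]. *)
have := key (a / (beta + 1)); rewrite -(mulrA _ B) -/beta expr2 -!mulrA.
rewrite -subr_ge0 (_ : _ - _ = - ((a / (beta + 1)) ^+ 2)); last by field; rewrite gt_eqF.
by rewrite oppr_ge0 leNgt exprn_even_gt0//= mulf_neq0// invr_eq0 gt_eqF.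
Qed.

End Calibrated.

Lemma conformal_minimizer : ~ homologous C (fun=> 0) ->
  exists ghat : X -> 'M[R]_n,
    [/\ riemannian_metric ghat, conformal g ghat &
        forall T : diff_form X k.+1 -> R, current T -> homologous T C ->
          (mass ghat C <= mass ghat T)%E /\ (mass ghat T = mass ghat C -> eq_current T C)].
Proof.
move=> nz; have Cex := integration_current_exact oM cM sf.
have [phi [sphi dphi Cphi]] := closed_form_of_cycle cC Cex nz.
have [nu [w [[snu sw w0 wf] wn nuE growth]]] := calibration_data emb oM cM gm.
have lC := current_linear cC; pose c0 := C nu.
have sth := smooth_lin (- c0) sphi snu.
(* The coefficient [c0] is chosen to make the integral zero, the hypothesis under which the
   difference is exact along the submanifold. *)
have th0 : C (fun x E => (- c0) * phi x E + nu x E) = 0 by rewrite lC// Cphi mulr1 addNr.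
have [eta seta etaE] := exact_on_submanifold oM cM emb kM sth th0.
pose Phi : diff_form X k.+1 := fun x E => c0 * phi x E + ext_deriv eta x E.
have sPhi : smooth_form Phi by exact: (smooth_lin c0 sphi (smooth_ext_deriv seta)).
have Phif x E : Phi (f x) E = nu (f x) E by rewrite /Phi -etaE mulNr addrA subrr add0r.
have dPhi x E : ext_deriv Phi x E = 0.
  by rewrite /Phi (ext_deriv_lin _ sphi (smooth_ext_deriv seta)) dphi ext_deriv2// mulr0 addr0.
have W0 := weight_gt0 sPhi wf wn nuE Phif.
have sW := smooth_weight sPhi sw.
exists (conf_metric (Psi := weight (Phi := Phi) (w := w))).
split; first exact: (conf_metric_riemannian sW W0).
  exists (conf_factor (Psi := weight (Phi := Phi) (w := w))).
  split; [exact: (smooth_conf_factor sW W0)|move=> x; exact: (conf_factor_gt0 W0 x)|by []].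
have mM := mass_submanifold sPhi sw w0 wf wn nuE Phif.
move=> T cT [S [cS TS]]; have lT := current_linear cT.
have TC psi : smooth_form psi -> (forall x E, ext_deriv psi x E = 0) -> T psi = C psi.
  move=> sp dp; have := TS psi sp; rewrite /boundary (_ : ext_deriv psi = @fzero R n X k.+2).
    by rewrite (form_linear0 (current_linear cS)) => /eqP; rewrite subr_eq0 => /eqP.
  by apply/funext => x; apply/funext => E; exact: dp.
have TP := TC Phi sPhi dPhi.
split.
  rewrite mM -TP; apply: ereal_sup_ubound; exists Phi => //; split=> // x.
  exact: (comass_Phi sPhi w0 wf wn nuE Phif).
rewrite mM => mT.
have Tv psi : smooth_form psi -> (forall x E, psi (f x) E = 0) -> T psi = 0.
  exact: (minimizer_vanish sPhi sw w0 wf wn nuE Phif growth cT TP mT).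
have Td eta' : smooth_form eta' -> T (ext_deriv eta') = 0.
  by move=> se; rewrite TC; [exact: Cex|exact: smooth_ext_deriv|move=> x E; exact: ext_deriv2].
have [c cE] := functional_on_submanifold oM cM emb kM lT Td Tv.
have c1 : c = 1 by have := cE phi sphi; rewrite (TC phi sphi dphi) Cphi mulr1.
by move=> psi sp; rewrite cE// c1 mul1r.
Qed.

End Main.

Theorem theorem3p7 (R : realType) (n m : nat) (m_gt0 : (0 < m)%N)
  (X : manifold R n) (g : X -> 'M[R]_n) (g_metric : riemannian_metric g)
  (M : manifold R m) (iota : M -> X) (iota_emb : embedding iota)
  (M_oriented : oriented M)
  (M_compact : compact [set: M]) (M_connected : connected [set: M])
  (M_nonzero : ~ homologous (integration_current iota) (fun=> 0)) :
  exists ghat : X -> 'M[R]_n,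
    [/\ riemannian_metric ghat,
        conformal g ghat &
        forall T : diff_form X m -> R,
          current T -> homologous T (integration_current iota) ->
          (mass ghat (integration_current iota) <= mass ghat T)%E /\
          (mass ghat T = mass ghat (integration_current iota) ->
           eq_current T (integration_current iota))].
Proof.
case: m m_gt0 M iota iota_emb M_oriented M_compact M_connected M_nonzero => // k _ M f emb oM cM kM nz.
exact: (conformal_minimizer emb oM cM kM g_metric nz).
Qed.
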